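(* Let $l\ge1$, let $I\subset\mathbb{R}$ be a compact interval, $\epsilon_0>0$, and let $a_0,\dots,a_l: I\times[0,\epsilon_0]\to\mathbb{C}$ satisfy the standing assumptions (S1)–(S3) of the context. Assume that the roots $\lambda_1(x,\epsilon),\dots,\lambda_l(x,\epsilon)$ of the complete characteristic polynomial $\sum_{j=0}^l a_j(x,\epsilon)\lambda^j$ satisfy $$|\lambda_m(x,\epsilon)-1|=\epsilon^q\,(Q_m(x)+o(\epsilon)),\qquad m\le l,$$ as $\epsilon\to0$, uniformly in $x\in I$, for some positive integer $q$, where the smooth functions $Q_m$ on $I$ satisfy $$\inf_{x\in I}Q_m(x)>0,\qquad \inf_{x\in I}|Q_m(x)-Q_n(x)|>0\quad(m\ne n),\qquad m,n\le l .$$ Then: (1) There exist $\epsilon'\in(0,\epsilon_0]$ and $l$ functions $F_1,\dots,F_l: I\times[0,\epsilon']\to\mathbb{C}$, $C^\infty$ in each variable, such that for each $\epsilon\in(0,\epsilon']$ the sequences $\exp(\epsilon^{-1}F_m(k\epsilon,\epsilon))$, $m=1,\dots,l$, form a fundamental set of solutions of $$\sum_{j=0}^l a_j(k\epsilon,\epsilon)\,y_{k+j}=0,$$ in the sense that for any solution $y_{k,\epsilon}$ there exist constants $C_1,\dots,C_l$ (independent of $k$) with $y_{k,\epsilon}=\sum_{m=1}^lC_m\exp[\epsilon^{-1}F_m(k\epsilon,\epsilon)]$ for all $k$ with $k\epsilon\in I$. (2) For any formal series solution $\Gamma=\sum_{i\ge0}\Psi_i(x)\epsilon^i$ of the recurrence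 there exists a true solution $y_{k,\epsilon}$ which is asymptotic to it: for every $s\in\mathbb{N}$, $$\sup_{k:\,k\epsilon\in I}\Bigl|y_{k,\epsilon}-\sum_{i=0}^s\Psi_i(k\epsilon)\epsilon^i\Bigr|=o(\epsilon^s)\qquad(\epsilon\to0).$$
   Context: Standing assumptions. (S1) Each $a_j(x,\epsilon)$ is $C^\infty$ in $x$ and $C^\infty$ in $\epsilon$ on $I\times[0,\epsilon_0]$. (S2) There are $a_{j,s}\in C^\infty(I)$ such that for every $t\in\mathbb{N}$ there is a constant $M_{j,t}$ with $|a_j(x,\epsilon)-\sum_{s=0}^t a_{j,s}(x)\epsilon^s|<M_{j,t}\,\epsilon^{t+1}$ for all $x\in I$, $\epsilon\in(0,\epsilon_0]$. (S3) $\inf_{x\in I}|a_0(x,0)|>0$ and $\inf_{x\in I}|a_l(x,0)|>0$. For fixed $\epsilon>0$, a solution of the recurrence is a complex sequence $y_k$, indexed by the integers $k$ with $k\epsilon\in I$, satisfying the recurrence for every $k$ such that $k\epsilon,\dots,(k+l)\epsilon$ all lie in $I$. A formal series solution is a formal series $\Gamma=\sum_{i=0}^\infty\Psi_i(x)\epsilon^i$ with $\Psi_i\in C^\infty(I)$ such that, with $\Gamma_s(x;\epsilon)=\sum_{i=0}^s\Psi_i(x)\epsilon^i$, for every $s$ one has $\sum_{j=0}^la_j(x,\epsilon)\Gamma_s(x+j\epsilon;\epsilon)=o(\epsilon^s)$ as $\epsilon\to0$, uniformly over $x$ with $x,x+l\epsilon\in I$.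
   Formalization: The coefficients a_j are assumed C^∞ with all their x-derivatives and all their ε-derivatives jointly continuous on I×[0,ε0]; with mere separate smoothness in x and in ε, part (1) fails already for l=1. The interval I is taken nondegenerate. *)

(* Defs.v *)
From Stdlib Require Import Reals ZArith.
From Coquelicot Require Import Coquelicot.

Open Scope R_scope.

Definition cint (A B : R) : R -> Prop := fun x => A <= x <= B.

Definition inf_on (I : R -> Prop) (f : R -> R) : Rbar :=
  Glb_Rbar (fun r => exists x, I x /\ r = f x).

(* Coquelicot's [is_derive f x d] is
   [filterdiff f (locally x) (fun h => scal h d)]; restricting the filter to I
   gives the derivative relative to I, one-sided at the end points of I. *)
Definition is_derive_on {V : NormedModule R_AbsRing}
    (I : R -> Prop) (f : R -> V) (x : R) (d : V) : Prop :=
  filterdiff f (within I (locally x)) (fun h => scal h d).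

(* f is C^oo on I; D n is its n-th derivative. *)
Definition smooth_on {V : NormedModule R_AbsRing}
    (I : R -> Prop) (f : R -> V) : Prop :=
  exists D : nat -> R -> V,
    (forall x, I x -> D 0%nat x = f x) /\
    (forall n x, I x -> is_derive_on I (D n) x (D (S n) x)).

(* f is C^oo in each of its two variables on the rectangle I x J: the partial
   derivatives of all orders in the first variable (Dx n) and in the second
   variable (De n) exist on I x J and are continuous functions of both
   variables there. *)
Definition smooth_on2 (I J : R -> Prop) (f : R -> R -> C) : Prop :=
  exists Dx De : nat -> R -> R -> C,
    (forall x e, I x -> J e -> Dx 0%nat x e = f x e /\ De 0%nat x e = f x e) /\
    (forall n x e, I x -> J e ->
       is_derive_on (V := C_R_NormedModule) I
         (fun u => Dx n u e) x (Dx (S n) x e) /\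
       is_derive_on (V := C_R_NormedModule) J
         (fun u => De n x u) e (De (S n) x e)) /\
    (forall n,
       continuous_on (fun p : R * R => I (fst p) /\ J (snd p))
         (fun p => Dx n (fst p) (snd p)) /\
       continuous_on (fun p : R * R => I (fst p) /\ J (snd p))
         (fun p => De n (fst p) (snd p))).

(* g e t = o(h e) as e -> 0+, uniformly over the t such that D e t. *)
Definition unif_little_o {T : Type}
    (D : R -> T -> Prop) (g : R -> T -> R) (h : R -> R) : Prop :=
  forall delta : posreal,
    at_right 0 (fun e => forall t, D e t -> g e t <= delta * h e).

Definition cexp (z : C) : C :=
  (exp (Re z) * cos (Im z), exp (Re z) * sin (Im z)).

(* f 1 * ... * f n *)
Fixpoint Cprod (f : nat -> C) (n : nat) : C :=
  match n with
  | O => RtoC 1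
  | S n' => Cmult (Cprod f n') (f n)
  end.

Definition charpoly (l : nat) (a : nat -> R -> R -> C) (x e : R) (z : C) : C :=
  sum_n (fun j => Cmult (a j x e) (Cpow z j)) l.

Definition solution (l : nat) (A B : R) (a : nat -> R -> R -> C)
    (e : R) (y : Z -> C) : Prop :=
  forall k : Z,
    (forall j, (j <= l)%nat -> cint A B (IZR (k + Z.of_nat j) * e)) ->
    sum_n (fun j => Cmult (a j (IZR k * e) e) (y (k + Z.of_nat j)%Z)) l = RtoC 0.

Definition partial_series (Psi : nat -> R -> C) (s : nat) (x e : R) : C :=
  sum_n (fun i => Cmult (Psi i x) (RtoC (e ^ i))) s.

Definition formal_solution (l : nat) (A B : R) (a : nat -> R -> R -> C)
    (Psi : nat -> R -> C) : Prop :=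
  (forall i, smooth_on (V := C_R_NormedModule) (cint A B) (Psi i)) /\
  (forall s,
     unif_little_o
       (fun e x => cint A B x /\ cint A B (x + INR l * e))
       (fun e x =>
          Cmod (sum_n (fun j => Cmult (a j x e)
                         (partial_series Psi s (x + INR j * e) e)) l))
       (fun e => e ^ s)).

Definition standing_assumptions (l : nat) (A B : R) (a : nat -> R -> R -> C)
    (e0 : R) : Prop :=
  (forall j, (j <= l)%nat -> smooth_on2 (cint A B) (cint 0 e0) (a j)) /\
  (forall j, (j <= l)%nat ->
     exists c : nat -> R -> C,
       (forall s, smooth_on (V := C_R_NormedModule) (cint A B) (c s)) /\
       (forall t : nat, exists M : R, forall x e,
          cint A B x -> 0 < e <= e0 ->
          Cmod (Cminus (a j x e) (partial_series c t x e)) < M * e ^ (S t))) /\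
  Rbar_lt 0 (inf_on (cint A B) (fun x => Cmod (a 0%nat x 0))) /\
  Rbar_lt 0 (inf_on (cint A B) (fun x => Cmod (a l x 0))).

(* lam 1, ..., lam l are the roots, with multiplicity, of the characteristic
   polynomial, wherever its leading coefficient does not vanish: the standing
   assumptions guarantee a l x e <> 0 only for small e. *)
Definition characteristic_roots (l : nat) (A B : R) (a : nat -> R -> R -> C)
    (e0 : R) (lam : nat -> R -> R -> C) : Prop :=
  forall x e, cint A B x -> cint 0 e0 e -> a l x e <> RtoC 0 ->
  forall z : C,
    charpoly l a x e z = Cmult (a l x e) (Cprod (fun m => Cminus z (lam m x e)) l).

Definition fundamental_set (l : nat) (A B : R) (a : nat -> R -> R -> C)
    (e : R) (u : nat -> Z -> C) : Prop :=
  (forall m, (1 <= m <= l)%nat -> solution l A B a e (u m)) /\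
  (forall y : Z -> C, solution l A B a e y ->
     exists c : nat -> C, forall k : Z, cint A B (IZR k * e) ->
       y k = sum_n_m (fun m => Cmult (c m) (u m k)) 1 l).

(* Main.v *)
Require Import Defs.
From Stdlib Require Import Reals ZArith Lra Lia Psatz List Classical ClassicalEpsilon.
From Coquelicot Require Import Coquelicot.
Open Scope R_scope.

(* Expand the characteristic polynomial in powers of lambda - 1. Since its roots are O(e)-close
   to 1, the coefficient of (lambda - 1)^j is O(e^(l - j)), hence e^(l - j) times a function smooth
   up to e = 0. So the scaled differences Z_i = d^i y, i < l, d y = (y(x + e) - y(x)) / e, satisfy
   Z(x + e) = (1 + e M(x, e)) Z(x) with M smooth up to e = 0, and discrete Gronwall estimates hold
   uniformly in e, in both directions.

   A formal solution is resummed by cutting off its terms; the exact solution with the same initial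
   differences is asymptotic to it, because the residual is smaller than any power of e.

   For the fundamental set, cut M off to the left of some a1, start there from constant vectors,
   iterate forwards, and from the region where the cutoff equals 1 iterate the true system back
   to the left. The solutions are smooth for e > 0 since finitely many steps suffice locally. Their
   derivatives are bounded up to e = 0 by induction on the number of e-derivatives: differentiating
   Z(x + e, e) in e produces Z_x(x + e, e), which a Taylor formula turns into a forcing term
   containing Z_xx only. By Gronwall the fundamental matrix stays invertible at e = 0, so its first row
   is a Lipschitz curve in C^l that avoids 0, and a generic linear combination of its entries
   vanishes nowhere: the bad coefficient vectors form a set of real codimension 1. Nowhere vanishing
   solutions u near such a combination have smooth logarithms L, and F = e L. *)

(** For real x the recurrence fixes a solution only through its values on a whole strip of width e,
    and smoothness requires these values to match across the ends of the strip. Where the cut-off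
    matrix vanishes, constant vectors match trivially; this is the reason for starting from a
    modified system. Qualitative notions are replaced by estimates: differentiability is a quadratic
    bound on the Taylor remainder with one constant for the whole domain. Such bounds survive
    limits, so they pass to the closed rectangle and to e = 0, where there is no recurrence to use.
    The coefficients come with pure derivatives in x and in e, whereas the shift x + e mixes the two
    variables. Mixed derivatives are obtained from the pure ones by Landau-Kolmogorov interpolation
    between difference quotients. An arbitrary basis of solutions may have zeros, and an exponential
    has none; hence the search for a basis that stays away from 0 uniformly in e before logarithms
    are taken. *)

(** * Increments controlled by derivatives *)

Lemma le_of_archimedean (x y c : R) :
  (forall n : nat, x <= y + c / (INR n + 1)) -> x <= y.
Proof.
  intros H. apply Rnot_lt_le. intros Hlt.
  destruct (Rle_or_lt c 0) as [Hc|Hc].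
  - specialize (H 0%nat). simpl in H. unfold Rdiv in H.
    rewrite Rplus_0_l, Rinv_1 in H. lra.
  - destruct (nfloor_ex (c / (x - y))) as [n [_ Hn]].
    { apply Rmult_le_pos; [lra|]. left. apply Rinv_0_lt_compat. lra. }
    specialize (H n).
    assert (0 <= INR n) by apply pos_INR.
    assert (c < (INR n + 1) * (x - y)).
    { apply (Rmult_lt_compat_r (x - y)) in Hn; [|lra].
      unfold Rdiv in Hn. rewrite Rmult_assoc, Rinv_l in Hn; lra. }
    assert (c / (INR n + 1) < x - y).
    { apply (Rmult_lt_reg_r (INR n + 1)); [lra|].
      unfold Rdiv. rewrite Rmult_assoc, Rinv_l; lra. }
    lra.
Qed.

Lemma Cmod_sub_sym (a b : C) : Cmod (a - b) = Cmod (b - a).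
Proof. replace (a - b)%C with (- (b - a))%C by ring. apply Cmod_opp. Qed.

Lemma Cmod_triangle_sub (a b c : C) : Cmod (a - c) <= Cmod (a - b) + Cmod (b - c).
Proof. replace (a - c)%C with ((a - b) + (b - c))%C by ring. apply Cmod_triangle. Qed.

Lemma Cmod_minus_le (a b : C) : Cmod (a - b) <= Cmod a + Cmod b.
Proof. unfold Cminus. eapply Rle_trans; [apply Cmod_triangle|]. rewrite Cmod_opp. lra. Qed.

Lemma Cmod_rmult (r : R) (z : C) : Cmod (RtoC r * z) = Rabs r * Cmod z.
Proof. now rewrite Cmod_mult, Cmod_R. Qed.

Definition convex1 (I : R -> Prop) :=
  forall a b t, I a -> I b -> 0 <= t <= 1 -> I (a + t * (b - a)).

(* Summing the estimate over n equal pieces, the quadratic remainders contribute O(1/n). *)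
Lemma lipschitz_of_derivative (I : R -> Prop) (f f' : R -> C) (K L : R) :
  convex1 I ->
  (forall t t', I t -> I t' -> Cmod (f t' - f t - RtoC (t' - t) * f' t) <= K * (t' - t) ^ 2) ->
  (forall t, I t -> Cmod (f' t) <= L) ->
  forall a b, I a -> I b -> Cmod (f b - f a) <= L * Rabs (b - a).
Proof.
  intros HI HQ HL a b Ha Hb.
  apply (le_of_archimedean _ _ (K * (b - a) ^ 2)). intros n.
  set (N := INR n + 1). assert (HN : 0 < N) by (unfold N; pose proof (pos_INR n); lra).
  set (s := (b - a) / N).
  assert (Hs : N * s = b - a) by (unfold s; field; lra).
  set (t := fun i : nat => a + INR i * s).
  assert (Ht : forall i, (i <= S n)%nat -> I (t i)).
  { intros i Hi. unfold t.
    replace (INR i * s) with (INR i / N * (b - a)) by (unfold s; field; lra).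
    apply HI; trivial. pose proof (pos_INR i). apply le_INR in Hi. rewrite S_INR in Hi. fold N in Hi.
    split.
    - apply Rmult_le_pos; [lra|]. left. now apply Rinv_0_lt_compat.
    - apply (Rmult_le_reg_r N); [lra|]. unfold Rdiv. rewrite Rmult_assoc, Rinv_l; lra. }
  assert (Hi : forall i, (i <= S n)%nat ->
     Cmod (f (t i) - f a) <= INR i * (L * Rabs s + K * s ^ 2)).
  { induction i as [|i IH]; intros Hle.
    - unfold t. simpl. rewrite Rmult_0_l, Rplus_0_r.
      replace (f a - f a)%C with (RtoC 0) by ring. rewrite Cmod_0. lra.
    - eapply Rle_trans; [apply (Cmod_triangle_sub _ (f (t i)))|].
      rewrite S_INR.
      assert (H1 : Cmod (f (t (S i)) - f (t i)) <= L * Rabs s + K * s ^ 2).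
      { assert (E : t (S i) - t i = s) by (unfold t; rewrite S_INR; ring).
        pose proof (HQ (t i) (t (S i)) (Ht i ltac:(lia)) (Ht (S i) Hle)) as Hq.
        rewrite E in Hq.
        replace (f (t (S i)) - f (t i))%C with
          ((f (t (S i)) - f (t i) - RtoC s * f' (t i)) + RtoC s * f' (t i))%C by ring.
        eapply Rle_trans; [apply Cmod_triangle|]. rewrite Cmod_rmult.
        pose proof (HL (t i) (Ht i ltac:(lia))). pose proof (Rabs_pos s). nra. }
      specialize (IH ltac:(lia)). lra. }
  specialize (Hi (S n) (le_n _)).
  assert (E : t (S n) = b) by (unfold t; rewrite S_INR; fold N; lra).
  rewrite E, S_INR in Hi. fold N in Hi.
  eapply Rle_trans; [exact Hi|].
  assert (E2 : N * Rabs s = Rabs (b - a)).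
  { rewrite <- Hs, Rabs_mult, (Rabs_pos_eq N); lra. }
  assert (E3 : N * (K * s ^ 2) = K * (b - a) ^ 2 / N) by (unfold s; field; lra).
  rewrite <- E2, <- E3. lra.
Qed.

(** Only the bound [L] on the second derivative enters the conclusion; [K] and [K'] merely express
    differentiability and disappear. The function f minus its tangent at a has derivative f' -
    f'(a), which is at most L |b - a| on the segment from a to b. *)
Lemma taylor1_of_derivative (I : R -> Prop) (f f' f'' : R -> C) (K K' L : R) :
  convex1 I ->
  (forall t t', I t -> I t' -> Cmod (f t' - f t - RtoC (t' - t) * f' t) <= K * (t' - t) ^ 2) ->
  (forall t t', I t -> I t' -> Cmod (f' t' - f' t - RtoC (t' - t) * f'' t) <= K' * (t' - t) ^ 2) ->
  (forall t, I t -> Cmod (f'' t) <= L) ->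
  forall t t', I t -> I t' -> Cmod (f t' - f t - RtoC (t' - t) * f' t) <= L * (t' - t) ^ 2.
Proof.
  intros HI H1 H2 HL a b Ha Hb.
  set (J := fun s => exists r, 0 <= r <= 1 /\ s = a + r * (b - a)).
  assert (HJI : forall s, J s -> I s) by (intros s [r [Hr ->]]; now apply HI).
  assert (HJ : convex1 J).
  { intros s1 s2 t [r1 [Hr1 ->]] [r2 [Hr2 ->]] Ht. exists (r1 + t * (r2 - r1)). split; [split; nra|ring]. }
  assert (H0L : 0 <= L) by (eapply Rle_trans; [apply Cmod_ge_0|apply (HL a Ha)]).
  pose proof (lipschitz_of_derivative J (fun s => f s - RtoC s * f' a)%C (fun s => f' s - f' a)%C
     K (L * Rabs (b - a)) HJ) as HH.
  assert (HbJ : J b) by (exists 1; split; [split; lra|ring]).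
  assert (HaJ : J a) by (exists 0; split; [split; lra|ring]).
  simpl in HH.
  replace (f b - f a - RtoC (b - a) * f' a)%C with ((f b - RtoC b * f' a) - (f a - RtoC a * f' a))%C
    by (rewrite RtoC_minus; ring).
  replace (L * (b - a) ^ 2) with (L * Rabs (b - a) * Rabs (b - a)).
  2:{ rewrite Rmult_assoc. rewrite <- Rabs_mult, Rabs_pos_eq; [ring|apply Rle_0_sqr]. }
  apply HH; trivial.
  - intros t t' Ht Ht'. specialize (H1 t t' (HJI _ Ht) (HJI _ Ht')).
    replace (f t' - RtoC t' * f' a - (f t - RtoC t * f' a) - RtoC (t' - t) * (f' t - f' a))%C
      with (f t' - f t - RtoC (t' - t) * f' t)%C; trivial. rewrite RtoC_minus. ring.
  - intros t Ht. pose proof (HJI _ Ht) as HIt. destruct Ht as [r [Hr ->]].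
    eapply Rle_trans; [apply (lipschitz_of_derivative I f' f'' K' L HI H2 HL); trivial|].
    apply Rmult_le_compat_l; trivial.
    replace (a + r * (b - a) - a) with (r * (b - a)) by ring.
    rewrite Rabs_mult, (Rabs_pos_eq r) by lra. pose proof (Rabs_pos (b - a)). nra.
Qed.

(** * Smooth functions of two variables *)

Notation fn := (R -> R -> C).
Notation dom := (R -> R -> Prop).

Definition dist2 (x e x' e' : R) := Rabs (x' - x) + Rabs (e' - e).

Definition open2 (U : dom) := forall x e, U x e ->
  exists d, 0 < d /\ forall x' e', Rabs (x' - x) < d -> Rabs (e' - e) < d -> U x' e'.

Definition convex2 (U : dom) := forall x e x' e' t, U x e -> U x' e' -> 0 <= t <= 1 ->
  U (x + t * (x' - x)) (e + t * (e' - e)).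

Definition sub2 (U V : dom) := forall x e, U x e -> V x e.

Definition bounded2 (U : dom) (f : fn) := exists K, forall x e, U x e -> Cmod (f x e) <= K.

Definition remainder (f fx fe : fn) (x e x' e' : R) : C :=
  (f x' e' - f x e - RtoC (x' - x) * fx x e - RtoC (e' - e) * fe x e)%C.

(** Differentiability with a quadratic remainder and a single constant for all pairs of points. No
    limit is involved, so the condition can be added, multiplied, integrated and carried to the
    closure of the domain. *)
Definition diff2 (U : dom) (f fx fe : fn) := exists K, forall x e x' e',
  U x e -> U x' e' -> Cmod (remainder f fx fe x e x' e') <= K * dist2 x e x' e' ^ 2.

(** [dX] and [dE] are total operators, so that they can be iterated freely; on an open set where
    [diff2] holds they agree with the derivatives it names ([diff2_unique]). *)
Definition dX (f : fn) : fn := fun x e =>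
  (Derive (fun u => Re (f u e)) x, Derive (fun u => Im (f u e)) x).
Definition dE (f : fn) : fn := fun x e =>
  (Derive (fun u => Re (f x u)) e, Derive (fun u => Im (f x u)) e).

(** All derivatives of order at most [n], with the two variables in every order, are bounded on [U],
    and those of order below [n] satisfy [diff2]. *)
Fixpoint Sm (n : nat) (U : dom) (f : fn) : Prop :=
  bounded2 U f /\
  match n with
  | O => True
  | S n' => diff2 U f (dX f) (dE f) /\ Sm n' U (dX f) /\ Sm n' U (dE f)
  end.

Definition smooth2 (U : dom) (f : fn) := forall n, Sm n U f.

Lemma dist2_pos x e x' e' : 0 <= dist2 x e x' e'.
Proof. unfold dist2. pose proof (Rabs_pos (x' - x)). pose proof (Rabs_pos (e' - e)). lra. Qed.

Lemma bounded2_pos U f : bounded2 U f -> exists K, 0 < K /\ forall x e, U x e -> Cmod (f x e) <= K.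
Proof.
  intros [K HK]. exists (Rmax K 1). split.
  - apply Rlt_le_trans with 1; [lra|apply Rmax_r].
  - intros x e H. eapply Rle_trans; [apply HK; trivial|apply Rmax_l].
Qed.

Lemma diff2_pos U f fx fe : diff2 U f fx fe -> exists K, 0 < K /\ forall x e x' e',
  U x e -> U x' e' -> Cmod (remainder f fx fe x e x' e') <= K * dist2 x e x' e' ^ 2.
Proof.
  intros [K HK]. exists (Rmax K 1). split.
  - apply Rlt_le_trans with 1; [lra|apply Rmax_r].
  - intros x e x' e' H H'. eapply Rle_trans; [apply HK; trivial|].
    apply Rmult_le_compat_r; [apply pow2_ge_0|apply Rmax_l].
Qed.

Lemma is_derive_of_quadratic (f : R -> C) (x : R) (v : C) (K d : R) :
  0 < d ->
  (forall x', Rabs (x' - x) < d -> Cmod (f x' - f x - RtoC (x' - x) * v) <= K * (x' - x) ^ 2) ->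
  is_derive (fun u => Re (f u)) x (Re v) /\ is_derive (fun u => Im (f u)) x (Im v).
Proof.
  intros Hd H.
  (* [p] stands for the real or the imaginary part, so that one argument serves both. *)
  assert (G : forall p : C -> R, (forall z, Rabs (p z) <= Cmod z) ->
    (forall a b, p (a - b)%C = p a - p b) -> (forall r a, p (RtoC r * a)%C = r * p a) ->
    is_derive (fun u => p (f u)) x (p v)).
  { intros p Hp Hm Hs. apply is_derive_Reals. intros eps He.
    assert (HK : 0 < Rabs K + 1) by (pose proof (Rabs_pos K); lra).
    assert (Hdd : 0 < Rmin d (eps / (Rabs K + 1))).
    { apply Rmin_pos; trivial. apply Rdiv_lt_0_compat; lra. }
    exists (mkposreal _ Hdd). simpl. intros h Hh Hlt.
    assert (Hh1 : Rabs h < d) by (eapply Rlt_le_trans; [exact Hlt|apply Rmin_l]).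
    assert (Hh2 : Rabs h < eps / (Rabs K + 1)) by (eapply Rlt_le_trans; [exact Hlt|apply Rmin_r]).
    assert (E : x + h - x = h) by ring.
    specialize (H (x + h)). rewrite E in H. specialize (H Hh1).
    pose proof (Hp (f (x + h)%R - f x - RtoC h * v)%C) as Hq.
    rewrite !Hm, Hs in Hq.
    replace ((p (f (x + h)) - p (f x)) / h - p v) with ((p (f (x + h)) - p (f x) - h * p v) / h)
      by (field; trivial).
    unfold Rdiv. rewrite Rabs_mult, Rabs_inv.
    assert (Hah : 0 < Rabs h) by (now apply Rabs_pos_lt).
    apply (Rmult_lt_reg_r (Rabs h)); trivial. rewrite Rmult_assoc, Rinv_l, Rmult_1_r by lra.
    apply Rle_lt_trans with (K * h ^ 2); [lra|].
    replace (h ^ 2) with (Rabs h * Rabs h) by (rewrite <- Rabs_mult, Rabs_pos_eq; [ring|apply Rle_0_sqr]).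
    apply (Rmult_lt_compat_r (Rabs K + 1)) in Hh2; [|lra].
    unfold Rdiv in Hh2. rewrite Rmult_assoc, Rinv_l, Rmult_1_r in Hh2 by lra.
    rewrite <- Rmult_assoc. apply Rmult_lt_compat_r; trivial.
    pose proof (Rle_abs K). nra. }
  split; apply G.
  - apply re_le_Cmod.
  - intros a b. reflexivity.
  - intros r [a1 a2]. unfold Re, Im, Cmult, RtoC. simpl. ring.
  - intros z. eapply Rle_trans; [|apply Rmax_Cmod]. apply Rmax_r.
  - intros a b. reflexivity.
  - intros r [a1 a2]. unfold Re, Im, Cmult, RtoC. simpl. ring.
Qed.

Lemma diff2_unique U f fx fe x e : open2 U -> diff2 U f fx fe -> U x e ->
  dX f x e = fx x e /\ dE f x e = fe x e.
Proof.
  intros HU [K HK] Hp. destruct (HU x e Hp) as [d [Hd HB]].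
  assert (Z : forall a : R, Rabs (a - a) < d) by (intros a; rewrite Rminus_diag, Rabs_R0; trivial).
  split.
  - destruct (is_derive_of_quadratic (fun u => f u e) x (fx x e) K d Hd) as [H1 H2].
    + intros x' Hx'. pose proof (HK x e x' e Hp (HB x' e Hx' (Z e))) as H.
      unfold remainder, dist2 in H. rewrite Rminus_diag, Rabs_R0, Rplus_0_r, pow2_abs in H.
      replace (f x' e - f x e - RtoC (x' - x) * fx x e)%C
       with (f x' e - f x e - RtoC (x' - x) * fx x e - 0 * fe x e)%C by ring. exact H.
    + transitivity (Re (fx x e), Im (fx x e)); [|symmetry; apply surjective_pairing].
      unfold dX. f_equal; apply is_derive_unique; assumption.
  - destruct (is_derive_of_quadratic (fun u => f x u) e (fe x e) K d Hd) as [H1 H2].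
    + intros e' He'. pose proof (HK x e x e' Hp (HB x e' (Z x) He')) as H.
      unfold remainder, dist2 in H. rewrite Rminus_diag, Rabs_R0, Rplus_0_l, pow2_abs in H.
      replace (f x e' - f x e - RtoC (e' - e) * fe x e)%C
       with (f x e' - f x e - 0 * fx x e - RtoC (e' - e) * fe x e)%C by ring. exact H.
    + transitivity (Re (fe x e), Im (fe x e)); [|symmetry; apply surjective_pairing].
      unfold dE. f_equal; apply is_derive_unique; assumption.
Qed.

Lemma dX_ext U f g x e : open2 U -> (forall x e, U x e -> f x e = g x e) -> U x e ->
  dX f x e = dX g x e.
Proof.
  intros HU H Hp. destruct (HU x e Hp) as [d [Hd HB]].
  assert (L : locally x (fun u => f u e = g u e)).
  { exists (mkposreal d Hd). intros y Hy. apply H, HB; [exact Hy|].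
    rewrite Rminus_diag, Rabs_R0; trivial. }
  unfold dX. f_equal; apply Derive_ext_loc; revert L; apply filter_imp; intros u ->; trivial.
Qed.

Lemma dE_ext U f g x e : open2 U -> (forall x e, U x e -> f x e = g x e) -> U x e ->
  dE f x e = dE g x e.
Proof.
  intros HU H Hp. destruct (HU x e Hp) as [d [Hd HB]].
  assert (L : locally e (fun u => f x u = g x u)).
  { exists (mkposreal d Hd). intros y Hy. apply H, HB; [|exact Hy].
    rewrite Rminus_diag, Rabs_R0; trivial. }
  unfold dE. f_equal; apply Derive_ext_loc; revert L; apply filter_imp; intros u ->; trivial.
Qed.

Lemma bounded2_ext U f g : (forall x e, U x e -> f x e = g x e) -> bounded2 U f -> bounded2 U g.
Proof. intros H [K HK]. exists K. intros x e Hp. rewrite <- H; auto. Qed.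

Lemma diff2_ext U f fx fe g gx ge :
  (forall x e, U x e -> f x e = g x e) -> (forall x e, U x e -> fx x e = gx x e) ->
  (forall x e, U x e -> fe x e = ge x e) -> diff2 U f fx fe -> diff2 U g gx ge.
Proof.
  intros H1 H2 H3 [K HK]. exists K. intros x e x' e' Hp Hp'.
  specialize (HK x e x' e' Hp Hp'). unfold remainder in *. now rewrite <- !H1, <- H2, <- H3.
Qed.

Lemma Sm_ext n U f g : open2 U -> (forall x e, U x e -> f x e = g x e) -> Sm n U f -> Sm n U g.
Proof.
  intros HU. revert f g. induction n as [|n IH]; intros f g H [Hb Hr].
  - split; trivial. now apply (bounded2_ext U f).
  - split; [now apply (bounded2_ext U f)|]. destruct Hr as [Hd [Hx He]].
    assert (EX : forall x e, U x e -> dX f x e = dX g x e) by (intros; now apply (dX_ext U)).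
    assert (EE : forall x e, U x e -> dE f x e = dE g x e) by (intros; now apply (dE_ext U)).
    split; [|split].
    + now apply (diff2_ext U f (dX f) (dE f)).
    + now apply (IH (dX f)).
    + now apply (IH (dE f)).
Qed.

(** The working rule for smoothness: explicit candidates take the place of [dX f] and [dE f], with
    which they agree because [U] is open. *)
Lemma Sm_intro n U f fx fe : open2 U -> bounded2 U f -> diff2 U f fx fe ->
  Sm n U fx -> Sm n U fe -> Sm (S n) U f.
Proof.
  intros HU Hb Hd Hx He. split; trivial.
  assert (E : forall x e, U x e -> fx x e = dX f x e /\ fe x e = dE f x e).
  { intros x e Hp. destruct (diff2_unique U f fx fe x e HU Hd Hp); auto. }
  split; [|split].
  - apply (diff2_ext U f fx fe); trivial; intros; now apply E.
  - apply (Sm_ext n U fx); trivial; intros; now apply E.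
  - apply (Sm_ext n U fe); trivial; intros; now apply E.
Qed.

Lemma Sm_bounded n U f : Sm n U f -> bounded2 U f.
Proof. destruct n; intros H; apply H. Qed.

Lemma Sm_sub n U V f : sub2 V U -> Sm n U f -> Sm n V f.
Proof.
  intros HV. revert f. induction n as [|n IH]; intros f [[K HK] Hr].
  - split; trivial. exists K. auto.
  - split; [exists K; auto|]. destruct Hr as [[K' HK'] [Hx He]].
    split; [exists K'; auto|]. split; now apply IH.
Qed.

Lemma Sm_S n U f : Sm (S n) U f -> Sm n U f.
Proof.
  revert f. induction n as [|n IH]; intros f [Hb [Hd [Hx He]]].
  - split; trivial.
  - split; trivial. split; trivial. split; now apply IH.
Qed.

Lemma smooth2_dX U f : smooth2 U f -> smooth2 U (dX f).
Proof. intros H n. apply (H (S n)). Qed.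
Lemma smooth2_dE U f : smooth2 U f -> smooth2 U (dE f).
Proof. intros H n. apply (H (S n)). Qed.
Lemma smooth2_diff2 U f : smooth2 U f -> diff2 U f (dX f) (dE f).
Proof. intros H. apply (H 1%nat). Qed.
Lemma smooth2_bounded U f : smooth2 U f -> bounded2 U f.
Proof. intros H. apply (H 0%nat). Qed.

(** * Algebraic operations *)

Lemma bounded2_plus U f g : bounded2 U f -> bounded2 U g -> bounded2 U (fun x e => f x e + g x e)%C.
Proof.
  intros [K HK] [K' HK']. exists (K + K'). intros x e H.
  eapply Rle_trans; [apply Cmod_triangle|]. specialize (HK x e H). specialize (HK' x e H). lra.
Qed.

Lemma bounded2_mult U f g : bounded2 U f -> bounded2 U g -> bounded2 U (fun x e => f x e * g x e)%C.
Proof.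
  intros [K HK] [K' HK']. exists (K * K'). intros x e H. rewrite Cmod_mult.
  apply Rmult_le_compat; auto; apply Cmod_ge_0.
Qed.

Lemma diff2_plus U f fx fe g gx ge : diff2 U f fx fe -> diff2 U g gx ge ->
  diff2 U (fun x e => f x e + g x e)%C (fun x e => fx x e + gx x e)%C (fun x e => fe x e + ge x e)%C.
Proof.
  intros [K HK] [K' HK']. exists (K + K'). intros x e x' e' Hp Hp'.
  specialize (HK x e x' e' Hp Hp'). specialize (HK' x e x' e' Hp Hp').
  replace (remainder _ _ _ x e x' e') with
    (remainder f fx fe x e x' e' + remainder g gx ge x e x' e')%C by (unfold remainder; ring).
  eapply Rle_trans; [apply Cmod_triangle|]. lra.
Qed.

Lemma linear_part_bound (a b : C) (h k A : R) : Cmod a <= A -> Cmod b <= A ->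
  Cmod (RtoC h * a + RtoC k * b) <= A * (Rabs h + Rabs k).
Proof.
  intros Ha Hb. eapply Rle_trans; [apply Cmod_triangle|]. rewrite !Cmod_rmult.
  pose proof (Rabs_pos h). pose proof (Rabs_pos k). nra.
Qed.

(** The domain may fail to be convex. Points at distance at most 1 are compared by the first-order
    expansion, whose quadratic error is then at most linear; for more distant points the bound on f
    is enough. *)
Lemma diff2_lipschitz U f fx fe : bounded2 U f -> bounded2 U fx -> bounded2 U fe ->
  diff2 U f fx fe -> exists L, 0 < L /\ forall x e x' e', U x e -> U x' e' ->
  Cmod (f x' e' - f x e) <= L * dist2 x e x' e'.
Proof.
  intros Hf Hfx Hfe Df.
  destruct (bounded2_pos _ _ Hf) as [F [F0 HF]].
  destruct (bounded2_pos _ _ Hfx) as [Fx [Fx0 HFx]].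
  destruct (bounded2_pos _ _ Hfe) as [Fe [Fe0 HFe]].
  destruct (diff2_pos _ _ _ _ Df) as [K [K0 HK]].
  exists (2 * F + Fx + Fe + K). split; [lra|]. intros x e x' e' Hp Hp'.
  specialize (HK x e x' e' Hp Hp'). pose proof (HF x e Hp) as F1. pose proof (HF x' e' Hp') as F2.
  set (d := dist2 x e x' e') in *. assert (Hd : 0 <= d) by apply dist2_pos.
  destruct (Rle_or_lt d 1) as [H1|H1].
  - replace (f x' e' - f x e)%C with (remainder f fx fe x e x' e' +
      (RtoC (x' - x) * fx x e + RtoC (e' - e) * fe x e))%C by (unfold remainder; ring).
    eapply Rle_trans; [apply Cmod_triangle|].
    assert (Hlf : Cmod (RtoC (x' - x) * fx x e + RtoC (e' - e) * fe x e) <= (Fx + Fe) * d).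
    { apply linear_part_bound; [specialize (HFx x e Hp)|specialize (HFe x e Hp)]; lra. }
    assert (d * d <= d * 1) by (apply Rmult_le_compat_l; trivial).
    assert (K * (d * d) <= K * d) by (apply Rmult_le_compat_l; lra).
    assert (0 <= F * d) by (apply Rmult_le_pos; lra).
    simpl in HK. rewrite Rmult_1_r in HK. lra.
  - eapply Rle_trans; [apply Cmod_minus_le|].
    assert (F * 1 <= F * d) by (apply Rmult_le_compat_l; lra).
    assert (0 <= (Fx + Fe + K) * d) by (apply Rmult_le_pos; lra). lra.
Qed.

Lemma diff2_mult U f fx fe g gx ge : bounded2 U f -> bounded2 U g ->
  bounded2 U fx -> bounded2 U fe -> bounded2 U gx -> bounded2 U ge ->
  diff2 U f fx fe -> diff2 U g gx ge ->
  diff2 U (fun x e => f x e * g x e)%C (fun x e => fx x e * g x e + f x e * gx x e)%C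
    (fun x e => fe x e * g x e + f x e * ge x e)%C.
Proof.
  intros Hf Hg Hfx Hfe Hgx Hge Df Dg.
  destruct (diff2_lipschitz U g gx ge Hg Hgx Hge Dg) as [L [L0 HL]].
  destruct (bounded2_pos _ _ Hf) as [F [F0 HF]]. destruct (bounded2_pos _ _ Hg) as [G [G0 HG]].
  destruct (bounded2_pos _ _ Hfx) as [Fx [Fx0 HFx]].
  destruct (bounded2_pos _ _ Hfe) as [Fe [Fe0 HFe]].
  destruct (diff2_pos _ _ _ _ Df) as [K [K0 HK]]. destruct (diff2_pos _ _ _ _ Dg) as [K' [K0' HK']].
  exists (K * G + F * K' + (Fx + Fe) * L). intros x e x' e' Hp Hp'.
  specialize (HK x e x' e' Hp Hp'). specialize (HK' x e x' e' Hp Hp').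
  specialize (HL x e x' e' Hp Hp'). pose proof (HG x' e' Hp') as G1. pose proof (HF x e Hp) as F1.
  assert (Hd : 0 <= dist2 x e x' e') by apply dist2_pos.
  assert (Hlf : Cmod (RtoC (x' - x) * fx x e + RtoC (e' - e) * fe x e)
     <= (Fx + Fe) * dist2 x e x' e').
  { apply linear_part_bound; [specialize (HFx x e Hp)|specialize (HFe x e Hp)]; lra. }
  (* Product rule with g at the far point and f at the near one; what is left over is a product of
     two increments, hence quadratic. *)
  replace (remainder _ _ _ x e x' e') with (remainder f fx fe x e x' e' * g x' e'
     + f x e * remainder g gx ge x e x' e'
     + (RtoC (x' - x) * fx x e + RtoC (e' - e) * fe x e) * (g x' e' - g x e))%C
    by (unfold remainder; ring).
  set (d := dist2 x e x' e') in *.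
  eapply Rle_trans; [apply Cmod_triangle|].
  eapply Rle_trans; [apply Rplus_le_compat_r, Cmod_triangle|]. rewrite !Cmod_mult.
  pose proof (Cmod_ge_0 (remainder f fx fe x e x' e')). pose proof (Cmod_ge_0 (g x' e')).
  pose proof (Cmod_ge_0 (remainder g gx ge x e x' e')). pose proof (Cmod_ge_0 (f x e)).
  pose proof (Cmod_ge_0 (RtoC (x' - x) * fx x e + RtoC (e' - e) * fe x e)).
  pose proof (Cmod_ge_0 (g x' e' - g x e)).
  assert (T1 : Cmod (remainder f fx fe x e x' e') * Cmod (g x' e') <= (K * d ^ 2) * G)
    by (apply Rmult_le_compat; trivial).
  assert (T2 : Cmod (f x e) * Cmod (remainder g gx ge x e x' e') <= F * (K' * d ^ 2))
    by (apply Rmult_le_compat; trivial).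
  assert (T3 : Cmod (RtoC (x' - x) * fx x e + RtoC (e' - e) * fe x e) * Cmod (g x' e' - g x e)
    <= ((Fx + Fe) * d) * (L * d)) by (apply Rmult_le_compat; trivial).
  lra.
Qed.

Section Operations.
Variable U : dom.
Hypothesis HU : open2 U.

Lemma Sm_const n (c : C) : Sm n U (fun _ _ => c).
Proof.
  revert c. induction n as [|n IH]; intros c.
  - split; trivial. exists (Cmod c). intros; lra.
  - apply (Sm_intro n U _ (fun _ _ => RtoC 0) (fun _ _ => RtoC 0)); trivial.
    + exists (Cmod c). intros; lra.
    + exists 0. intros x e x' e' _ _. unfold remainder.
      replace (c - c - RtoC (x' - x) * 0 - RtoC (e' - e) * 0)%C with (RtoC 0) by ring.
      rewrite Cmod_0. lra.
Qed.

Lemma Sm_plus n f g : Sm n U f -> Sm n U g -> Sm n U (fun x e => f x e + g x e)%C.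
Proof.
  revert f g. induction n as [|n IH]; intros f g Hf Hg.
  - split; trivial. apply bounded2_plus; [apply Hf|apply Hg].
  - destruct Hf as [Bf [Df [Xf Ef]]]. destruct Hg as [Bg [Dg [Xg Eg]]].
    eapply Sm_intro; trivial.
    + now apply bounded2_plus.
    + apply diff2_plus; [exact Df|exact Dg].
    + now apply IH.
    + now apply IH.
Qed.

Lemma Sm_mult n f g : Sm n U f -> Sm n U g -> Sm n U (fun x e => f x e * g x e)%C.
Proof.
  revert f g. induction n as [|n IH]; intros f g Hf Hg.
  - split; trivial. apply bounded2_mult; [apply Hf|apply Hg].
  - pose proof (Sm_S _ _ _ Hf) as Hf'. pose proof (Sm_S _ _ _ Hg) as Hg'.
    destruct Hf as [Bf [Df [Xf Ef]]]. destruct Hg as [Bg [Dg [Xg Eg]]].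
    eapply Sm_intro; trivial.
    + now apply bounded2_mult.
    + apply diff2_mult; [exact Bf|exact Bg|exact (Sm_bounded _ _ _ Xf)|exact (Sm_bounded _ _ _ Ef)
        |exact (Sm_bounded _ _ _ Xg)|exact (Sm_bounded _ _ _ Eg)|exact Df|exact Dg].
    + apply Sm_plus; now apply IH.
    + apply Sm_plus; now apply IH.
Qed.

Lemma Sm_scal n (c : C) f : Sm n U f -> Sm n U (fun x e => c * f x e)%C.
Proof. intros H. apply (Sm_mult n (fun _ _ => c)); trivial. apply Sm_const. Qed.

Lemma Sm_minus n f g : Sm n U f -> Sm n U g -> Sm n U (fun x e => f x e - g x e)%C.
Proof.
  intros Hf Hg. apply (Sm_ext n U (fun x e => f x e + (- RtoC 1) * g x e)%C); trivial.
  - intros x e _. ring.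
  - apply Sm_plus; trivial. now apply Sm_scal.
Qed.

Lemma Sm_inv n f k : 0 < k -> (forall x e, U x e -> k <= Cmod (f x e)) ->
  Sm n U f -> Sm n U (fun x e => / f x e)%C.
Proof.
  intros Hk Hlow. assert (Hnz : forall x e, U x e -> f x e <> 0%C).
  { intros x e Hp E. specialize (Hlow x e Hp). rewrite E, Cmod_0 in Hlow. lra. }
  assert (Hb : bounded2 U (fun x e => / f x e)%C).
  { exists (/ k). intros x e Hp. rewrite Cmod_inv by auto. apply Rinv_le_contravar; auto. }
  induction n as [|n IH]; intros Hf.
  - split; trivial.
  - pose proof (IH (Sm_S _ _ _ Hf)) as Hi.
    destruct Hf as [Bf [Df [Xf Ef]]].
    apply (Sm_intro n U _ (fun x e => (- RtoC 1) * (dX f x e * (/ f x e * / f x e)))%C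
       (fun x e => (- RtoC 1) * (dE f x e * (/ f x e * / f x e)))%C); trivial.
    + destruct (diff2_lipschitz U f _ _ Bf (Sm_bounded _ _ _ Xf) (Sm_bounded _ _ _ Ef) Df)
        as [L [L0 HL]].
      destruct (diff2_pos _ _ _ _ Df) as [K [K0 HK]].
      exists (/ k * / k * K + / k * / k * / k * L * L). intros x e x' e' Hp Hp'.
      specialize (HK x e x' e' Hp Hp'). specialize (HL x e x' e' Hp Hp').
      assert (Hd : 0 <= dist2 x e x' e') by apply dist2_pos.
      replace (remainder _ _ _ x e x' e') with
        (- (/ f x e * / f x e * remainder f (dX f) (dE f) x e x' e')
         + / f x e * / f x e * / f x' e' * ((f x' e' - f x e) * (f x' e' - f x e)))%C.
      2:{ unfold remainder. field. split; auto. }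
      eapply Rle_trans; [apply Cmod_triangle|]. rewrite Cmod_opp, !Cmod_mult, !Cmod_inv by auto.
      pose proof (Cmod_ge_0 (remainder f (dX f) (dE f) x e x' e')).
      pose proof (Cmod_ge_0 (f x' e' - f x e)).
      set (d := dist2 x e x' e') in *.
      assert (I1 : / Cmod (f x e) <= / k) by (apply Rinv_le_contravar; auto).
      assert (I2 : / Cmod (f x' e') <= / k) by (apply Rinv_le_contravar; auto).
      assert (P1 : 0 <= / Cmod (f x e)).
      { left. apply Rinv_0_lt_compat. specialize (Hlow x e Hp). lra. }
      assert (P2 : 0 <= / Cmod (f x' e')).
      { left. apply Rinv_0_lt_compat. specialize (Hlow x' e' Hp'). lra. }
      assert (T0 : / Cmod (f x e) * / Cmod (f x e) <= / k * / k) by (apply Rmult_le_compat; trivial).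
      assert (T0p : 0 <= / Cmod (f x e) * / Cmod (f x e)) by (apply Rmult_le_pos; trivial).
      assert (T1 : / Cmod (f x e) * / Cmod (f x e) * Cmod (remainder f (dX f) (dE f) x e x' e')
         <= / k * / k * (K * d ^ 2)) by (apply Rmult_le_compat; trivial).
      assert (T2 : / Cmod (f x e) * / Cmod (f x e) * / Cmod (f x' e') <= / k * / k * / k)
        by (apply Rmult_le_compat; trivial).
      assert (T3 : Cmod (f x' e' - f x e) * Cmod (f x' e' - f x e) <= (L * d) * (L * d))
        by (apply Rmult_le_compat; trivial).
      assert (T4 : / Cmod (f x e) * / Cmod (f x e) * / Cmod (f x' e') *
         (Cmod (f x' e' - f x e) * Cmod (f x' e' - f x e)) <= / k * / k * / k * ((L * d) * (L * d))).
      { apply Rmult_le_compat; trivial; [|]; repeat apply Rmult_le_pos; trivial. }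
      lra.
    + apply Sm_scal, Sm_mult; trivial. now apply Sm_mult.
    + apply Sm_scal, Sm_mult; trivial. now apply Sm_mult.
Qed.

End Operations.

Lemma diff2_affine U V f fx fe (al be ga : R) :
  (forall x e, V x e -> U (x + al * e) (be * e + ga)) -> diff2 U f fx fe ->
  diff2 V (fun x e => f (x + al * e) (be * e + ga)) (fun x e => fx (x + al * e) (be * e + ga))
    (fun x e => RtoC al * fx (x + al * e)%R (be * e + ga)%R
              + RtoC be * fe (x + al * e)%R (be * e + ga)%R)%C.
Proof.
  intros Hmap [K HK]. exists (Rabs K * (1 + Rabs al + Rabs be) ^ 2). intros x e x' e' Hp Hp'.
  specialize (HK _ _ _ _ (Hmap _ _ Hp) (Hmap _ _ Hp')).
  replace (remainder _ _ _ x e x' e') with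
   (remainder f fx fe (x + al * e) (be * e + ga) (x' + al * e') (be * e' + ga)).
  2:{ unfold remainder.
      replace (x' + al * e' - (x + al * e)) with ((x' - x) + al * (e' - e)) by ring.
      replace (be * e' + ga - (be * e + ga)) with (be * (e' - e)) by ring.
      rewrite RtoC_plus, !RtoC_mult. ring. }
  eapply Rle_trans; [exact HK|].
  set (d := dist2 x e x' e').
  assert (Hd : 0 <= d) by apply dist2_pos.
  set (d' := dist2 (x + al * e) (be * e + ga) (x' + al * e') (be * e' + ga)).
  assert (Hd' : 0 <= d') by apply dist2_pos.
  assert (Hdd : d' <= (1 + Rabs al + Rabs be) * d).
  { unfold d', d, dist2.
    replace (x' + al * e' - (x + al * e)) with ((x' - x) + al * (e' - e)) by ring.
    replace (be * e' + ga - (be * e + ga)) with (be * (e' - e)) by ring.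
    pose proof (Rabs_triang (x' - x) (al * (e' - e))). rewrite Rabs_mult in *.
    pose proof (Rabs_pos (x' - x)). pose proof (Rabs_pos (e' - e)).
    pose proof (Rabs_pos al). pose proof (Rabs_pos be). nra. }
  apply Rle_trans with (Rabs K * d' ^ 2).
  - apply Rmult_le_compat_r; [apply pow2_ge_0|apply Rle_abs].
  - rewrite Rmult_assoc, <- Rpow_mult_distr.
    apply Rmult_le_compat_l; [apply Rabs_pos|]. now apply pow_incr.
Qed.

Lemma Sm_affine n U V f (al be ga : R) : open2 U -> open2 V ->
  (forall x e, V x e -> U (x + al * e) (be * e + ga)) ->
  Sm n U f -> Sm n V (fun x e => f (x + al * e) (be * e + ga)).
Proof.
  intros HU HV Hmap. revert f. induction n as [|n IH]; intros f [[K HK] Hr].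
  - split; trivial. exists K. auto.
  - destruct Hr as [HD [Hx He]].
    eapply Sm_intro; [trivial| |apply (diff2_affine U V f (dX f) (dE f)); trivial| |].
    + exists K. auto.
    + now apply IH.
    + apply Sm_plus; trivial; apply Sm_scal; trivial; now apply IH.
Qed.

(* If a point of the first piece lies outside the second one, or vice versa, the two points
   are at distance at least c' - c and the remainder estimate is trivial. *)
Lemma Sm_glue n U f (c c' : R) : c < c' -> open2 U ->
  Sm n (fun x e => U x e /\ x < c') f -> Sm n (fun x e => U x e /\ c < x) f -> Sm n U f.
Proof.
  intros Hc HU. revert f. induction n as [|n IH]; intros f [B1 H1] [B2 H2].
  all: assert (BG : forall g, bounded2 (fun x e => U x e /\ x < c') g ->
      bounded2 (fun x e => U x e /\ c < x) g -> bounded2 U g).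
  1,3: intros g [K1 HK1] [K2 HK2]; exists (Rmax K1 K2); intros x e Hp;
      destruct (Rlt_or_le x c') as [Hl|Hl];
      [eapply Rle_trans; [apply HK1; tauto|apply Rmax_l]
      |eapply Rle_trans; [apply HK2; split; trivial; lra|apply Rmax_r]].
  - split; auto.
  - split; auto. destruct H1 as [D1 [X1 E1]]. destruct H2 as [D2 [X2 E2]].
    split; [|split; auto].
    destruct (bounded2_pos _ _ (BG f B1 B2)) as [F [F0 HF]].
    destruct (bounded2_pos _ _ (BG _ (Sm_bounded _ _ _ X1) (Sm_bounded _ _ _ X2))) as [Fx [Fx0 HFx]].
    destruct (bounded2_pos _ _ (BG _ (Sm_bounded _ _ _ E1) (Sm_bounded _ _ _ E2))) as [Fe [Fe0 HFe]].
    destruct (diff2_pos _ _ _ _ D1) as [K1 [K10 HK1]].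
    destruct (diff2_pos _ _ _ _ D2) as [K2 [K20 HK2]].
    set (w := c' - c). assert (Hw : 0 < w) by (unfold w; lra).
    set (K3 := (2 * F / w + Fx + Fe) / w).
    assert (HK3 : 0 < K3).
    { unfold K3. apply Rdiv_lt_0_compat; trivial.
      assert (0 < 2 * F / w) by (apply Rdiv_lt_0_compat; lra). lra. }
    exists (K1 + K2 + K3). intros x e x' e' Hp Hp'.
    pose proof (pow2_ge_0 (dist2 x e x' e')) as Hsq.
    assert (Far : w <= Rabs (x' - x) ->
      Cmod (remainder f (dX f) (dE f) x e x' e') <= (K1 + K2 + K3) * dist2 x e x' e' ^ 2).
    { intros Hfar. set (d := dist2 x e x' e') in *.
      assert (Hd : w <= d) by (unfold d, dist2; pose proof (Rabs_pos (e' - e)); lra).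
      replace (remainder f (dX f) (dE f) x e x' e') with
        ((f x' e' - f x e) - (RtoC (x' - x) * dX f x e + RtoC (e' - e) * dE f x e))%C
        by (unfold remainder; ring).
      assert (Hl : Cmod (RtoC (x' - x) * dX f x e + RtoC (e' - e) * dE f x e) <= (Fx + Fe) * d).
      { apply linear_part_bound; [specialize (HFx x e Hp)|specialize (HFe x e Hp)]; lra. }
      assert (Hl2 : Cmod (f x' e' - f x e) <= 2 * F).
      { eapply Rle_trans; [apply Cmod_minus_le|].
        pose proof (HF x e Hp). pose proof (HF x' e' Hp'). lra. }
      apply Rle_trans with (2 * F + (Fx + Fe) * d).
      { eapply Rle_trans; [apply Cmod_minus_le|]. lra. }
      apply Rle_trans with (K3 * d ^ 2); [|nra].
      replace (K3 * d ^ 2) with (2 * F * ((d / w) * (d / w)) + (Fx + Fe) * d * (d / w))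
        by (unfold K3; field; lra).
      assert (Hr : 1 <= d / w).
      { apply (Rmult_le_reg_r w); trivial. unfold Rdiv. rewrite Rmult_assoc, Rinv_l; lra. }
      assert (1 <= (d / w) * (d / w)) by nra.
      assert (0 <= (Fx + Fe) * d) by nra. nra. }
    destruct (Rlt_or_le x c') as [Hx|Hx]; destruct (Rlt_or_le x' c') as [Hx'|Hx'].
    + eapply Rle_trans; [apply HK1; tauto|]. nra.
    + destruct (Rlt_or_le c x) as [Hx2|Hx2].
      * eapply Rle_trans; [apply HK2; split; trivial; lra|]. nra.
      * apply Far. unfold w. rewrite Rabs_pos_eq; lra.
    + destruct (Rlt_or_le c x') as [Hx2|Hx2].
      * eapply Rle_trans; [apply HK2; split; trivial; lra|]. nra.
      * apply Far. unfold w. rewrite Rabs_left1; lra.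
    + eapply Rle_trans; [apply HK2; split; trivial; lra|]. nra.
Qed.

(** * Integrals of complex functions of a real variable *)

(** A pointwise condition that implies continuity, hence integrability, and is stable under products
    by an elementary estimate. *)
Definition lip_near (f : R -> C) (t : R) := exists K d, 0 < d /\
  forall s, Rabs (s - t) < d -> Cmod (f s - f t) <= K * Rabs (s - t).

Lemma lip_near_continuous f t : lip_near f t -> continuous (U := C_R_NormedModule) f t.
Proof.
  intros [K [d [Hd H]]]. apply filterlim_locally. intros eps.
  assert (Hd2 : 0 < Rmin d (eps / (Rabs K + 1))).
  { apply Rmin_pos; trivial. apply Rdiv_lt_0_compat; [apply cond_pos|].
    pose proof (Rabs_pos K). lra. }
  exists (mkposreal _ Hd2). intros s Hs. simpl in Hs.
  apply C_NormedModule_mixin_compat1.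
  change (Rabs (s - t) < Rmin d (eps / (Rabs K + 1))) in Hs.
  assert (H1 : Rabs (s - t) < d) by (eapply Rlt_le_trans; [exact Hs|apply Rmin_l]).
  assert (H2 : Rabs (s - t) < eps / (Rabs K + 1)) by (eapply Rlt_le_trans; [exact Hs|apply Rmin_r]).
  pose proof (Rabs_pos K). pose proof (Rle_abs K). pose proof (Rabs_pos (s - t)).
  change (Cmod (f s - f t) < eps).
  eapply Rle_lt_trans; [apply H; trivial|].
  apply (Rmult_lt_compat_r (Rabs K + 1)) in H2; [|lra].
  unfold Rdiv in H2. rewrite Rmult_assoc, Rinv_l, Rmult_1_r in H2 by lra.
  nra.
Qed.

Definition isI (f : R -> C) (a b : R) (v : C) := is_RInt (V := C_R_CompleteNormedModule) f a b v.
Definition Cint (f : R -> C) (a b : R) : C := RInt (V := C_R_CompleteNormedModule) f a b.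

Definition in_between (a b t : R) := Rmin a b <= t <= Rmax a b.

Lemma isI_Cint f a b : (forall t, in_between a b t -> lip_near f t) -> isI f a b (Cint f a b).
Proof.
  intros H. apply (RInt_correct (V := C_R_CompleteNormedModule)).
  apply (ex_RInt_continuous (V := C_R_CompleteNormedModule)).
  intros z Hz. apply lip_near_continuous. now apply H.
Qed.

Lemma isI_unique f a b v : isI f a b v -> Cint f a b = v.
Proof. apply (is_RInt_unique (V := C_R_CompleteNormedModule)). Qed.

Lemma isI_plus f g a b u v : isI f a b u -> isI g a b v ->
  isI (fun t => f t + g t)%C a b (u + v)%C.
Proof. apply (is_RInt_plus (V := C_R_CompleteNormedModule)). Qed.

Lemma isI_ext f g a b v : (forall t, f t = g t) -> isI f a b v -> isI g a b v.
Proof. intros H. apply (is_RInt_ext (V := C_R_CompleteNormedModule)). intros; apply H. Qed.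

Lemma isI_scal r f a b v : isI f a b v -> isI (fun t => RtoC r * f t)%C a b (RtoC r * v)%C.
Proof.
  intros H. rewrite <- scal_R_Cmult.
  apply (isI_ext (fun t => scal (V := C_R_CompleteNormedModule) r (f t))).
  - intros t. apply scal_R_Cmult.
  - now apply (is_RInt_scal (V := C_R_CompleteNormedModule)).
Qed.

Lemma isI_minus f g a b u v : isI f a b u -> isI g a b v ->
  isI (fun t => f t - g t)%C a b (u - v)%C.
Proof. apply (is_RInt_minus (V := C_R_CompleteNormedModule)). Qed.

Lemma isI_chasles f a b c u v : isI f a b u -> isI f b c v -> isI f a c (u + v)%C.
Proof. apply (is_RInt_Chasles (V := C_R_CompleteNormedModule)). Qed.

Lemma isI_swap f a b v : isI f a b v -> isI f b a (- v)%C.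
Proof. apply (is_RInt_swap (V := C_R_CompleteNormedModule)). Qed.

Lemma isI_const a b c : isI (fun _ => c) a b (RtoC (b - a) * c)%C.
Proof. rewrite <- scal_R_Cmult. apply (is_RInt_const (V := C_R_CompleteNormedModule)). Qed.

Lemma isI_bound f a b v K : isI f a b v -> (forall t, in_between a b t -> Cmod (f t) <= K) ->
  Cmod v <= K * Rabs (b - a).
Proof.
  assert (G : forall a b v, a <= b -> isI f a b v ->
     (forall t, in_between a b t -> Cmod (f t) <= K) -> Cmod v <= K * (b - a)).
  { clear. intros a b v Hab Hv H. rewrite Cmod_norm.
    apply (norm_RInt_le (V := C_R_CompleteNormedModule) f (fun _ => K) a b v); trivial.
    - intros t Ht. rewrite <- Cmod_norm. apply H. unfold in_between.
      rewrite Rmin_left, Rmax_right; trivial.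
    - replace (K * (b - a)) with (scal (V := R_NormedModule) (b - a) K)
        by (unfold scal; simpl; unfold mult; simpl; ring).
      apply (is_RInt_const (V := R_NormedModule)). }
  intros Hv H. destruct (Rle_or_lt a b) as [Hab|Hab].
  - rewrite Rabs_pos_eq by lra. now apply G.
  - rewrite Rabs_left1 by lra. rewrite <- (Cmod_opp v).
    replace (- (b - a)) with (a - b) by ring. apply G; [lra|now apply isI_swap|].
    intros t Ht. apply H. unfold in_between in *. now rewrite Rmin_comm, Rmax_comm.
Qed.

Lemma isI_derive (f f' : R -> C) (a b K : R) :
  (forall t, in_between a b t -> exists d, 0 < d /\ forall s, Rabs (s - t) < d ->
     Cmod (f s - f t - RtoC (s - t) * f' t) <= K * (s - t) ^ 2) ->
  (forall t, in_between a b t -> lip_near f' t) -> isI f' a b (f b - f a)%C.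
Proof.
  intros H Hc.
  apply (is_RInt_derive (V := C_R_CompleteNormedModule) f f' a b).
  - intros t Ht. destruct (H t Ht) as [d [Hd HQ]]. split.
    + apply (is_linear_scal_l (V := C_R_NormedModule)).
    + intros y Hy. pose proof (is_filter_lim_locally_unique (V := R_NormedModule) t y Hy) as Ey. subst y.
      intros eps.
      assert (Hd2 : 0 < Rmin d (eps / (Rabs K + 1))).
      { apply Rmin_pos; trivial. apply Rdiv_lt_0_compat; [apply cond_pos|].
        pose proof (Rabs_pos K). lra. }
      exists (mkposreal _ Hd2). intros s Hs. simpl in Hs.
      change (Rabs (s - t) < Rmin d (eps / (Rabs K + 1))) in Hs.
      assert (H1 : Rabs (s - t) < d) by (eapply Rlt_le_trans; [exact Hs|apply Rmin_l]).
      assert (H2 : Rabs (s - t) < eps / (Rabs K + 1))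
        by (eapply Rlt_le_trans; [exact Hs|apply Rmin_r]).
      specialize (HQ s H1).
      change (minus s t) with (s - t). rewrite scal_R_Cmult.
      change (norm (V := C_R_NormedModule) (f s - f t - RtoC (s - t) * f' t)%C
        <= eps * Rabs (s - t)).
      rewrite <- Cmod_norm.
      eapply Rle_trans; [exact HQ|].
      rewrite <- (pow2_abs (s - t)). pose proof (Rabs_pos (s - t)).
      pose proof (Rabs_pos K). pose proof (Rle_abs K).
      apply (Rmult_lt_compat_r (Rabs K + 1)) in H2; [|lra].
      unfold Rdiv in H2. rewrite Rmult_assoc, Rinv_l, Rmult_1_r in H2 by lra.
      assert (K * Rabs (s - t) <= eps) by nra.
      replace (K * Rabs (s - t) ^ 2) with (K * Rabs (s - t) * Rabs (s - t)) by ring.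
      now apply Rmult_le_compat_r.
  - intros t Ht. apply lip_near_continuous. now apply Hc.
Qed.

Lemma lip_near_mult f g t : lip_near f t -> lip_near g t -> lip_near (fun s => f s * g s)%C t.
Proof.
  intros [K [d [Hd H]]] [K' [d' [Hd' H']]].
  exists (Rabs K * (Cmod (g t) + Rabs K') + Cmod (f t) * Rabs K').
  exists (Rmin (Rmin d d') 1). split.
  { apply Rmin_pos; [now apply Rmin_pos|lra]. }
  intros s Hs.
  assert (H1 : Rabs (s - t) < 1) by (eapply Rlt_le_trans; [exact Hs|apply Rmin_r]).
  assert (H2 : Rabs (s - t) < Rmin d d') by (eapply Rlt_le_trans; [exact Hs|apply Rmin_l]).
  assert (H3 : Rabs (s - t) < d) by (eapply Rlt_le_trans; [exact H2|apply Rmin_l]).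
  assert (H4 : Rabs (s - t) < d') by (eapply Rlt_le_trans; [exact H2|apply Rmin_r]).
  specialize (H s H3). specialize (H' s H4).
  pose proof (Rabs_pos (s - t)) as Hp.
  assert (G1 : Cmod (f s - f t) <= Rabs K * Rabs (s - t)).
  { eapply Rle_trans; [exact H|]. apply Rmult_le_compat_r; trivial. apply Rle_abs. }
  assert (G2 : Cmod (g s - g t) <= Rabs K' * Rabs (s - t)).
  { eapply Rle_trans; [exact H'|]. apply Rmult_le_compat_r; trivial. apply Rle_abs. }
  assert (G3 : Cmod (g s) <= Cmod (g t) + Rabs K').
  { replace (g s) with (g t + (g s - g t))%C by ring. eapply Rle_trans; [apply Cmod_triangle|].
    pose proof (Rabs_pos K'). nra. }
  replace (f s * g s - f t * g t)%C with ((f s - f t) * g s + f t * (g s - g t))%C by ring.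
  eapply Rle_trans; [apply Cmod_triangle|]. rewrite !Cmod_mult.
  assert (Cmod (f s - f t) * Cmod (g s) <= (Rabs K * Rabs (s - t)) * (Cmod (g t) + Rabs K')).
  { apply Rmult_le_compat; trivial; apply Cmod_ge_0. }
  assert (Cmod (f t) * Cmod (g s - g t) <= Cmod (f t) * (Rabs K' * Rabs (s - t))).
  { apply Rmult_le_compat_l; trivial. apply Cmod_ge_0. }
  lra.
Qed.

Lemma lip_near_pow k t : lip_near (fun s => RtoC (s ^ k)) t.
Proof.
  induction k as [|k IH].
  - exists 0. exists 1. split; [lra|]. intros s _. simpl.
    replace (RtoC 1 - RtoC 1)%C with (RtoC 0) by ring. rewrite Cmod_0. lra.
  - destruct (fun H => lip_near_mult (fun s => RtoC s) (fun s => RtoC (s ^ k)) t H IH) as [K [d [Hd H]]].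
    + exists 1. exists 1. split; [lra|]. intros s _. rewrite <- RtoC_minus, Cmod_R. lra.
    + exists K. exists d. split; trivial. intros s Hs. simpl. rewrite !RtoC_mult. now apply H.
Qed.

(** * Averages along segments *)

(** The average of s^k g over the segment from (x, b0 e) to (x + al e, (b0 + b1) e). The weights are
    carried along because a derivative in e brings down a factor s, so that the family is closed
    under both derivatives. Two cases occur: (1, 1, 0) averages over x to x + e at fixed e, and (0,
    0, 1) averages over 0 to e at fixed x. *)
Definition Av (al b0 b1 : R) (k : nat) (g : fn) : fn := fun x e =>
  Cint (fun s => RtoC (s ^ k) * g (x + al * s * e)%R ((b0 + b1 * s) * e)%R)%C 0 1.

Section Averages.
Variables (al b0 b1 : R) (U V : dom).
Hypothesis Hal : 0 <= al <= 1.
Hypothesis Hb : forall s, 0 <= s <= 1 -> 0 <= b0 + b1 * s <= 1.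
Hypothesis Hmap : forall x e s, V x e -> 0 <= s <= 1 -> U (x + al * s * e) ((b0 + b1 * s) * e).

Let segment_lip (g : fn) := forall x e s, V x e -> 0 <= s <= 1 ->
  lip_near (fun s => g (x + al * s * e) ((b0 + b1 * s) * e)) s.

Lemma isI_Av g k x e : segment_lip g -> V x e ->
  isI (fun s => RtoC (s ^ k) * g (x + al * s * e)%R ((b0 + b1 * s) * e)%R)%C 0 1 (Av al b0 b1 k g x e).
Proof.
  intros Hg Hp. apply isI_Cint. intros t Ht.
  unfold in_between in Ht. rewrite Rmin_left, Rmax_right in Ht by lra.
  apply lip_near_mult; [apply lip_near_pow|]. now apply Hg.
Qed.

Lemma pow_unit_interval k s : 0 <= s <= 1 -> Rabs (s ^ k) <= 1.
Proof.
  intros Hs. rewrite Rabs_pos_eq by (apply pow_le; lra).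
  rewrite <- (pow1 k). apply pow_incr; lra.
Qed.

Lemma bounded2_Av g k : segment_lip g -> bounded2 U g -> bounded2 V (Av al b0 b1 k g).
Proof.
  intros Hg HB. destruct (bounded2_pos _ _ HB) as [K [K0 HK]]. exists K. intros x e Hp.
  replace K with (K * Rabs (1 - 0)) by (rewrite Rminus_0_r, Rabs_R1; ring).
  apply (isI_bound _ _ _ _ _ (isI_Av g k x e Hg Hp)).
  intros t Ht. unfold in_between in Ht. rewrite Rmin_left, Rmax_right in Ht by lra.
  rewrite Cmod_rmult. specialize (HK _ _ (Hmap x e t Hp Ht)).
  pose proof (pow_unit_interval k t Ht). pose proof (Rabs_pos (t ^ k)).
  pose proof (Cmod_ge_0 (g (x + al * t * e) ((b0 + b1 * t) * e))). nra.
Qed.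

(** Differentiation under the integral: the remainder of the average is the average of the
    remainders, so the quadratic bound integrates. The points used on the segments are at most twice
    as far apart as the original ones, whence the factor 4. *)
Lemma diff2_Av g gx ge k : segment_lip g -> segment_lip gx -> segment_lip ge ->
  diff2 U g gx ge ->
  diff2 V (Av al b0 b1 k g) (Av al b0 b1 k gx)
    (fun x e => RtoC al * Av al b0 b1 (S k) gx x e +
       (RtoC b0 * Av al b0 b1 k ge x e + RtoC b1 * Av al b0 b1 (S k) ge x e))%C.
Proof.
  intros Hg Hgx Hge HD. destruct (diff2_pos _ _ _ _ HD) as [K [K0 HK]].
  exists (K * 4). intros x e x' e' Hp Hp'.
  assert (HI : isI (fun s => RtoC (s ^ k) * remainder g gx ge
      (x + al * s * e)%R ((b0 + b1 * s) * e)%R (x' + al * s * e')%R ((b0 + b1 * s) * e')%R)%C 0 1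
     (remainder (Av al b0 b1 k g) (Av al b0 b1 k gx)
    (fun x e => RtoC al * Av al b0 b1 (S k) gx x e +
       (RtoC b0 * Av al b0 b1 k ge x e + RtoC b1 * Av al b0 b1 (S k) ge x e))%C x e x' e')).
  { unfold remainder.
    eapply isI_ext.
    2:{ apply isI_minus; [apply isI_minus; [apply isI_minus|]|].
        - apply (isI_Av g k x' e' Hg Hp').
        - apply (isI_Av g k x e Hg Hp).
        - apply isI_scal. apply (isI_Av gx k x e Hgx Hp).
        - apply isI_scal. apply isI_plus; [|apply isI_plus]; apply isI_scal.
          + apply (isI_Av gx (S k) x e Hgx Hp).
          + apply (isI_Av ge k x e Hge Hp).
          + apply (isI_Av ge (S k) x e Hge Hp). }
    intros s. simpl.
    replace (x' + al * s * e' - (x + al * s * e)) with ((x' - x) + al * s * (e' - e)) by ring.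
    replace ((b0 + b1 * s) * e' - (b0 + b1 * s) * e) with ((b0 + b1 * s) * (e' - e)) by ring.
    rewrite !RtoC_plus, !RtoC_mult, !RtoC_plus, !RtoC_mult. ring. }
  replace (K * 4 * dist2 x e x' e' ^ 2) with (K * (2 * dist2 x e x' e') ^ 2 * Rabs (1 - 0))
    by (rewrite Rminus_0_r, Rabs_R1; ring).
  apply (isI_bound _ _ _ _ _ HI).
  intros s Hs. unfold in_between in Hs. rewrite Rmin_left, Rmax_right in Hs by lra.
  rewrite Cmod_rmult.
  specialize (HK _ _ _ _ (Hmap x e s Hp Hs) (Hmap x' e' s Hp' Hs)).
  set (rr := Cmod _) in *. set (d' := dist2 (x + al * s * e) _ _ _) in *.
  assert (Hd : 0 <= d' <= 2 * dist2 x e x' e').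
  { split; [apply dist2_pos|]. unfold d', dist2.
    replace (x' + al * s * e' - (x + al * s * e)) with ((x' - x) + al * s * (e' - e)) by ring.
    replace ((b0 + b1 * s) * e' - (b0 + b1 * s) * e) with ((b0 + b1 * s) * (e' - e)) by ring.
    pose proof (Rabs_triang (x' - x) (al * s * (e' - e))) as HT. rewrite !Rabs_mult in *.
    rewrite (Rabs_pos_eq al) in HT by lra. rewrite (Rabs_pos_eq s) in HT by lra.
    specialize (Hb s Hs). rewrite (Rabs_pos_eq (b0 + b1 * s)) by lra.
    pose proof (Rabs_pos (x' - x)). pose proof (Rabs_pos (e' - e)).
    assert (al * s <= 1) by nra.
    assert (al * s * Rabs (e' - e) <= 1 * Rabs (e' - e)) by (apply Rmult_le_compat_r; lra).
    assert ((b0 + b1 * s) * Rabs (e' - e) <= 1 * Rabs (e' - e)) by (apply Rmult_le_compat_r; lra).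
    lra. }
  assert (Hd2 : d' ^ 2 <= (2 * dist2 x e x' e') ^ 2) by (apply pow_incr; lra).
  pose proof (pow_unit_interval k s Hs). pose proof (Rabs_pos (s ^ k)).
  assert (0 <= rr) by apply Cmod_ge_0. nra.
Qed.

End Averages.

(** * A discrete Gronwall inequality *)

Fixpoint csum (f : nat -> C) (n : nat) : C :=
  match n with O => f O | S m => (csum f m + f (S m))%C end.

Definition vnorm (N : nat) (v : nat -> C) : R := sum_f_R0 (fun i => Cmod (v i)) N.

Lemma csum_ext f g n : (forall i, (i <= n)%nat -> f i = g i) -> csum f n = csum g n.
Proof.
  induction n as [|n IH]; intros H; simpl; [apply H; lia|].
  rewrite IH by (intros; apply H; lia). rewrite H by lia. reflexivity.
Qed.

Lemma csum_plus f g n : csum (fun i => f i + g i)%C n = (csum f n + csum g n)%C.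
Proof. induction n as [|n IH]; simpl; trivial. rewrite IH. ring. Qed.

Lemma csum_scal (c : C) f n : csum (fun i => c * f i)%C n = (c * csum f n)%C.
Proof. induction n as [|n IH]; simpl; trivial. rewrite IH. ring. Qed.

Lemma csum_zero (f : nat -> C) n : (forall i, (i <= n)%nat -> f i = 0%C) -> csum f n = 0%C.
Proof.
  induction n as [|n IH]; intros H; simpl; [apply H; lia|].
  rewrite IH by (intros; apply H; lia). rewrite H by lia. ring.
Qed.

Lemma csum_single (f : nat -> C) n j : (j <= n)%nat -> (forall i, (i <= n)%nat -> i <> j -> f i = 0%C) ->
  csum f n = f j.
Proof.
  induction n as [|n IH]; intros Hj H; simpl.
  - now replace j with 0%nat by lia.
  - destruct (Nat.eq_dec j (S n)) as [->|Hn].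
    + rewrite csum_zero by (intros; apply H; lia). ring.
    + rewrite IH by (try lia; intros; apply H; lia). rewrite (H (S n)) by lia. ring.
Qed.

Lemma csum_swap f n m :
  csum (fun i => csum (fun j => f i j) m) n = csum (fun j => csum (fun i => f i j) n) m.
Proof.
  induction n as [|n IH]; simpl; trivial. rewrite IH, csum_plus. reflexivity.
Qed.

Lemma Cmod_csum f n : Cmod (csum f n) <= sum_f_R0 (fun i => Cmod (f i)) n.
Proof.
  induction n as [|n IH]; simpl; [lra|]. eapply Rle_trans; [apply Cmod_triangle|]. lra.
Qed.

Lemma vnorm_pos N v : 0 <= vnorm N v.
Proof. apply cond_pos_sum. intros. apply Cmod_ge_0. Qed.

Lemma vnorm_ge N v i : (i <= N)%nat -> Cmod (v i) <= vnorm N v.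
Proof.
  unfold vnorm. induction N as [|N IH]; intros Hi; simpl.
  - replace i with 0%nat by lia. lra.
  - destruct (Nat.eq_dec i (S N)) as [->|Hn].
    + pose proof (vnorm_pos N v). unfold vnorm in *. lra.
    + specialize (IH ltac:(lia)). pose proof (Cmod_ge_0 (v (S N))). lra.
Qed.

Lemma vnorm_le N v K : (forall i, (i <= N)%nat -> Cmod (v i) <= K) -> vnorm N v <= INR (S N) * K.
Proof.
  unfold vnorm. induction N as [|N IH]; intros H; simpl sum_f_R0.
  - simpl. rewrite Rmult_1_l. apply H. lia.
  - rewrite S_INR. specialize (IH ltac:(intros; apply H; lia)). specialize (H (S N) (le_n _)). lra.
Qed.

Lemma vnorm_ext N v w : (forall i, (i <= N)%nat -> v i = w i) -> vnorm N v = vnorm N w.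
Proof. intros H. apply sum_eq. intros i Hi. now rewrite H. Qed.

Lemma vnorm_add_le N (u w : nat -> C) (c : R) :
  (forall i, (i <= N)%nat -> Cmod (w i) <= Cmod (u i) + c) ->
  vnorm N w <= vnorm N u + INR (S N) * c.
Proof.
  unfold vnorm. induction N as [|N IH]; intros H; simpl sum_f_R0.
  - simpl INR. rewrite Rmult_1_l. apply H. lia.
  - rewrite (S_INR (S N)). specialize (IH ltac:(intros; apply H; lia)). specialize (H (S N) (le_n _)). lra.
Qed.

Lemma matrix_vector_bound N (m : nat -> C) v K :
  (forall k, (k <= N)%nat -> Cmod (m k) <= K) ->
  Cmod (csum (fun k => m k * v k)%C N) <= K * vnorm N v.
Proof.
  intros H. eapply Rle_trans; [apply Cmod_csum|].
  unfold vnorm. rewrite scal_sum. apply sum_Rle. intros k Hk.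
  rewrite Cmod_mult, Rmult_comm. apply Rmult_le_compat_l; [apply Cmod_ge_0|auto].
Qed.

Lemma gronwall_step N (m : nat -> nat -> C) (g v w : nat -> C) (e K G : R) :
  0 <= e -> (forall i k, (i <= N)%nat -> (k <= N)%nat -> Cmod (m i k) <= K) ->
  (forall i, (i <= N)%nat -> Cmod (g i) <= G) ->
  (forall i, (i <= N)%nat -> w i = (v i + RtoC e * (csum (fun k => m i k * v k)%C N + g i))%C) ->
  vnorm N w <= vnorm N v + INR (S N) * (e * (K * vnorm N v + G)) /\
  vnorm N v <= vnorm N w + INR (S N) * (e * (K * vnorm N v + G)).
Proof.
  intros He Hm Hg Hw.
  assert (HB : forall i, (i <= N)%nat ->
    Cmod (RtoC e * (csum (fun k => m i k * v k)%C N + g i)) <= e * (K * vnorm N v + G)).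
  { intros i Hi. rewrite Cmod_rmult, Rabs_pos_eq by trivial. apply Rmult_le_compat_l; trivial.
    eapply Rle_trans; [apply Cmod_triangle|]. apply Rplus_le_compat; auto.
    apply matrix_vector_bound. auto. }
  split; apply vnorm_add_le; trivial; intros i Hi; specialize (HB i Hi).
  - rewrite Hw by trivial. eapply Rle_trans; [apply Cmod_triangle|]. lra.
  - replace (v i) with (w i - RtoC e * (csum (fun k => m i k * v k)%C N + g i))%C
      by (rewrite Hw by trivial; ring).
    eapply Rle_trans; [apply Cmod_minus_le|]. lra.
Qed.

Lemma gronwall_iterate (a : nat -> R) (K e G : R) n : 0 <= K -> 0 <= e -> 0 <= G ->
  (forall i, 0 <= a i) ->
  (forall i, (i < n)%nat -> a (S i) <= (1 + K * e) * a i + e * G) ->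
  a n <= exp (K * (INR n * e)) * (a 0%nat + INR n * e * G).
Proof.
  intros HK He HG Ha. induction n as [|n IH]; intros H.
  - simpl. rewrite !Rmult_0_l, Rmult_0_r, exp_0. lra.
  - specialize (IH ltac:(intros; apply H; lia)). specialize (H n ltac:(lia)).
    eapply Rle_trans; [exact H|].
    rewrite S_INR.
    replace (K * ((INR n + 1) * e)) with (K * e + K * (INR n * e)) by ring. rewrite exp_plus.
    pose proof (exp_ineq1_le (K * e)) as H1.
    set (E := exp (K * (INR n * e))) in *.
    assert (HE : 1 <= E).
    { unfold E. pose proof (exp_ineq1_le (K * (INR n * e))).
      assert (0 <= K * (INR n * e)) by (repeat apply Rmult_le_pos; trivial; apply pos_INR). lra. }
    assert (H0 : 0 <= K * e) by now apply Rmult_le_pos.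
    apply Rle_trans with (exp (K * e) * (E * (a 0%nat + INR n * e * G)) + exp (K * e) * E * (e * G)).
    + apply Rplus_le_compat.
      * apply Rmult_le_compat; trivial. lra.
      * rewrite <- (Rmult_1_l (e * G)) at 1.
        apply Rmult_le_compat_r; [now apply Rmult_le_pos|]. nra.
    + right. ring.
Qed.

(** [D] bounds the total length n e of the iteration and N + 1 counts the components. The factors 2
    cover the backward direction, where 1 / (1 - p) <= 1 + 2 p for 0 <= p <= 1/2. *)
Definition gronwall_constant (N : nat) (K D : R) : R :=
  exp (2 * (INR (S N) * K) * D) * (1 + 2 * (INR (S N) * D)).

(** The step e and the number of steps enter the constant only through n e <= D, which makes the
    bound uniform in e. The smallness condition keeps the norm of e times the matrix below 1/2, so
    that a step can also be estimated backwards. *)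
Lemma gronwall (N : nat) (m : nat -> nat -> nat -> C) (g v : nat -> nat -> C) (e K G D : R) n :
  0 < e -> 0 <= K -> 0 <= G -> INR (S N) * K * e <= 1 / 2 -> INR n * e <= D ->
  (forall j i k, (j < n)%nat -> (i <= N)%nat -> (k <= N)%nat -> Cmod (m j i k) <= K) ->
  (forall j i, (j < n)%nat -> (i <= N)%nat -> Cmod (g j i) <= G) ->
  (forall j i, (j < n)%nat -> (i <= N)%nat ->
     v (S j) i = (v j i + RtoC e * (csum (fun k => m j i k * v j k)%C N + g j i))%C) ->
  vnorm N (v n) <= gronwall_constant N K D * (vnorm N (v 0%nat) + G) /\
  vnorm N (v 0%nat) <= gronwall_constant N K D * (vnorm N (v n) + G).
Proof.
  intros He HK HG Hs HD Hm Hg Hv.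
  set (K1 := INR (S N) * K). set (G1 := INR (S N) * G).
  assert (HN : 0 < INR (S N)) by (apply lt_0_INR; lia).
  assert (HK1 : 0 <= K1) by (apply Rmult_le_pos; lra).
  assert (HG1 : 0 <= G1) by (apply Rmult_le_pos; lra).
  assert (HnD : 0 <= INR n * e) by (apply Rmult_le_pos; [apply pos_INR|lra]).
  assert (Step : forall j, (j < n)%nat ->
     vnorm N (v (S j)) <= (1 + 2 * K1 * e) * vnorm N (v j) + e * (2 * G1) /\
     vnorm N (v j) <= (1 + 2 * K1 * e) * vnorm N (v (S j)) + e * (2 * G1)).
  { intros j Hj.
    destruct (gronwall_step N (m j) (g j) (v j) (v (S j)) e K G) as [H1 H2]; auto; try lra.
    pose proof (vnorm_pos N (v j)). pose proof (vnorm_pos N (v (S j))).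
    fold K1 in Hs.
    assert (E : INR (S N) * (e * (K * vnorm N (v j) + G)) = K1 * e * vnorm N (v j) + e * G1)
      by (unfold K1, G1; ring).
    rewrite E in H1, H2.
    assert (0 <= K1 * e) by (apply Rmult_le_pos; lra). assert (0 <= e * G1) by (apply Rmult_le_pos; lra).
    split.
    - assert (0 <= K1 * e * vnorm N (v j)) by (apply Rmult_le_pos; lra). lra.
    - set (p := K1 * e) in *. set (a := vnorm N (v j)) in *. set (b := vnorm N (v (S j))) in *.
      set (q := e * G1) in *. replace (2 * K1 * e) with (2 * p) by (unfold p; ring).
      replace (e * (2 * G1)) with (2 * q) by (unfold q; ring).
      (* from (1 - p) a <= b + q and p <= 1/2 *)
      assert (0 <= (1 + 2 * p) * (b + q - (1 - p) * a)) by (apply Rmult_le_pos; lra).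
      assert (0 <= p * (1 - 2 * p) * a) by (repeat apply Rmult_le_pos; lra).
      assert (0 <= (1 - 2 * p) * q) by (apply Rmult_le_pos; lra). lra. }
  assert (Fin : forall a : nat -> R, (forall i, 0 <= a i) ->
     (forall i, (i < n)%nat -> a (S i) <= (1 + 2 * K1 * e) * a i + e * (2 * G1)) ->
     a n <= gronwall_constant N K D * (a 0%nat + G)).
  { intros a Ha H.
    eapply Rle_trans; [apply (gronwall_iterate a (2 * K1) e (2 * G1) n); trivial; lra|].
    unfold gronwall_constant. fold K1. rewrite (Rmult_assoc (exp _)).
    specialize (Ha 0%nat).
    apply Rmult_le_compat.
    - left; apply exp_pos.
    - assert (0 <= INR n * e * (2 * G1)) by (apply Rmult_le_pos; lra). lra.
    - assert (HKD : 2 * K1 * (INR n * e) <= 2 * K1 * D) by (apply Rmult_le_compat_l; lra).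
      destruct HKD as [Hl|Hl]; [left; now apply exp_increasing|rewrite Hl; lra].
    - assert (INR n * e * (2 * G1) <= D * (2 * G1)) by (apply Rmult_le_compat_r; lra).
      assert (0 <= INR (S N) * D) by (apply Rmult_le_pos; lra).
      assert (0 <= INR (S N) * D * a 0%nat) by (apply Rmult_le_pos; lra).
      unfold G1 in *. nra. }
  split.
  - apply (Fin (fun j => vnorm N (v j))); [intros; apply vnorm_pos|]. intros i Hi. now apply Step.
  (* The backward estimate is the forward one for the reversed sequence of norms. *)
  - pose proof (Fin (fun j => vnorm N (v (n - j)%nat))) as H. cbv beta in H.
    rewrite Nat.sub_diag, Nat.sub_0_r in H. apply H; [intros; apply vnorm_pos|].
    intros i Hi. replace (n - i)%nat with (S (n - S i)) by lia. apply Step. lia.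
Qed.

(** * Uniform bounds on convex domains *)

Lemma segment_derivative U f fx fe K x e x' e' : convex2 U -> U x e -> U x' e' ->
  (forall x e x' e', U x e -> U x' e' ->
     Cmod (remainder f fx fe x e x' e') <= K * dist2 x e x' e' ^ 2) ->
  forall t t', 0 <= t <= 1 -> 0 <= t' <= 1 ->
  Cmod (f (x + t' * (x' - x)) (e + t' * (e' - e)) - f (x + t * (x' - x)) (e + t * (e' - e))
    - RtoC (t' - t) * (RtoC (x' - x) * fx (x + t * (x' - x))%R (e + t * (e' - e))%R
                     + RtoC (e' - e) * fe (x + t * (x' - x))%R (e + t * (e' - e))%R))
    <= K * dist2 x e x' e' ^ 2 * (t' - t) ^ 2.
Proof.
  intros HU Hp Hp' HK t t' Ht Ht'.
  pose proof (HK _ _ _ _ (HU x e x' e' t Hp Hp' Ht) (HU x e x' e' t' Hp Hp' Ht')) as H.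
  unfold remainder, dist2 in H.
  replace (x + t' * (x' - x) - (x + t * (x' - x))) with ((t' - t) * (x' - x)) in H by ring.
  replace (e + t' * (e' - e) - (e + t * (e' - e))) with ((t' - t) * (e' - e)) in H by ring.
  rewrite !Rabs_mult, <- Rmult_plus_distr_l, Rpow_mult_distr, pow2_abs in H. unfold dist2.
  replace (K * (Rabs (x' - x) + Rabs (e' - e)) ^ 2 * (t' - t) ^ 2)
    with (K * ((t' - t) ^ 2 * (Rabs (x' - x) + Rabs (e' - e)) ^ 2)) by ring.
  eapply Rle_trans; [|exact H]. right. f_equal. rewrite !RtoC_mult. ring.
Qed.

Lemma unit_interval_convex : convex1 (fun t => 0 <= t <= 1).
Proof. intros a b t Ha Hb Ht. split; nra. Qed.

(** On a convex domain the bound on the derivatives is itself the Lipschitz constant, up to the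
    choice of norm in [dist2]; the constant of [diff2] disappears. *)
Lemma lipschitz2 U f fx fe L : convex2 U -> diff2 U f fx fe ->
  (forall x e, U x e -> Cmod (fx x e) <= L) -> (forall x e, U x e -> Cmod (fe x e) <= L) ->
  forall x e x' e', U x e -> U x' e' -> Cmod (f x' e' - f x e) <= L * dist2 x e x' e'.
Proof.
  intros HU [K HK] Hx He x e x' e' Hp Hp'.
  pose proof (lipschitz_of_derivative (fun t => 0 <= t <= 1)
    (fun t => f (x + t * (x' - x)) (e + t * (e' - e)))
    (fun t => RtoC (x' - x) * fx (x + t * (x' - x))%R (e + t * (e' - e))%R
                     + RtoC (e' - e) * fe (x + t * (x' - x))%R (e + t * (e' - e))%R)%C
    _ (L * dist2 x e x' e') unit_interval_convex
    (segment_derivative U f fx fe K x e x' e' HU Hp Hp' HK)) as H.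
  assert (H1 : forall t, 0 <= t <= 1 ->
    Cmod (RtoC (x' - x) * fx (x + t * (x' - x))%R (e + t * (e' - e))%R
        + RtoC (e' - e) * fe (x + t * (x' - x))%R (e + t * (e' - e))%R) <= L * dist2 x e x' e').
  { intros t Ht. apply linear_part_bound; [apply Hx|apply He]; now apply HU. }
  specialize (H H1 0 1 ltac:(lra) ltac:(lra)). cbv beta in H.
  rewrite !Rmult_0_l, !Rmult_1_l, !Rplus_0_r, Rminus_0_r, Rabs_R1, Rmult_1_r in H.
  now replace (x + (x' - x)) with x' in H by ring; replace (e + (e' - e)) with e' in H by ring.
Qed.

(** As in one variable, the constants of the three differentiability hypotheses disappear and only
    the bound on second derivatives remains. This permits estimates uniform down to e = 0 for
    functions whose differentiability is known with constants on e > ep only. *)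
Lemma taylor2 U f fx fe fxx fxe fex fee L : convex2 U ->
  diff2 U f fx fe -> diff2 U fx fxx fxe -> diff2 U fe fex fee ->
  (forall x e, U x e -> Cmod (fxx x e) <= L /\ Cmod (fxe x e) <= L /\
                        Cmod (fex x e) <= L /\ Cmod (fee x e) <= L) ->
  forall x e x' e', U x e -> U x' e' ->
  Cmod (remainder f fx fe x e x' e') <= L * dist2 x e x' e' ^ 2.
Proof.
  intros HU [K HK] Dx De HL x e x' e' Hp Hp'.
  assert (Lx := lipschitz2 U fx fxx fxe L HU Dx (fun x e H => proj1 (HL x e H))
    (fun x e H => proj1 (proj2 (HL x e H)))).
  assert (Le := lipschitz2 U fe fex fee L HU De (fun x e H => proj1 (proj2 (proj2 (HL x e H))))
    (fun x e H => proj2 (proj2 (proj2 (HL x e H))))).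
  assert (HL0 : 0 <= L) by (eapply Rle_trans; [apply Cmod_ge_0|apply (HL x e Hp)]).
  set (l := (RtoC (x' - x) * fx x e + RtoC (e' - e) * fe x e)%C).
  pose proof (lipschitz_of_derivative (fun t => 0 <= t <= 1)
    (fun t => f (x + t * (x' - x))%R (e + t * (e' - e))%R - RtoC t * l)%C
    (fun t => RtoC (x' - x) * fx (x + t * (x' - x))%R (e + t * (e' - e))%R
                     + RtoC (e' - e) * fe (x + t * (x' - x))%R (e + t * (e' - e))%R - l)%C
    (K * dist2 x e x' e' ^ 2) (L * dist2 x e x' e' ^ 2) unit_interval_convex) as H.
  lapply H; clear H.
  2:{ intros t t' Ht Ht'.
      eapply Rle_trans;
        [|apply (segment_derivative U f fx fe K x e x' e' HU Hp Hp' HK t t' Ht Ht')].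
      right. f_equal. rewrite !RtoC_minus. ring. }
  intros H. lapply H; clear H.
  2:{ intros t Ht. set (d := dist2 x e x' e').
      assert (Hd : 0 <= d) by apply dist2_pos.
      pose proof (HU x e x' e' t Hp Hp' Ht) as Hpt.
      pose proof (Lx _ _ _ _ Hp Hpt) as L1. pose proof (Le _ _ _ _ Hp Hpt) as L2.
      assert (Hdt : dist2 x e (x + t * (x' - x)) (e + t * (e' - e)) <= d).
      { unfold d, dist2.
        replace (x + t * (x' - x) - x) with (t * (x' - x)) by ring.
        replace (e + t * (e' - e) - e) with (t * (e' - e)) by ring.
        rewrite !Rabs_mult, !(Rabs_pos_eq t) by lra.
        pose proof (Rabs_pos (x' - x)). pose proof (Rabs_pos (e' - e)). nra. }
      unfold l.
      replace (RtoC (x' - x) * fx (x + t * (x' - x))%R (e + t * (e' - e))%R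
        + RtoC (e' - e) * fe (x + t * (x' - x))%R (e + t * (e' - e))%R
        - (RtoC (x' - x) * fx x e + RtoC (e' - e) * fe x e))%C with
       (RtoC (x' - x) * (fx (x + t * (x' - x))%R (e + t * (e' - e))%R - fx x e)
        + RtoC (e' - e) * (fe (x + t * (x' - x))%R (e + t * (e' - e))%R - fe x e))%C by ring.
      replace (L * d ^ 2) with (L * d * (Rabs (x' - x) + Rabs (e' - e)))
        by (unfold d, dist2; ring).
      apply linear_part_bound; (eapply Rle_trans; [eassumption|]); now apply Rmult_le_compat_l. }
  intros H. specialize (H 0 1 ltac:(lra) ltac:(lra)). cbv beta in H.
  rewrite !Rmult_0_l, !Rmult_1_l, !Rplus_0_r, Rminus_0_r, Rabs_R1, Rmult_1_r in H.
  replace (x + (x' - x)) with x' in H by ring. replace (e + (e' - e)) with e' in H by ring.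
  eapply Rle_trans; [|exact H]. right. f_equal. unfold remainder, l. ring.
Qed.

(** * Functions smooth away from [e = 0], with uniform bounds on some derivatives *)

Definition above (ep : R) (U : dom) : dom := fun x e => U x e /\ ep < e.

(** All constants may blow up as ep tends to 0. *)
Definition smooth_off (U : dom) (f : fn) := forall ep, 0 < ep -> smooth2 (above ep U) f.

Definition pos_dom (U : dom) := forall x e, U x e -> 0 < e.

(* Uniform bounds for all derivatives of order at most n containing at most j derivatives in e. *)
Fixpoint Wb (n j : nat) (U : dom) (f : fn) : Prop :=
  bounded2 U f /\
  match n with
  | O => True
  | S n' => Wb n' j U (dX f) /\ match j with O => True | S j' => Wb n' j' U (dE f) end
  end.

Lemma open2_above ep U : open2 U -> open2 (above ep U).
Proof.
  intros HU x e [Hp He]. destruct (HU x e Hp) as [d [Hd H]].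
  exists (Rmin d (e - ep)). split; [apply Rmin_pos; lra|].
  intros x' e' H1 H2. split.
  - apply H; eapply Rlt_le_trans; try eassumption; apply Rmin_l.
  - assert (Rabs (e' - e) < e - ep) by (eapply Rlt_le_trans; [exact H2|apply Rmin_r]).
    apply Rabs_def2 in H0. lra.
Qed.

Lemma convex2_above ep U : convex2 U -> convex2 (above ep U).
Proof.
  intros HU x e x' e' t [Hp He] [Hp' He'] Ht. split; [now apply HU|].
  destruct (Rlt_or_le t (1/2)); nra.
Qed.

Lemma smooth2_off U f : smooth2 U f -> smooth_off U f.
Proof. intros H ep Hep n. apply (Sm_sub n U); trivial. now intros x e []. Qed.

Lemma smooth_off_dX U f : smooth_off U f -> smooth_off U (dX f).
Proof. intros H ep Hep. now apply smooth2_dX, H. Qed.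
Lemma smooth_off_dE U f : smooth_off U f -> smooth_off U (dE f).
Proof. intros H ep Hep. now apply smooth2_dE, H. Qed.

Lemma smooth_off_ext U f g : open2 U -> (forall x e, U x e -> f x e = g x e) ->
  smooth_off U f -> smooth_off U g.
Proof.
  intros HU H Hf ep Hep n. apply (Sm_ext n _ f).
  - now apply open2_above.
  - intros x e [Hp _]. auto.
  - now apply Hf.
Qed.

Lemma smooth_off_sub U V f : sub2 V U -> smooth_off U f -> smooth_off V f.
Proof.
  intros H Hf ep Hep n. apply (Sm_sub n (above ep U)); [|now apply Hf].
  intros x e [Hp He]. split; auto.
Qed.

Lemma smooth_off_plus U f g : open2 U -> smooth_off U f -> smooth_off U g ->
  smooth_off U (fun x e => f x e + g x e)%C.
Proof. intros HU Hf Hg ep Hep n. apply Sm_plus; [now apply open2_above|apply Hf|apply Hg]; trivial. Qed.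

Lemma smooth_off_mult U f g : open2 U -> smooth_off U f -> smooth_off U g ->
  smooth_off U (fun x e => f x e * g x e)%C.
Proof. intros HU Hf Hg ep Hep n. apply Sm_mult; [now apply open2_above|apply Hf|apply Hg]; trivial. Qed.

Lemma smooth_off_const U c : open2 U -> smooth_off U (fun _ _ => c).
Proof. intros HU ep Hep n. apply Sm_const. now apply open2_above. Qed.

Lemma smooth_off_csum U (f : nat -> fn) N : open2 U -> (forall k, (k <= N)%nat -> smooth_off U (f k)) ->
  smooth_off U (fun x e => csum (fun k => f k x e) N).
Proof.
  intros HU. induction N as [|N IH]; intros H; simpl.
  - apply (smooth_off_ext U (f 0%nat)); trivial. apply H. lia.
  - apply smooth_off_plus; trivial; [apply IH; intros; apply H; lia|apply H; lia].
Qed.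

Lemma derivative_unique_off U f fx fe : open2 U -> pos_dom U ->
  (forall ep, 0 < ep -> diff2 (above ep U) f fx fe) ->
  forall x e, U x e -> dX f x e = fx x e /\ dE f x e = fe x e.
Proof.
  intros HU HP HD x e Hp. pose proof (HP x e Hp).
  apply (diff2_unique (above (e / 2) U)).
  - now apply open2_above.
  - apply HD. lra.
  - split; trivial. lra.
Qed.

Section OffRules.
Variable U : dom.
Hypothesis HU : open2 U.
Hypothesis HP : pos_dom U.

Lemma off_diff2 f ep : smooth_off U f -> 0 < ep -> diff2 (above ep U) f (dX f) (dE f).
Proof. intros H Hep. now apply smooth2_diff2, H. Qed.

Lemma d_plus f g : smooth_off U f -> smooth_off U g -> forall x e, U x e ->
  dX (fun x e => f x e + g x e)%C x e = (dX f x e + dX g x e)%C /\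
  dE (fun x e => f x e + g x e)%C x e = (dE f x e + dE g x e)%C.
Proof.
  intros Hf Hg.
  apply (derivative_unique_off U _ (fun x e => dX f x e + dX g x e)%C
     (fun x e => dE f x e + dE g x e)%C); trivial.
  intros ep Hep. apply diff2_plus; now apply off_diff2.
Qed.

Lemma d_mult f g : smooth_off U f -> smooth_off U g -> forall x e, U x e ->
  dX (fun x e => f x e * g x e)%C x e = (dX f x e * g x e + f x e * dX g x e)%C /\
  dE (fun x e => f x e * g x e)%C x e = (dE f x e * g x e + f x e * dE g x e)%C.
Proof.
  intros Hf Hg.
  apply (derivative_unique_off U _ (fun x e => dX f x e * g x e + f x e * dX g x e)%C
     (fun x e => dE f x e * g x e + f x e * dE g x e)%C); trivial.
  intros ep Hep. apply diff2_mult; try (now apply off_diff2); apply smooth2_bounded;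
   try (now apply Hf); try (now apply Hg);
   try (now apply smooth2_dX, Hf); try (now apply smooth2_dX, Hg);
   try (now apply smooth2_dE, Hf); now apply smooth2_dE, Hg.
Qed.

Lemma d_const c : forall x e, dX (fun _ _ => c) x e = 0%C /\ dE (fun _ _ => c) x e = 0%C.
Proof. intros x e. unfold dX, dE. rewrite !Derive_const. split; reflexivity. Qed.

Lemma d_csum (f : nat -> fn) N : (forall k, (k <= N)%nat -> smooth_off U (f k)) ->
  forall x e, U x e ->
  dX (fun x e => csum (fun k => f k x e) N) x e = csum (fun k => dX (f k) x e) N /\
  dE (fun x e => csum (fun k => f k x e) N) x e = csum (fun k => dE (f k) x e) N.
Proof.
  induction N as [|N IH]; intros H x e Hp.
  - split; reflexivity.
  - simpl csum.
    destruct (d_plus (fun x e => csum (fun k => f k x e) N) (f (S N))) with (3 := Hp) as [-> ->].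
    + apply smooth_off_csum; trivial. intros; apply H; lia.
    + apply H. lia.
    + destruct (IH ltac:(intros; apply H; lia) x e Hp) as [-> ->]. split; reflexivity.
Qed.

Lemma Wb_ext n j f g : (forall x e, U x e -> f x e = g x e) -> Wb n j U f -> Wb n j U g.
Proof.
  revert j f g. induction n as [|n IH]; intros j f g H [Hb Hr].
  - split; trivial. now apply (bounded2_ext U f).
  - split; [now apply (bounded2_ext U f)|]. destruct Hr as [Hx He]. split.
    + apply (IH j (dX f)); trivial. intros; now apply (dX_ext U).
    + destruct j as [|j]; trivial. apply (IH j (dE f)); trivial. intros; now apply (dE_ext U).
Qed.

Lemma Wb_plus n j f g : smooth_off U f -> smooth_off U g -> Wb n j U f -> Wb n j U g ->
  Wb n j U (fun x e => f x e + g x e)%C.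
Proof.
  revert j f g. induction n as [|n IH]; intros j f g Sf Sg [Bf Hf] [Bg Hg].
  - split; trivial. now apply bounded2_plus.
  - split; [now apply bounded2_plus|]. destruct Hf as [Xf Ef]. destruct Hg as [Xg Eg]. split.
    + apply (Wb_ext n j (fun x e => dX f x e + dX g x e)%C).
      * intros; symmetry; now apply d_plus.
      * apply IH; trivial; now apply smooth_off_dX.
    + destruct j as [|j]; trivial. apply (Wb_ext n j (fun x e => dE f x e + dE g x e)%C).
      * intros; symmetry; now apply d_plus.
      * apply IH; trivial; now apply smooth_off_dE.
Qed.

Lemma Wb_bounded n j f : Wb n j U f -> bounded2 U f.
Proof. destruct n; intros H; apply H. Qed.

Lemma Wb_S n j f : Wb (S n) j U f -> Wb n j U f.
Proof.
  revert j f. induction n as [|n IH]; intros j f [Hb [Hx He]]; split; trivial.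
  split; [now apply IH|]. destruct j as [|j]; trivial. now apply IH.
Qed.

Lemma Wb_j n j f : Wb n (S j) U f -> Wb n j U f.
Proof.
  revert j f. induction n as [|n IH]; intros j f [Hb H]; split; trivial.
  destruct H as [Hx He]. split; [now apply IH|]. destruct j as [|j]; trivial. now apply IH.
Qed.

Lemma Wb_mult n j f g : smooth_off U f -> smooth_off U g -> Wb n j U f -> Wb n j U g ->
  Wb n j U (fun x e => f x e * g x e)%C.
Proof.
  revert j f g. induction n as [|n IH]; intros j f g Sf Sg Wf Wg.
  - split; trivial. apply bounded2_mult; [apply Wf|apply Wg].
  - pose proof (Wb_S _ _ _ Wf) as Wf1. pose proof (Wb_S _ _ _ Wg) as Wg1.
    destruct Wf as [Bf [Xf Ef]]. destruct Wg as [Bg [Xg Eg]].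
    split; [now apply bounded2_mult|].
    pose proof (smooth_off_dX _ _ Sf). pose proof (smooth_off_dX _ _ Sg).
    pose proof (smooth_off_dE _ _ Sf). pose proof (smooth_off_dE _ _ Sg). split.
    + apply (Wb_ext n j (fun x e => dX f x e * g x e + f x e * dX g x e)%C).
      * intros; symmetry; now apply d_mult.
      * apply Wb_plus; try (now apply smooth_off_mult); now apply IH.
    + destruct j as [|j]; trivial.
      apply (Wb_ext n j (fun x e => dE f x e * g x e + f x e * dE g x e)%C).
      * intros; symmetry; now apply d_mult.
      * apply Wb_plus; try (now apply smooth_off_mult); apply IH; trivial; now apply Wb_j.
Qed.

Lemma Wb_csum n j (f : nat -> fn) N : (forall k, (k <= N)%nat -> smooth_off U (f k)) ->
  (forall k, (k <= N)%nat -> Wb n j U (f k)) -> Wb n j U (fun x e => csum (fun k => f k x e) N).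
Proof.
  intros Hs. induction N as [|N IH]; intros H; simpl.
  - apply (Wb_ext n j (f 0%nat)); trivial. apply H; lia.
  - apply Wb_plus.
    + apply smooth_off_csum; trivial. intros; apply Hs; lia.
    + apply Hs; lia.
    + apply IH; intros; [apply Hs|apply H]; lia.
    + apply H; lia.
Qed.

Lemma Wb_const n j c : Wb n j U (fun _ _ => c).
Proof.
  revert j c. induction n as [|n IH]; intros j c.
  - split; trivial. exists (Cmod c). intros; lra.
  - split; [exists (Cmod c); intros; lra|]. split.
    + apply (Wb_ext n j (fun _ _ => 0%C)); [|apply IH]. intros; symmetry; apply d_const.
    + destruct j as [|j]; trivial. apply (Wb_ext n j (fun _ _ => 0%C)); [|apply IH].
      intros; symmetry; apply d_const.
Qed.

End OffRules.

Lemma Wb_sub n j U V f : sub2 V U -> Wb n j U f -> Wb n j V f.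
Proof.
  intros HV. revert j f. induction n as [|n IH]; intros j f [[K HK] Hr].
  - split; trivial. exists K. auto.
  - split; [exists K; auto|]. destruct Hr as [Hx He]. split; [now apply IH|].
    destruct j as [|j]; trivial. now apply IH.
Qed.

Lemma Wb_of_Sm n j U f : Sm n U f -> Wb n j U f.
Proof.
  revert j f. induction n as [|n IH]; intros j f [Hb H]; split; trivial.
  destruct H as [_ [Hx He]]. split; [now apply IH|]. destruct j as [|j]; trivial. now apply IH.
Qed.

(** Any two points of [U] lie together in some [above ep U], whose constants depend on ep; [taylor2]
    discards these and keeps the bounds on second derivatives, which hold on all of [U]. *)
Lemma smooth2_of_Wb U f : open2 U -> convex2 U -> pos_dom U -> smooth_off U f ->
  (forall n j, Wb n j U f) -> smooth2 U f.
Proof.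
  intros HU HC HP Hs HW n. revert f Hs HW. induction n as [|n IH]; intros f Hs HW.
  - split; trivial. apply (HW 0%nat 0%nat).
  - assert (HX : forall n j, Wb n j U (dX f)) by (intros m j; apply (HW (S m) j)).
    assert (HE : forall n j, Wb n j U (dE f)) by (intros m j; apply (HW (S m) (S j))).
    pose proof (smooth_off_dX _ _ Hs) as Sx. pose proof (smooth_off_dE _ _ Hs) as Se.
    split; [apply (HW 0%nat 0%nat)|]. split; [|split; now apply IH].
    destruct (bounded2_pos _ _ (Wb_bounded _ 0 0 _ (proj1 (proj2 (HX 1%nat 1%nat))))) as [K1 [P1 H1]].
    destruct (bounded2_pos _ _ (Wb_bounded _ 0 0 _ (proj2 (proj2 (HX 1%nat 1%nat))))) as [K2 [P2 H2]].
    destruct (bounded2_pos _ _ (Wb_bounded _ 0 0 _ (proj1 (proj2 (HE 1%nat 1%nat))))) as [K3 [P3 H3]].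
    destruct (bounded2_pos _ _ (Wb_bounded _ 0 0 _ (proj2 (proj2 (HE 1%nat 1%nat))))) as [K4 [P4 H4]].
    exists (K1 + K2 + K3 + K4). intros x e x' e' Hp Hp'.
    pose proof (HP _ _ Hp). pose proof (HP _ _ Hp').
    assert (Hm : 0 < Rmin e e' / 2) by (assert (0 < Rmin e e') by (now apply Rmin_pos); lra).
    pose proof (Rmin_l e e'). pose proof (Rmin_r e e').
    apply (taylor2 (above (Rmin e e' / 2) U) f (dX f) (dE f) (dX (dX f)) (dE (dX f))
      (dX (dE f)) (dE (dE f))).
    + now apply convex2_above.
    + now apply off_diff2.
    + now apply off_diff2.
    + now apply off_diff2.
    + intros y d [Hy _]. specialize (H1 y d Hy). specialize (H2 y d Hy).
      specialize (H3 y d Hy). specialize (H4 y d Hy). lra.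
    + split; trivial. lra.
    + split; trivial. lra.
Qed.

(* Uniform bounds for all mixed derivatives with at most j + 1 derivatives in e, the first of which
   comes after at most n derivatives in x. *)
Fixpoint Wb_e (n j : nat) (U : dom) (f : fn) : Prop :=
  (forall m, Wb m j U f) /\ (forall m, Wb m j U (dE f)) /\
  match n with O => True | S n' => Wb_e n' j U (dX f) end.

Lemma Wb_e_of_Wb n j U f : (forall m, Wb m (S j) U f) -> Wb_e n j U f.
Proof.
  revert f. induction n as [|n IH]; intros f H; (split; [intros m; apply Wb_j, H|]);
   (split; [intros m; apply (H (S m))|trivial]).
  apply IH. intros m. apply (H (S m)).
Qed.

Lemma Wb_of_Wb_e n j U f : Wb_e n j U f -> Wb n (S j) U f.
Proof.
  revert f. induction n as [|n IH]; intros f [H1 [H2 H3]].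
  - split; trivial. apply (H1 0%nat).
  - split; [apply (H1 0%nat)|]. split; [now apply IH|apply H2].
Qed.

Lemma Wb_e_S n j U f : Wb_e (S n) j U f -> Wb_e n j U f.
Proof.
  revert f. induction n as [|n IH]; intros f [H1 [H2 H3]]; (split; [trivial|split; trivial]).
  now apply IH.
Qed.

Lemma Wb_e_sub n j U V f : sub2 V U -> Wb_e n j U f -> Wb_e n j V f.
Proof.
  intros HV. revert f. induction n as [|n IH]; intros f [H1 [H2 H3]];
   (split; [intros m; now apply (Wb_sub m j U)|split; [intros m; now apply (Wb_sub m j U)|trivial]]).
  now apply IH.
Qed.

Section OffRulesE.
Variable U : dom.
Hypothesis HU : open2 U.
Hypothesis HP : pos_dom U.

Lemma Wb_e_ext n j f g : (forall x e, U x e -> f x e = g x e) -> Wb_e n j U f -> Wb_e n j U g.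
Proof.
  revert f g. induction n as [|n IH]; intros f g H [H1 [H2 H3]];
   (split; [intros m; now apply (Wb_ext U HU m j f)|
    split; [intros m; apply (Wb_ext U HU m j (dE f)); trivial; intros; now apply (dE_ext U)|trivial]]).
  apply (IH (dX f)); trivial. intros; now apply (dX_ext U).
Qed.

Lemma Wb_e_plus n j f g : smooth_off U f -> smooth_off U g -> Wb_e n j U f -> Wb_e n j U g ->
  Wb_e n j U (fun x e => f x e + g x e)%C.
Proof.
  revert f g. induction n as [|n IH]; intros f g Sf Sg [F1 [F2 F3]] [G1 [G2 G3]];
   (split; [intros m; now apply Wb_plus|split;
     [intros m; apply (Wb_ext U HU m j (fun x e => dE f x e + dE g x e)%C);
       [intros; symmetry; now apply (d_plus U HU HP)
       |apply Wb_plus; trivial; now apply smooth_off_dE]|trivial]]).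
  apply (Wb_e_ext n j (fun x e => dX f x e + dX g x e)%C).
  - intros; symmetry; now apply (d_plus U HU HP).
  - apply IH; trivial; now apply smooth_off_dX.
Qed.

Lemma Wb_e_mult n j f g : smooth_off U f -> smooth_off U g -> Wb_e n j U f -> Wb_e n j U g ->
  Wb_e n j U (fun x e => f x e * g x e)%C.
Proof.
  revert f g. induction n as [|n IH]; intros f g Sf Sg Wf Wg.
  all: pose proof (smooth_off_dX _ _ Sf); pose proof (smooth_off_dX _ _ Sg);
    pose proof (smooth_off_dE _ _ Sf); pose proof (smooth_off_dE _ _ Sg).
  all: assert (HE : forall m, Wb m j U (dE (fun x e => f x e * g x e)%C)) by
    (intros m; apply (Wb_ext U HU m j (fun x e => dE f x e * g x e + f x e * dE g x e)%C);
      [intros; symmetry; now apply (d_mult U HU HP)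
      |apply Wb_plus; trivial; try (now apply smooth_off_mult); apply Wb_mult; trivial;
       solve [apply Wf|apply Wg]]).
  - split; [intros m; apply Wb_mult; trivial; [apply Wf|apply Wg]|]. split; trivial.
  - split; [intros m; apply Wb_mult; trivial; [apply Wf|apply Wg]|]. split; trivial.
    apply (Wb_e_ext n j (fun x e => dX f x e * g x e + f x e * dX g x e)%C).
    + intros; symmetry; now apply (d_mult U HU HP).
    + apply Wb_e_plus; trivial; try (now apply smooth_off_mult); apply IH; trivial;
      solve [apply Wf|apply Wg|now apply Wb_e_S].
Qed.

Lemma Wb_e_csum n j (f : nat -> fn) N : (forall k, (k <= N)%nat -> smooth_off U (f k)) ->
  (forall k, (k <= N)%nat -> Wb_e n j U (f k)) -> Wb_e n j U (fun x e => csum (fun k => f k x e) N).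
Proof.
  intros Hs. induction N as [|N IH]; intros H; simpl.
  - apply (Wb_e_ext n j (f 0%nat)); trivial. apply H; lia.
  - apply Wb_e_plus.
    + apply smooth_off_csum; trivial. intros; apply Hs; lia.
    + apply Hs; lia.
    + apply IH; intros; [apply Hs|apply H]; lia.
    + apply H; lia.
Qed.

End OffRulesE.

(** * One-step recurrences with smooth coefficients *)

Definition rect (A B e0 e1 : R) : dom := fun x e => A < x < B /\ e0 < e < e1.
(** The points of the rectangle whose successor x + e still lies inside: the domain on which a
    one-step equation can be imposed. *)
Definition trap (A B e1 : R) : dom := fun x e => (A < x /\ x + e < B) /\ 0 < e < e1.

Lemma open2_rect A B e0 e1 : open2 (rect A B e0 e1).
Proof.
  intros x e [Hx He]. exists (Rmin (Rmin (x - A) (B - x)) (Rmin (e - e0) (e1 - e))).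
  split; [repeat apply Rmin_pos; lra|]. intros x' e' H1 H2.
  apply Rabs_def2 in H1. apply Rabs_def2 in H2.
  pose proof (Rmin_l (Rmin (x - A) (B - x)) (Rmin (e - e0) (e1 - e))).
  pose proof (Rmin_r (Rmin (x - A) (B - x)) (Rmin (e - e0) (e1 - e))).
  pose proof (Rmin_l (x - A) (B - x)). pose proof (Rmin_r (x - A) (B - x)).
  pose proof (Rmin_l (e - e0) (e1 - e)). pose proof (Rmin_r (e - e0) (e1 - e)).
  split; lra.
Qed.

Lemma convex2_rect A B e0 e1 : convex2 (rect A B e0 e1).
Proof.
  intros x e x' e' t [Hx He] [Hx' He'] Ht.
  assert (G : forall a b y y', a < y < b -> a < y' < b -> a < y + t * (y' - y) < b).
  { intros a b y y' H H'. destruct (Rlt_or_le t (1 / 2)); split; nra. }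
  split; now apply G.
Qed.

Lemma open2_trap A B e1 : open2 (trap A B e1).
Proof.
  intros x e [Hx He]. exists (Rmin (Rmin (x - A) ((B - x - e) / 2)) (Rmin e (e1 - e))).
  split; [repeat apply Rmin_pos; lra|]. intros x' e' H1 H2.
  apply Rabs_def2 in H1. apply Rabs_def2 in H2.
  pose proof (Rmin_l (Rmin (x - A) ((B - x - e) / 2)) (Rmin e (e1 - e))).
  pose proof (Rmin_r (Rmin (x - A) ((B - x - e) / 2)) (Rmin e (e1 - e))).
  pose proof (Rmin_l (x - A) ((B - x - e) / 2)). pose proof (Rmin_r (x - A) ((B - x - e) / 2)).
  pose proof (Rmin_l e (e1 - e)). pose proof (Rmin_r e (e1 - e)).
  split; split; lra.
Qed.

Lemma trap_rect A B e1 : sub2 (trap A B e1) (rect A B 0 e1).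
Proof. intros x e [[H1 H2] H3]. split; split; lra. Qed.

Lemma pos_dom_rect A B e0 e1 : 0 <= e0 -> pos_dom (rect A B e0 e1).
Proof. intros H0 x e [H1 H2]. lra. Qed.

Lemma pos_dom_trap A B e1 : pos_dom (trap A B e1).
Proof. intros x e [H1 H2]. lra. Qed.

Lemma floor_steps r e : 0 <= r -> 0 < e -> exists m, INR m * e <= r < (INR m + 1) * e.
Proof.
  intros Hr He. assert (Hi : 0 < / e) by now apply Rinv_0_lt_compat.
  destruct (nfloor_ex (r / e)) as [m Hm]; [apply Rmult_le_pos; lra|]. exists m. split.
  - apply (Rmult_le_reg_r (/ e)); trivial. rewrite Rmult_assoc, Rinv_r, Rmult_1_r by lra. apply Hm.
  - apply (Rmult_lt_reg_r (/ e)); trivial. rewrite Rmult_assoc, Rinv_r, Rmult_1_r by lra. apply Hm.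
Qed.

Section Recurrence.
Variables (A B e1 : R).
Let U := rect A B 0 e1.
Let V := trap A B e1.
Let HU : open2 U := open2_rect A B 0 e1.
Let HV : open2 V := open2_trap A B e1.
Let PV : pos_dom V := pos_dom_trap A B e1.
Let VU : sub2 V U := trap_rect A B e1.

Lemma trap_shift x e : V x e -> U (x + e) e.
Proof. intros [[H1 H2] H3]. split; split; lra. Qed.

Lemma diff2_shift f fx fe ep : diff2 (above ep U) f fx fe ->
  diff2 (above ep V) (fun x e => f (x + e) e) (fun x e => fx (x + e) e)
    (fun x e => fx (x + e)%R e + fe (x + e)%R e)%C.
Proof.
  intros H.
  assert (E1 : forall x e : R, x + 1 * e = x + e) by (intros; ring).
  assert (E2 : forall e : R, 1 * e + 0 = e) by (intros; ring).
  apply (diff2_ext _ (fun x e => f (x + 1 * e) (1 * e + 0)) (fun x e => fx (x + 1 * e) (1 * e + 0))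
    (fun x e => RtoC 1 * fx (x + 1 * e)%R (1 * e + 0)%R
              + RtoC 1 * fe (x + 1 * e)%R (1 * e + 0)%R)%C).
  - intros x e _. now rewrite E1, E2.
  - intros x e _. now rewrite E1, E2.
  - intros x e _. rewrite E1, E2. ring.
  - apply (diff2_affine (above ep U)); trivial.
    intros x e [Hp He]. rewrite E1, E2. split; trivial. now apply trap_shift.
Qed.

Lemma d_shift f : smooth_off U f -> forall x e, V x e ->
  dX (fun x e => f (x + e) e) x e = dX f (x + e) e /\
  dE (fun x e => f (x + e) e) x e = (dX f (x + e)%R e + dE f (x + e)%R e)%C.
Proof.
  intros Hf.
  apply (derivative_unique_off V _ (fun x e => dX f (x + e) e)
    (fun x e => dX f (x + e)%R e + dE f (x + e)%R e)%C); trivial.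
  intros ep Hep. apply diff2_shift. now apply off_diff2.
Qed.

Notation av := (Av 1 1 0).

Lemma av_map x e s : V x e -> 0 <= s <= 1 -> U (x + 1 * s * e) ((1 + 0 * s) * e).
Proof. intros [[H1 H2] H3] Hs. assert (0 <= s * e <= e) by (split; nra). split; split; lra. Qed.

Lemma av_segment_lip g ep : smooth2 (above ep U) g -> forall x e s, above ep V x e -> 0 <= s <= 1 ->
  lip_near (fun s => g (x + 1 * s * e) ((1 + 0 * s) * e)) s.
Proof.
  intros Hg x e s [Hp He] Hs.
  pose proof (av_map x e s Hp Hs) as Hq.
  destruct (diff2_lipschitz (above ep U) g (dX g) (dE g)) as [L [L0 HL]].
  { now apply smooth2_bounded. } { now apply smooth2_bounded, smooth2_dX. }
  { now apply smooth2_bounded, smooth2_dE. } { now apply smooth2_diff2. }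
  destruct (HU _ _ Hq) as [d [Hd HB]].
  assert (He0 : 0 < e) by (destruct Hp; lra).
  exists (L * e). exists (d / e). split; [now apply Rdiv_lt_0_compat|].
  intros t Ht.
  assert (Ht2 : Rabs (t - s) * e < d).
  { apply (Rmult_lt_compat_r e) in Ht; trivial. unfold Rdiv in Ht.
    rewrite Rmult_assoc, Rinv_l in Ht; lra. }
  assert (Ex : x + 1 * t * e - (x + 1 * s * e) = (t - s) * e) by ring.
  assert (Ee : (1 + 0 * t) * e - (1 + 0 * s) * e = 0) by ring.
  eapply Rle_trans; [apply HL|].
  - split; trivial. replace ((1 + 0 * s) * e) with e by ring. trivial.
  - split.
    + apply HB; [rewrite Ex, Rabs_mult, (Rabs_pos_eq e); lra|rewrite Ee, Rabs_R0; trivial].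
    + replace ((1 + 0 * t) * e) with e by ring. trivial.
  - unfold dist2. rewrite Ex, Ee, Rabs_R0, Rabs_mult, (Rabs_pos_eq e) by lra. lra.
Qed.

Lemma av_hyp_b s : 0 <= s <= 1 -> 0 <= 1 + 0 * s <= 1.
Proof. lra. Qed.

Lemma av_map_above ep x e s : above ep V x e -> 0 <= s <= 1 ->
  above ep U (x + 1 * s * e) ((1 + 0 * s) * e).
Proof.
  intros [Hp He] Hs. split; [now apply av_map|]. replace ((1 + 0 * s) * e) with e by ring. trivial.
Qed.

Lemma av_diff2 g k ep : smooth2 (above ep U) g ->
  diff2 (above ep V) (av k g) (av k (dX g))
    (fun x e => RtoC 1 * av (S k) (dX g) x e +
       (RtoC 1 * av k (dE g) x e + RtoC 0 * av (S k) (dE g) x e))%C.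
Proof.
  intros Hg. apply (diff2_Av 1 1 0 (above ep U)).
  - lra.
  - apply av_hyp_b.
  - apply av_map_above.
  - intros x e s. now apply av_segment_lip.
  - intros x e s. now apply av_segment_lip, smooth2_dX.
  - intros x e s. now apply av_segment_lip, smooth2_dE.
  - now apply smooth2_diff2.
Qed.

Lemma smooth_off_av g k : smooth_off U g -> smooth_off V (av k g).
Proof.
  intros Hg ep Hep n. specialize (Hg ep Hep). revert g k Hg.
  assert (HB : forall g k, smooth2 (above ep U) g -> bounded2 (above ep V) (av k g)).
  { intros g k Hg. apply (bounded2_Av 1 1 0 (above ep U)).
    - apply av_map_above.
    - intros x e s. now apply av_segment_lip.
    - now apply smooth2_bounded. }
  assert (HO : open2 (above ep V)) by now apply open2_above.
  induction n as [|n IH]; intros g k Hg.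
  - split; trivial. now apply HB.
  - eapply Sm_intro; [trivial|now apply HB|now apply av_diff2| |].
    + apply IH. now apply smooth2_dX.
    + apply Sm_plus; trivial; [|apply Sm_plus; trivial]; apply Sm_scal; trivial; apply IH;
       try (now apply smooth2_dX); now apply smooth2_dE.
Qed.

Lemma d_av g k : smooth_off U g -> forall x e, V x e ->
  dX (av k g) x e = av k (dX g) x e /\
  dE (av k g) x e = (av (S k) (dX g) x e + av k (dE g) x e)%C.
Proof.
  intros Hg.
  assert (G := derivative_unique_off V (av k g) (av k (dX g))
     (fun x e => RtoC 1 * av (S k) (dX g) x e +
       (RtoC 1 * av k (dE g) x e + RtoC 0 * av (S k) (dE g) x e))%C HV PV).
  intros x e Hp. destruct (G (fun ep Hep => av_diff2 g k ep (Hg ep Hep)) x e Hp) as [-> ->].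
  split; [reflexivity|ring].
Qed.

Lemma Wb_av n j g k : smooth_off U g -> Wb n j U g -> Wb n j V (av k g).
Proof.
  revert j g k. induction n as [|n IH]; intros j g k Hg HW.
  all: assert (HB : bounded2 V (av k g)).
  1,3: apply (bounded2_Av 1 1 0 U);
    [intros x e s; apply av_map
    |intros x e s Hp Hs; assert (He : 0 < e) by (destruct Hp; lra);
     apply (av_segment_lip g (e / 2)); [apply Hg; lra|split; [trivial|lra]|trivial]
    |eapply Wb_bounded; eassumption].
  - split; trivial.
  - split; trivial. destruct HW as [_ [Wx We]].
    pose proof (smooth_off_dX _ _ Hg) as Sx. pose proof (smooth_off_dE _ _ Hg) as Se. split.
    + apply (Wb_ext V HV n j (av k (dX g))); [|now apply IH].
      intros x e Hp. exact (eq_sym (proj1 (d_av g k Hg x e Hp))).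
    + destruct j as [|j]; trivial.
      apply (Wb_ext V HV n j (fun x e => av (S k) (dX g) x e + av k (dE g) x e)%C).
      * intros x e Hp. exact (eq_sym (proj2 (d_av g k Hg x e Hp))).
      * apply Wb_plus; trivial; try (now apply smooth_off_av); apply IH; trivial. now apply Wb_j.
Qed.

(* Integration by parts: e^2 times the average of s f_xx is the Taylor remainder of f based at x + e. *)
Lemma av_second_derivative f : smooth_off U f -> forall x e, V x e ->
  (RtoC e * (RtoC e * av 1 (dX (dX f)) x e))%C =
  (RtoC e * dX f (x + e)%R e - (f (x + e)%R e - f x e))%C.
Proof.
  intros Hf x e Hp.
  assert (He : 0 < e) by (destruct Hp; lra).
  assert (Hep : 0 < e / 2) by lra.
  assert (Hpe : above (e / 2) V x e) by (split; trivial; lra).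
  pose proof (Hf _ Hep) as Sf.
  pose proof (smooth2_dX _ _ Sf) as Sx. pose proof (smooth2_dX _ _ Sx) as Sxx.
  destruct (diff2_pos _ _ _ _ (smooth2_diff2 _ _ Sf)) as [K [K0 HK]].
  destruct (diff2_pos _ _ _ _ (smooth2_diff2 _ _ Sx)) as [K' [K0' HK']].
  destruct (bounded2_pos _ _ (smooth2_bounded _ _ Sxx)) as [M [M0 HM]].
  set (y := fun t => x + 1 * t * e).
  assert (Ed : forall t, (1 + 0 * t) * e = e) by (intros; ring).
  assert (I1 : isI (fun t => RtoC e * (RtoC e *
       (RtoC (t ^ 1) * dX (dX f) (x + 1 * t * e)%R ((1 + 0 * t) * e)%R)))%C 0 1
     (RtoC e * (RtoC e * av 1 (dX (dX f)) x e))%C).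
  { do 2 apply isI_scal. apply (isI_Av 1 1 0 (above (e / 2) V)); trivial.
    intros x' e' s. now apply av_segment_lip. }
  assert (I2 : isI (fun t => RtoC e * (RtoC e *
       (RtoC (t ^ 1) * dX (dX f) (x + 1 * t * e)%R ((1 + 0 * t) * e)%R)))%C 0 1
      ((RtoC (1 * e) * dX f (y 1%R) e - f (y 1%R) e) - (RtoC (0 * e) * dX f (y 0%R) e - f (y 0%R) e))%C).
  (* The antiderivative that integration by parts suggests. Its remainder has three parts: that of
     f_x with weight |s e| <= 2 e, which gives 2 e K'; that of f, which gives K; and (s - t)^2 e^2
     f_xx, which gives M. *)
  { apply (isI_derive (fun t => RtoC (t * e) * dX f (y t) e - f (y t) e)%C _ 0 1
      ((2 * e * K' + K + M) * e ^ 2)).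
    - intros t Ht. unfold in_between in Ht. rewrite Rmin_left, Rmax_right in Ht by lra.
      pose proof (av_map_above _ x e t Hpe Ht) as Hq. rewrite Ed in Hq. fold (y t) in Hq.
      destruct (open2_above (e / 2) U HU _ _ Hq) as [d [Hd HBd]].
      exists (Rmin (d / e) 1). split; [apply Rmin_pos; [now apply Rdiv_lt_0_compat|lra]|].
      intros s Hs.
      assert (Hs1 : Rabs (s - t) < 1) by (eapply Rlt_le_trans; [exact Hs|apply Rmin_r]).
      assert (Hs2 : Rabs (s - t) < d / e) by (eapply Rlt_le_trans; [exact Hs|apply Rmin_l]).
      assert (Hs3 : Rabs (s - t) * e < d).
      { apply (Rmult_lt_compat_r e) in Hs2; trivial. unfold Rdiv in Hs2.
        rewrite Rmult_assoc, Rinv_l in Hs2; lra. }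
      assert (Ey : y s - y t = (s - t) * e) by (unfold y; ring).
      assert (Hq' : above (e / 2) U (y s) e).
      { apply HBd; [rewrite Ey, Rabs_mult, (Rabs_pos_eq e); lra|].
        rewrite Rminus_diag, Rabs_R0; trivial. }
      specialize (HK _ _ _ _ Hq Hq'). specialize (HK' _ _ _ _ Hq Hq').
      specialize (HM _ _ Hq).
      assert (Ey2 : dist2 (y t) e (y s) e ^ 2 = e ^ 2 * (s - t) ^ 2).
      { unfold dist2. rewrite Ey, Rminus_diag, Rabs_R0, Rplus_0_r, pow2_abs. ring. }
      rewrite Ey2 in HK, HK'. rewrite Ed. fold (y t).
      replace (RtoC (s * e) * dX f (y s) e - f (y s) e - (RtoC (t * e) * dX f (y t) e - f (y t) e)
        - RtoC (s - t) * (RtoC e * (RtoC e * (RtoC (t ^ 1) * dX (dX f) (y t) e))))%C with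
       (RtoC (s * e) * remainder (dX f) (dX (dX f)) (dE (dX f)) (y t) e (y s) e
        - remainder f (dX f) (dE f) (y t) e (y s) e
        + RtoC ((s - t) ^ 2 * e ^ 2) * dX (dX f) (y t) e)%C.
      2:{ unfold remainder. rewrite Ey, Rminus_diag.
          replace ((s - t) ^ 2 * e ^ 2) with ((s - t) * (s - t) * (e * e)) by ring.
          replace (t ^ 1) with t by ring.
          rewrite !RtoC_mult, !RtoC_minus. ring. }
      set (q := e ^ 2 * (s - t) ^ 2) in *.
      assert (Hq0 : 0 <= q) by (unfold q; apply Rmult_le_pos; apply pow2_ge_0).
      eapply Rle_trans; [apply Cmod_triangle|].
      eapply Rle_trans; [apply Rplus_le_compat_r, Cmod_minus_le|].
      rewrite !Cmod_rmult.
      replace ((s - t) ^ 2 * e ^ 2) with q by (unfold q; ring). rewrite (Rabs_pos_eq q) by trivial.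
      replace ((2 * e * K' + K + M) * e ^ 2 * (s - t) ^ 2) with ((2 * e) * (K' * q) + K * q + q * M)
        by (unfold q; ring).
      assert (Rabs (s * e) <= 2 * e).
      { rewrite Rabs_mult, (Rabs_pos_eq e) by lra. apply Rmult_le_compat_r; [lra|].
        apply Rabs_def2 in Hs1. apply Rabs_le. lra. }
      apply Rplus_le_compat; [apply Rplus_le_compat; trivial|].
      + apply Rmult_le_compat; trivial; [apply Rabs_pos|apply Cmod_ge_0].
      + now apply Rmult_le_compat_l.
    - intros t Ht. unfold in_between in Ht. rewrite Rmin_left, Rmax_right in Ht by lra.
      assert (L0 : lip_near (fun _ => RtoC e) t).
      { exists 0. exists 1. split; [lra|]. intros s _.
        replace (RtoC e - RtoC e)%C with (RtoC 0) by ring. rewrite Cmod_0. lra. }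
      apply lip_near_mult; trivial. apply lip_near_mult; trivial.
      apply lip_near_mult; [apply lip_near_pow|]. now apply (av_segment_lip _ (e / 2)). }
  apply isI_unique in I1. apply isI_unique in I2. rewrite I1 in I2. rewrite I2.
  unfold y. rewrite !Rmult_0_r, !Rmult_0_l, !Rmult_1_l, Rplus_0_r. ring.
Qed.

(** * Propagation of bounds that are uniform down to e = 0 *)

Section UniformBounds.
Variables (N : nat) (M : nat -> nat -> fn) (K : R) (c c' : R).
Hypothesis HM : forall i k, (i <= N)%nat -> (k <= N)%nat -> smooth2 U (M i k).
Hypothesis HK : forall i k x e, (i <= N)%nat -> (k <= N)%nat -> U x e -> Cmod (M i k x e) <= K.
Hypothesis HK0 : 0 <= K.
Hypothesis Hsmall : INR (S N) * K * e1 <= 1 / 2.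
Hypothesis Hc : A <= c /\ c' <= B /\ e1 <= c' - c.

(** The forcing [G] is present because the derivatives of a homogeneous solution satisfy the same
    equation with a forcing. *)
Definition one_step (Z G : nat -> fn) := forall i x e, (i <= N)%nat -> V x e ->
  Z i (x + e) e = (Z i x e + RtoC e * (csum (fun k => M i k x e * Z k x e)%C N + G i x e))%C.

Lemma one_step_gronwall Z G g x e n : 0 <= g -> one_step Z G ->
  (forall i x e, (i <= N)%nat -> V x e -> Cmod (G i x e) <= g) ->
  0 < e < e1 -> A < x -> x + INR n * e < B ->
  vnorm N (fun i => Z i (x + INR n * e) e) <=
    gronwall_constant N K (B - A) * (vnorm N (fun i => Z i x e) + g) /\
  vnorm N (fun i => Z i x e) <=
    gronwall_constant N K (B - A) * (vnorm N (fun i => Z i (x + INR n * e) e) + g).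
Proof.
  intros Hg HZ HG He Hx Hn.
  assert (HV' : forall j, (j < n)%nat -> V (x + INR j * e) e).
  { intros j Hj. apply le_INR in Hj. rewrite S_INR in Hj. pose proof (pos_INR j).
    split; trivial. split; nra. }
  pose proof (gronwall N (fun j i k => M i k (x + INR j * e) e) (fun j i => G i (x + INR j * e) e)
    (fun j i => Z i (x + INR j * e) e) e K g (B - A) n) as H.
  cbv beta in H.
  assert (E0 : vnorm N (fun i => Z i (x + INR 0 * e) e) = vnorm N (fun i => Z i x e)).
  { apply vnorm_ext. intros i _. simpl. now rewrite Rmult_0_l, Rplus_0_r. }
  rewrite E0 in H. apply H; trivial; try lra.
  - apply Rle_trans with (INR (S N) * K * e1); trivial. apply Rmult_le_compat_l; [|lra].
    apply Rmult_le_pos; trivial. apply pos_INR.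
  - intros j i k Hj Hi Hk. apply HK; trivial. now apply VU, HV'.
  - intros j i Hj Hi. apply HG; trivial. now apply HV'.
  - intros j i Hj Hi. rewrite <- HZ by auto. f_equal. rewrite S_INR. ring.
Qed.

Let S := rect c c' 0 e1.

(** A step is no longer than the strip c < x < c', so no iteration can jump over it: points left of
    the strip reach it forwards, points right of it backwards. The bound on the strip is then
    transported by the two directions of Gronwall. *)
Lemma one_step_bounded Z G : one_step Z G ->
  (forall i, (i <= N)%nat -> bounded2 V (G i)) -> (forall i, (i <= N)%nat -> bounded2 S (Z i)) ->
  forall i, (i <= N)%nat -> bounded2 U (Z i).
Proof.
  intros HZ HG HS.
  assert (Hmax : forall (W : dom) (Y : nat -> fn) n, (forall i, (i <= n)%nat -> bounded2 W (Y i)) ->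
    exists g, 0 <= g /\ forall i x e, (i <= n)%nat -> W x e -> Cmod (Y i x e) <= g).
  { intros W Y n. induction n as [|n IH]; intros H.
    - destruct (bounded2_pos _ _ (H 0%nat (le_n _))) as [k [k0 Hk]]. exists k. split; [lra|].
      intros i x e Hi. replace i with 0%nat by lia. auto.
    - destruct IH as [g [g0 Hg]]; [intros; apply H; lia|].
      destruct (bounded2_pos _ _ (H (Datatypes.S n) (le_n _))) as [k [k0 Hk]].
      exists (g + k). split; [lra|]. intros i x e Hi Hp.
      destruct (Nat.eq_dec i (Datatypes.S n)) as [->|Hn].
      + specialize (Hk x e Hp). lra.
      + specialize (Hg i x e ltac:(lia) Hp). lra. }
  destruct (Hmax V G N HG) as [g [g0 Hg]]. destruct (Hmax S Z N HS) as [z [z0 Hz]].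
  intros i Hi. set (C := gronwall_constant N K (B - A)).
  exists (C * (INR (Datatypes.S N) * z + g) + z). intros x e Hp.
  destruct (classic (S x e)) as [Hs|Hs].
  { assert (0 <= C * (INR (Datatypes.S N) * z + g)).
    { apply Rmult_le_pos.
      - unfold C, gronwall_constant. apply Rmult_le_pos; [left; apply exp_pos|].
        assert (0 <= INR (Datatypes.S N) * (B - A)).
        { apply Rmult_le_pos; [apply pos_INR|destruct Hp; lra]. } lra.
      - assert (0 <= INR (Datatypes.S N) * z) by (apply Rmult_le_pos; trivial; apply pos_INR). lra. }
    specialize (Hz i x e Hi Hs). lra. }
  eapply Rle_trans; [apply (vnorm_ge N (fun i => Z i x e)); trivial|].
  enough (H : vnorm N (fun i => Z i x e) <= C * (INR (Datatypes.S N) * z + g)) by lra.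
  assert (Hend : forall x', S x' e -> vnorm N (fun i => Z i x' e) <= INR (Datatypes.S N) * z).
  { intros x' Hx'. apply vnorm_le. intros k Hk. now apply Hz. }
  assert (HC : 0 <= C).
  { unfold C, gronwall_constant. apply Rmult_le_pos; [left; apply exp_pos|].
    assert (0 <= INR (Datatypes.S N) * (B - A)).
    { apply Rmult_le_pos; [apply pos_INR|destruct Hp; lra]. } lra. }
  destruct Hp as [Hx He].
  destruct (Rle_or_lt x c) as [Hxc|Hxc].
  - destruct (floor_steps (c - x) e) as [m H1]; [lra|lra|].
    assert (HS' : S (x + INR (Datatypes.S m) * e) e).
    { rewrite S_INR. split; split; lra. }
    destruct (one_step_gronwall Z G g x e (Datatypes.S m)) as [_ H]; trivial; try lra.
    { destruct HS'; lra. }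
    eapply Rle_trans; [exact H|]. apply Rmult_le_compat_l; trivial.
    apply Rplus_le_compat_r. now apply Hend.
  - assert (Hxc' : c' <= x).
    { apply Rnot_lt_le. intros Hl. apply Hs. split; split; lra. }
    destruct (floor_steps (x - c') e) as [m H1]; [lra|lra|].
    set (x0 := x - INR (Datatypes.S m) * e).
    assert (HS' : S x0 e).
    { unfold x0. rewrite S_INR. split; split; lra. }
    assert (Ex : x0 + INR (Datatypes.S m) * e = x) by (unfold x0; ring).
    destruct (one_step_gronwall Z G g x0 e (Datatypes.S m)) as [H _]; trivial; try lra.
    { destruct HS'; lra. }
    rewrite Ex in H. eapply Rle_trans; [exact H|]. apply Rmult_le_compat_l; trivial.
    apply Rplus_le_compat_r. now apply Hend.
Qed.

Lemma one_step_rhs_smooth i Z : (i <= N)%nat -> (forall i, (i <= N)%nat -> smooth_off U (Z i)) ->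
  forall Y : nat -> fn, (forall k, (k <= N)%nat -> smooth_off V (Y k)) ->
  smooth_off V (fun x e => csum (fun k => Y k x e * Z k x e)%C N).
Proof.
  intros Hi HZ Y HY.
  apply (smooth_off_csum V (fun k x e => Y k x e * Z k x e)%C); trivial.
  intros k Hk. apply smooth_off_mult; auto. apply (smooth_off_sub U); auto.
Qed.

Definition forcing_x (Z G : nat -> fn) (i : nat) : fn := fun x e =>
  (csum (fun k => dX (M i k) x e * Z k x e)%C N + dX (G i) x e)%C.

(** Differentiating Z(x + e, e) = Z + e s in e leaves the terms s - Z_x(x + e), which carry no
    factor e. Since s is the difference quotient (Z(x + e) - Z(x)) / e, they equal -e times the
    average of t Z_xx over x to x + e, and so become part of the forcing. *)
Definition forcing_e (Z G : nat -> fn) (i : nat) : fn := fun x e =>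
  ((csum (fun k => dE (M i k) x e * Z k x e)%C N + dE (G i) x e)
    + - RtoC 1 * av 1 (dX (dX (Z i))) x e)%C.

Lemma smooth_off_M i k : (i <= N)%nat -> (k <= N)%nat -> smooth_off V (M i k).
Proof. intros Hi Hk. apply (smooth_off_sub U); trivial. now apply smooth2_off, HM. Qed.

Lemma d_one_step_rhs Z G i : (i <= N)%nat -> (forall i, (i <= N)%nat -> smooth_off U (Z i)) ->
  (forall i, (i <= N)%nat -> smooth_off V (G i)) -> forall x e, V x e ->
  dX (fun x e => csum (fun k => M i k x e * Z k x e)%C N + G i x e)%C x e =
    (csum (fun k => M i k x e * dX (Z k) x e)%C N + forcing_x Z G i x e)%C /\
  dE (fun x e => csum (fun k => M i k x e * Z k x e)%C N + G i x e)%C x e =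
    (csum (fun k => M i k x e * dE (Z k) x e)%C N
      + (csum (fun k => dE (M i k) x e * Z k x e)%C N + dE (G i) x e))%C.
Proof.
  intros Hi HZ HG x e Hp.
  assert (HZV : forall k, (k <= N)%nat -> smooth_off V (Z k)).
  { intros k Hk. apply (smooth_off_sub U); auto. }
  assert (S1 : forall k, (k <= N)%nat -> smooth_off V (fun x e => M i k x e * Z k x e)%C).
  { intros k Hk. apply smooth_off_mult; auto. now apply smooth_off_M. }
  assert (S2 : smooth_off V (fun x e => csum (fun k => M i k x e * Z k x e)%C N)).
  { now apply (smooth_off_csum V (fun k x e => M i k x e * Z k x e)%C). }
  destruct (d_plus V HV PV _ _ S2 (HG i Hi) x e Hp) as [-> ->].
  destruct (d_csum V HV PV (fun k x e => M i k x e * Z k x e)%C N S1 x e Hp) as [-> ->].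
  unfold forcing_x.
  rewrite (csum_ext (fun k => dX (fun x e => M i k x e * Z k x e)%C x e)
    (fun k => dX (M i k) x e * Z k x e + M i k x e * dX (Z k) x e)%C).
  2:{ intros k Hk. apply (d_mult V HV PV); auto. now apply smooth_off_M. }
  rewrite (csum_ext (fun k => dE (fun x e => M i k x e * Z k x e)%C x e)
    (fun k => dE (M i k) x e * Z k x e + M i k x e * dE (Z k) x e)%C).
  2:{ intros k Hk. apply (d_mult V HV PV); auto. now apply smooth_off_M. }
  rewrite !csum_plus. split; ring.
Qed.

Lemma smooth_off_coordinate : smooth_off V (fun _ e => RtoC e).
Proof.
  intros ep Hep n. assert (HO : open2 (above ep V)) by now apply open2_above.
  assert (HB : bounded2 (above ep V) (fun _ e => RtoC e)).
  { exists e1. intros x e [[_ He] _]. rewrite Cmod_R, Rabs_pos_eq; lra. }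
  destruct n as [|n]; [split; trivial|].
  apply (Sm_intro n _ _ (fun _ _ => RtoC 0) (fun _ _ => RtoC 1)); trivial; try (now apply Sm_const).
  exists 0. intros x e x' e' _ _. unfold remainder.
  replace (RtoC e' - RtoC e - RtoC (x' - x) * 0 - RtoC (e' - e) * 1)%C with (RtoC 0).
  - rewrite Cmod_0. lra.
  - rewrite !RtoC_minus. ring.
Qed.

Lemma d_coordinate x e : V x e -> dX (fun _ e => RtoC e) x e = 0%C /\ dE (fun _ e => RtoC e) x e = 1%C.
Proof.
  intros Hp. apply (derivative_unique_off V _ (fun _ _ => RtoC 0) (fun _ _ => RtoC 1)); trivial.
  intros ep Hep. exists 0. intros y d y' d' _ _. unfold remainder.
  replace (RtoC d' - RtoC d - RtoC (y' - y) * 0 - RtoC (d' - d) * 1)%C with (RtoC 0).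
  - rewrite Cmod_0. lra.
  - rewrite !RtoC_minus. ring.
Qed.

Lemma one_step_derivatives Z G : one_step Z G -> (forall i, (i <= N)%nat -> smooth_off U (Z i)) ->
  (forall i, (i <= N)%nat -> smooth_off V (G i)) ->
  one_step (fun i => dX (Z i)) (forcing_x Z G) /\ one_step (fun i => dE (Z i)) (forcing_e Z G).
Proof.
  intros HZ SZ SG.
  assert (SM : forall i, (i <= N)%nat ->
    smooth_off V (fun x e => csum (fun k => M i k x e * Z k x e)%C N + G i x e)%C).
  { intros i Hi. apply smooth_off_plus; auto.
    apply (one_step_rhs_smooth i Z Hi SZ (fun k => M i k)). intros k Hk. now apply smooth_off_M. }
  assert (D : forall i x e, (i <= N)%nat -> V x e ->
    dX (Z i) (x + e) e = (dX (Z i) x e + RtoC e *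
      (csum (fun k => M i k x e * dX (Z k) x e)%C N + forcing_x Z G i x e))%C /\
    (dX (Z i) (x + e)%R e + dE (Z i) (x + e)%R e)%C = (dE (Z i) x e + ((csum (fun k => M i k x e * Z k x e)%C N + G i x e) + RtoC e *
      (csum (fun k => M i k x e * dE (Z k) x e)%C N
      + (csum (fun k => dE (M i k) x e * Z k x e)%C N + dE (G i) x e))))%C).
  { intros i x e Hi Hp.
    destruct (d_shift (Z i) (SZ i Hi) x e Hp) as [E1 E2]. rewrite <- E2, <- E1.
    rewrite (dX_ext V _ _ x e HV (fun x e Hp => HZ i x e Hi Hp) Hp).
    rewrite (dE_ext V _ _ x e HV (fun x e Hp => HZ i x e Hi Hp) Hp).
    pose proof (smooth_off_mult V _ _ HV smooth_off_coordinate (SM i Hi)) as SE.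
    destruct (d_plus V HV PV (Z i) _ (smooth_off_sub U V _ VU (SZ i Hi)) SE x e Hp) as [-> ->].
    destruct (d_mult V HV PV _ _ smooth_off_coordinate (SM i Hi) x e Hp) as [-> ->].
    destruct (d_coordinate x e Hp) as [-> ->].
    destruct (d_one_step_rhs Z G i Hi SZ SG x e Hp) as [-> ->]. split; ring. }
  split; intros i x e Hi Hp; destruct (D i x e Hi Hp) as [D1 D2]; trivial.
  assert (He : RtoC e <> 0%C).
  { intros E. apply RtoC_inj in E. destruct Hp; lra. }
  (* The identity is shown after multiplication by e: the Taylor formula [av_second_derivative]
     contains Z(x + e) - Z(x), which is e times the right-hand side. The factor is cancelled
     below. *)
  assert (Fin : (RtoC e * (dE (Z i) (x + e)%R e - (dE (Z i) x e + RtoC e *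
     (csum (fun k => M i k x e * dE (Z k) x e)%C N + forcing_e Z G i x e))))%C = 0%C).
  { replace (dE (Z i) (x + e)%R e) with
      ((dX (Z i) (x + e)%R e + dE (Z i) (x + e)%R e) - dX (Z i) (x + e)%R e)%C by ring.
    rewrite D2. unfold forcing_e.
    pose proof (av_second_derivative (Z i) (SZ i Hi) x e Hp) as HA.
    rewrite (HZ i x e Hi Hp) in HA.
    set (a := av 1 (dX (dX (Z i))) x e) in *. set (b := dX (Z i) (x + e)%R e) in *.
    set (s := (csum (fun k => M i k x e * Z k x e)%C N + G i x e)%C) in *.
    transitivity ((RtoC e * (RtoC e * a)) - (RtoC e * b - RtoC e * s))%C; [ring|].
    rewrite HA. unfold s. ring. }
  set (rhs := (dE (Z i) x e + RtoC e * _)%C) in *.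
  replace (dE (Z i) (x + e)%R e) with
    (rhs + / RtoC e * (RtoC e * (dE (Z i) (x + e)%R e - rhs)))%C by (field; trivial).
  rewrite Fin. ring.
Qed.

(** The outer induction is on the number j of e-derivatives. Passing to j + 1, the outer hypothesis
    for [Z] bounds Z_xx, hence the forcing of [dE Z], and the outer hypothesis for [dE Z] then
    bounds it with j further e-derivatives. Derivatives in which x comes before the first e are
    reached by an inner induction that replaces [Z] by [dX Z]; [Wb_e] is the predicate stable under
    this replacement. *)
Theorem one_step_uniform_bounds j : forall Z G, one_step Z G ->
  (forall i, (i <= N)%nat -> smooth_off U (Z i)) ->
  (forall i, (i <= N)%nat -> smooth_off V (G i)) ->
  (forall i n, (i <= N)%nat -> Wb n j S (Z i)) ->
  (forall i n, (i <= N)%nat -> Wb n j V (G i)) ->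
  forall i n, (i <= N)%nat -> Wb n j U (Z i).
Proof.
  assert (HMW : forall i k n j, (i <= N)%nat -> (k <= N)%nat ->
     Wb n j V (M i k) /\ Wb n j V (dX (M i k)) /\ Wb n j V (dE (M i k)) /\
     smooth_off V (dX (M i k)) /\ smooth_off V (dE (M i k))).
  { intros i k n j' Hi Hk. pose proof (HM i k Hi Hk) as H.
    pose proof (smooth2_dX _ _ H) as Hx. pose proof (smooth2_dE _ _ H) as He.
    repeat split; try (apply (Wb_sub n j' U V); trivial; apply Wb_of_Sm; trivial);
     apply (smooth_off_sub U V); trivial; now apply smooth2_off. }
  assert (SX : forall Z G i, (i <= N)%nat -> (forall i, (i <= N)%nat -> smooth_off U (Z i)) ->
    (forall i, (i <= N)%nat -> smooth_off V (G i)) -> smooth_off V (forcing_x Z G i)).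
  { intros Z G i Hi SZ SG. apply smooth_off_plus; trivial; [|now apply smooth_off_dX, SG].
    apply (one_step_rhs_smooth i Z Hi SZ (fun k => dX (M i k))).
    intros k Hk. now apply (HMW i k 0%nat 0%nat). }
  assert (SE : forall Z G i, (i <= N)%nat -> (forall i, (i <= N)%nat -> smooth_off U (Z i)) ->
    (forall i, (i <= N)%nat -> smooth_off V (G i)) -> smooth_off V (forcing_e Z G i)).
  { intros Z G i Hi SZ SG. apply smooth_off_plus; trivial.
    - apply smooth_off_plus; trivial; [|now apply smooth_off_dE, SG].
      apply (one_step_rhs_smooth i Z Hi SZ (fun k => dE (M i k))).
      intros k Hk. now apply (HMW i k 0%nat 0%nat).
    - apply smooth_off_mult; trivial; [now apply smooth_off_const|].
      apply smooth_off_av. now apply smooth_off_dX, smooth_off_dX, SZ. }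
  assert (WS : forall n j Z (Y : nat -> fn), (forall i, (i <= N)%nat -> smooth_off U (Z i)) ->
    (forall k, (k <= N)%nat -> smooth_off V (Y k)) ->
    (forall k, (k <= N)%nat -> Wb n j U (Z k)) -> (forall k, (k <= N)%nat -> Wb n j V (Y k)) ->
    Wb n j V (fun x e => csum (fun k => Y k x e * Z k x e)%C N)).
  { intros n j' Z Y SZ SY WZ WY.
    assert (SZV : forall k, (k <= N)%nat -> smooth_off V (Z k)).
    { intros k Hk. apply (smooth_off_sub U); auto. }
    apply (Wb_csum V HV PV n j' (fun k x e => Y k x e * Z k x e)%C).
    - intros k Hk. apply smooth_off_mult; auto.
    - intros k Hk. apply Wb_mult; auto. apply (Wb_sub n j' U); auto. }
  induction j as [|j IHj]; intros Z G HZ SZ SG WZ WG.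
  (* the e-derivatives satisfy the one-step equation with a forcing involving Z_xx, which has
     fewer e-derivatives *)
  - assert (Main : forall n Z G, one_step Z G -> (forall i, (i <= N)%nat -> smooth_off U (Z i)) ->
      (forall i, (i <= N)%nat -> smooth_off V (G i)) ->
      (forall i n, (i <= N)%nat -> Wb n 0 S (Z i)) ->
      (forall i n, (i <= N)%nat -> Wb n 0 V (G i)) ->
      forall i, (i <= N)%nat -> Wb n 0 U (Z i)).
    2:{ intros i n Hi. now apply (Main n Z G). }
    clear Z G HZ SZ SG WZ WG.
    (* Here [G] is bounded only to the order n of the conclusion. This is what the induction can
       supply: the forcing of [dX Z] contains [Z], known to order n only at that stage. *)
    assert (Main : forall n Z G, one_step Z G -> (forall i, (i <= N)%nat -> smooth_off U (Z i)) ->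
      (forall i, (i <= N)%nat -> smooth_off V (G i)) ->
      (forall i n, (i <= N)%nat -> Wb n 0 S (Z i)) ->
      (forall i, (i <= N)%nat -> Wb n 0 V (G i)) ->
      forall i, (i <= N)%nat -> Wb n 0 U (Z i)).
    2:{ intros n Z G HZ SZ SG WZ WG. apply (Main n Z G); trivial. intros k Hk. now apply WG. }
    induction n as [|n IH]; intros Z G HZ SZ SG WZ WG i Hi.
    1,2: assert (HB : bounded2 U (Z i)) by
      (apply (one_step_bounded Z G HZ); trivial; intros k Hk; eapply Wb_bounded;
       [now apply WG|now apply (WZ k 0%nat)]).
    + split; trivial.
    + split; trivial. split; trivial.
      assert (WZn : forall k, (k <= N)%nat -> Wb n 0 U (Z k)).
      { intros k Hk. apply (IH Z G); trivial. intros m Hm. now apply Wb_S, WG. }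
      apply (IH (fun i => dX (Z i)) (forcing_x Z G)); trivial.
      * now apply one_step_derivatives.
      * intros k Hk. now apply smooth_off_dX, SZ.
      * intros k Hk. now apply SX.
      * intros k m Hk. apply (WZ k (Datatypes.S m) Hk).
      * intros k Hk. apply Wb_plus; trivial.
        -- apply (one_step_rhs_smooth k Z Hk SZ (fun k' => dX (M k k'))).
           intros k' Hk'. now apply (HMW k k' 0%nat 0%nat).
        -- now apply smooth_off_dX, SG.
        -- apply (WS n 0%nat Z (fun k' => dX (M k k'))); trivial; intros k' Hk'; now apply HMW.
        -- apply (WG k Hk).
  - assert (Main : forall n Z G, one_step Z G -> (forall i, (i <= N)%nat -> smooth_off U (Z i)) ->
      (forall i, (i <= N)%nat -> smooth_off V (G i)) ->
      (forall i n, (i <= N)%nat -> Wb n (Datatypes.S j) S (Z i)) ->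
      (forall i, (i <= N)%nat -> Wb_e n j V (G i)) ->
      forall i, (i <= N)%nat -> Wb_e n j U (Z i)).
    2:{ intros i n Hi. apply Wb_of_Wb_e. apply (Main n Z G); trivial.
        intros k Hk. apply Wb_e_of_Wb. intros m. now apply WG. }
    clear Z G HZ SZ SG WZ WG.
    induction n as [|n IH]; intros Z G HZ SZ SG WZ WG.
    all: assert (WZj : forall i n, (i <= N)%nat -> Wb n j U (Z i)) by
      (apply (IHj Z G); trivial; intros; [now apply Wb_j, WZ|now apply (WG i)]).
    all: destruct (one_step_derivatives Z G HZ SZ SG) as [OX OE].
    all: assert (WEj : forall i n, (i <= N)%nat -> Wb n j U (dE (Z i))) by
      (apply (IHj (fun i => dE (Z i)) (forcing_e Z G)); trivial;
       [intros k Hk; now apply smooth_off_dE, SZ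
       |intros k Hk; now apply SE
       |intros k m Hk; apply (WZ k (Datatypes.S m) Hk)
       |intros k m Hk; apply Wb_plus; trivial;
         [apply smooth_off_plus; trivial;
           [apply (one_step_rhs_smooth k Z Hk SZ (fun k' => dE (M k k')));
            intros k' Hk'; now apply (HMW k k' 0%nat 0%nat)
           |now apply smooth_off_dE, SG]
         |apply smooth_off_mult; trivial; [now apply smooth_off_const|];
          apply smooth_off_av; now apply smooth_off_dX, smooth_off_dX, SZ
         |apply Wb_plus; trivial;
           [apply (one_step_rhs_smooth k Z Hk SZ (fun k' => dE (M k k')));
            intros k' Hk'; now apply (HMW k k' 0%nat 0%nat)
           |now apply smooth_off_dE, SG
           |apply (WS m j Z (fun k' => dE (M k k'))); auto; intros k' Hk'; now apply HMW
           |now apply (WG k Hk)]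
         |apply Wb_mult; trivial;
           [now apply smooth_off_const
           |apply smooth_off_av; now apply smooth_off_dX, smooth_off_dX, SZ
           |now apply Wb_const
           |apply Wb_av; [now apply smooth_off_dX, smooth_off_dX, SZ
             |apply (WZj k (Datatypes.S (Datatypes.S m)) Hk)]]]]).
    + intros i Hi. repeat split; auto.
    + intros i Hi. split; [auto|]. split; [auto|].
      apply (IH (fun i => dX (Z i)) (forcing_x Z G)); trivial.
      * intros k Hk. now apply smooth_off_dX, SZ.
      * intros k Hk. now apply SX.
      * intros k m Hk. apply (WZ k (Datatypes.S m) Hk).
      * assert (WZn : forall k, (k <= N)%nat -> Wb_e n j U (Z k)).
        { apply (IH Z G); trivial. intros k Hk. now apply Wb_e_S, WG. }
        intros k Hk. apply (Wb_e_plus V HV PV).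
        -- apply (one_step_rhs_smooth k Z Hk SZ (fun k' => dX (M k k'))).
           intros k' Hk'. now apply (HMW k k' 0%nat 0%nat).
        -- now apply smooth_off_dX, SG.
        -- apply (Wb_e_csum V HV PV n j (fun k' x e => dX (M k k') x e * Z k' x e)%C).
           ++ intros k' Hk'. apply smooth_off_mult; trivial; [now apply (HMW k k' 0%nat 0%nat)|].
              apply (smooth_off_sub U); auto.
           ++ intros k' Hk'. apply (Wb_e_mult V HV PV); [now apply (HMW k k' 0%nat 0%nat)| | |].
              ** apply (smooth_off_sub U); auto.
              ** apply Wb_e_of_Wb. intros m. now apply HMW.
              ** apply (Wb_e_sub n j U); auto.
        -- apply (WG k Hk).
Qed.

End UniformBounds.
End Recurrence.

(** * Interpolation of intermediate derivatives *)

Lemma le_of_geometric (x y c th : R) : 0 <= th < 1 -> (forall n : nat, x <= y + c * th ^ n) -> x <= y.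
Proof.
  intros Hth H. apply Rnot_lt_le. intros Hlt.
  assert (Hc : 0 < Rabs c + 1) by (pose proof (Rabs_pos c); lra).
  destruct (pow_lt_1_zero th) with (y := (x - y) / (Rabs c + 1)) as [n Hn].
  { rewrite Rabs_pos_eq; lra. }
  { apply Rdiv_lt_0_compat; lra. }
  specialize (Hn n (le_n _)). specialize (H n).
  assert (Hp : 0 <= th ^ n) by (apply pow_le; lra).
  rewrite Rabs_pos_eq in Hn by trivial.
  apply (Rmult_lt_compat_r (Rabs c + 1)) in Hn; trivial.
  unfold Rdiv in Hn. rewrite Rmult_assoc, Rinv_l, Rmult_1_r in Hn by lra.
  pose proof (Rle_abs c). nra.
Qed.

Lemma pow_le_one x n : 0 <= x <= 1 -> x ^ n <= 1.
Proof. intros H. rewrite <- (pow1 n). now apply pow_incr. Qed.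

Lemma pow_two_half n : 2 ^ n * (1 / 2) ^ n = 1.
Proof. rewrite <- Rpow_mult_distr. replace (2 * (1 / 2)) with 1 by lra. apply pow1. Qed.

(** Absorption of a term on the left-hand side: n applications, starting from any finite bound X0,
    give 2 Y + X0 / 2^n. The size of X0 leaves no trace. *)
Lemma bound_of_halving (T : Type) (P : T -> Prop) (v : T -> R) (X0 Y : R) :
  (forall t, P t -> v t <= X0) ->
  (forall X, 0 <= X -> (forall t, P t -> v t <= X) -> forall t, P t -> v t <= X / 2 + Y) ->
  0 <= X0 -> 0 <= Y -> forall t, P t -> v t <= 2 * Y.
Proof.
  intros H0 H HX HY t Ht.
  apply (le_of_geometric _ _ X0 (1 / 2)); [lra|]. intros n. revert t Ht.
  induction n as [|n IH]; intros t Ht.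
  - simpl. specialize (H0 t Ht). lra.
  - simpl. pose proof (pow_le (1 / 2) n ltac:(lra)).
    specialize (H (2 * Y + X0 * (1 / 2) ^ n)).
    assert (0 <= X0 * (1 / 2) ^ n) by now apply Rmult_le_pos.
    specialize (H ltac:(lra) IH t Ht). lra.
Qed.

(** A function together with all its derivatives. The constants are only qualitative; the
    interpolation inequalities below do not depend on them. *)
Definition deriv_family (I : R -> Prop) (u : nat -> R -> C) := forall i, exists K,
  (forall t, I t -> Cmod (u i t) <= K) /\
  forall t t', I t -> I t' -> Cmod (u i t' - u i t - RtoC (t' - t) * u (S i) t) <= K * (t' - t) ^ 2.

Lemma interval_convex c d : convex1 (fun t => c < t < d).
Proof. intros a b t Ha Hb Ht. destruct (Rlt_or_le t (1 / 2)); split; nra. Qed.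

Lemma deriv_family_taylor I u i L : convex1 I -> deriv_family I u ->
  (forall t, I t -> Cmod (u (S (S i)) t) <= L) ->
  forall t t', I t -> I t' -> Cmod (u i t' - u i t - RtoC (t' - t) * u (S i) t) <= L * (t' - t) ^ 2.
Proof.
  intros HI Hu HL. destruct (Hu i) as [K [_ HK]]. destruct (Hu (S i)) as [K' [_ HK']].
  now apply (taylor1_of_derivative I (u i) (u (S i)) (u (S (S i))) K K' L).
Qed.

(** Landau's inequality: Taylor's formula between t and a point at distance s determines the middle
    derivative from two values of [u i]. As 2 s < d - c, such a point exists on the side of the more
    distant end. *)
Lemma landau c d u i a b s : deriv_family (fun t => c < t < d) u ->
  (forall t, c < t < d -> Cmod (u i t) <= a) -> (forall t, c < t < d -> Cmod (u (S (S i)) t) <= b) ->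
  0 < s -> 2 * s < d - c -> forall t, c < t < d -> Cmod (u (S i) t) <= 2 * a / s + b * s.
Proof.
  intros Hu Ha Hb Hs Hs2 t Ht.
  assert (G : exists t', c < t' < d /\ Rabs (t' - t) = s).
  { destruct (Rlt_or_le t ((c + d) / 2)).
    - exists (t + s). split; [lra|]. replace (t + s - t) with s by ring. apply Rabs_pos_eq; lra.
    - exists (t - s). split; [lra|]. replace (t - s - t) with (- s) by ring.
      rewrite Rabs_Ropp. apply Rabs_pos_eq; lra. }
  destruct G as [t' [Ht' Et]].
  pose proof (deriv_family_taylor _ u i b (interval_convex c d) Hu Hb t t' Ht Ht') as H.
  rewrite <- (pow2_abs (t' - t)), Et in H.
  assert (H1 : s * Cmod (u (S i) t) <= 2 * a + b * s ^ 2).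
  { rewrite <- Et at 1. rewrite <- Cmod_rmult.
    replace (RtoC (t' - t) * u (S i) t)%C with
      ((u i t' - u i t) - (u i t' - u i t - RtoC (t' - t) * u (S i) t))%C by ring.
    eapply Rle_trans; [apply Cmod_minus_le|].
    pose proof (Cmod_minus_le (u i t') (u i t)). pose proof (Ha t Ht). pose proof (Ha t' Ht'). lra. }
  apply (Rmult_le_reg_l s); trivial.
  replace (s * (2 * a / s + b * s)) with (2 * a + b * s ^ 2) by (field; lra). exact H1.
Qed.

(** The Landau-Kolmogorov inequality with a free scale s. In the induction step, with X a bound for
    the derivative of order N + 1, the hypothesis bounds order N by K (a / s^N + X s), and Landau's
    inequality with step 4 K s returns X / 2 plus known terms; [bound_of_halving] removes X. *)
Lemma kolmogorov c d N : c < d -> exists K s0, 0 < K /\ 0 < s0 /\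
  forall u a b, deriv_family (fun t => c < t < d) u -> 0 <= a -> 0 <= b ->
  (forall t, c < t < d -> Cmod (u 0%nat t) <= a) ->
  (forall t, c < t < d -> Cmod (u (S N) t) <= b) ->
  forall m s t, (m <= S N)%nat -> 0 < s <= s0 -> c < t < d ->
  Cmod (u m t) <= K * (a / s ^ m + b * s ^ (S N - m)).
Proof.
  intros Hcd. induction N as [|N [K [s0 [HK [Hs0 IH]]]]].
  - exists 1. exists 1. split; [lra|]. split; [lra|]. intros u a b Hu Ha Hb H0 H1 m s t Hm Hs Ht.
    destruct m as [|[|m]]; [| |lia].
    + specialize (H0 t Ht). simpl. assert (0 <= b * s) by (apply Rmult_le_pos; lra).
      unfold Rdiv. rewrite Rinv_1. lra.
    + specialize (H1 t Ht). simpl. rewrite !Rmult_1_r.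
      assert (0 <= a / s) by (apply Rmult_le_pos; [lra|left; apply Rinv_0_lt_compat; lra]). lra.
  (* With 16 K s <= d - c the Landau step 4 K s fits into the interval. Inserting the bound 2 Y for
     order N + 1 into the induction hypothesis yields the coefficients 2 K and 8 K^2; the added 1
     covers the top order. *)
  - assert (Hs1 : 0 < (d - c) / (16 * K)) by (apply Rdiv_lt_0_compat; lra).
    exists (2 * K + 8 * K * K + 1). exists (Rmin s0 ((d - c) / (16 * K))).
    split; [nra|]. split; [now apply Rmin_pos|].
    intros u a b Hu Ha Hb H0 H1 m s t Hm [Hs Hs'] Ht.
    assert (Hsa : s <= s0) by (eapply Rle_trans; [exact Hs'|apply Rmin_l]).
    assert (Hsb : s <= (d - c) / (16 * K)) by (eapply Rle_trans; [exact Hs'|apply Rmin_r]).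
    assert (Htau : 16 * K * s <= d - c).
    { apply (Rmult_le_compat_l (16 * K)) in Hsb; [|lra].
      unfold Rdiv in Hsb. rewrite (Rmult_comm (d - c)), <- Rmult_assoc, Rinv_r in Hsb by lra. lra. }
    assert (Hpow : forall k, 0 < s ^ k) by (intros; now apply pow_lt).
    assert (Hdiv : forall k, 0 <= a / s ^ k).
    { intros k. apply Rmult_le_pos; [lra|]. left. now apply Rinv_0_lt_compat. }
    set (Y := a / (2 * s ^ S N) + 4 * K * b * s).
    assert (HY : 0 <= Y).
    { unfold Y. assert (0 <= a / (2 * s ^ S N)).
      { apply Rmult_le_pos; [lra|]. left. apply Rinv_0_lt_compat. pose proof (Hpow (S N)). lra. }
      assert (0 <= K * b) by (apply Rmult_le_pos; lra).
      assert (0 <= K * b * s) by (apply Rmult_le_pos; lra). lra. }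
    destruct (Hu (S N)) as [X0 [HX0 _]].
    assert (HX : forall r, c < r < d -> Cmod (u (S N) r) <= 2 * Y).
    { apply (bound_of_halving R (fun r => c < r < d) (fun r => Cmod (u (S N) r)) X0 Y); trivial.
      2:{ eapply Rle_trans; [apply Cmod_ge_0|apply (HX0 t Ht)]. }
      intros X HXp HXb r Hr.
      assert (Hn : forall q, c < q < d -> Cmod (u N q) <= K * (a / s ^ N + X * s)).
      { intros q Hq. pose proof (IH u a X Hu Ha HXp H0 HXb N s q ltac:(lia) ltac:(lra) Hq) as G.
        replace (S N - N)%nat with 1%nat in G by lia. now rewrite pow_1 in G. }
      pose proof (landau c d u N _ b (4 * K * s) Hu Hn H1) as L.
      assert (HKs : 0 < K * s) by now apply Rmult_lt_0_compat.
      specialize (L ltac:(lra) ltac:(lra) r Hr).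
      eapply Rle_trans; [exact L|]. right. unfold Y. simpl. field.
      pose proof (Hpow N). lra. }
    destruct (Nat.eq_dec m (S (S N))) as [->|Hm'].
    + rewrite Nat.sub_diag. simpl pow at 2. rewrite Rmult_1_r.
      specialize (H1 t Ht). specialize (Hdiv (S (S N))).
      assert (0 <= (2 * K + 8 * K * K) * (a / s ^ S (S N) + b)).
      { apply Rmult_le_pos; [nra|lra]. }
      rewrite Rmult_plus_distr_r. lra.
    + assert (Hm2 : (m <= S N)%nat) by lia.
      eapply Rle_trans; [apply (IH u a (2 * Y) Hu Ha ltac:(lra) H0 HX m s t Hm2 ltac:(lra) Ht)|].
      assert (E : 2 * Y * s ^ (S N - m) = a / s ^ m + 8 * K * (b * s ^ (S (S N) - m))).
      { unfold Y. replace (S (S N) - m)%nat with (S (S N - m)) by lia.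
        replace (s ^ S N) with (s ^ (S N - m) * s ^ m)
          by (rewrite <- pow_add; f_equal; lia).
        simpl. field. pose proof (Hpow m). pose proof (Hpow (S N - m)%nat).
        split; apply Rgt_not_eq; [apply (Hpow m)|apply (Hpow (S N - m)%nat)]. }
      rewrite E. set (p := a / s ^ m). set (q := b * s ^ (S (S N) - m)).
      assert (0 <= p) by apply Hdiv.
      assert (0 <= q) by (unfold q; apply Rmult_le_pos; trivial; left; apply Hpow).
      assert (0 <= K * p) by (apply Rmult_le_pos; lra). assert (0 <= K * q) by (apply Rmult_le_pos; lra).
      assert (0 <= K * (K * p)) by (apply Rmult_le_pos; lra). lra.
Qed.

(** * Limits of sequences of complex numbers *)

Definition Clim (z : nat -> C) : C :=
  (real (Lim_seq (fun n => Re (z n))), real (Lim_seq (fun n => Im (z n)))).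

(** The factor 2 comes from estimating the real and the imaginary part separately. *)
Lemma Clim_cauchy (z : nat -> C) (ep : nat -> R) :
  (forall n m, (n <= m)%nat -> Cmod (z m - z n) <= ep n) -> is_lim_seq ep 0 ->
  forall n, Cmod (Clim z - z n) <= 2 * ep n.
Proof.
  intros H He.
  assert (G : forall w : nat -> R, (forall n m, (n <= m)%nat -> Rabs (w m - w n) <= ep n) ->
    forall n, Rabs (real (Lim_seq w) - w n) <= ep n).
  { intros w Hw.
    assert (Hex : ex_finite_lim_seq w).
    { apply ex_lim_seq_cauchy_corr. intros eps.
      apply is_lim_seq_spec in He. destruct (He (pos_div_2 eps)) as [n0 Hn0].
      exists n0. intros n m Hn Hm. specialize (Hn0 n0 (le_n _)). simpl in Hn0.
      rewrite Rminus_0_r in Hn0. apply Rabs_def2 in Hn0.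
      pose proof (Hw n0 n Hn). pose proof (Hw n0 m Hm).
      replace (w n - w m) with ((w n - w n0) - (w m - w n0)) by ring.
      eapply Rle_lt_trans; [apply Rabs_triang|]. rewrite Rabs_Ropp. lra. }
    destruct Hex as [lw Hl]. rewrite (is_lim_seq_unique _ _ Hl). simpl. intros n.
    apply (is_lim_seq_le_loc (fun m => Rabs (w m - w n)) (fun _ => ep n)
      (Rabs (lw - w n)) (ep n)).
    - exists n. intros m Hm. now apply Hw.
    - apply (is_lim_seq_abs (fun m => w m - w n) (lw - w n)).
      apply is_lim_seq_minus'; trivial. apply is_lim_seq_const.
    - apply is_lim_seq_const. }
  intros n.
  assert (H1 := G (fun n => Re (z n)) (fun n m Hnm => Rle_trans _ _ _ (re_le_Cmod (z m - z n)) (H n m Hnm)) n).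
  assert (H2 : Rabs (real (Lim_seq (fun n => Im (z n))) - Im (z n)) <= ep n).
  { apply (G (fun n => Im (z n))). intros k m Hkm. eapply Rle_trans; [|apply (H k m Hkm)].
    eapply Rle_trans; [|apply Rmax_Cmod]. apply Rmax_r. }
  replace (Clim z - z n)%C with
   (RtoC (real (Lim_seq (fun n => Re (z n))) - Re (z n)) +
     Ci * RtoC (real (Lim_seq (fun n => Im (z n))) - Im (z n)))%C.
  - eapply Rle_trans; [apply Cmod_triangle|]. rewrite Cmod_mult, Cmod_Ci, !Cmod_R. lra.
  - unfold Clim. generalize (real (Lim_seq (fun n => Re (z n)))) (real (Lim_seq (fun n => Im (z n)))).
    intros p q. unfold Ci, RtoC, Cplus, Cmult, Cminus, Copp, Re, Im.
    apply injective_projections; simpl; ring.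
Qed.

Lemma Clim_geometric (z : nat -> C) (E th : R) : 0 < th < 1 -> 0 <= E ->
  (forall n, Cmod (z (S n) - z n) <= E * th ^ n) ->
  forall n, Cmod (Clim z - z n) <= 2 * (E / (1 - th)) * th ^ n.
Proof.
  intros Hth HE H.
  assert (HE1 : 0 <= E / (1 - th)).
  { apply Rmult_le_pos; trivial. left. apply Rinv_0_lt_compat; lra. }
  intros n. rewrite Rmult_assoc.
  apply (Clim_cauchy z (fun n => E / (1 - th) * th ^ n)).
  - clear n. intros n m Hnm. replace m with (n + (m - n))%nat by lia. generalize (m - n)%nat as k. clear m Hnm.
    assert (G : forall k, Cmod (z (n + k)%nat - z n) <= E / (1 - th) * th ^ n * (1 - th ^ k)).
    { induction k as [|k IH].
      - rewrite Nat.add_0_r. replace (z n - z n)%C with (RtoC 0) by ring. rewrite Cmod_0. simpl. lra.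
      - rewrite Nat.add_succ_r.
        eapply Rle_trans; [apply (Cmod_triangle_sub _ (z (n + k)%nat))|].
        specialize (H (n + k)%nat). rewrite pow_add in H.
        replace (E / (1 - th) * th ^ n * (1 - th ^ S k)) with
         (E * (th ^ n * th ^ k) + E / (1 - th) * th ^ n * (1 - th ^ k)) by (simpl; field; lra).
        lra. }
    intros k. eapply Rle_trans; [apply G|].
    assert (0 <= th ^ k) by (apply pow_le; lra). assert (0 <= th ^ n) by (apply pow_le; lra).
    assert (0 <= E / (1 - th) * th ^ n) by (apply Rmult_le_pos; trivial). nra.
  - replace (Finite 0) with (Rbar_mult (E / (1 - th)) 0) by (simpl; now rewrite Rmult_0_r).
    apply is_lim_seq_scal_l. apply is_lim_seq_geom. rewrite Rabs_pos_eq; lra.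
Qed.

(** * Regularity of mixed derivatives *)

(** Pure derivatives in x with bounds uniform on [U], the points compared having the same e. This
    and its counterpart [derivs_e] are all that the hypotheses on the coefficients provide; nothing
    is said yet about mixed derivatives. *)
Definition derivs_x (U : dom) (f : fn) (D : nat -> fn) :=
  (forall x e, U x e -> D 0%nat x e = f x e) /\
  forall n, exists K, (forall x e, U x e -> Cmod (D n x e) <= K) /\
    forall x x' e, U x e -> U x' e ->
      Cmod (D n x' e - D n x e - RtoC (x' - x) * D (S n) x e) <= K * (x' - x) ^ 2.

Definition derivs_e (U : dom) (f : fn) (D : nat -> fn) :=
  (forall x e, U x e -> D 0%nat x e = f x e) /\
  forall n, exists K, (forall x e, U x e -> Cmod (D n x e) <= K) /\
    forall x e e', U x e -> U x e' ->
      Cmod (D n x e' - D n x e - RtoC (e' - e) * D (S n) x e) <= K * (e' - e) ^ 2.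

Definition flip (f : fn) : fn := fun x e => f e x.

Lemma derivs_flip A B c d f D : derivs_x (rect A B c d) f D ->
  derivs_e (rect c d A B) (flip f) (fun n => flip (D n)).
Proof.
  intros [H1 H2]. split.
  - intros x e [Hx He]. apply H1. split; trivial.
  - intros n. destruct (H2 n) as [K [HK HK']]. exists K. split.
    + intros x e [Hx He]. apply HK. split; trivial.
    + intros x e e' [Hx He] [_ He']. apply HK'; split; trivial.
Qed.

Lemma derivs_flip' A B c d f D : derivs_e (rect A B c d) f D ->
  derivs_x (rect c d A B) (flip f) (fun n => flip (D n)).
Proof.
  intros [H1 H2]. split.
  - intros x e [Hx He]. apply H1. split; trivial.
  - intros n. destruct (H2 n) as [K [HK HK']]. exists K. split.
    + intros x e [Hx He]. apply HK. split; trivial.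
    + intros x x' e [Hx He] [Hx' _]. apply HK'; split; trivial.
Qed.

Section Mixed.
Variables (A B c d : R) (f : fn) (Dx De : nat -> fn).
Hypothesis HAB : A < B.
Hypothesis Hcd : c < d.
Let U := rect A B c d.
Hypothesis HDx : derivs_x U f Dx.
Hypothesis HDe : derivs_e U f De.

Let h0 := (B - A) / 4.
(** The increment points into the longer half of the interval, so that a length of at most (B - A) /
    4 never leaves it. *)
Let sg (x : R) := if Rlt_dec x ((A + B) / 2) then 1 else -1.
Let h (x : R) (n : nat) := sg x * (h0 * (1 / 2) ^ n).

Lemma mixed_step x n : A < x < B -> A < x + h x n < B /\ Rabs (h x n) = h0 * (1 / 2) ^ n /\ h x n <> 0.
Proof.
  intros Hx.
  assert (Hp : 0 < (1 / 2) ^ n <= 1).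
  { split; [apply pow_lt; lra|]. apply pow_le_one; lra. }
  assert (Hh : 0 < h0) by (unfold h0; lra).
  assert (H1 : 0 < h0 * (1 / 2) ^ n <= h0) by (split; [apply Rmult_lt_0_compat; lra|nra]).
  assert (Eh : h0 = (B - A) / 4) by reflexivity.
  unfold h. set (t := h0 * (1 / 2) ^ n) in *. unfold sg. destruct (Rlt_dec x ((A + B) / 2)).
  - rewrite Rmult_1_l. split; [lra|]. split; [apply Rabs_pos_eq; lra|lra].
  - split; [lra|]. split; [|lra]. rewrite Rabs_left1; lra.
Qed.

(** The m-th e-derivative of the n-th difference quotient of f in x. For m = 0 it tends to [Dx 1] at
    the rate 2^-n; for larger m only growth like 2^n is evident. *)
Let g (m n : nat) : fn := fun x e => (RtoC (/ h x n) * (De m (x + h x n)%R e - De m x e))%C.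

Lemma mixed_g_bound m : exists K, 0 <= K /\ forall n x e, U x e -> Cmod (g m n x e) <= K * 2 ^ n.
Proof.
  destruct (proj2 HDe m) as [K [HK _]].
  assert (Hh : 0 < h0) by (unfold h0; lra).
  exists (2 * Rabs K / h0). split.
  { apply Rmult_le_pos; [pose proof (Rabs_pos K); lra|left; now apply Rinv_0_lt_compat]. }
  intros n x e [Hx He]. destruct (mixed_step x n Hx) as [H1 [H2 H3]].
  unfold g. rewrite Cmod_rmult, Rabs_inv, H2.
  assert (Hpow : 0 < (1 / 2) ^ n) by (apply pow_lt; lra).
  replace (/ (h0 * (1 / 2) ^ n)) with (2 ^ n / h0).
  2:{ pose proof (pow_two_half n) as E.
      apply (Rmult_eq_reg_r (h0 * (1 / 2) ^ n)); [|apply Rgt_not_eq; nra].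
      rewrite Rinv_l by (apply Rgt_not_eq; nra). transitivity (2 ^ n * (1 / 2) ^ n); [field; lra|exact E]. }
  replace (2 * Rabs K / h0 * 2 ^ n) with (2 ^ n / h0 * (2 * Rabs K)) by (field; lra).
  apply Rmult_le_compat_l.
  - apply Rmult_le_pos; [left; apply pow_lt; lra|left; now apply Rinv_0_lt_compat].
  - eapply Rle_trans; [apply Cmod_minus_le|].
    pose proof (HK x e (conj Hx He)). pose proof (HK _ e (conj H1 He)). pose proof (Rle_abs K). lra.
Qed.

Lemma mixed_g_approx : exists K, 0 <= K /\ forall n x e, U x e ->
  Cmod (g 0 n x e - Dx 1%nat x e) <= K * (1 / 2) ^ n.
Proof.
  destruct (proj2 HDx 0%nat) as [K [_ HK]].
  exists (Rabs K * h0). split; [apply Rmult_le_pos; [apply Rabs_pos|unfold h0; lra]|].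
  intros n x e [Hx He]. destruct (mixed_step x n Hx) as [H1 [H2 H3]].
  specialize (HK x (x + h x n) e (conj Hx He) (conj H1 He)).
  replace (x + h x n - x) with (h x n) in HK by ring.
  rewrite !(proj1 HDx) in HK by (split; trivial). unfold g.
  rewrite !(proj1 HDe) by (split; trivial).
  replace (RtoC (/ h x n) * (f (x + h x n)%R e - f x e) - Dx 1%nat x e)%C with
    (RtoC (/ h x n) * (f (x + h x n)%R e - f x e - RtoC (h x n) * Dx 1%nat x e))%C.
  2:{ rewrite RtoC_inv by trivial. field. intros E. apply RtoC_inj in E. contradiction. }
  rewrite Cmod_rmult, Rabs_inv, H2, Rmult_assoc, <- H2.
  assert (Ha : 0 < Rabs (h x n)) by now apply Rabs_pos_lt.
  apply (Rmult_le_reg_l (Rabs (h x n))); trivial.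
  rewrite <- Rmult_assoc, Rinv_r, Rmult_1_l by lra.
  eapply Rle_trans; [exact HK|]. rewrite <- pow2_abs. pose proof (Rle_abs K).
  assert (0 <= Rabs (h x n) ^ 2) by apply pow2_ge_0. nra.
Qed.

Lemma mixed_g_family n x : A < x < B -> deriv_family (fun e => c < e < d) (fun m e => g m n x e).
Proof.
  intros Hx m. destruct (mixed_step x n Hx) as [H1 [H2 H3]].
  destruct (mixed_g_bound m) as [K1 [P1 HK1]]. destruct (proj2 HDe m) as [K [_ HK]].
  exists (K1 * 2 ^ n + Rabs (/ h x n) * (2 * Rabs K)). split.
  - intros e He. specialize (HK1 n x e (conj Hx He)). pose proof (Rabs_pos (/ h x n)).
    pose proof (Rabs_pos K). nra.
  - intros e e' He He'.
    pose proof (HK x e e' (conj Hx He) (conj Hx He')) as A1.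
    pose proof (HK _ e e' (conj H1 He) (conj H1 He')) as A2.
    unfold g.
    replace (_ - _ - _)%C with (RtoC (/ h x n) *
     ((De m (x + h x n)%R e' - De m (x + h x n)%R e - RtoC (e' - e) * De (S m) (x + h x n)%R e)
      - (De m x e' - De m x e - RtoC (e' - e) * De (S m) x e)))%C by ring.
    rewrite Cmod_rmult, Rmult_plus_distr_r.
    assert (0 <= K1 * 2 ^ n * (e' - e) ^ 2).
    { apply Rmult_le_pos; [|apply pow2_ge_0]. apply Rmult_le_pos; trivial. left. apply pow_lt; lra. }
    assert (Rabs (/ h x n) * Cmod ((De m (x + h x n)%R e' - De m (x + h x n)%R e - RtoC (e' - e) * De (S m) (x + h x n)%R e)
      - (De m x e' - De m x e - RtoC (e' - e) * De (S m) x e)) <= Rabs (/ h x n) * (2 * Rabs K * (e' - e) ^ 2)).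
    { apply Rmult_le_compat_l; [apply Rabs_pos|].
      eapply Rle_trans; [apply Cmod_minus_le|]. pose proof (Rle_abs K). pose proof (pow2_ge_0 (e' - e)). nra. }
    lra.
Qed.

Lemma deriv_family_minus I u v : deriv_family I u -> deriv_family I v ->
  deriv_family I (fun m t => u m t - v m t)%C.
Proof.
  intros Hu Hv i. destruct (Hu i) as [K [H1 H2]]. destruct (Hv i) as [K' [H1' H2']].
  exists (K + K'). split.
  - intros t Ht. eapply Rle_trans; [apply Cmod_minus_le|]. specialize (H1 t Ht). specialize (H1' t Ht). lra.
  - intros t t' Ht Ht'. specialize (H2 t t' Ht Ht'). specialize (H2' t t' Ht Ht').
    replace (_ - _ - _)%C with ((u i t' - u i t - RtoC (t' - t) * u (S i) t)
      - (v i t' - v i t - RtoC (t' - t) * v (S i) t))%C by ring.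
    eapply Rle_trans; [apply Cmod_minus_le|]. lra.
Qed.

Lemma root_of_quarter N : exists r, 0 < r < 1 /\ r ^ (2 * S N) = 1 / 4.
Proof.
  exists (Rpower (1 / 4) (/ INR (2 * S N))).
  assert (HN : 0 < INR (2 * S N)) by (apply lt_0_INR; lia).
  split; [split|].
  - apply exp_pos.
  - unfold Rpower. apply Rlt_le_trans with (exp 0); [apply exp_increasing|rewrite exp_0; lra].
    assert (ln (1 / 4) < 0) by (apply Rlt_le_trans with (ln 1); [apply ln_increasing; lra|rewrite ln_1; lra]).
    assert (0 < / INR (2 * S N)) by now apply Rinv_0_lt_compat. nra.
  - rewrite <- Rpower_pow by apply exp_pos. rewrite Rpower_mult, Rinv_l, Rpower_1; lra.
Qed.

(* Consecutive difference quotients differ by O(2^-n) while all their e-derivatives are O(2^n);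
   interpolation makes the m-th derivatives of the differences geometrically small. *)
Lemma mixed_geometric m : exists E th, 0 <= E /\ 0 < th < 1 /\ forall n x e, U x e ->
  Cmod (g m (S n) x e - g m n x e) <= E * th ^ n.
Proof.
  set (N := (2 * m + 1)%nat).
  destruct (root_of_quarter N) as [r [Hr Er]].
  destruct (kolmogorov c d (2 * N + 1) Hcd) as [K [s0 [HK [Hs0 HKol]]]].
  destruct mixed_g_approx as [Ka [Ka0 HKa]].
  destruct (mixed_g_bound (2 * S N)) as [Kb [Kb0 HKb]].
  assert (HrN : r ^ S N = 1 / 2).
  { assert (0 < r ^ S N) by (apply pow_lt; lra).
    replace (2 * S N)%nat with (S N + S N)%nat in Er by lia. rewrite pow_add in Er.
    assert (HH : (r ^ S N - 1 / 2) * (r ^ S N + 1 / 2) = 0) by lra.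
    apply Rmult_integral in HH. destruct HH; lra. }
  assert (Hrm : 1 / 2 < r ^ m).
  { rewrite <- HrN. replace (S N) with (m + (S N - m))%nat by lia. rewrite pow_add.
    assert (0 < r ^ m) by (apply pow_lt; lra).
    assert (r ^ (S N - m) < 1) by (apply pow_lt_1_compat; [lra|unfold N; lia]). nra. }
  (* The interpolation is between order 0, of size 2^-n, and order 2 (N + 1), of size 2^n, at the
     scale s0 r^n. Because r^(2 (N + 1)) = 1/4, both terms of the inequality become multiples of
     2^-n r^(-m n) = th^n. The ratio is below 1, since m < N + 1 gives r^m > r^(N + 1) = 1/2. *)
  set (th := / (2 * r ^ m)).
  assert (Hth : 0 < th < 1).
  { unfold th. split; [apply Rinv_0_lt_compat; lra|].
    rewrite <- Rinv_1. apply Rinv_lt_contravar; lra. }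
  set (P := 2 * Ka / s0 ^ m + 3 * Kb * s0 ^ (2 * S N - m)).
  assert (HP : 0 <= P).
  { unfold P. assert (0 < s0 ^ m) by now apply pow_lt.
    assert (0 < s0 ^ (2 * S N - m)) by now apply pow_lt.
    assert (0 <= 2 * Ka / s0 ^ m) by (apply Rmult_le_pos; [lra|left; now apply Rinv_0_lt_compat]).
    assert (0 <= Kb * s0 ^ (2 * S N - m)) by (apply Rmult_le_pos; lra). lra. }
  exists (K * P). exists th. split; [apply Rmult_le_pos; lra|]. split; trivial.
  intros n x e [Hx He].
  assert (Hhalf : 0 < (1 / 2) ^ n) by (apply pow_lt; lra).
  assert (H2n : 0 < 2 ^ n) by (apply pow_lt; lra).
  assert (Hrn : 0 < r ^ n <= 1).
  { split; [apply pow_lt; lra|]. apply pow_le_one; lra. }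
  pose proof (HKol (fun m e => g m (S n) x e - g m n x e)%C (2 * Ka * (1 / 2) ^ n) (3 * Kb * 2 ^ n)
    (deriv_family_minus _ _ _ (mixed_g_family (S n) x Hx) (mixed_g_family n x Hx))) as HH.
  specialize (HH ltac:(apply Rmult_le_pos; lra) ltac:(apply Rmult_le_pos; lra)).
  lapply HH; clear HH.
  2:{ intros t Ht. eapply Rle_trans; [apply (Cmod_triangle_sub _ (Dx 1%nat x t))|].
      rewrite (Cmod_sub_sym (Dx 1%nat x t)).
      pose proof (HKa n x t (conj Hx Ht)). pose proof (HKa (S n) x t (conj Hx Ht)) as H5.
      simpl in H5. assert (0 <= Ka * (1 / 2) ^ n) by (apply Rmult_le_pos; lra). lra. }
  intros HH. replace (S (2 * N + 1)) with (2 * S N)%nat in HH by lia.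
  lapply HH; clear HH.
  2:{ intros t Ht. eapply Rle_trans; [apply Cmod_minus_le|].
      pose proof (HKb n x t (conj Hx Ht)). pose proof (HKb (S n) x t (conj Hx Ht)) as H5.
      change (2 ^ S n) with (2 * 2 ^ n) in H5. lra. }
  intros HH. specialize (HH m (s0 * r ^ n) e ltac:(unfold N; lia)).
  assert (Hs : 0 < s0 * r ^ n <= s0) by (split; [apply Rmult_lt_0_compat; lra|nra]).
  specialize (HH Hs He). eapply Rle_trans; [exact HH|].
  rewrite (Rmult_assoc K P). apply Rmult_le_compat_l; [lra|]. right.
  assert (Eth : th ^ n = (1 / 2) ^ n / (r ^ m) ^ n).
  { unfold th. rewrite Rinv_mult, Rpow_mult_distr, (pow_inv (r ^ m)).
    replace (/ 2) with (1 / 2) by lra. reflexivity. }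
  assert (Epow : forall k, (s0 * r ^ n) ^ k = s0 ^ k * (r ^ k) ^ n).
  { intros k. rewrite Rpow_mult_distr, <- !pow_mult. do 2 f_equal. lia. }
  rewrite !Epow, Eth.
  assert (Esplit : (r ^ (2 * S N - m)) ^ n = (1 / 4) ^ n / (r ^ m) ^ n).
  { rewrite <- Er. replace (2 * S N)%nat with ((2 * S N - m) + m)%nat at 2 by (unfold N; lia).
    rewrite pow_add, Rpow_mult_distr. field. apply pow_nonzero, pow_nonzero. lra. }
  rewrite Esplit. replace (1 / 4) with ((1 / 2) * (1 / 2)) by lra. rewrite Rpow_mult_distr.
  assert (E2 := pow_two_half n).
  assert (Hrmn : (r ^ m) ^ n <> 0) by (apply pow_nonzero, pow_nonzero; lra).
  assert (Hsm : s0 ^ m <> 0) by (apply pow_nonzero; lra).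
  unfold P.
  transitivity (2 * Ka * (1 / 2) ^ n / (s0 ^ m * (r ^ m) ^ n) + 3 * Kb * s0 ^ (2 * S N - m) *
     ((2 ^ n * (1 / 2) ^ n) * (1 / 2) ^ n / (r ^ m) ^ n)); [field; split; trivial|].
  rewrite E2. field. split; trivial.
Qed.

Let v (m : nat) : fn := fun x e => Clim (fun n => g m n x e).

Lemma mixed_limit m : exists E th, 0 <= E /\ 0 < th < 1 /\ forall n x e, U x e ->
  Cmod (v m x e - g m n x e) <= E * th ^ n.
Proof.
  destruct (mixed_geometric m) as [E [th [HE [Hth H]]]].
  exists (2 * (E / (1 - th))). exists th. split; [|split; trivial].
  - apply Rmult_le_pos; [lra|]. apply Rmult_le_pos; trivial. left. apply Rinv_0_lt_compat; lra.
  - intros n x e Hp. apply (Clim_geometric (fun n => g m n x e) E th Hth HE). intros k. now apply H.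
Qed.

Lemma mixed_bounded m : exists K, 0 <= K /\ (forall x e, U x e -> Cmod (v m x e) <= K) /\
  forall n x e, U x e -> Cmod (g m n x e) <= K.
Proof.
  destruct (mixed_limit m) as [E [th [HE [Hth H]]]]. destruct (mixed_g_bound m) as [K [K0 HK]].
  assert (HV : forall x e, U x e -> Cmod (v m x e) <= K + E).
  { intros x e Hp. specialize (H 0%nat x e Hp). specialize (HK 0%nat x e Hp). simpl in *.
    replace (v m x e) with (g m 0 x e + (v m x e - g m 0 x e))%C by ring.
    eapply Rle_trans; [apply Cmod_triangle|]. lra. }
  exists (K + E + E). split; [lra|]. split.
  - intros x e Hp. specialize (HV x e Hp). lra.
  - intros n x e Hp. specialize (HV x e Hp). specialize (H n x e Hp).
    assert (0 <= th ^ n <= 1).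
    { split; [apply pow_le; lra|]. apply pow_le_one; lra. }
    replace (g m n x e) with (v m x e - (v m x e - g m n x e))%C by ring.
    eapply Rle_trans; [apply Cmod_minus_le|]. nra.
Qed.

(** The e-derivatives of [Dx 1] are the limits of [g m n] in n. For each m the functions [g m n]
    have a bound independent of n, so Taylor's formula in e, with its constant taken from order m +
    2, passes to the limit. *)
Theorem mixed_derivatives : derivs_e U (Dx 1%nat) v.
Proof.
  split.
  - intros x e Hp. destruct (mixed_limit 0) as [E [th [HE [Hth H]]]].
    destruct mixed_g_approx as [Ka [Ka0 HKa]].
    assert (G : Cmod (v 0%nat x e - Dx 1%nat x e) <= 0).
    { set (w := Rmax th (1 / 2)).
      assert (Hw : 0 <= w < 1) by (unfold w; split; [apply Rle_trans with (1/2); [lra|apply Rmax_r]|apply Rmax_lub_lt; lra]).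
      apply (le_of_geometric _ _ (E + Ka) w Hw).
      intros n. specialize (H n x e Hp). specialize (HKa n x e Hp).
      eapply Rle_trans; [apply (Cmod_triangle_sub _ (g 0 n x e))|].
      assert (th ^ n <= w ^ n) by (apply pow_incr; split; [lra|apply Rmax_l]).
      assert ((1 / 2) ^ n <= w ^ n) by (apply pow_incr; split; [lra|apply Rmax_r]).
      nra. }
    assert (G0 : Cmod (v 0%nat x e - Dx 1%nat x e) = 0) by (pose proof (Cmod_ge_0 (v 0%nat x e - Dx 1%nat x e)); lra).
    apply Cmod_eq_0 in G0. replace (v 0%nat x e) with ((v 0%nat x e - Dx 1%nat x e) + Dx 1%nat x e)%C by ring.
    rewrite G0. ring.
  - intros m. destruct (mixed_bounded m) as [K [K0 [HK _]]].
    destruct (mixed_bounded (S (S m))) as [K2 [K20 [_ HK2]]].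
    destruct (mixed_limit m) as [E [th [HE [Hth H]]]].
    destruct (mixed_limit (S m)) as [E' [th' [HE' [Hth' H']]]].
    exists (K + K2). split; [intros x e Hp; specialize (HK x e Hp); lra|].
    intros x e e' Hp Hp'.
    apply Rle_trans with (K2 * (e' - e) ^ 2).
    2:{ pose proof (pow2_ge_0 (e' - e)). nra. }
    set (w := Rmax th th').
    assert (Hw : 0 <= w < 1) by (unfold w; split; [apply Rle_trans with th; [lra|apply Rmax_l]|apply Rmax_lub_lt; lra]).
    apply (le_of_geometric _ _ (2 * E + Rabs (e' - e) * E') w Hw). intros n.
    destruct Hp as [Hx He]. destruct Hp' as [_ He'].
    pose proof (deriv_family_taylor (fun e => c < e < d) (fun m e => g m n x e) m K2
      (interval_convex c d) (mixed_g_family n x Hx) (fun t Ht => HK2 n x t (conj Hx Ht)) e e' He He') as T.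
    pose proof (H n x e (conj Hx He)) as H1. pose proof (H n x e' (conj Hx He')) as H2.
    pose proof (H' n x e (conj Hx He)) as H3.
    replace (v m x e' - v m x e - RtoC (e' - e) * v (S m) x e)%C with
     ((g m n x e' - g m n x e - RtoC (e' - e) * g (S m) n x e) +
      ((v m x e' - g m n x e') + (- (v m x e - g m n x e) +
        - (RtoC (e' - e) * (v (S m) x e - g (S m) n x e)))))%C by ring.
    assert (P1 : th ^ n <= w ^ n) by (apply pow_incr; split; [lra|apply Rmax_l]).
    assert (P2 : th' ^ n <= w ^ n) by (apply pow_incr; split; [lra|apply Rmax_r]).
    eapply Rle_trans; [apply Cmod_triangle|]. apply Rplus_le_compat; [exact T|].
    eapply Rle_trans; [apply Cmod_triangle|].
    eapply Rle_trans; [apply Rplus_le_compat_l, Cmod_triangle|].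
    rewrite !Cmod_opp, Cmod_rmult. pose proof (Rabs_pos (e' - e)).
    assert (E * th ^ n <= E * w ^ n) by now apply Rmult_le_compat_l.
    assert (E' * th' ^ n <= E' * w ^ n) by now apply Rmult_le_compat_l.
    assert (Rabs (e' - e) * Cmod (v (S m) x e - g (S m) n x e) <= Rabs (e' - e) * (E' * w ^ n)).
    { apply Rmult_le_compat_l; trivial. lra. }
    lra.
Qed.

End Mixed.

Definition pure_smooth (U : dom) (f : fn) :=
  (exists D, derivs_x U f D) /\ (exists D, derivs_e U f D).

Lemma derivs_x_tail U f D : derivs_x U f D -> derivs_x U (D 1%nat) (fun n => D (S n)).
Proof. intros [H1 H2]. split; [reflexivity|]. intros n. apply (H2 (S n)). Qed.

Lemma derivs_e_tail U f D : derivs_e U f D -> derivs_e U (D 1%nat) (fun n => D (S n)).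
Proof. intros [H1 H2]. split; [reflexivity|]. intros n. apply (H2 (S n)). Qed.

(** The class of functions with all pure derivatives is closed under both first derivatives, by
    [mixed_derivatives] and its mirror image under [flip]; iteration reaches every mixed derivative.
    The joint remainder is split at the corner (x, e'), the change of [Dx 1] along e being
    Lipschitz. *)
Lemma pure_smooth_Sm A B c d f n : A < B -> c < d -> pure_smooth (rect A B c d) f ->
  Sm n (rect A B c d) f.
Proof.
  intros HAB Hcd. revert f. induction n as [|n IH]; intros f [[Dx HX] [De HE]].
  - split; trivial. destruct (proj2 HX 0%nat) as [K [HK _]]. exists K. intros x e Hp.
    rewrite <- (proj1 HX) by trivial. auto.
  - assert (PX : pure_smooth (rect A B c d) (Dx 1%nat)).
    { split; [eexists; apply (derivs_x_tail _ _ _ HX)|].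
      eexists. apply (mixed_derivatives A B c d f Dx De HAB Hcd HX HE). }
    assert (PE : pure_smooth (rect A B c d) (De 1%nat)).
    { split; [|eexists; apply (derivs_e_tail _ _ _ HE)].
      pose proof (mixed_derivatives c d A B (flip f) _ _ Hcd HAB (derivs_flip' _ _ _ _ _ _ HE)
        (derivs_flip _ _ _ _ _ _ HX)) as HM.
      apply derivs_flip' in HM. eexists. exact HM. }
    apply (Sm_intro n _ _ (Dx 1%nat) (De 1%nat)).
    + apply open2_rect.
    + destruct (proj2 HX 0%nat) as [K [HK _]]. exists K. intros x e Hp.
      rewrite <- (proj1 HX) by trivial. auto.
    + destruct PX as [_ [D HD]]. destruct (proj2 HD 0%nat) as [K1 [_ HK1]].
      destruct (proj2 HD 1%nat) as [L [HL _]].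
      destruct (proj2 HX 0%nat) as [K2 [_ HK2]]. destruct (proj2 HE 0%nat) as [K3 [_ HK3]].
      assert (LIP : forall x e e', rect A B c d x e -> rect A B c d x e' ->
        Cmod (Dx 1%nat x e' - Dx 1%nat x e) <= Rabs L * Rabs (e' - e)).
      { intros x e e' [Hx He] [_ He'].
        apply (lipschitz_of_derivative (fun t => c < t < d) (fun t => Dx 1%nat x t) (fun t => D 1%nat x t) K1); trivial.
        - apply interval_convex.
        - intros t t' Ht Ht'. rewrite <- !(proj1 HD) by (split; trivial). apply HK1; split; trivial.
        - intros t Ht. eapply Rle_trans; [apply HL; split; trivial|apply Rle_abs]. }
      exists (Rabs K2 + Rabs L + Rabs K3). intros x e x' e' Hp Hp'.
      assert (Hq : rect A B c d x e') by (destruct Hp, Hp'; split; trivial).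
      specialize (HK2 x x' e' Hq Hp'). specialize (HK3 x e e' Hp Hq). specialize (LIP x e e' Hp Hq).
      rewrite !(proj1 HX) in HK2 by trivial. rewrite !(proj1 HE) in HK3 by trivial.
      replace (remainder f (Dx 1%nat) (De 1%nat) x e x' e') with
       ((f x' e' - f x e' - RtoC (x' - x) * Dx 1%nat x e') + (RtoC (x' - x) * (Dx 1%nat x e' - Dx 1%nat x e)
        + (f x e' - f x e - RtoC (e' - e) * De 1%nat x e)))%C by (unfold remainder; ring).
      eapply Rle_trans; [apply Cmod_triangle|].
      eapply Rle_trans; [apply Rplus_le_compat_l, Cmod_triangle|]. rewrite Cmod_rmult.
      unfold dist2. rewrite <- (pow2_abs (x' - x)) in HK2. rewrite <- (pow2_abs (e' - e)) in HK3.
      set (p := Rabs (x' - x)) in *. set (q := Rabs (e' - e)) in *.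
      assert (0 <= p) by apply Rabs_pos. assert (0 <= q) by apply Rabs_pos.
      pose proof (Rabs_pos L). pose proof (Rabs_pos K2). pose proof (Rabs_pos K3).
      pose proof (Rle_abs K2). pose proof (Rle_abs K3).
      assert (T1 : p * Cmod (Dx 1%nat x e' - Dx 1%nat x e) <= p * (Rabs L * q)) by now apply Rmult_le_compat_l.
      assert (T2 : K2 * p ^ 2 <= Rabs K2 * (p + q) ^ 2).
      { apply Rle_trans with (Rabs K2 * p ^ 2).
        - apply Rmult_le_compat_r; [apply pow2_ge_0|trivial].
        - apply Rmult_le_compat_l; trivial. apply pow_incr; lra. }
      assert (T3 : K3 * q ^ 2 <= Rabs K3 * (p + q) ^ 2).
      { apply Rle_trans with (Rabs K3 * q ^ 2).
        - apply Rmult_le_compat_r; [apply pow2_ge_0|trivial].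
        - apply Rmult_le_compat_l; trivial. apply pow_incr; lra. }
      assert (T4 : p * (Rabs L * q) <= Rabs L * (p + q) ^ 2).
      { replace (p * (Rabs L * q)) with (Rabs L * (p * q)) by ring. apply Rmult_le_compat_l; trivial. nra. }
      lra.
    + now apply IH.
    + now apply IH.
Qed.

(** * Extension to the closed rectangle *)

Definition crect (A B c d : R) : dom := fun x e => A <= x <= B /\ c <= e <= d.
Definition clamp (a b t : R) := Rmax a (Rmin b t).
(** A contraction towards the midpoint by the factor 1 - 1 / (n + 2). It sends end points into the
    open interval, does not increase distances, and tends to the identity. *)
Definition inward (a b t : R) (n : nat) := t + ((a + b) / 2 - t) / (INR n + 2).

(* The limit of f along the segment towards the centre of the rectangle, after projecting
   the point onto the closed rectangle. *)
Definition ext (A B c d : R) (f : fn) : fn := fun x e =>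
  Clim (fun n => f (inward A B (clamp A B x) n) (inward c d (clamp c d e) n)).

Definition lip2 (U : dom) (f : fn) (L : R) := forall x e x' e', U x e -> U x' e' ->
  Cmod (f x' e' - f x e) <= L * dist2 x e x' e'.

Lemma smooth2_lip2 U f : convex2 U -> smooth2 U f -> exists L, 0 <= L /\ lip2 U f L.
Proof.
  intros HC HS.
  destruct (bounded2_pos _ _ (smooth2_bounded _ _ (smooth2_dX _ _ HS))) as [K1 [P1 H1]].
  destruct (bounded2_pos _ _ (smooth2_bounded _ _ (smooth2_dE _ _ HS))) as [K2 [P2 H2]].
  exists (K1 + K2). split; [lra|]. intros x e x' e' Hp Hp'.
  apply (lipschitz2 U f (dX f) (dE f)); trivial.
  - now apply smooth2_diff2.
  - intros y t Hy. specialize (H1 y t Hy). lra.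
  - intros y t Hy. specialize (H2 y t Hy). lra.
Qed.

Lemma clamp_range a b t : a <= b -> a <= clamp a b t <= b.
Proof.
  intros H. unfold clamp. split; [apply Rmax_l|]. apply Rmax_lub; trivial. apply Rmin_l.
Qed.

Lemma clamp_id a b t : a <= t <= b -> clamp a b t = t.
Proof. intros H. unfold clamp. rewrite Rmin_right by lra. apply Rmax_right; lra. Qed.

Lemma clamp_lip a b t t' : Rabs (clamp a b t' - clamp a b t) <= Rabs (t' - t).
Proof.
  unfold clamp, Rmax, Rmin.
  repeat destruct Rle_dec; unfold Rabs; repeat destruct Rcase_abs; lra.
Qed.

Lemma inward_range a b t n : a < b -> a <= t <= b -> a < inward a b t n < b.
Proof.
  intros Hab Ht. unfold inward. pose proof (pos_INR n).
  assert (H1 : 0 < / (INR n + 2)) by (apply Rinv_0_lt_compat; lra).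
  assert (H2 : / (INR n + 2) <= / 2) by (apply Rinv_le_contravar; lra).
  set (q := / (INR n + 2)) in *. unfold Rdiv at 1 3. fold q.
  split; nra.
Qed.

Lemma inward_diff a b t t' n : Rabs (inward a b t' n - inward a b t n) <= Rabs (t' - t).
Proof.
  unfold inward. pose proof (pos_INR n).
  assert (H1 : 0 < / (INR n + 2)) by (apply Rinv_0_lt_compat; lra).
  assert (H2 : / (INR n + 2) <= / 2) by (apply Rinv_le_contravar; lra).
  replace (t' + ((a + b) / 2 - t') / (INR n + 2) - (t + ((a + b) / 2 - t) / (INR n + 2)))
    with ((1 - / (INR n + 2)) * (t' - t)) by (field; lra).
  rewrite Rabs_mult, Rabs_pos_eq by lra. pose proof (Rabs_pos (t' - t)). nra.
Qed.

Lemma inward_self a b t n : a < b -> a <= t <= b ->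
  Rabs (inward a b t n - t) <= (b - a) / (INR n + 1).
Proof.
  intros Hab Ht. unfold inward. pose proof (pos_INR n).
  replace (t + ((a + b) / 2 - t) / (INR n + 2) - t) with (((a + b) / 2 - t) / (INR n + 2)) by ring.
  unfold Rdiv. rewrite Rabs_mult.
  assert (H1 : 0 < / (INR n + 2)) by (apply Rinv_0_lt_compat; lra).
  assert (H2 : / (INR n + 2) <= / (INR n + 1)) by (apply Rinv_le_contravar; lra).
  rewrite (Rabs_pos_eq (/ _)) by lra.
  apply Rmult_le_compat; try lra; [apply Rabs_pos|]. apply Rabs_le. lra.
Qed.

Section Extension.
Variables (A B c d : R).
Hypothesis HAB : A < B.
Hypothesis Hcd : c < d.
Let U := rect A B c d.
Let W := (B - A) + (d - c).

Let px (x : R) (n : nat) := inward A B (clamp A B x) n.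
Let pe (e : R) (n : nat) := inward c d (clamp c d e) n.

Lemma ext_point x e n : U (px x n) (pe e n).
Proof.
  split; apply inward_range; trivial; apply clamp_range; lra.
Qed.

Lemma ext_approx f L : 0 <= L -> lip2 U f L -> forall x e n,
  Cmod (ext A B c d f x e - f (px x n) (pe e n)) <= 4 * L * W / (INR n + 1).
Proof.
  intros HL Hf x e n.
  replace (4 * L * W / (INR n + 1)) with (2 * (2 * L * W / (INR n + 1))) by (field; pose proof (pos_INR n); lra).
  apply (Clim_cauchy (fun n => f (px x n) (pe e n)) (fun n => 2 * L * W / (INR n + 1))).
  - clear n. intros n m Hnm.
    eapply Rle_trans; [apply Hf; apply ext_point|].
    pose proof (clamp_range A B x ltac:(lra)) as Cx. pose proof (clamp_range c d e ltac:(lra)) as Ce.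
    pose proof (inward_self A B _ n HAB Cx) as X1. pose proof (inward_self A B _ m HAB Cx) as X2.
    pose proof (inward_self c d _ n Hcd Ce) as E1. pose proof (inward_self c d _ m Hcd Ce) as E2.
    assert (Hinv : / (INR m + 1) <= / (INR n + 1)).
    { apply Rinv_le_contravar; [pose proof (pos_INR n); lra|]. apply le_INR in Hnm. lra. }
    assert (G : forall a b p t, Rabs (p - t) <= a -> Rabs (b - t) <= a -> Rabs (p - b) <= 2 * a).
    { intros a b p t H1 H2. replace (p - b) with ((p - t) - (b - t)) by ring.
      eapply Rle_trans; [apply Rabs_triang|]. rewrite Rabs_Ropp. lra. }
    assert (X3 : Rabs (px x m - px x n) <= 2 * ((B - A) / (INR n + 1))).
    { apply (G _ _ _ (clamp A B x)); trivial. eapply Rle_trans; [exact X2|].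
      apply Rmult_le_compat_l; lra. }
    assert (E3 : Rabs (pe e m - pe e n) <= 2 * ((d - c) / (INR n + 1))).
    { apply (G _ _ _ (clamp c d e)); trivial. eapply Rle_trans; [exact E2|].
      apply Rmult_le_compat_l; lra. }
    unfold dist2, W.
    replace (2 * L * (B - A + (d - c)) / (INR n + 1)) with
      (L * (2 * ((B - A) / (INR n + 1)) + 2 * ((d - c) / (INR n + 1)))) by (field; pose proof (pos_INR n); lra).
    apply Rmult_le_compat_l; trivial. lra.
  - replace (Finite 0) with (Rbar_mult (2 * L * W) 0) by (simpl; now rewrite Rmult_0_r).
    apply (is_lim_seq_ext (fun n => 2 * L * W * / (INR n + 1))); [reflexivity|].
    apply is_lim_seq_scal_l.
    apply (is_lim_seq_ext (fun n => / INR (S n))); [intros k; now rewrite S_INR|].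
    apply (is_lim_seq_incr_1 (fun n => / INR n)).
    apply (is_lim_seq_inv _ p_infty); [apply is_lim_seq_INR|discriminate].
Qed.

Lemma ext_inside f L : 0 <= L -> lip2 U f L -> forall x e, U x e -> ext A B c d f x e = f x e.
Proof.
  intros HL Hf x e Hp.
  assert (G : Cmod (ext A B c d f x e - f x e) <= 0).
  { apply (le_of_archimedean _ _ (5 * L * W)). intros n.
    eapply Rle_trans; [apply (Cmod_triangle_sub _ (f (px x n) (pe e n)))|].
    pose proof (ext_approx f L HL Hf x e n) as H1.
    pose proof (Hf x e _ _ Hp (ext_point x e n)) as H2. pose proof (pos_INR n).
    assert (H3 : dist2 x e (px x n) (pe e n) <= W / (INR n + 1)).
    { destruct Hp as [Hx He].
      unfold dist2, px, pe. rewrite !clamp_id by lra.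
      pose proof (inward_self A B x n HAB ltac:(lra)). pose proof (inward_self c d e n Hcd ltac:(lra)).
      unfold W. rewrite Rdiv_plus_distr. lra. }
    assert (L * dist2 x e (px x n) (pe e n) <= L * (W / (INR n + 1))) by now apply Rmult_le_compat_l.
    replace (5 * L * W / (INR n + 1)) with (4 * L * W / (INR n + 1) + L * (W / (INR n + 1)))
      by (field; lra). lra. }
  pose proof (Cmod_ge_0 (ext A B c d f x e - f x e)).
  assert (G0 : Cmod (ext A B c d f x e - f x e) = 0) by lra. apply Cmod_eq_0 in G0.
  replace (ext A B c d f x e) with ((ext A B c d f x e - f x e) + f x e)%C by ring.
  rewrite G0. ring.
Qed.

Lemma ext_lip f L : 0 <= L -> lip2 U f L -> forall x e x' e',
  Cmod (ext A B c d f x' e' - ext A B c d f x e) <= L * dist2 x e x' e'.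
Proof.
  intros HL Hf x e x' e'. apply (le_of_archimedean _ _ (8 * L * W)). intros n.
  pose proof (ext_approx f L HL Hf x e n) as H1. pose proof (ext_approx f L HL Hf x' e' n) as H2.
  pose proof (Hf _ _ _ _ (ext_point x e n) (ext_point x' e' n)) as H3.
  assert (H4 : dist2 (px x n) (pe e n) (px x' n) (pe e' n) <= dist2 x e x' e').
  { unfold dist2, px, pe.
    apply Rplus_le_compat; (eapply Rle_trans; [apply inward_diff|apply clamp_lip]). }
  replace (ext A B c d f x' e' - ext A B c d f x e)%C with
    ((ext A B c d f x' e' - f (px x' n) (pe e' n)) + ((f (px x' n) (pe e' n) - f (px x n) (pe e n))
     - (ext A B c d f x e - f (px x n) (pe e n))))%C by ring.
  eapply Rle_trans; [apply Cmod_triangle|].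
  eapply Rle_trans; [apply Rplus_le_compat_l, Cmod_minus_le|].
  assert (L * dist2 (px x n) (pe e n) (px x' n) (pe e' n) <= L * dist2 x e x' e')
    by now apply Rmult_le_compat_l.
  replace (8 * L * W / (INR n + 1)) with (4 * L * W / (INR n + 1) + 4 * L * W / (INR n + 1))
      by (field; pose proof (pos_INR n); lra). lra.
Qed.

Lemma ext_bound f L K : 0 <= L -> lip2 U f L -> (forall x e, U x e -> Cmod (f x e) <= K) ->
  forall x e, Cmod (ext A B c d f x e) <= K.
Proof.
  intros HL Hf HK x e. apply (le_of_archimedean _ _ (4 * L * W)). intros n.
  pose proof (ext_approx f L HL Hf x e n) as H1. pose proof (HK _ _ (ext_point x e n)).
  replace (ext A B c d f x e) with
    (f (px x n) (pe e n) + (ext A B c d f x e - f (px x n) (pe e n)))%C by ring.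
  eapply Rle_trans; [apply Cmod_triangle|]. lra.
Qed.

(** Boundary points are replaced by their contracted images, where the interior estimate holds with
    increments shortened by 1 - r, r = 1 / (n + 2). The replacement and the shortening cost O(1 /
    n), so the interior constant survives in the limit. *)
Lemma diff2_ext_closed f fx fe L : 0 <= L -> lip2 U f L -> lip2 U fx L -> lip2 U fe L ->
  bounded2 U fx -> bounded2 U fe -> diff2 U f fx fe ->
  diff2 (crect A B c d) (ext A B c d f) (ext A B c d fx) (ext A B c d fe).
Proof.
  intros HL Hf Hfx Hfe Bx Be HD. destruct (diff2_pos _ _ _ _ HD) as [K [K0 HK]].
  destruct (bounded2_pos _ _ Bx) as [Mx [Mx0 HMx]]. destruct (bounded2_pos _ _ Be) as [Me [Me0 HMe]].
  exists K. intros x e x' e' Hp Hp'.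
  set (hx := x' - x). set (he := e' - e).
  apply (le_of_archimedean _ _ (8 * L * W + (Rabs hx + Rabs he) * (4 * L * W + Mx + Me))). intros n.
  pose proof (ext_approx f L HL Hf x e n) as H1. pose proof (ext_approx f L HL Hf x' e' n) as H2.
  pose proof (ext_approx fx L HL Hfx x e n) as H3. pose proof (ext_approx fe L HL Hfe x e n) as H4.
  pose proof (HK _ _ _ _ (ext_point x e n) (ext_point x' e' n)) as H5.
  pose proof (HMx _ _ (ext_point x e n)) as H6. pose proof (HMe _ _ (ext_point x e n)) as H7.
  assert (Hn1 : 0 < INR n + 1) by (pose proof (pos_INR n); lra).
  set (r := / (INR n + 2)).
  assert (Hr : 0 < r <= 1) by (unfold r; split; [apply Rinv_0_lt_compat; lra|
    rewrite <- Rinv_1; apply Rinv_le_contravar; lra]).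
  assert (Hr2 : r <= / (INR n + 1)) by (apply Rinv_le_contravar; lra).
  assert (Ex : px x' n - px x n = (1 - r) * hx).
  { destruct Hp as [Hx _]. destruct Hp' as [Hx' _]. unfold px, inward, r, hx. rewrite !clamp_id by lra.
    field. lra. }
  assert (Ee : pe e' n - pe e n = (1 - r) * he).
  { destruct Hp as [_ He]. destruct Hp' as [_ He']. unfold pe, inward, r, he. rewrite !clamp_id by lra.
    field. lra. }
  assert (Hd : dist2 (px x n) (pe e n) (px x' n) (pe e' n) <= dist2 x e x' e').
  { unfold dist2, px, pe.
    apply Rplus_le_compat; (eapply Rle_trans; [apply inward_diff|apply clamp_lip]). }
  assert (Hd2 : K * dist2 (px x n) (pe e n) (px x' n) (pe e' n) ^ 2 <= K * dist2 x e x' e' ^ 2).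
  { apply Rmult_le_compat_l; [lra|]. apply pow_incr. split; [apply dist2_pos|trivial]. }
  set (q := / (INR n + 1)) in *.
  unfold remainder in H5. rewrite Ex, Ee in H5.
  set (F0 := f (px x n) (pe e n)) in *. set (F1 := f (px x' n) (pe e' n)) in *.
  set (X0 := fx (px x n) (pe e n)) in *. set (E0 := fe (px x n) (pe e n)) in *.
  unfold remainder. fold hx he.
  set (G0 := ext A B c d f x e) in *. set (G1 := ext A B c d f x' e') in *.
  set (GX := ext A B c d fx x e) in *. set (GE := ext A B c d fe x e) in *.
  replace (G1 - G0 - RtoC hx * GX - RtoC he * GE)%C with
   ((F1 - F0 - RtoC ((1 - r) * hx) * X0 - RtoC ((1 - r) * he) * E0)
    + (((G1 - F1) - (G0 - F0)) - ((RtoC hx * (GX - X0) + RtoC he * (GE - E0))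
      + RtoC r * (RtoC hx * X0 + RtoC he * E0))))%C.
  2:{ rewrite !RtoC_mult, !RtoC_minus. ring. }
  unfold Rdiv in *. fold q in H1, H2, H3, H4. fold q.
  assert (0 <= 4 * L * W) by (apply Rmult_le_pos; [lra|unfold W; lra]).
  assert (Hq : 0 < q) by (apply Rinv_0_lt_compat; lra).
  assert (T1 : Cmod (RtoC hx * (GX - X0) + RtoC he * (GE - E0)) <= 4 * L * W * q * (Rabs hx + Rabs he))
    by now apply linear_part_bound.
  assert (T2 : Cmod (RtoC hx * X0 + RtoC he * E0) <= (Mx + Me) * (Rabs hx + Rabs he))
    by (apply linear_part_bound; lra).
  eapply Rle_trans; [apply Cmod_triangle|]. apply Rplus_le_compat; [lra|].
  eapply Rle_trans; [apply Cmod_minus_le|].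
  eapply Rle_trans; [apply Rplus_le_compat; [apply Cmod_minus_le|apply Cmod_triangle]|].
  rewrite Cmod_rmult, (Rabs_pos_eq r) by lra.
  assert (T3 : r * Cmod (RtoC hx * X0 + RtoC he * E0) <= q * ((Mx + Me) * (Rabs hx + Rabs he))).
  { apply Rmult_le_compat; trivial; [lra|apply Cmod_ge_0]. }
  lra.
Qed.

End Extension.

(** * Division by e *)

(** Hadamard's lemma: a function that vanishes at e = 0 is e times the average of f_e(x, s e) over 0
    <= s <= 1. The segments touch e = 0, so the average is taken of the extension to the closed
    rectangle, and its smoothness follows from that of averages. *)
Lemma linear_vanishing_quotient A B e1 f C0 : A < B -> 0 < e1 ->
  smooth2 (rect A B 0 e1) f ->
  (forall x e, rect A B 0 e1 x e -> Cmod (f x e) <= C0 * e) ->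
  smooth2 (rect A B 0 e1) (fun x e => / RtoC e * f x e)%C.
Proof.
  intros HAB He1 Hf HC.
  set (U := rect A B 0 e1) in *. set (E := ext A B 0 e1).
  assert (CU : convex2 U) by apply convex2_rect.
  assert (OU : open2 U) by apply open2_rect.
  set (H := fun k g => Av 0 0 1 k (E g)).
  assert (Hmap : forall x e s, U x e -> 0 <= s <= 1 ->
    crect A B 0 e1 (x + 0 * s * e) ((0 + 1 * s) * e)).
  { intros x e s [Hx He] Hs. rewrite Rmult_0_l, Rmult_0_l, Rplus_0_r, Rplus_0_l, Rmult_1_l.
    split; [lra|]. split; nra. }
  assert (SL : forall g, smooth2 U g -> forall x e s, U x e -> 0 <= s <= 1 ->
    lip_near (fun s => E g (x + 0 * s * e) ((0 + 1 * s) * e)) s).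
  { intros g Hg x e s [Hx He] Hs. destruct (smooth2_lip2 U g CU Hg) as [L [L0 HL]].
    exists (L * e). exists 1. split; [lra|]. intros t _.
    eapply Rle_trans; [apply (ext_lip A B 0 e1 HAB He1 g L L0 HL)|].
    unfold dist2.
    replace (x + 0 * t * e - (x + 0 * s * e)) with 0 by ring.
    replace ((0 + 1 * t) * e - (0 + 1 * s) * e) with (e * (t - s)) by ring.
    rewrite Rabs_R0, Rabs_mult, (Rabs_pos_eq e) by lra. lra. }
  assert (DH : forall g k, smooth2 U g -> diff2 U (H k g) (H k (dX g))
     (fun x e => RtoC 0 * H (S k) (dX g) x e + (RtoC 0 * H k (dE g) x e + RtoC 1 * H (S k) (dE g) x e))%C).
  { intros g k Hg. pose proof (smooth2_dX _ _ Hg) as Gx. pose proof (smooth2_dE _ _ Hg) as Ge.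
    apply (diff2_Av 0 0 1 (crect A B 0 e1)); trivial; try lra; auto.
    - intros s Hs. lra.
    - destruct (smooth2_lip2 U g CU Hg) as [L1 [P1 H1]].
      destruct (smooth2_lip2 U _ CU Gx) as [L2 [P2 H2]]. destruct (smooth2_lip2 U _ CU Ge) as [L3 [P3 H3]].
      assert (UP : forall h L', L' <= L1 + L2 + L3 -> lip2 U h L' -> lip2 U h (L1 + L2 + L3)).
      { intros h L' HL' Hh x e x' e' Hp Hp'. eapply Rle_trans; [apply Hh; trivial|].
        apply Rmult_le_compat_r; trivial. apply dist2_pos. }
      apply (diff2_ext_closed A B 0 e1 HAB He1 g (dX g) (dE g) (L1 + L2 + L3)).
      + lra.
      + apply (UP g L1); trivial; lra.
      + apply (UP _ L2); trivial; lra.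
      + apply (UP _ L3); trivial; lra.
      + now apply smooth2_bounded.
      + now apply smooth2_bounded.
      + now apply smooth2_diff2. }
  assert (SH : forall n g k, smooth2 U g -> Sm n U (H k g)).
  { assert (BH : forall g k, smooth2 U g -> bounded2 U (H k g)).
    { intros g k Hg. apply (bounded2_Av 0 0 1 (crect A B 0 e1)); auto.
      destruct (smooth2_lip2 U g CU Hg) as [L [L0 HL]].
      destruct (smooth2_bounded _ _ Hg) as [K HK].
      exists K. intros x e _. now apply (ext_bound A B 0 e1 HAB He1 g L). }
    induction n as [|n IH]; intros g k Hg.
    - split; trivial. now apply BH.
    - eapply Sm_intro; [trivial|now apply BH|now apply DH| |].
      + apply IH. now apply smooth2_dX.
      + apply Sm_plus; trivial; [|apply Sm_plus; trivial]; apply Sm_scal; trivial; apply IH;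
        try (now apply smooth2_dX); now apply smooth2_dE. }
  intros n. apply (Sm_ext n U (H 0%nat (dE f))); trivial; [|now apply SH, smooth2_dE].
  intros x e Hp. destruct Hp as [Hx He].
  pose proof (smooth2_dE _ _ Hf) as Ge.
  destruct (smooth2_lip2 U f CU Hf) as [L1 [P1 H1]]. destruct (smooth2_lip2 U _ CU Ge) as [L2 [P2 H2]].
  destruct (bounded2_pos _ _ (smooth2_bounded _ _ Ge)) as [M [M0 HM]].
  destruct (diff2_pos _ _ _ _ (smooth2_diff2 _ _ Hf)) as [K [K0 HK]].
  assert (C00 : 0 <= C0).
  { assert (0 <= C0 * e) by (eapply Rle_trans; [apply Cmod_ge_0|apply (HC x e); split; trivial]). nra. }
  set (w := fun s : R => (RtoC (s ^ 0) * E (dE f) (x + 0 * s * e)%R ((0 + 1 * s) * e)%R)%C).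
  assert (Lw : forall s, 0 <= s <= 1 -> lip_near w s).
  { intros s Hs. apply lip_near_mult; [apply lip_near_pow|]. apply SL; trivial. split; trivial. }
  assert (Ew : forall s, w s = E (dE f) x (s * e)).
  { intros s. unfold w. simpl pow. rewrite Cmult_1_l. f_equal; ring. }
  (* E (dE f) is a derivative of f on (0, 1] only, so the integral is cut at a small s *)
  assert (Cut : Cmod (RtoC e * H 0%nat (dE f) x e - f x e) <= 0).
  { apply (le_of_archimedean _ _ (M * e + C0 * e)). intros n0.
    set (t := / (INR n0 + 1)). assert (Hn0 := pos_INR n0).
    assert (Ht : 0 < t <= 1) by (unfold t; split; [apply Rinv_0_lt_compat; lra|
      rewrite <- Rinv_1; apply Rinv_le_contravar; lra]).
    assert (I1 : isI w 0 t (Cint w 0 t)).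
    { apply isI_Cint. intros s Hs. unfold in_between in Hs. rewrite Rmin_left, Rmax_right in Hs by lra.
      apply Lw. lra. }
    assert (I2 : isI (fun s => RtoC e * w s)%C t 1 (f x (1 * e)%R - f x (t * e)%R)%C).
    { apply (isI_derive (fun s => f x (s * e)%R) _ t 1 (K * e ^ 2)).
      - intros s Hs. unfold in_between in Hs. rewrite Rmin_left, Rmax_right in Hs by lra.
        assert (Hps : U x (s * e)) by (split; trivial; split; nra).
        destruct (OU _ _ Hps) as [dl [Hdl HB]].
        exists (dl / e). split; [apply Rdiv_lt_0_compat; lra|]. intros s' Hs'.
        assert (Es : s' * e - s * e = (s' - s) * e) by ring.
        assert (Hps' : U x (s' * e)).
        { apply HB; [rewrite Rminus_diag, Rabs_R0; trivial|].
          rewrite Es, Rabs_mult, (Rabs_pos_eq e) by lra.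
          apply (Rmult_lt_compat_r e) in Hs'; [|lra].
          unfold Rdiv in Hs'. rewrite Rmult_assoc, Rinv_l in Hs'; lra. }
        specialize (HK _ _ _ _ Hps Hps').
        rewrite Ew. unfold E. rewrite (ext_inside A B 0 e1 HAB He1 (dE f) L2 P2 H2 _ _ Hps).
        unfold remainder, dist2 in HK. rewrite Es, Rminus_diag, Rabs_R0, Rplus_0_l, pow2_abs in HK.
        replace (K * e ^ 2 * (s' - s) ^ 2) with (K * ((s' - s) * e) ^ 2) by ring.
        eapply Rle_trans; [|exact HK]. right. f_equal. rewrite RtoC_mult. ring.
      - intros s Hs. unfold in_between in Hs. rewrite Rmin_left, Rmax_right in Hs by lra.
        apply lip_near_mult; [|apply Lw; lra].
        exists 0. exists 1. split; [lra|]. intros s' _.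
        replace (RtoC e - RtoC e)%C with (RtoC 0) by ring. rewrite Cmod_0. lra. }
    assert (I3 : isI (fun s => RtoC e * w s)%C 0 1
       (RtoC e * Cint w 0 t + (f x (1 * e)%R - f x (t * e)%R))%C).
    { apply (isI_chasles _ 0 t 1); trivial. now apply isI_scal. }
    assert (I4 : isI (fun s => RtoC e * w s)%C 0 1 (RtoC e * H 0%nat (dE f) x e)%C).
    { apply isI_scal. apply (isI_Av 0 0 1 U (E (dE f)) 0 x e); [|split; trivial].
      intros x' e' s Hp' Hs'. now apply SL. }
    apply isI_unique in I3. apply isI_unique in I4. rewrite <- I4, I3, Rmult_1_l.
    replace (RtoC e * Cint w 0 t + (f x e - f x (t * e)%R) - f x e)%C with
      (RtoC e * Cint w 0 t - f x (t * e)%R)%C by ring.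
    eapply Rle_trans; [apply Cmod_minus_le|]. rewrite Cmod_rmult, (Rabs_pos_eq e) by lra.
    assert (Hw : Cmod (Cint w 0 t) <= M * t).
    { replace (M * t) with (M * Rabs (t - 0)) by (rewrite Rminus_0_r, Rabs_pos_eq; lra).
      apply (isI_bound w 0 t); trivial. intros s _. rewrite Ew.
      apply (ext_bound A B 0 e1 HAB He1 (dE f) L2); trivial. }
    assert (Hft : Cmod (f x (t * e)) <= C0 * (t * e)) by (apply HC; split; trivial; split; nra).
    assert (e * Cmod (Cint w 0 t) <= e * (M * t)) by (apply Rmult_le_compat_l; lra).
    unfold Rdiv. fold t. lra. }
  assert (Hne : RtoC e <> 0%C) by (intros E0; apply RtoC_inj in E0; lra).
  pose proof (Cmod_ge_0 (RtoC e * H 0%nat (dE f) x e - f x e)).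
  assert (G0 : Cmod (RtoC e * H 0%nat (dE f) x e - f x e) = 0) by lra. apply Cmod_eq_0 in G0.
  transitivity (/ RtoC e * ((RtoC e * H 0%nat (dE f) x e - f x e) + f x e))%C; [field; trivial|].
  rewrite G0. ring.
Qed.

(** One factor at a time: the bound C0 e^(m + 1) is weakened to a linear one in order to divide by e
    once, and it then reads C0 e^m for the quotient. *)
Lemma power_vanishing_quotient A B e1 m : A < B -> 0 < e1 -> forall f C0,
  smooth2 (rect A B 0 e1) f ->
  (forall x e, rect A B 0 e1 x e -> Cmod (f x e) <= C0 * e ^ m) ->
  smooth2 (rect A B 0 e1) (fun x e => / RtoC (e ^ m) * f x e)%C.
Proof.
  intros HAB He1. induction m as [|m IH]; intros f C0 Hf HC n.
  - apply (Sm_ext n _ f); [apply open2_rect| |apply Hf].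
    intros x e _. simpl. field.
  - assert (HC0 : 0 <= C0).
    { assert (Hp : rect A B 0 e1 ((A + B) / 2) (e1 / 2)) by (split; lra).
      specialize (HC _ _ Hp). pose proof (Cmod_ge_0 (f ((A + B) / 2) (e1 / 2))).
      assert (0 < (e1 / 2) ^ S m) by (apply pow_lt; lra). nra. }
    assert (H1 : smooth2 (rect A B 0 e1) (fun x e => / RtoC e * f x e)%C).
    { apply (linear_vanishing_quotient A B e1 f (C0 * e1 ^ m)); trivial.
      intros x e Hp. eapply Rle_trans; [apply HC; trivial|]. destruct Hp as [_ He].
      assert (e ^ m <= e1 ^ m) by (apply pow_incr; lra).
      simpl. replace (C0 * (e * e ^ m)) with (C0 * e * e ^ m) by ring.
      replace (C0 * e1 ^ m * e) with (C0 * e * e1 ^ m) by ring.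
      apply Rmult_le_compat_l; trivial. apply Rmult_le_pos; lra. }
    apply (Sm_ext n _ (fun x e => / RtoC (e ^ m) * (/ RtoC e * f x e))%C); [apply open2_rect| |].
    + intros x e [_ He]. simpl. rewrite RtoC_mult. field.
      split; intros E; apply RtoC_inj in E; [|lra]. revert E. apply pow_nonzero; lra.
    + apply (IH _ C0 H1). intros x e Hp. rewrite Cmod_mult. specialize (HC x e Hp).
      destruct Hp as [_ He].
      rewrite Cmod_inv by (intros E; apply RtoC_inj in E; lra). rewrite Cmod_R, Rabs_pos_eq by lra.
      apply (Rmult_le_reg_l e); [lra|]. rewrite <- Rmult_assoc, Rinv_r, Rmult_1_l by lra.
      simpl in HC. lra.
Qed.

(** * A smooth step *)

Lemma mean_value (I : R -> Prop) (f f' : R -> R) a b : convex1 I ->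
  (forall t, I t -> is_derive f t (f' t)) -> I a -> I b ->
  exists c, I c /\ Rabs (c - a) <= Rabs (b - a) /\ f b - f a = f' c * (b - a).
Proof.
  intros HI Hf Ha Hb.
  assert (Hin : forall t, Rmin a b <= t <= Rmax a b -> I t).
  { intros t Ht. destruct (Req_dec a b) as [<-|Hab].
    - rewrite Rmin_left, Rmax_left in Ht by lra. replace t with a by lra. trivial.
    - replace t with (a + ((t - a) / (b - a)) * (b - a)) by (field; lra).
      apply HI; trivial. unfold Rmin, Rmax in Ht. destruct (Rle_dec a b).
      + split; [apply Rmult_le_pos; [lra|left; apply Rinv_0_lt_compat; lra]|].
        apply (Rmult_le_reg_r (b - a)); [lra|]. unfold Rdiv. rewrite Rmult_assoc, Rinv_l; lra.
      + replace ((t - a) / (b - a)) with ((a - t) / (a - b)) by (field; lra).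
        split; [apply Rmult_le_pos; [lra|left; apply Rinv_0_lt_compat; lra]|].
        apply (Rmult_le_reg_r (a - b)); [lra|]. unfold Rdiv. rewrite Rmult_assoc, Rinv_l; lra. }
  destruct (MVT_gen f a b f') as [c [Hc E]].
  - intros t Ht. apply Hf, Hin. lra.
  - intros t Ht. apply derivable_continuous_pt. exists (f' t). apply is_derive_Reals. now apply Hf, Hin.
  - exists c. split; [now apply Hin|]. split; trivial.
    unfold Rmin, Rmax in Hc. destruct (Rle_dec a b); unfold Rabs; repeat destruct Rcase_abs; lra.
Qed.

Lemma real_taylor1 (I : R -> Prop) (f f' f'' : R -> R) L : convex1 I ->
  (forall t, I t -> is_derive f t (f' t)) -> (forall t, I t -> is_derive f' t (f'' t)) ->
  (forall t, I t -> Rabs (f'' t) <= L) ->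
  forall t t', I t -> I t' -> Rabs (f t' - f t - (t' - t) * f' t) <= L * (t' - t) ^ 2.
Proof.
  intros HI H1 H2 HL t t' Ht Ht'.
  destruct (mean_value I f f' t t' HI H1 Ht Ht') as [c [Hc [Ec E]]].
  destruct (mean_value I f' f'' t c HI H2 Ht Hc) as [s [Hs [_ E']]].
  replace (f t' - f t - (t' - t) * f' t) with ((f' c - f' t) * (t' - t)) by (rewrite E; ring).
  rewrite E', !Rabs_mult, <- pow2_abs. specialize (HL s Hs).
  pose proof (Rabs_pos (f'' s)). pose proof (Rabs_pos (c - t)). pose proof (Rabs_pos (t' - t)).
  assert (Rabs (f'' s) * Rabs (c - t) <= L * Rabs (t' - t)) by (apply Rmult_le_compat; trivial).
  nra.
Qed.

Lemma exp_pow u n : exp u ^ n = exp (INR n * u).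
Proof.
  induction n as [|n IH]; [simpl; now rewrite Rmult_0_l, exp_0|].
  rewrite S_INR. simpl pow. rewrite IH, <- exp_plus. f_equal. ring.
Qed.

(** The flat function exp(-1/t) with a factor t^-k. The derivative of [psi k] is psi (k + 2) - k psi
    (k + 1), so linear combinations of the family are closed under differentiation, and smoothness
    is proved for all k at once. *)
Definition psi (k : nat) (t : R) : R := if Rlt_dec 0 t then (/ t) ^ k * exp (- / t) else 0.

(** With u = 1 / t and k > 0, the inequality 1 + u / k <= exp(u / k) raised to the power k gives u^k
    exp(-u) <= k^k. *)
Lemma psi_bound k : exists K, 0 < K /\ forall t, 0 <= psi k t <= K.
Proof.
  exists (INR k ^ k + 1). split; [assert (0 <= INR k ^ k) by (apply pow_le, pos_INR); lra|].
  intros t. unfold psi. destruct (Rlt_dec 0 t) as [Ht|Ht].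
  2:{ assert (0 <= INR k ^ k) by (apply pow_le, pos_INR). lra. }
  assert (Hu : 0 < / t) by now apply Rinv_0_lt_compat.
  set (u := / t) in *. pose proof (exp_pos (- u)).
  split; [apply Rmult_le_pos; [apply pow_le|]; lra|].
  destruct k as [|k].
  - simpl. rewrite Rmult_1_l. rewrite <- (Rplus_0_l 1).
    assert (exp (- u) <= 1) by (rewrite <- exp_0; left; apply exp_increasing; lra). lra.
  - assert (Hk : 0 < INR (S k)) by (apply lt_0_INR; lia).
    assert (E : (u / INR (S k)) ^ S k <= exp u).
    { replace (exp u) with ((exp (u / INR (S k))) ^ S k).
      - apply pow_incr. split; [apply Rmult_le_pos; [lra|left; now apply Rinv_0_lt_compat]|].
        pose proof (exp_ineq1_le (u / INR (S k))). lra.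
      - rewrite exp_pow. f_equal. field. lra. }
    rewrite exp_Ropp.
    replace (u ^ S k) with (INR (S k) ^ S k * (u / INR (S k)) ^ S k)
      by (rewrite <- Rpow_mult_distr; f_equal; field; lra).
    assert (0 < exp u) by apply exp_pos.
    apply (Rmult_le_reg_r (exp u)); trivial. rewrite Rmult_assoc, Rinv_l, Rmult_1_r by lra.
    assert (0 <= INR (S k) ^ S k) by (apply pow_le; lra). nra.
Qed.

Lemma psi_shift k t : psi k t = t * psi (S k) t.
Proof.
  unfold psi. destruct (Rlt_dec 0 t) as [Ht|Ht]; [|ring]. simpl. field. lra.
Qed.

Definition psi' (k : nat) (t : R) : R := psi (S (S k)) t - INR k * psi (S k) t.

Lemma psi_derive k t : 0 < t -> is_derive (psi k) t (psi' k t).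
Proof.
  intros Ht.
  apply (is_derive_ext_loc (fun t => (/ t) ^ k * exp (- / t))).
  - exists (mkposreal t Ht). intros s Hs. apply Rabs_def2 in Hs. simpl in Hs.
    unfold minus, plus, opp in Hs. simpl in Hs.
    unfold psi. destruct (Rlt_dec 0 s); trivial. lra.
  - unfold psi', psi. destruct (Rlt_dec 0 t); [|lra].
    auto_derive; [repeat split; lra|].
    destruct k as [|k]; simpl; [field; lra|].
    replace (match k with 0%nat => 1 | S _ => INR k + 1 end) with (INR k + 1)
      by (destruct k; simpl; lra).
    field. lra.
Qed.

(** On one side of 0 this is Taylor's formula or trivial. When 0 separates the points, both are
    within |t' - t| of 0, and [psi_shift] extracts the factors t or t' that make each term
    quadratic. *)
Lemma psi_quadratic k : exists K, 0 < K /\ forall t t',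
  Rabs (psi k t' - psi k t - (t' - t) * psi' k t) <= K * (t' - t) ^ 2.
Proof.
  destruct (psi_bound (S (S k))) as [K2 [P2 H2]]. destruct (psi_bound (S (S (S k)))) as [K3 [P3 H3]].
  destruct (psi_bound (S (S (S (S k))))) as [K4 [P4 H4]].
  set (L := (K4 + INR (S (S k)) * K3) + INR k * (K3 + INR (S k) * K2)).
  assert (Hk : 0 <= INR k) by apply pos_INR.
  assert (Hk1 : 0 <= INR (S k)) by apply pos_INR. assert (Hk2 : 0 <= INR (S (S k))) by apply pos_INR.
  assert (HL : 0 < L).
  { unfold L. assert (0 <= INR (S (S k)) * K3) by (apply Rmult_le_pos; lra).
    assert (0 <= INR (S k) * K2) by (apply Rmult_le_pos; lra).
    assert (0 <= INR k * (K3 + INR (S k) * K2)) by (apply Rmult_le_pos; lra). lra. }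
  exists (L + K2 + K3 + INR k * K2).
  assert (HkK : 0 <= INR k * K2) by (apply Rmult_le_pos; lra).
  split; [lra|]. intros t t'. pose proof (pow2_ge_0 (t' - t)) as Hsq.
  destruct (Rlt_or_le 0 t) as [Ht|Ht]; destruct (Rlt_or_le 0 t') as [Ht'|Ht'].
  - apply Rle_trans with (L * (t' - t) ^ 2); [|apply Rmult_le_compat_r; lra].
    apply (real_taylor1 (fun t => 0 < t) (psi k) (psi' k)
      (fun t => psi' (S (S k)) t - INR k * psi' (S k) t)); trivial.
    + intros a b s Ha Hb Hs. destruct (Rlt_or_le s (1 / 2)); nra.
    + intros s Hs. now apply psi_derive.
    + intros s Hs. apply (is_derive_minus (psi (S (S k))) (fun t => INR k * psi (S k) t)).
      * now apply psi_derive.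
      * apply (is_derive_scal (psi (S k))). now apply psi_derive.
    + intros s Hs. unfold psi'.
      specialize (H2 s). specialize (H3 s). specialize (H4 s).
      assert (0 <= INR (S (S k)) * psi (S (S (S k))) s <= INR (S (S k)) * K3)
       by (split; [apply Rmult_le_pos; lra|apply Rmult_le_compat_l; lra]).
      assert (0 <= INR (S k) * psi (S (S k)) s <= INR (S k) * K2)
       by (split; [apply Rmult_le_pos; lra|apply Rmult_le_compat_l; lra]).
      unfold L. eapply Rle_trans; [apply Rabs_triang|]. rewrite Rabs_Ropp, Rabs_mult.
      rewrite (Rabs_pos_eq (INR k)) by trivial.
      apply Rplus_le_compat; [apply Rabs_le; lra|].
      apply Rmult_le_compat_l; trivial. apply Rabs_le; lra.
  - assert (E : psi k t' = 0) by (unfold psi; destruct (Rlt_dec 0 t'); lra).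
    rewrite E. replace (0 - psi k t - (t' - t) * psi' k t) with
      (- (t * t * psi (S (S k)) t) + - ((t' - t) * (t * psi (S (S (S k))) t - INR k * (t * psi (S (S k)) t)))).
    2:{ unfold psi'. rewrite (psi_shift k t), (psi_shift (S k) t), (psi_shift (S (S k)) t). ring. }
    specialize (H2 t). specialize (H3 t).
    assert (Hd : Rabs (t' - t) = t - t') by (rewrite Rabs_left1; lra).
    eapply Rle_trans; [apply Rabs_triang|]. rewrite !Rabs_Ropp.
    assert (T1 : Rabs (t * t * psi (S (S k)) t) <= (t' - t) ^ 2 * K2).
    { rewrite Rabs_pos_eq by (apply Rmult_le_pos; nra). apply Rmult_le_compat; nra. }
    assert (T2 : Rabs ((t' - t) * (t * psi (S (S (S k))) t - INR k * (t * psi (S (S k)) t)))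
       <= (t' - t) ^ 2 * (K3 + INR k * K2)).
    { replace (t * psi (S (S (S k))) t - INR k * (t * psi (S (S k)) t)) with
        (t * (psi (S (S (S k))) t - INR k * psi (S (S k)) t)) by ring.
      rewrite !Rabs_mult, Hd, (Rabs_pos_eq t) by lra.
      assert (Rabs (psi (S (S (S k))) t - INR k * psi (S (S k)) t) <= K3 + INR k * K2).
      { assert (0 <= INR k * psi (S (S k)) t <= INR k * K2)
         by (split; [apply Rmult_le_pos; lra|apply Rmult_le_compat_l; lra]). apply Rabs_le. lra. }
      rewrite <- Rmult_assoc. apply Rmult_le_compat; trivial; [nra|apply Rabs_pos|nra]. }
    nra.
  - assert (E : psi k t = 0) by (unfold psi; destruct (Rlt_dec 0 t); lra).
    assert (E' : psi' k t = 0) by (unfold psi', psi; destruct (Rlt_dec 0 t); lra).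
    rewrite E, E', Rmult_0_r, !Rminus_0_r, psi_shift, (psi_shift (S k)).
    specialize (H2 t'). rewrite <- Rmult_assoc, Rabs_pos_eq by (apply Rmult_le_pos; nra).
    assert (t' * t' * psi (S (S k)) t' <= (t' - t) ^ 2 * K2) by (apply Rmult_le_compat; nra).
    nra.
  - assert (E : psi k t = 0) by (unfold psi; destruct (Rlt_dec 0 t); lra).
    assert (E1 : psi k t' = 0) by (unfold psi; destruct (Rlt_dec 0 t'); lra).
    assert (E' : psi' k t = 0) by (unfold psi', psi; destruct (Rlt_dec 0 t); lra).
    rewrite E, E', E1, Rmult_0_r, !Rminus_0_r, Rabs_R0. apply Rmult_le_pos; lra.
Qed.

Lemma Sm_psi n U k s t : open2 U -> Sm n U (fun x _ => RtoC (psi k (s * x + t))).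
Proof.
  intros HU. revert k. induction n as [|n IH]; intros k.
  all: assert (HB : bounded2 U (fun x _ => RtoC (psi k (s * x + t)))) by
   (destruct (psi_bound k) as [K [_ HK]]; exists K; intros x e _; rewrite Cmod_R;
    specialize (HK (s * x + t)); rewrite Rabs_pos_eq; lra).
  - split; trivial.
  - apply (Sm_intro n U _ (fun x _ => RtoC s * (RtoC (psi (S (S k)) (s * x + t))
       - RtoC (INR k) * RtoC (psi (S k) (s * x + t))))%C (fun _ _ => RtoC 0)); trivial.
    + destruct (psi_quadratic k) as [K [K0 HK]]. exists (K * s ^ 2). intros x e x' e' _ _.
      specialize (HK (s * x + t) (s * x' + t)).
      unfold remainder. rewrite Cmult_0_r.
      replace (_ - _ - _ - _)%C with (RtoC (psi k (s * x' + t) - psi k (s * x + t)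
        - (s * x' + t - (s * x + t)) * psi' k (s * x + t))).
      2:{ unfold psi'. rewrite !RtoC_minus, !RtoC_mult, !RtoC_minus, !RtoC_plus, !RtoC_mult. ring. }
      rewrite Cmod_R. eapply Rle_trans; [exact HK|].
      replace (s * x' + t - (s * x + t)) with (s * (x' - x)) by ring.
      rewrite Rpow_mult_distr, <- Rmult_assoc. apply Rmult_le_compat_l.
      * apply Rmult_le_pos; [lra|apply pow2_ge_0].
      * rewrite <- pow2_abs. apply pow_incr. unfold dist2. pose proof (Rabs_pos (x' - x)).
        pose proof (Rabs_pos (e' - e)). lra.
    + apply Sm_scal; trivial. apply Sm_minus; trivial. apply Sm_scal; trivial.
    + now apply Sm_const.
Qed.

Definition step (c c' x : R) : R := psi 0 (x - c) / (psi 0 (x - c) + psi 0 (c' - x)).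

Lemma step_left c c' x : c < c' -> x <= c -> step c c' x = 0.
Proof.
  intros Hc Hx. unfold step.
  assert (E : psi 0 (x - c) = 0) by (unfold psi; destruct (Rlt_dec 0 (x - c)); lra).
  rewrite E. unfold Rdiv. ring.
Qed.

Lemma step_right c c' x : c < c' -> c' <= x -> step c c' x = 1.
Proof.
  intros Hc Hx. unfold step.
  assert (E : psi 0 (c' - x) = 0) by (unfold psi; destruct (Rlt_dec 0 (c' - x)); lra).
  rewrite E. unfold psi. destruct (Rlt_dec 0 (x - c)) as [H|H]; [|lra].
  pose proof (exp_pos (- / (x - c))). field. simpl. lra.
Qed.

(** One of x - c and c' - x is at least half the width c' - c. *)
Lemma step_denominator c c' x : c < c' ->
  exp (- / ((c' - c) / 2)) <= psi 0 (x - c) + psi 0 (c' - x).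
Proof.
  intros Hc.
  assert (G : forall t, (c' - c) / 2 <= t -> exp (- / ((c' - c) / 2)) <= psi 0 t).
  { intros t Ht. unfold psi. destruct (Rlt_dec 0 t) as [H|H]; [|lra].
    simpl. rewrite Rmult_1_l.
    assert (/ t <= / ((c' - c) / 2)) by (apply Rinv_le_contravar; lra).
    destruct (Rle_lt_or_eq_dec _ _ H0) as [H1|H1]; [left; apply exp_increasing; lra|rewrite H1; lra]. }
  destruct (psi_bound 0) as [K [_ HK]].
  pose proof (HK (x - c)). pose proof (HK (c' - x)).
  destruct (Rle_or_lt ((c' - c) / 2) (x - c)) as [H1|H1].
  - specialize (G _ H1). lra.
  - specialize (G (c' - x) ltac:(lra)). lra.
Qed.

Lemma step_range c c' x : c < c' -> 0 <= step c c' x <= 1.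
Proof.
  intros Hc. pose proof (step_denominator c c' x Hc). pose proof (exp_pos (- / ((c' - c) / 2))).
  destruct (psi_bound 0) as [K [_ HK]]. pose proof (HK (x - c)). pose proof (HK (c' - x)).
  unfold step. split.
  - apply Rmult_le_pos; [lra|]. left. apply Rinv_0_lt_compat. lra.
  - apply (Rmult_le_reg_r (psi 0 (x - c) + psi 0 (c' - x))); [lra|].
    unfold Rdiv. rewrite Rmult_assoc, Rinv_l; lra.
Qed.

Lemma smooth2_step U c c' : open2 U -> c < c' -> smooth2 U (fun x _ => RtoC (step c c' x)).
Proof.
  intros HU Hc n.
  assert (S1 : Sm n U (fun x _ => RtoC (psi 0 (x - c)))).
  { apply (Sm_ext n U (fun x _ => RtoC (psi 0 (1 * x + - c)))); trivial.
    - intros x _ _. do 2 f_equal. ring.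
    - now apply Sm_psi. }
  assert (S2 : Sm n U (fun x _ => RtoC (psi 0 (c' - x)))).
  { apply (Sm_ext n U (fun x _ => RtoC (psi 0 (-1 * x + c')))); trivial.
    - intros x _ _. do 2 f_equal. ring.
    - now apply Sm_psi. }
  apply (Sm_ext n U (fun x _ => RtoC (psi 0 (x - c)) * / (RtoC (psi 0 (x - c)) + RtoC (psi 0 (c' - x))))%C); trivial.
  - intros x _ _. unfold step.
    pose proof (step_denominator c c' x Hc). pose proof (exp_pos (- / ((c' - c) / 2))).
    rewrite RtoC_div by lra. now rewrite RtoC_plus.
  - apply Sm_mult; trivial.
    apply (Sm_inv U HU n (fun x _ => RtoC (psi 0 (x - c)) + RtoC (psi 0 (c' - x)))%C
       (exp (- / ((c' - c) / 2)))).
    + apply exp_pos.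
    + intros x _ _. rewrite <- RtoC_plus, Cmod_R.
      pose proof (step_denominator c c' x Hc). pose proof (exp_pos (- / ((c' - c) / 2))).
      rewrite Rabs_pos_eq; lra.
    + now apply Sm_plus.
Qed.

(** * Exact smooth solutions of one-step recurrences *)

Definition apply_step (N : nat) (M : nat -> nat -> fn) (x e : R) (v : nat -> C) (i : nat) : C :=
  (v i + RtoC e * csum (fun k => M i k x e * v k)%C N)%C.

Lemma apply_step_ext N M x e v w i : (i <= N)%nat -> (forall k, (k <= N)%nat -> v k = w k) ->
  apply_step N M x e v i = apply_step N M x e w i.
Proof.
  intros Hi H. unfold apply_step. rewrite H by trivial. do 2 f_equal.
  apply csum_ext. intros k Hk. now rewrite H.
Qed.

Lemma Sm_coordinate n U e1 : open2 U -> (forall x e, U x e -> 0 < e < e1) ->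
  Sm n U (fun _ e => RtoC e).
Proof.
  intros HU He. assert (HB : bounded2 U (fun _ e => RtoC e)).
  { exists e1. intros x e Hp. specialize (He x e Hp). rewrite Cmod_R, Rabs_pos_eq; lra. }
  destruct n as [|n]; [split; trivial|].
  apply (Sm_intro n _ _ (fun _ _ => RtoC 0) (fun _ _ => RtoC 1)); trivial; try (now apply Sm_const).
  exists 0. intros x e x' e' _ _. unfold remainder.
  replace (RtoC e' - RtoC e - RtoC (x' - x) * 0 - RtoC (e' - e) * 1)%C with (RtoC 0).
  - rewrite Cmod_0. lra.
  - rewrite !RtoC_minus. ring.
Qed.

Lemma Sm_csum n U (f : nat -> fn) N : open2 U -> (forall k, (k <= N)%nat -> Sm n U (f k)) ->
  Sm n U (fun x e => csum (fun k => f k x e) N).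
Proof.
  intros HU. induction N as [|N IH]; intros H; simpl.
  - apply (Sm_ext n U (f 0%nat)); trivial. apply H; lia.
  - apply Sm_plus; trivial; [apply IH; intros; apply H; lia|apply H; lia].
Qed.

Lemma Sm_apply_step n U e1 N M (v : nat -> fn) i : open2 U -> (forall x e, U x e -> 0 < e < e1) ->
  (i <= N)%nat -> (forall k, (k <= N)%nat -> Sm n U (M i k)) ->
  (forall k, (k <= N)%nat -> Sm n U (v k)) ->
  Sm n U (fun x e => apply_step N M x e (fun k => v k x e) i).
Proof.
  intros HU He Hi HM Hv. apply Sm_plus; auto. apply Sm_mult; trivial.
  - now apply (Sm_coordinate n U e1).
  - apply (Sm_csum n U (fun k x e => M i k x e * v k x e)%C); trivial.
    intros k Hk. apply Sm_mult; auto.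
Qed.

Lemma Sm_shift n U V f s : open2 U -> open2 V -> (forall x e, V x e -> U (x + s * e) e) ->
  Sm n U f -> Sm n V (fun x e => f (x + s * e) e).
Proof.
  intros HU HV Hm Hf. apply (Sm_ext n V (fun x e => f (x + s * e) (1 * e + 0))); trivial.
  - intros x e _. f_equal. ring.
  - apply (Sm_affine n U); trivial. intros x e Hp. replace (1 * e + 0) with e by ring. auto.
Qed.

Definition step_count (L e : R) : nat := Z.to_nat (up (L / e)).

Lemma step_count_spec L e : 0 < L -> 0 < e -> L <= INR (step_count L e) * e.
Proof.
  intros HL He. destruct (archimed (L / e)) as [H _].
  assert (HLe : 0 < L / e) by now apply Rdiv_lt_0_compat.
  assert (Hz : (0 <= up (L / e))%Z) by (apply le_IZR; lra).
  unfold step_count. rewrite INR_IZR_INZ, Z2Nat.id by trivial.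
  apply (Rmult_le_reg_r (/ e)); [now apply Rinv_0_lt_compat|].
  rewrite (Rmult_assoc (IZR _)), Rinv_r by lra. unfold Rdiv in H. lra.
Qed.

Section Stage1.
Variables (A B e1 : R) (N : nat) (M : nat -> nat -> fn) (K a1 a2 : R).
Hypothesis Ha : A < a1 /\ a1 < a2 /\ a2 < B.
Let U := rect A B 0 e1.
Hypothesis HM : forall i k, (i <= N)%nat -> (k <= N)%nat -> smooth2 U (M i k).
Hypothesis HK : forall i k x e, (i <= N)%nat -> (k <= N)%nat -> U x e -> Cmod (M i k x e) <= K.
Hypothesis HK0 : 0 <= K.
Hypothesis Hsmall : INR (S N) * K * e1 <= 1 / 2.
Hypothesis He1 : 0 < e1 /\ e1 <= a1 - A.

(** Set to zero for x <= A, where nothing is known about [M], because the iteration from the left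
    evaluates it arbitrarily far to the left; accordingly the domain [UL] is unbounded on that side.
    The two formulas overlap on A < x < a1, where the step function is zero. *)
Definition cut_matrix (i k : nat) : fn := fun x e =>
  if Rlt_dec A x then (RtoC (step a1 a2 x) * M i k x e)%C else RtoC 0.

Let UL : dom := fun x e => x < B /\ 0 < e < e1.

Lemma open2_UL : open2 UL.
Proof.
  intros x e [Hx He]. exists (Rmin (B - x) (Rmin e (e1 - e))).
  split; [repeat apply Rmin_pos; lra|]. intros x' e' H1 H2.
  apply Rabs_def2 in H1. apply Rabs_def2 in H2.
  pose proof (Rmin_l (B - x) (Rmin e (e1 - e))). pose proof (Rmin_r (B - x) (Rmin e (e1 - e))).
  pose proof (Rmin_l e (e1 - e)). pose proof (Rmin_r e (e1 - e)). split; lra.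
Qed.

Lemma open2_cut (W : dom) c : open2 W -> open2 (fun x e => W x e /\ x < c).
Proof.
  intros HW x e [Hp Hx]. destruct (HW x e Hp) as [d [Hd H]].
  exists (Rmin d (c - x)). split; [apply Rmin_pos; lra|]. intros x' e' H1 H2. split.
  - apply H; eapply Rlt_le_trans; try eassumption; apply Rmin_l.
  - assert (Rabs (x' - x) < c - x) by (eapply Rlt_le_trans; [exact H1|apply Rmin_r]).
    apply Rabs_def2 in H0. lra.
Qed.

Lemma open2_cut' (W : dom) c : open2 W -> open2 (fun x e => W x e /\ c < x).
Proof.
  intros HW x e [Hp Hx]. destruct (HW x e Hp) as [d [Hd H]].
  exists (Rmin d (x - c)). split; [apply Rmin_pos; lra|]. intros x' e' H1 H2. split.
  - apply H; eapply Rlt_le_trans; try eassumption; apply Rmin_l.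
  - assert (Rabs (x' - x) < x - c) by (eapply Rlt_le_trans; [exact H1|apply Rmin_r]).
    apply Rabs_def2 in H0. lra.
Qed.

Lemma cut_matrix_left i k x e : x <= a1 -> cut_matrix i k x e = RtoC 0.
Proof.
  intros Hx. unfold cut_matrix. destruct (Rlt_dec A x); trivial.
  rewrite step_left by lra. ring.
Qed.

Lemma cut_matrix_right i k x e : a2 <= x -> cut_matrix i k x e = M i k x e.
Proof.
  intros Hx. unfold cut_matrix. destruct (Rlt_dec A x); [|lra].
  rewrite step_right by lra. ring.
Qed.

Lemma cut_matrix_smooth i k : (i <= N)%nat -> (k <= N)%nat -> smooth2 UL (cut_matrix i k).
Proof.
  intros Hi Hk n. pose proof open2_UL as OL. apply (Sm_glue n UL _ A a1); [lra|trivial| |].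
  - apply (Sm_ext n _ (fun _ _ => RtoC 0)); [now apply open2_cut| |apply Sm_const; now apply open2_cut].
    intros x e [_ Hx]. symmetry. apply cut_matrix_left; lra.
  - apply (Sm_ext n _ (fun x e => RtoC (step a1 a2 x) * M i k x e)%C); [now apply open2_cut'| |].
    + intros x e [_ Hx]. unfold cut_matrix. destruct (Rlt_dec A x); [trivial|lra].
    + apply Sm_mult; [now apply open2_cut'| |].
      * apply smooth2_step; [now apply open2_cut'|lra].
      * apply (Sm_sub n U); [|now apply HM]. intros x e [[H1 H2] H3]. split; trivial. lra.
Qed.

Lemma cut_matrix_bound i k x e : (i <= N)%nat -> (k <= N)%nat -> U x e -> Cmod (cut_matrix i k x e) <= K.
Proof.
  intros Hi Hk Hp. unfold cut_matrix. destruct (Rlt_dec A x) as [H|H]; [|rewrite Cmod_0; trivial].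
  rewrite Cmod_rmult. specialize (HK i k x e Hi Hk Hp).
  pose proof (step_range a1 a2 x ltac:(lra)). rewrite Rabs_pos_eq by lra.
  pose proof (Cmod_ge_0 (M i k x e)). nra.
Qed.

Variable v0 : nat -> C.

(** The result at x of n steps of the cut system started at x - n e from the constant vector [v0].
    Once x - n e lies left of a1, starting further left changes nothing, since every step there is
    the identity; this is [forward_stable]. *)
Fixpoint forward (n : nat) (i : nat) : fn := fun x e =>
  match n with
  | O => v0 i
  | S m => apply_step N cut_matrix (x + -1 * e) e (fun k => forward m k (x + -1 * e) e) i
  end.

Lemma forward_left n i x e : (i <= N)%nat -> 0 < e -> x < a1 -> forward n i x e = v0 i.
Proof.
  revert i x. induction n as [|n IH]; intros i x Hi He Hx; simpl; trivial.
  unfold apply_step. rewrite IH by (trivial; lra).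
  rewrite csum_zero; [ring|]. intros k Hk. rewrite cut_matrix_left by lra. ring.
Qed.

Lemma forward_stable n i x e : (i <= N)%nat -> 0 < e -> x - INR n * e < a1 ->
  forward (S n) i x e = forward n i x e.
Proof.
  revert i x. induction n as [|n IH]; intros i x Hi He Hx.
  - simpl in Hx. rewrite !forward_left by (trivial; lra). reflexivity.
  - change (apply_step N cut_matrix (x + -1 * e) e (fun k => forward (S n) k (x + -1 * e) e) i =
      apply_step N cut_matrix (x + -1 * e) e (fun k => forward n k (x + -1 * e) e) i).
    apply apply_step_ext; trivial. intros k Hk. apply IH; trivial. rewrite S_INR in Hx. lra.
Qed.

Lemma forward_stable_le n m i x e : (i <= N)%nat -> 0 < e -> (n <= m)%nat -> x - INR n * e < a1 ->
  forward m i x e = forward n i x e.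
Proof.
  intros Hi He Hnm Hx. induction Hnm as [|m Hnm IH]; trivial.
  rewrite forward_stable; trivial. apply le_INR in Hnm. nra.
Qed.

Lemma forward_smooth n i : (i <= N)%nat -> smooth2 UL (forward n i).
Proof.
  pose proof open2_UL as OL.
  revert i. induction n as [|n IH]; intros i Hi k; simpl.
  - now apply Sm_const.
  - assert (MP : forall x e, UL x e -> UL (x + -1 * e) e) by (intros x e [H1 H2]; split; lra).
    apply (Sm_apply_step k UL e1 N (fun i k x e => cut_matrix i k (x + -1 * e) e)
      (fun k x e => forward n k (x + -1 * e) e)); trivial.
    + intros x e [_ H]; exact H.
    + intros j Hj. apply (Sm_shift k UL UL); trivial. now apply cut_matrix_smooth.
    + intros j Hj. apply (Sm_shift k UL UL); trivial. now apply IH.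
Qed.

Definition stage1 (i : nat) : fn := fun x e => forward (step_count (B - A) e) i x e.

Lemma stage1_eq i n x e : (i <= N)%nat -> 0 < e -> x < B -> x - INR n * e < a1 ->
  stage1 i x e = forward n i x e.
Proof.
  intros Hi He Hx Hn. unfold stage1.
  pose proof (step_count_spec (B - A) e ltac:(lra) He).
  destruct (le_ge_dec n (step_count (B - A) e)).
  - now apply forward_stable_le.
  - symmetry. apply forward_stable_le; trivial; lra.
Qed.

Lemma stage1_left i x e : (i <= N)%nat -> 0 < e -> x < a1 -> stage1 i x e = v0 i.
Proof. intros. now apply forward_left. Qed.

(** The step count in [stage1] jumps with e, but the count for ep is sufficient for every e > ep. On
    that domain the solution is therefore one fixed finite composition of smooth maps. *)
Lemma stage1_smooth_off i : (i <= N)%nat -> smooth_off U (stage1 i).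
Proof.
  intros Hi ep Hep n.
  apply (Sm_ext n _ (forward (step_count (B - A) ep) i)).
  - apply open2_above, open2_rect.
  - intros x e [[Hx He] Hep']. symmetry. apply stage1_eq; trivial; try lra.
    pose proof (step_count_spec (B - A) ep ltac:(lra) Hep).
    pose proof (pos_INR (step_count (B - A) ep)). nra.
  - apply (Sm_sub n UL); [|now apply forward_smooth]. intros x e [[Hx He] _]. split; lra.
Qed.

Lemma stage1_one_step : one_step A B e1 N cut_matrix stage1 (fun _ _ _ => RtoC 0).
Proof.
  intros i x e Hi [[Hx1 Hx2] He].
  pose proof (step_count_spec (B - A) e ltac:(lra) ltac:(lra)).
  rewrite (stage1_eq i (S (step_count (B - A) e)) (x + e) e); try (trivial; rewrite ?S_INR; lra).
  simpl. replace (x + e + -1 * e) with x by ring. unfold apply_step, stage1. ring.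
Qed.

(** The strip A < x < a1, on which the solution is constant, provides the bounds from which those on
    the whole rectangle are propagated. *)
Lemma stage1_smooth i : (i <= N)%nat -> smooth2 U (stage1 i).
Proof.
  intros Hi. apply smooth2_of_Wb.
  - apply open2_rect.
  - apply convex2_rect.
  - now apply pos_dom_rect, Rle_refl.
  - now apply stage1_smooth_off.
  - intros n j.
    apply (one_step_uniform_bounds A B e1 N cut_matrix K A a1) with (G := fun _ _ _ => RtoC 0); trivial.
    + intros i' k Hi' Hk m. apply (Sm_sub m UL); [|now apply cut_matrix_smooth].
      intros x e [Hx He]. split; lra.
    + apply cut_matrix_bound.
    + lra.
    + apply stage1_one_step.
    + apply stage1_smooth_off.
    + intros i' _. apply smooth_off_const, open2_trap.
    + intros i' m Hi'. apply (Wb_ext _ (open2_rect A a1 0 e1) m j (fun _ _ => v0 i')).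
      * intros x e [Hx He]. symmetry. apply stage1_left; trivial; lra.
      * apply Wb_const, open2_rect.
    + intros i' m _. apply Wb_const, open2_trap.
Qed.

End Stage1.

(** * Companion systems and their backward continuation *)

(* The system satisfied by the scaled differences y, dy, ..., d^N y when
   d^(N+1) y + sum_(k <= N) beta_k d^k y = 0. *)
Definition companion (N : nat) (beta : nat -> fn) (i k : nat) : fn := fun x e =>
  if Nat.eq_dec i N then (- RtoC 1 * beta k x e)%C
  else if Nat.eq_dec k (S i) then RtoC 1 else RtoC 0.

Lemma companion_step N beta x e v i : (i < N)%nat ->
  apply_step N (companion N beta) x e v i = (v i + RtoC e * v (S i))%C.
Proof.
  intros Hi. unfold apply_step. do 2 f_equal.
  transitivity (companion N beta i (S i) x e * v (S i))%C.
  - apply (csum_single (fun k => companion N beta i k x e * v k)%C); [lia|].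
    intros k Hk Hne. unfold companion. destruct (Nat.eq_dec i N); [lia|].
    destruct (Nat.eq_dec k (S i)); [lia|ring].
  - unfold companion. destruct (Nat.eq_dec i N); [lia|].
    destruct (Nat.eq_dec (S i) (S i)); [ring|lia].
Qed.

Lemma companion_last N beta x e v :
  apply_step N (companion N beta) x e v N =
  (v N - RtoC e * csum (fun k => beta k x e * v k)%C N)%C.
Proof.
  unfold apply_step.
  rewrite (csum_ext (fun k => companion N beta N k x e * v k)%C
    (fun k => - RtoC 1 * (beta k x e * v k))%C).
  - rewrite csum_scal. ring.
  - intros k Hk. unfold companion. destruct (Nat.eq_dec N N); [ring|lia].
Qed.

Fixpoint back_part (e : R) (w : nat -> C) (i : nat) : C :=
  match i with O => RtoC 0 | S j => (RtoC (/ e) * (w j - back_part e w j))%C end.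

(** The characteristic polynomial of the companion matrix M evaluated at -1 / e; it vanishes exactly
    when 1 + e M is singular. *)
Definition back_det (N : nat) (beta : nat -> fn) : fn := fun x e =>
  (csum (fun k => beta k x e * RtoC ((- / e) ^ k))%C N + RtoC ((- / e) ^ S N))%C.

(* Solving z_i + e z_(i+1) = w_i from i = 0 on gives z_i = back_part_i + (-1/e)^i z_0, and the
   last equation then determines z_0. *)
Definition back (N : nat) (beta : nat -> fn) (x e : R) (w : nat -> C) (i : nat) : C :=
  (back_part e w i + RtoC ((- / e) ^ i) *
    (- (/ back_det N beta x e *
        (csum (fun k => beta k x e * back_part e w k)%C N + back_part e w (S N)))))%C.

Lemma back_part_ext e v w i : (forall k, (k < i)%nat -> v k = w k) -> back_part e v i = back_part e w i.
Proof.
  induction i as [|i IH]; intros H; simpl; trivial.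
  rewrite (H i) by lia. rewrite IH; [reflexivity|]. intros; apply H; lia.
Qed.

Lemma back_ext N beta x e v w i : (i <= N)%nat -> (forall k, (k <= N)%nat -> v k = w k) ->
  back N beta x e v i = back N beta x e w i.
Proof.
  intros Hi H. unfold back.
  rewrite (back_part_ext e v w i) by (intros; apply H; lia).
  rewrite (back_part_ext e v w (S N)) by (intros; apply H; lia).
  rewrite (csum_ext (fun k => beta k x e * back_part e v k)%C (fun k => beta k x e * back_part e w k)%C); trivial.
  intros k Hk. f_equal. apply back_part_ext. intros; apply H; lia.
Qed.

Lemma back_affine e v z0 N (w : nat -> C) : e <> 0 -> v 0%nat = z0 ->
  (forall i, (i <= N)%nat -> w i = (v i + RtoC e * v (S i))%C) ->
  forall i, (i <= S N)%nat -> v i = (back_part e w i + RtoC ((- / e) ^ i) * z0)%C.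
Proof.
  intros He H0 H. induction i as [|i IH]; intros Hi.
  - simpl. rewrite H0. ring.
  - simpl. rewrite (H i ltac:(lia)). rewrite RtoC_mult, RtoC_opp, (RtoC_inv e) by trivial.
    rewrite (IH ltac:(lia)) at 1. field. intros E. apply RtoC_inj in E. contradiction.
Qed.

Section Stage2.
Variables (A B e1 : R) (N : nat) (beta : nat -> fn) (K a1 a2 a3 : R).
Hypothesis Ha : A < a1 /\ a1 < a2 /\ a2 < a3 /\ a3 < B.
Let U := rect A B 0 e1.
Hypothesis Hbeta : forall k, (k <= N)%nat -> smooth2 U (beta k).
Hypothesis HK : forall k x e, (k <= N)%nat -> U x e -> Cmod (beta k x e) <= K.
Hypothesis HK1 : 1 <= K.
Hypothesis Hsmall : INR (S N) * K * e1 <= 1 / 2.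
Hypothesis He1 : 0 < e1 /\ e1 <= 1 /\ e1 <= a1 - A /\ e1 <= B - a3.

Notation M := (companion N beta).

Lemma companion_smooth i k : (i <= N)%nat -> (k <= N)%nat -> smooth2 U (M i k).
Proof.
  intros Hi Hk n. pose proof (open2_rect A B 0 e1) as OU. unfold companion.
  destruct (Nat.eq_dec i N); [apply Sm_scal; trivial; now apply Hbeta|].
  destruct (Nat.eq_dec k (S i)); now apply Sm_const.
Qed.

Lemma companion_bound i k x e : (i <= N)%nat -> (k <= N)%nat -> U x e -> Cmod (M i k x e) <= K.
Proof.
  intros Hi Hk Hp. unfold companion. specialize (HK k x e Hk Hp).
  destruct (Nat.eq_dec i N).
  - rewrite Cmod_mult, Cmod_opp, Cmod_1. lra.
  - destruct (Nat.eq_dec k (S i)); [rewrite Cmod_1; lra|rewrite Cmod_0; lra].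
Qed.

(** The leading term has modulus e^-(N + 1). The others add up to at most (N + 1) K e^-N, which the
    smallness of e1 keeps below half of it; and e is below 1. *)
Lemma back_det_bound x e : U x e -> 1 / 2 <= Cmod (back_det N beta x e).
Proof.
  intros Hp. pose proof Hp as [Hx He].
  assert (Hi : 1 <= / e) by (rewrite <- Rinv_1; apply Rinv_le_contravar; lra).
  assert (Hpow : forall k, Rabs ((- / e) ^ k) = (/ e) ^ k).
  { intros k. rewrite <- RPow_abs, Rabs_Ropp, Rabs_pos_eq; lra. }
  assert (H1 : Cmod (csum (fun k => beta k x e * RtoC ((- / e) ^ k))%C N) <= INR (S N) * (K * (/ e) ^ N)).
  { eapply Rle_trans; [apply Cmod_csum|].
    apply (vnorm_le N (fun k => beta k x e * RtoC ((- / e) ^ k))%C). intros k Hk.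
    rewrite Cmod_mult, Cmod_R, Hpow. apply Rmult_le_compat.
    - apply Cmod_ge_0.
    - apply pow_le; lra.
    - now apply HK.
    - now apply Rle_pow. }
  assert (H2 : Cmod (RtoC ((- / e) ^ S N)) = / e * (/ e) ^ N).
  { rewrite Cmod_R, Hpow. reflexivity. }
  assert (HN : 1 <= (/ e) ^ N) by (apply pow_R1_Rle; lra).
  assert (H3 : INR (S N) * K <= 1 / 2 * / e).
  { apply (Rmult_le_reg_r e); [lra|]. rewrite (Rmult_assoc (1 / 2)), Rinv_l, Rmult_1_r by lra.
    assert (0 <= INR (S N) * K) by (apply Rmult_le_pos; [apply pos_INR|lra]). nra. }
  assert (H4 : INR (S N) * (K * (/ e) ^ N) <= 1 / 2 * / e * (/ e) ^ N).
  { rewrite <- Rmult_assoc. apply Rmult_le_compat_r; lra. }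
  unfold back_det.
  set (s := csum _ _) in *. set (q := RtoC ((- / e) ^ S N)) in *.
  assert (H5 : Cmod q <= Cmod (s + q) + Cmod s).
  { replace q with ((s + q) - s)%C at 1 by ring. apply Cmod_minus_le. }
  assert (1 * 1 <= / e * (/ e) ^ N) by (apply Rmult_le_compat; lra). lra.
Qed.

Lemma back_det_nonzero x e : U x e -> back_det N beta x e <> RtoC 0.
Proof. intros Hp E. pose proof (back_det_bound x e Hp). rewrite E, Cmod_0 in H. lra. Qed.

Lemma csum_affine (f g h : nat -> C) (z : C) n :
  csum (fun k => f k * (g k + h k * z))%C n = (csum (fun k => f k * g k)%C n + csum (fun k => f k * h k)%C n * z)%C.
Proof. induction n as [|n IH]; simpl; [ring|]. rewrite IH. ring. Qed.

Lemma back_left_inverse x e v i : U x e -> (i <= N)%nat ->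
  back N beta x e (apply_step N M x e v) i = v i.
Proof.
  intros Hp Hi. pose proof (back_det_nonzero x e Hp) as Hdet. destruct Hp as [Hx He].
  set (w := apply_step N M x e v).
  (* An additional component, defined by the scalar equation, gives the last row of the system the
     same form w_i = v_i + e v_(i+1) as the other rows. *)
  set (v' := fun k => if Nat.eq_dec k (S N) then (- csum (fun k => beta k x e * v k)%C N)%C else v k).
  assert (Hv' : forall k, (k <= N)%nat -> v' k = v k).
  { intros k Hk. unfold v'. destruct (Nat.eq_dec k (S N)); [lia|trivial]. }
  assert (Hlast : v' (S N) = (- csum (fun k => beta k x e * v k)%C N)%C).
  { unfold v'. destruct (Nat.eq_dec (S N) (S N)); [trivial|lia]. }
  assert (HA : forall k, (k <= S N)%nat ->
    v' k = (back_part e w k + RtoC ((- / e) ^ k) * v 0%nat)%C).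
  { apply (back_affine e v' (v 0%nat) N w); [lra|apply Hv'; lia|].
    intros k Hk. unfold w. destruct (Nat.eq_dec k N) as [->|Hn].
    - rewrite companion_last, Hlast, Hv' by trivial. ring.
    - rewrite companion_step, !Hv' by lia. reflexivity. }
  assert (HZ : (csum (fun k => beta k x e * back_part e w k)%C N + back_part e w (S N))%C =
     (- (back_det N beta x e * v 0%nat))%C).
  { pose proof (HA (S N) (le_n _)) as HAN. rewrite Hlast in HAN.
    rewrite (csum_ext (fun k => beta k x e * v k)%C
      (fun k => beta k x e * (back_part e w k + RtoC ((- / e) ^ k) * v 0%nat))%C) in HAN.
    2:{ intros k Hk. rewrite <- HA, Hv' by lia. reflexivity. }
    rewrite csum_affine in HAN. unfold back_det.
    replace (back_part e w (S N)) with
      ((back_part e w (S N) + RtoC ((- / e) ^ S N) * v 0%nat) - RtoC ((- / e) ^ S N) * v 0%nat)%C by ring.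
    rewrite <- HAN. ring. }
  unfold back. fold w. rewrite HZ. rewrite <- (Hv' i Hi), (HA i ltac:(lia)). field. trivial.
Qed.

Lemma back_right_inverse x e w i : U x e -> (i <= N)%nat ->
  apply_step N M x e (back N beta x e w) i = w i.
Proof.
  intros Hp Hi. pose proof (back_det_nonzero x e Hp) as Hdet. destruct Hp as [Hx He].
  assert (Hne : RtoC e <> 0%C) by (intros E; apply RtoC_inj in E; lra).
  set (z0 := (- (/ back_det N beta x e *
        (csum (fun k => beta k x e * back_part e w k)%C N + back_part e w (S N))))%C).
  assert (HB : forall k, back N beta x e w k = (back_part e w k + RtoC ((- / e) ^ k) * z0)%C)
    by reflexivity.
  assert (HS : forall k, (RtoC e * (back_part e w (S k) + RtoC ((- / e) ^ S k) * z0))%C =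
     (w k - (back_part e w k + RtoC ((- / e) ^ k) * z0))%C).
  { intros k. simpl. rewrite RtoC_mult, RtoC_opp, RtoC_inv by lra. field. trivial. }
  destruct (Nat.eq_dec i N) as [->|Hn].
  - rewrite companion_last.
    rewrite (csum_ext (fun k => beta k x e * back N beta x e w k)%C
      (fun k => beta k x e * (back_part e w k + RtoC ((- / e) ^ k) * z0))%C)
      by (intros; now rewrite HB).
    rewrite csum_affine, HB.
    assert (HZ : (csum (fun k => beta k x e * back_part e w k)%C N +
      csum (fun k => beta k x e * RtoC ((- / e) ^ k))%C N * z0)%C =
      (- (back_part e w (S N) + RtoC ((- / e) ^ S N) * z0))%C).
    { assert (HD : (back_det N beta x e * z0)%C =
         (- (csum (fun k => beta k x e * back_part e w k)%C N + back_part e w (S N)))%C)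
       by (unfold z0; field; trivial).
      unfold back_det in HD.
      set (s := csum (fun k => beta k x e * RtoC ((- / e) ^ k))%C N) in *.
      set (s' := csum (fun k => beta k x e * back_part e w k)%C N) in *.
      set (q := RtoC ((- / e) ^ S N)) in *.
      replace (s' + s * z0)%C with (s' + ((s + q) * z0) - q * z0)%C by ring. rewrite HD. ring. }
    rewrite HZ.
    replace (RtoC e * - (back_part e w (S N) + RtoC ((- / e) ^ S N) * z0))%C with
      (- (RtoC e * (back_part e w (S N) + RtoC ((- / e) ^ S N) * z0)))%C by ring.
    rewrite HS. ring.
  - rewrite companion_step, !HB, HS by lia. ring.
Qed.

Lemma Sm_inv_pow n V k : open2 V -> (exists ep, 0 < ep /\ forall x e, V x e -> ep < e < e1) ->
  Sm n V (fun _ e => RtoC ((- / e) ^ k)).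
Proof.
  intros HV [ep [Hep He]].
  assert (HI : Sm n V (fun _ e => / RtoC e)%C).
  { apply (Sm_inv V HV n (fun _ e => RtoC e) ep); trivial.
    - intros x e Hp. specialize (He x e Hp). rewrite Cmod_R, Rabs_pos_eq; lra.
    - apply (Sm_coordinate n V e1); trivial. intros x e Hp. specialize (He x e Hp). lra. }
  induction k as [|k IH].
  - now apply (Sm_const V HV n (RtoC 1)).
  - apply (Sm_ext n V (fun _ e => (- RtoC 1 * / RtoC e) * RtoC ((- / e) ^ k))%C); trivial.
    + intros x e Hp. specialize (He x e Hp). simpl. rewrite RtoC_mult, RtoC_opp, RtoC_inv by lra. ring.
    + apply Sm_mult; trivial. now apply Sm_scal.
Qed.

Lemma Sm_back n V (w : nat -> fn) i : open2 V -> sub2 V U ->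
  (exists ep, 0 < ep /\ forall x e, V x e -> ep < e < e1) -> (i <= N)%nat ->
  (forall k, (k <= N)%nat -> Sm n V (w k)) ->
  Sm n V (fun x e => back N beta x e (fun k => w k x e) i).
Proof.
  intros HV HVU Hep Hi Hw.
  assert (HB : forall k, (k <= N)%nat -> Sm n V (beta k)).
  { intros k Hk. apply (Sm_sub n U); trivial. now apply Hbeta. }
  assert (HI : Sm n V (fun _ e => RtoC (/ e))).
  { apply (Sm_ext n V (fun _ e => - RtoC 1 * RtoC ((- / e) ^ 1))%C); trivial.
    - intros x e _. rewrite pow_1, RtoC_opp. ring.
    - apply Sm_scal; trivial. now apply Sm_inv_pow. }
  assert (HP : forall k, (k <= S N)%nat -> Sm n V (fun x e => back_part e (fun k => w k x e) k)).
  { induction k as [|k IH]; intros Hk; simpl; [now apply Sm_const|].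
    apply Sm_mult; trivial. apply Sm_minus; trivial; [apply Hw; lia|apply IH; lia]. }
  apply (Sm_ext n V (fun x e => back_part e (fun k => w k x e) i + RtoC ((- / e) ^ i) *
    (- RtoC 1 * (/ back_det N beta x e *
        (csum (fun k => beta k x e * back_part e (fun k => w k x e) k)%C N
          + back_part e (fun k => w k x e) (S N)))))%C); trivial.
  { intros x e _. unfold back. ring. }
  apply Sm_plus; [trivial|apply HP; lia|]. apply Sm_mult; trivial; [now apply Sm_inv_pow|].
  apply Sm_scal; trivial. apply Sm_mult; trivial.
  - apply (Sm_inv V HV n (back_det N beta) (1 / 2)); [lra| |].
    + intros x e Hp. apply back_det_bound. auto.
    + apply Sm_plus; trivial; [|now apply Sm_inv_pow].
      apply (Sm_csum n V (fun k x e => beta k x e * RtoC ((- / e) ^ k))%C); trivial.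
      intros k Hk. apply Sm_mult; auto. now apply Sm_inv_pow.
  - apply Sm_plus; trivial; [|apply HP; lia].
    apply (Sm_csum n V (fun k x e => beta k x e * back_part e (fun k => w k x e) k)%C); trivial.
    intros k Hk. apply Sm_mult; auto.
Qed.

Variable v0 : nat -> C.

Let M1 := cut_matrix A M a1 a2.
Let Z1 := stage1 A B N M a1 a2 v0.

Let Ha' : A < a1 /\ a1 < a2 /\ a2 < B.
Proof. lra. Qed.
Let HK0 : 0 <= K.
Proof. lra. Qed.
Let He1' : 0 < e1 /\ e1 <= a1 - A.
Proof. lra. Qed.

Lemma Z1_smooth i : (i <= N)%nat -> smooth2 U (Z1 i).
Proof.
  apply (stage1_smooth A B e1 N M K a1 a2 Ha' companion_smooth companion_bound HK0 Hsmall He1').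
Qed.

Lemma Z1_one_step : one_step A B e1 N M1 Z1 (fun _ _ _ => RtoC 0).
Proof. now apply stage1_one_step. Qed.

Lemma Z1_exact i x e : (i <= N)%nat -> trap A B e1 x e -> a2 <= x ->
  Z1 i (x + e) e = apply_step N M x e (fun k => Z1 k x e) i.
Proof.
  intros Hi Hp Hx. rewrite Z1_one_step by trivial. unfold apply_step.
  rewrite (csum_ext (fun k => M1 i k x e * Z1 k x e)%C (fun k => M i k x e * Z1 k x e)%C).
  - ring.
  - intros k Hk. unfold M1. now rewrite (cut_matrix_right A B M a1 a2 Ha').
Qed.

(** The branch at a3 is not a genuine switch: for a2 < x < a3 the cutoff equals 1, and solving the
    true system backwards from [Z1] returns [Z1] ([backward_right]). Inverting only for x < a3, with
    e1 <= B - a3, keeps x + e inside the rectangle. *)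
Fixpoint backward (n : nat) (i : nat) : fn := fun x e =>
  match n with
  | O => Z1 i x e
  | S m => if Rlt_dec x a3 then back N beta x e (fun k => backward m k (x + 1 * e) e) i else Z1 i x e
  end.

Lemma backward_right n i x e : (i <= N)%nat -> U x e -> a2 < x -> backward n i x e = Z1 i x e.
Proof.
  revert i x. induction n as [|n IH]; intros i x Hi Hp Hx; simpl; trivial.
  destruct (Rlt_dec x a3) as [H|H]; trivial.
  rewrite <- (back_left_inverse x e (fun k => Z1 k x e) i Hp Hi).
  apply back_ext; trivial. intros k Hk.
  pose proof Hp as [Hpx He].
  rewrite IH; [|trivial|split; lra|lra].
  rewrite Rmult_1_l. apply Z1_exact; trivial; [split; lra|lra].
Qed.

Lemma backward_stable n i x e : (i <= N)%nat -> U x e -> a2 < x + INR n * e ->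
  backward (S n) i x e = backward n i x e.
Proof.
  revert i x. induction n as [|n IH]; intros i x Hi Hp Hx.
  - simpl in Hx. apply (backward_right 1); trivial. lra.
  - change ((if Rlt_dec x a3 then back N beta x e (fun k => backward (S n) k (x + 1 * e) e) i else Z1 i x e)
      = (if Rlt_dec x a3 then back N beta x e (fun k => backward n k (x + 1 * e) e) i else Z1 i x e)).
    destruct (Rlt_dec x a3) as [H|H]; trivial.
    apply back_ext; trivial. intros k Hk. destruct Hp as [Hpx He].
    apply IH; trivial; [split; lra|]. rewrite S_INR in Hx. lra.
Qed.

Lemma backward_stable_le n m i x e : (i <= N)%nat -> U x e -> (n <= m)%nat -> a2 < x + INR n * e ->
  backward m i x e = backward n i x e.
Proof.
  intros Hi Hp Hnm Hx. induction Hnm as [|m Hnm IH]; trivial.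
  rewrite backward_stable; trivial. apply le_INR in Hnm. destruct Hp. nra.
Qed.

(** Two smooth descriptions are glued on the overlap a2 < x < a3: the inverse step to the left of a3
    and [Z1] to the right of a2. The inverse step contains negative powers of e, so smoothness is
    obtained for e > ep only at this stage. *)
Lemma backward_smooth_off n i : (i <= N)%nat -> smooth_off U (backward n i).
Proof.
  pose proof (open2_rect A B 0 e1) as OU.
  revert i. induction n as [|n IH]; intros i Hi ep Hep k.
  - simpl. apply smooth2_off; trivial. now apply Z1_smooth.
  - pose proof (open2_above ep U OU) as OA.
    apply (Sm_glue k (above ep U) _ a2 a3); [lra|trivial| |].
    + set (V := fun x e => above ep U x e /\ x < a3).
      assert (OV : open2 V) by now apply open2_cut.
      apply (Sm_ext k V (fun x e => back N beta x e (fun k => backward n k (x + 1 * e) e) i)); trivial.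
      * intros x e [_ Hx]. simpl. destruct (Rlt_dec x a3); [trivial|lra].
      * apply (Sm_back k V (fun k x e => backward n k (x + 1 * e) e)); trivial.
        -- intros x e [[Hp _] _]. exact Hp.
        -- exists ep. split; trivial. intros x e [[[_ He] Hpe] _]. lra.
        -- intros j Hj. apply (Sm_shift k (above ep U)); trivial; [|now apply IH].
           intros x e [[[Hx He] Hpe] Hx3]. split; trivial. split; lra.
    + apply (Sm_ext k _ (Z1 i)); [now apply open2_cut'| |].
      * intros x e [[Hp _] Hx]. symmetry. now apply backward_right.
      * apply (Sm_sub k U); [|now apply Z1_smooth]. intros x e [[Hp _] _]. exact Hp.
Qed.

Definition stage2 (i : nat) : fn := fun x e => backward (step_count (B - A) e) i x e.

Lemma stage2_eq i n x e : (i <= N)%nat -> U x e -> a2 < x + INR n * e ->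
  stage2 i x e = backward n i x e.
Proof.
  intros Hi Hp Hn. pose proof Hp as [Hx He]. unfold stage2.
  pose proof (step_count_spec (B - A) e ltac:(lra) ltac:(lra)).
  destruct (le_ge_dec n (step_count (B - A) e)).
  - now apply backward_stable_le.
  - symmetry. apply backward_stable_le; trivial; lra.
Qed.

Lemma stage2_right i x e : (i <= N)%nat -> U x e -> a2 < x -> stage2 i x e = Z1 i x e.
Proof. intros. now apply backward_right. Qed.

Lemma stage2_smooth_off i : (i <= N)%nat -> smooth_off U (stage2 i).
Proof.
  intros Hi ep Hep n.
  apply (Sm_ext n _ (backward (step_count (B - A) ep) i)).
  - apply open2_above, open2_rect.
  - intros x e [Hp Hep']. symmetry. apply stage2_eq; trivial. destruct Hp as [Hx He].
    pose proof (step_count_spec (B - A) ep ltac:(lra) Hep).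
    pose proof (pos_INR (step_count (B - A) ep)). nra.
  - now apply backward_smooth_off.
Qed.

Lemma stage2_one_step : one_step A B e1 N M stage2 (fun _ _ _ => RtoC 0).
Proof.
  intros i x e Hi Hp. pose proof (trap_rect _ _ _ _ _ Hp) as HU. pose proof (trap_shift A B e1 _ _ Hp) as HU'.
  transitivity (apply_step N M x e (fun k => stage2 k x e) i); [|unfold apply_step; ring].
  pose proof Hp as [[Hx1 Hx2] He].
  destruct (Rlt_dec x a3) as [H|H].
  - rewrite <- (back_right_inverse x e (fun k => stage2 k (x + e) e) i HU Hi).
    apply apply_step_ext; trivial. intros k Hk.
    pose proof (step_count_spec (B - A) e ltac:(lra) ltac:(lra)).
    rewrite (stage2_eq k (S (step_count (B - A) e)) x e); [|trivial|trivial|rewrite S_INR; lra].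
    simpl. destruct (Rlt_dec x a3); [|lra]. rewrite Rmult_1_l. reflexivity.
  - rewrite stage2_right by (trivial; lra).
    rewrite Z1_exact by (trivial; lra). apply apply_step_ext; trivial.
    intros k Hk. symmetry. apply stage2_right; trivial. lra.
Qed.

(** Bounds are propagated a second time, for the true system, from the strip a2 < x < B, where the
    solution is [Z1] and already smooth with uniform constants. *)
Lemma stage2_smooth i : (i <= N)%nat -> smooth2 U (stage2 i).
Proof.
  intros Hi. apply smooth2_of_Wb.
  - apply open2_rect.
  - apply convex2_rect.
  - apply pos_dom_rect. lra.
  - now apply stage2_smooth_off.
  - intros n j.
    apply (one_step_uniform_bounds A B e1 N M K a2 B) with (G := fun _ _ _ => RtoC 0); trivial.
    + apply companion_smooth.
    + apply companion_bound.
    + lra.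
    + apply stage2_one_step.
    + apply stage2_smooth_off.
    + intros i' _. apply smooth_off_const, open2_trap.
    + assert (HS : sub2 (rect a2 B 0 e1) U) by (intros x e [Hx He]; split; lra).
      intros i' m Hi'. apply (Wb_ext _ (open2_rect a2 B 0 e1) m j (Z1 i')).
      * intros x e Hp. symmetry. apply stage2_right; trivial; [now apply HS|]. destruct Hp; lra.
      * apply (Wb_sub m j U); trivial. apply Wb_of_Sm. now apply Z1_smooth.
    + intros i' m _. apply Wb_const, open2_trap.
Qed.

End Stage2.

(** * From the recurrence to the companion system *)

Lemma sum_n_csum (f : nat -> C) n : sum_n f n = csum f n.
Proof.
  induction n as [|n IH]; simpl; [apply sum_O|]. rewrite sum_Sn, IH. reflexivity.
Qed.

Fixpoint bin (n k : nat) : nat :=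
  match n, k with
  | _, O => 1
  | O, S _ => 0
  | S n', S k' => bin n' k' + bin n' k
  end.

Lemma bin_large n k : (n < k)%nat -> bin n k = 0%nat.
Proof.
  revert k. induction n as [|n IH]; intros [|k] H; simpl; try lia. rewrite !IH; lia.
Qed.

Lemma csum_shift (f : nat -> C) n : csum f (S n) = (f 0%nat + csum (fun k => f (S k)) n)%C.
Proof. induction n as [|n IH]; [reflexivity|]. change (csum f (S (S n))) with (csum f (S n) + f (S (S n)))%C. rewrite IH. simpl. ring. Qed.

(* Both the expansion of (1 + w)^n and Newton's forward difference formula are instances. *)
Lemma binomial_array (z : nat -> nat -> C) (t : C) :
  (forall i n, z i (S n) = (z i n + t * z (S i) n)%C) ->
  forall n i L, (n <= L)%nat ->
  z i n = csum (fun r => RtoC (INR (bin n r)) * (Cpow t r * z (i + r)%nat 0%nat))%C L.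
Proof.
  intros H. induction n as [|n IH]; intros i L HL.
  - rewrite (csum_single _ L 0) by (try lia; intros r Hr Hr0; rewrite bin_large by lia; simpl; ring).
    simpl. rewrite Nat.add_0_r. ring.
  - rewrite H. destruct L as [|L]; [lia|].
    rewrite (IH i (S L)) by lia. rewrite (IH (S i) L) by lia.
    rewrite (csum_shift (fun r => RtoC (INR (bin n r)) * (Cpow t r * z (i + r)%nat 0%nat))%C).
    rewrite (csum_shift (fun r => RtoC (INR (bin (S n) r)) * (Cpow t r * z (i + r)%nat 0%nat))%C).
    rewrite <- Cplus_assoc. f_equal.
    { destruct n; reflexivity. }
    rewrite <- csum_scal, <- csum_plus. apply csum_ext. intros r Hr.
    change (bin (S n) (S r)) with (bin n r + bin n (S r))%nat.
    rewrite plus_INR, RtoC_plus. replace (i + S r)%nat with (S i + r)%nat by lia. simpl. ring.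
Qed.

(** The coefficient of w^r in the polynomial after the substitution lambda = 1 + w, and equally the
    coefficient of the r-th forward difference in the recurrence. *)
Definition shifted_coef (l : nat) (a : nat -> C) (r : nat) : C :=
  csum (fun j => RtoC (INR (bin j r)) * a j)%C l.

Lemma recurrence_in_differences (z : nat -> nat -> C) (t : C) l (a : nat -> C) :
  (forall i n, z i (S n) = (z i n + t * z (S i) n)%C) ->
  csum (fun j => a j * z 0%nat j)%C l =
  csum (fun r => shifted_coef l a r * (Cpow t r * z r 0%nat))%C l.
Proof.
  intros H.
  rewrite (csum_ext _ (fun j => csum (fun r => RtoC (INR (bin j r)) * a j * (Cpow t r * z r 0%nat))%C l)%C).
  2:{ intros j Hj. rewrite (binomial_array z t H j 0 l Hj), <- csum_scal. apply csum_ext.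
      intros r _. simpl. ring. }
  rewrite csum_swap. apply csum_ext. intros r _. unfold shifted_coef.
  rewrite (Cmult_comm (csum _ _)), <- csum_scal. apply csum_ext. intros j _. ring.
Qed.

(** The array w^i (1 + w)^n satisfies the recursion of forward differences with t = 1, so the
    identity for recurrences applies to it. *)
Lemma polynomial_shift l (a : nat -> C) (w : C) :
  csum (fun j => a j * Cpow (1 + w) j)%C l = csum (fun r => shifted_coef l a r * Cpow w r)%C l.
Proof.
  pose proof (recurrence_in_differences (fun i n => Cpow w i * Cpow (1 + w) n)%C 1 l a) as H.
  simpl in H. rewrite (csum_ext _ (fun j => a j * (1 * Cpow (1 + w) j))%C) by (intros; ring).
  rewrite H by (intros; ring). apply csum_ext. intros r _.
  assert (E : Cpow 1 r = 1%C) by (induction r as [|r IH]; simpl; trivial; rewrite IH; ring).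
  rewrite E. ring.
Qed.

Lemma shifted_coef_top l a : shifted_coef l a l = a l.
Proof.
  unfold shifted_coef. rewrite (csum_single _ l l).
  - assert (E : forall n, bin n n = 1%nat).
    { induction n as [|n IH]; trivial. simpl. rewrite IH, bin_large; lia. }
    rewrite E. simpl. ring.
  - lia.
  - intros i Hi Hne. rewrite bin_large by lia. simpl. ring.
Qed.

(** The iterated difference quotient with step e: the value at index n of the scaled difference of
    order i. *)
Fixpoint quot (e : R) (y : nat -> C) (i : nat) (n : nat) : C :=
  match i with O => y n | S j => (RtoC (/ e) * (quot e y j (S n) - quot e y j n))%C end.

Lemma quot_step e y i n : e <> 0 -> quot e y i (S n) = (quot e y i n + RtoC e * quot e y (S i) n)%C.
Proof.
  intros He. simpl. rewrite RtoC_inv by trivial. field. intros E. apply RtoC_inj in E. contradiction.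
Qed.

(** * Coefficients of a polynomial bounded on [0, 1] *)

(** Equivalence of two norms on polynomials of bounded degree, with a constant that will not depend
    on x and e. By induction on the degree: from degree l + 1, combining the values at v and v / 2
    eliminates the top coefficient and multiplies the coefficient of v^r by 2^(l + 1 - r) - 1 >=
    1. *)
Lemma coefficient_bound l : exists K, 0 < K /\ forall (c : nat -> C) (k : R), 0 <= k ->
  (forall v, 0 <= v <= 1 -> Cmod (csum (fun r => c r * RtoC (v ^ r))%C l) <= k) ->
  forall r, (r <= l)%nat -> Cmod (c r) <= K * k.
Proof.
  induction l as [|l [K [HK IH]]].
  - exists 1. split; [lra|]. intros c k Hk H r Hr. replace r with 0%nat by lia.
    specialize (H 0 ltac:(lra)). simpl in H. rewrite Cmult_1_r in H. lra.
  - set (K1 := K * (2 ^ S l + 1)).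
    assert (H2 : forall n, 1 <= 2 ^ n) by (intros; apply pow_R1_Rle; lra).
    assert (HK1 : 0 < K1) by (unfold K1; pose proof (H2 (S l)); apply Rmult_lt_0_compat; lra).
    exists (K1 + (1 + INR (S l) * K1)).
    assert (HS : 0 <= INR (S l) * K1) by (apply Rmult_le_pos; [apply pos_INR|lra]).
    split; [lra|]. intros c k Hk H.
    assert (Low : forall r, (r <= l)%nat -> Cmod (c r) <= K1 * k).
    { intros r Hr.
      set (c' := fun r => (RtoC (2 ^ (S l - r) - 1) * c r)%C).
      assert (Hc' : Cmod (c' r) <= K * ((2 ^ S l + 1) * k)).
      { apply (IH c'); trivial.
        { pose proof (H2 (S l)). apply Rmult_le_pos; lra. }
        intros v Hv.
        (* 2^(l+1) p(v/2) - p(v) has degree at most l *)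
        assert (E : (RtoC (2 ^ S l) * csum (fun r => c r * RtoC ((v / 2) ^ r))%C (S l)
           - csum (fun r => c r * RtoC (v ^ r))%C (S l))%C = csum (fun r => c' r * RtoC (v ^ r))%C l).
        { assert (T : forall r, (r <= S l)%nat -> (RtoC (2 ^ S l) * (c r * RtoC ((v / 2) ^ r)))%C =
             (RtoC (2 ^ (S l - r)) * c r * RtoC (v ^ r))%C).
          { intros s Hs. replace ((v / 2) ^ s) with (v ^ s * (1 / 2) ^ s)
              by (rewrite <- Rpow_mult_distr; f_equal; lra).
            replace (2 ^ S l) with (2 ^ (S l - s) * 2 ^ s) by (rewrite <- pow_add; f_equal; lia).
            rewrite !RtoC_mult.
            replace (RtoC (2 ^ (S l - s)) * RtoC (2 ^ s) * (c s * (RtoC (v ^ s) * RtoC ((1 / 2) ^ s))))%C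
             with (RtoC (2 ^ (S l - s)) * c s * RtoC (v ^ s) * RtoC (2 ^ s * (1 / 2) ^ s))%C
             by (rewrite RtoC_mult; ring).
            rewrite pow_two_half. ring. }
          rewrite <- csum_scal. rewrite (csum_ext _ _ _ T).
          change (csum (fun r => RtoC (2 ^ (S l - r)) * c r * RtoC (v ^ r))%C l
             + RtoC (2 ^ (S l - S l)) * c (S l) * RtoC (v ^ S l)
             - (csum (fun r => c r * RtoC (v ^ r))%C l + c (S l) * RtoC (v ^ S l)) =
             csum (fun r => c' r * RtoC (v ^ r))%C l)%C.
          rewrite Nat.sub_diag.
          rewrite (csum_ext (fun r => c' r * RtoC (v ^ r))%C
            (fun r => RtoC (2 ^ (S l - r)) * c r * RtoC (v ^ r) + - RtoC 1 * (c r * RtoC (v ^ r)))%C).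
          - rewrite csum_plus, csum_scal. change (2 ^ 0) with 1. ring.
          - intros s Hs. unfold c'. rewrite RtoC_minus. ring. }
        rewrite <- E. eapply Rle_trans; [apply Cmod_minus_le|]. rewrite Cmod_rmult.
        pose proof (H v Hv). pose proof (H (v / 2) ltac:(lra)). pose proof (H2 (S l)).
        rewrite Rabs_pos_eq by lra.
        assert (2 ^ S l * Cmod (csum (fun r => c r * RtoC ((v / 2) ^ r))%C (S l)) <= 2 ^ S l * k)
          by (apply Rmult_le_compat_l; lra). lra. }
      unfold c' in Hc'. rewrite Cmod_rmult in Hc'.
      assert (1 <= 2 ^ (S l - r) - 1).
      { replace (S l - r)%nat with (S (l - r)) by lia. simpl. pose proof (H2 (l - r)%nat). lra. }
      rewrite Rabs_pos_eq in Hc' by lra. pose proof (Cmod_ge_0 (c r)). unfold K1. nra. }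
    assert (0 <= K1 * k) by (apply Rmult_le_pos; lra).
    assert (0 <= INR (S l) * K1 * k) by (apply Rmult_le_pos; lra).
    intros r Hr. destruct (Nat.eq_dec r (S l)) as [->|Hn].
    2:{ specialize (Low r ltac:(lia)). lra. }
    specialize (H 1 ltac:(lra)).
    change (csum (fun r => c r * RtoC (1 ^ r))%C (S l)) with
      (csum (fun r => c r * RtoC (1 ^ r))%C l + c (S l) * RtoC (1 ^ S l))%C in H.
    rewrite pow1, Cmult_1_r in H.
    assert (Cmod (csum (fun r => c r * RtoC (1 ^ r))%C l) <= INR (S l) * (K1 * k)).
    { eapply Rle_trans; [apply Cmod_csum|]. apply (vnorm_le l (fun r => c r * RtoC (1 ^ r))%C).
      intros s Hs. rewrite pow1, Cmult_1_r. auto. }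
    set (s := csum _ l) in *.
    replace (c (S l)) with ((s + c (S l)) - s)%C by ring.
    eapply Rle_trans; [apply Cmod_minus_le|]. lra.
Qed.

(** * Bounds on compact rectangles *)

Lemma bounded_of_locally_bounded A B c d (g : R -> R -> R) :
  (forall x y, crect A B c d x y -> exists dl, 0 < dl /\ exists K, forall x' y',
     crect A B c d x' y' -> Rabs (x' - x) < dl -> Rabs (y' - y) < dl -> g x' y' <= K) ->
  exists K, forall x y, crect A B c d x y -> g x y <= K.
Proof.
  intros H.
  assert (HC : forall p : R * R, exists q : posreal * R, crect A B c d (fst p) (snd p) ->
    forall x' y', crect A B c d x' y' -> Rabs (x' - fst p) < fst q -> Rabs (y' - snd p) < fst q ->
    g x' y' <= snd q).
  { intros [x y]. destruct (classic (crect A B c d x y)) as [Hp|Hp].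
    - destruct (H x y Hp) as [dl [Hdl [K HK]]]. exists (mkposreal dl Hdl, K). intros _. exact HK.
    - exists (mkposreal 1 Rlt_0_1, 0). intros Hc. contradiction. }
  set (F := fun p => proj1_sig (constructive_indefinite_description _ (HC p))).
  assert (HF : forall p, crect A B c d (fst p) (snd p) -> forall x' y', crect A B c d x' y' ->
     Rabs (x' - fst p) < fst (F p) -> Rabs (y' - snd p) < fst (F p) -> g x' y' <= snd (F p)).
  { intros p. unfold F. apply (proj2_sig (constructive_indefinite_description _ (HC p))). }
  (* Compactness of the rectangle as a finite cover by the squares of the gauge [F]; the cover is
     provided up to double negation. Off the rectangle the gauge has an arbitrary value. *)
  destruct (NNPP _ (compactness_list 2 (A, (c, tt)) (B, (d, tt))
    (fun t => fst (F (fst t, fst (snd t)))))) as [l Hl].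
  assert (HM : exists K, forall t, In t l -> snd (F (fst t, fst (snd t))) <= K).
  { clear Hl. induction l as [|t l [K IH]].
    - exists 0. intros t [].
    - exists (Rmax K (snd (F (fst t, fst (snd t))))). intros s [<-|Hs].
      + apply Rmax_r.
      + eapply Rle_trans; [apply IH; trivial|apply Rmax_l]. }
  destruct HM as [K HK]. exists K. intros x y [Hx Hy].
  destruct (Hl (x, (y, tt))) as [[u [v []]] [Hin [Hb Hcl]]].
  { simpl. tauto. }
  simpl in Hb, Hcl. eapply Rle_trans; [|apply (HK _ Hin)]. simpl.
  apply (HF (u, v)); simpl; unfold crect; tauto.
Qed.

Lemma continuous_on_eps (D : R * R -> Prop) (f : R * R -> C) p : continuous_on D f -> D p ->
  forall ep, 0 < ep -> exists dl, 0 < dl /\ forall q, D q -> Rabs (fst q - fst p) < dl ->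
    Rabs (snd q - snd p) < dl -> Cmod (f q - f p) < ep.
Proof.
  intros Hf Hp ep Hep. specialize (Hf p Hp).
  assert (Hs : 0 < ep / 2) by lra.
  pose proof (proj1 (filterlim_locally (U := C_UniformSpace) f (f p)) Hf (mkposreal _ Hs)) as H.
  destruct H as [dl H]. exists dl. split; [apply cond_pos|]. intros q Hq H1 H2.
  assert (HB : ball p dl q) by (split; [exact H1|exact H2]).
  specialize (H q HB Hq). destruct H as [H3 H4].
  change (Rabs (fst (f q) - fst (f p)) < ep / 2) in H3.
  change (Rabs (snd (f q) - snd (f p)) < ep / 2) in H4.
  replace (f q - f p)%C with (RtoC (fst (f q) - fst (f p)) + Ci * RtoC (snd (f q) - snd (f p)))%C.
  - eapply Rle_lt_trans; [apply Cmod_triangle|]. rewrite Cmod_mult, Cmod_Ci, !Cmod_R. lra.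
  - unfold Ci, RtoC, Cplus, Cmult, Cminus, Copp. apply injective_projections; simpl; ring.
Qed.

Lemma continuous_on_bounded A B c d (f : fn) :
  continuous_on (fun p : R * R => cint A B (fst p) /\ cint c d (snd p)) (fun p => f (fst p) (snd p)) ->
  exists K, forall x e, crect A B c d x e -> Cmod (f x e) <= K.
Proof.
  intros Hf. apply (bounded_of_locally_bounded A B c d (fun x e => Cmod (f x e))).
  intros x e Hp. destruct (continuous_on_eps _ _ (x, e) Hf Hp 1 Rlt_0_1) as [dl [Hdl H]].
  exists dl. split; trivial. exists (Cmod (f x e) + 1). intros x' e' Hq H1 H2.
  specialize (H (x', e') Hq H1 H2). simpl in H.
  replace (f x' e') with ((f x' e' - f x e) + f x e)%C by ring.
  eapply Rle_trans; [apply Cmod_triangle|]. lra.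
Qed.

Lemma is_derive_on_interior (I : R -> Prop) (f : R -> C) x v d : 0 < d ->
  (forall y, Rabs (y - x) < d -> I y) -> is_derive_on (V := C_R_NormedModule) I f x v ->
  is_derive (fun u => Re (f u)) x (Re v) /\ is_derive (fun u => Im (f u)) x (Im v).
Proof.
  intros Hd HI [_ H].
  assert (Hx : I x) by (apply HI; rewrite Rminus_diag, Rabs_R0; trivial).
  assert (HL : is_filter_lim (within I (locally x)) x).
  { intros P HP. unfold within. revert HP. apply filter_imp. trivial. }
  specialize (H x HL).
  assert (G : forall p : C -> R, (forall z, Rabs (p z) <= Cmod z) ->
    (forall a b, p (a - b)%C = p a - p b) -> (forall r a, p (RtoC r * a)%C = r * p a) ->
    is_derive (fun u => p (f u)) x (p v)).
  { intros p Hp Hm Hs. split; [apply (is_linear_scal_l (V := R_NormedModule))|].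
    intros y Hy. pose proof (is_filter_lim_locally_unique (V := R_NormedModule) x y Hy) as Ey. subst y.
    intros eps. specialize (H eps).
    assert (HId : locally x I) by (exists (mkposreal d Hd); intros y Hy'; now apply HI).
    unfold within in H. generalize (filter_and _ _ H HId). apply filter_imp.
    intros y [H1 H2]. specialize (H1 H2).
    rewrite <- Cmod_norm in H1.
    change (Cmod (f y - f x - scal (V := C_R_NormedModule) (y - x)%R v)%C <= eps * Rabs (y - x)) in H1.
    rewrite scal_R_Cmult in H1.
    change (Rabs (p (f y) - p (f x) - (y - x) * p v) <= eps * Rabs (y - x)).
    eapply Rle_trans; [|exact H1]. rewrite <- Hs, <- !Hm. apply Hp. }
  split; apply G.
  - apply re_le_Cmod.
  - intros a b. reflexivity.
  - intros r [a1 a2]. unfold Re, Im, Cmult, RtoC. simpl. ring.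
  - intros z. eapply Rle_trans; [|apply Rmax_Cmod]. apply Rmax_r.
  - intros a b. reflexivity.
  - intros r [a1 a2]. unfold Re, Im, Cmult, RtoC. simpl. ring.
Qed.

Lemma Im_le_Cmod z : Rabs (Im z) <= Cmod z.
Proof. eapply Rle_trans; [|apply Rmax_Cmod]. apply Rmax_r. Qed.

Lemma Cmod_le_Re_Im z : Cmod z <= Rabs (Re z) + Rabs (Im z).
Proof.
  replace z with (RtoC (Re z) + Ci * RtoC (Im z))%C at 1.
  - eapply Rle_trans; [apply Cmod_triangle|]. rewrite Cmod_mult, Cmod_Ci, !Cmod_R. lra.
  - destruct z. unfold Re, Im, Ci, RtoC, Cplus, Cmult. apply injective_projections; simpl; ring.
Qed.

Lemma complex_taylor1 (A B : R) (f f' f'' : R -> C) L :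
  (forall t, A < t < B -> is_derive_on (V := C_R_NormedModule) (cint A B) f t (f' t)) ->
  (forall t, A < t < B -> is_derive_on (V := C_R_NormedModule) (cint A B) f' t (f'' t)) ->
  (forall t, A < t < B -> Cmod (f'' t) <= L) ->
  forall t t', A < t < B -> A < t' < B ->
  Cmod (f t' - f t - RtoC (t' - t) * f' t) <= 2 * L * (t' - t) ^ 2.
Proof.
  intros H1 H2 HL t t' Ht Ht'.
  assert (HI : forall t, A < t < B -> exists d, 0 < d /\ forall y, Rabs (y - t) < d -> cint A B y).
  { intros s Hs. exists (Rmin (s - A) (B - s)). split; [apply Rmin_pos; lra|].
    intros y Hy. apply Rabs_def2 in Hy.
    pose proof (Rmin_l (s - A) (B - s)). pose proof (Rmin_r (s - A) (B - s)). split; lra. }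
  assert (D1 : forall t, A < t < B -> is_derive (fun u => Re (f u)) t (Re (f' t)) /\
     is_derive (fun u => Im (f u)) t (Im (f' t))).
  { intros s Hs. destruct (HI s Hs) as [d [Hd Hi]]. apply (is_derive_on_interior (cint A B) f s _ d); auto. }
  assert (D2 : forall t, A < t < B -> is_derive (fun u => Re (f' u)) t (Re (f'' t)) /\
     is_derive (fun u => Im (f' u)) t (Im (f'' t))).
  { intros s Hs. destruct (HI s Hs) as [d [Hd Hi]]. apply (is_derive_on_interior (cint A B) f' s _ d); auto. }
  eapply Rle_trans; [apply Cmod_le_Re_Im|].
  assert (E : forall p : C -> R, p = Re \/ p = Im ->
    p (f t' - f t - RtoC (t' - t) * f' t)%C = p (f t') - p (f t) - (t' - t) * p (f' t)).
  { intros p [->| ->]; destruct (f t'), (f t), (f' t); unfold Re, Im, Cminus, Cmult, RtoC, Cplus, Copp; simpl; ring. }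
  rewrite !E by tauto.
  assert (R1 : Rabs (Re (f t') - Re (f t) - (t' - t) * Re (f' t)) <= L * (t' - t) ^ 2).
  { apply (real_taylor1 (fun t => A < t < B) (fun t => Re (f t)) (fun t => Re (f' t)) (fun t => Re (f'' t))); trivial.
    - apply interval_convex.
    - intros s Hs. now apply D1.
    - intros s Hs. now apply D2.
    - intros s Hs. eapply Rle_trans; [apply re_le_Cmod|auto]. }
  assert (R2 : Rabs (Im (f t') - Im (f t) - (t' - t) * Im (f' t)) <= L * (t' - t) ^ 2).
  { apply (real_taylor1 (fun t => A < t < B) (fun t => Im (f t)) (fun t => Im (f' t)) (fun t => Im (f'' t))); trivial.
    - apply interval_convex.
    - intros s Hs. now apply D1.
    - intros s Hs. now apply D2.
    - intros s Hs. eapply Rle_trans; [apply Im_le_Cmod|auto]. }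
  lra.
Qed.

(** Continuity on the compact rectangle bounds every pure derivative; the bound for order m + 2 is
    then the Taylor constant for order m. The mixed derivatives come from [pure_smooth_Sm]. *)
Lemma smooth_on2_smooth2 A B c d f : A < B -> c < d -> smooth_on2 (cint A B) (cint c d) f ->
  smooth2 (rect A B c d) f.
Proof.
  intros HAB Hcd [Dx [De [H0 [HD HC]]]] n.
  assert (HR : sub2 (rect A B c d) (crect A B c d)) by (intros x e [H1 H2]; split; lra).
  apply pure_smooth_Sm; trivial. split.
  - exists Dx. split; [intros x e Hp; apply HR in Hp; apply (H0 x e); apply Hp|].
    intros m. destruct (continuous_on_bounded A B c d (Dx m) (proj1 (HC m))) as [K HK].
    destruct (continuous_on_bounded A B c d (Dx (S (S m))) (proj1 (HC (S (S m))))) as [K2 HK2].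
    exists (Rabs K + 2 * Rabs K2). split.
    + intros x e Hp. specialize (HK x e (HR _ _ Hp)). pose proof (Rle_abs K). pose proof (Rabs_pos K2). lra.
    + intros x x' e [Hx He] [Hx' _].
      apply Rle_trans with (2 * Rabs K2 * (x' - x) ^ 2).
      2:{ apply Rmult_le_compat_r; [apply pow2_ge_0|]. pose proof (Rabs_pos K). lra. }
      assert (Hce : cint c d e) by (split; lra).
      apply (complex_taylor1 A B (fun u => Dx m u e) (fun u => Dx (S m) u e) (fun u => Dx (S (S m)) u e)); trivial.
      * intros t Ht. apply HD; trivial. split; lra.
      * intros t Ht. apply HD; trivial. split; lra.
      * intros t Ht. eapply Rle_trans; [apply HK2|apply Rle_abs]. split; trivial. lra.
  - exists De. split; [intros x e Hp; apply HR in Hp; apply (H0 x e); apply Hp|].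
    intros m. destruct (continuous_on_bounded A B c d (De m) (proj2 (HC m))) as [K HK].
    destruct (continuous_on_bounded A B c d (De (S (S m))) (proj2 (HC (S (S m))))) as [K2 HK2].
    exists (Rabs K + 2 * Rabs K2). split.
    + intros x e Hp. specialize (HK x e (HR _ _ Hp)). pose proof (Rle_abs K). pose proof (Rabs_pos K2). lra.
    + intros x e e' [Hx He] [_ He'].
      apply Rle_trans with (2 * Rabs K2 * (e' - e) ^ 2).
      2:{ apply Rmult_le_compat_r; [apply pow2_ge_0|]. pose proof (Rabs_pos K). lra. }
      assert (Hcx : cint A B x) by (split; lra).
      apply (complex_taylor1 c d (fun u => De m x u) (fun u => De (S m) x u) (fun u => De (S (S m)) x u)); trivial.
      * intros t Ht. apply HD; trivial. split; lra.
      * intros t Ht. apply HD; trivial. split; lra.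
      * intros t Ht. eapply Rle_trans; [apply HK2|apply Rle_abs]. split; trivial. lra.
Qed.

Lemma smooth_on2_continuous A B c d f : smooth_on2 (cint A B) (cint c d) f ->
  continuous_on (fun p : R * R => cint A B (fst p) /\ cint c d (snd p)) (fun p => f (fst p) (snd p)).
Proof.
  intros [Dx [De [H0 [HD HC]]]] [x e] Hp.
  pose proof (proj1 (HC 0%nat) (x, e) Hp) as H. destruct Hp as [Hx He]. simpl in Hx, He.
  change (filterlim (fun p : R * R => Dx 0%nat (fst p) (snd p))
    (within (fun p : R * R => cint A B (fst p) /\ cint c d (snd p)) (locally (x, e)))
    (locally (Dx 0%nat x e))) in H.
  rewrite (proj1 (H0 x e Hx He)) in H.
  eapply filterlim_ext_loc; [|exact H].
  unfold within. apply filter_forall. intros q [Hq1 Hq2]. now apply H0.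
Qed.

(** The extension sees interior values only; continuity identifies its boundary values with those of
    f. As a result the interior Lipschitz constant of a coefficient is valid on the closed
    rectangle, e = 0 included. *)
Lemma ext_of_continuous A B c d f L : A < B -> c < d -> 0 <= L -> lip2 (rect A B c d) f L ->
  continuous_on (fun p : R * R => cint A B (fst p) /\ cint c d (snd p)) (fun p => f (fst p) (snd p)) ->
  forall x e, crect A B c d x e -> ext A B c d f x e = f x e.
Proof.
  intros HAB Hcd HL Hf Hc x e Hp.
  assert (G : forall ep, 0 < ep -> Cmod (ext A B c d f x e - f x e) <= 0 + ep).
  { intros ep Hep. destruct (continuous_on_eps _ _ (x, e) Hc Hp (ep / 2) ltac:(lra)) as [dl [Hdl H]].
    simpl in H.
    assert (HW : 0 < (B - A) + (d - c)) by lra.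
    set (W := (B - A) + (d - c)) in *.
    destruct (floor_steps (W * (1 + dl) / dl + 8 * L * W / ep) 1) as [n [_ Hn]]; [|lra|].
    { assert (0 <= W * (1 + dl) / dl).
      { apply Rmult_le_pos; [nra|left; now apply Rinv_0_lt_compat]. }
      assert (0 <= 8 * L * W / ep).
      { apply Rmult_le_pos; [nra|left; now apply Rinv_0_lt_compat]. } lra. }
    pose proof (pos_INR n) as Hn0.
    pose proof (ext_approx A B c d HAB Hcd f L HL Hf x e n) as H1. fold W in H1.
    destruct Hp as [Hx He]. cbv beta in H1. rewrite !clamp_id in H1 by lra.
    pose proof (inward_self A B x n HAB Hx) as X1. pose proof (inward_self c d e n Hcd He) as E1.
    assert (HD1 : W * (1 + dl) / dl < INR n + 1).
    { assert (0 <= 8 * L * W / ep) by (apply Rmult_le_pos; [nra|left; now apply Rinv_0_lt_compat]). lra. }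
    assert (HD2 : 8 * L * W / ep < INR n + 1).
    { assert (0 <= W * (1 + dl) / dl) by (apply Rmult_le_pos; [nra|left; now apply Rinv_0_lt_compat]). lra. }
    assert (HWn : W / (INR n + 1) < dl).
    { apply (Rmult_lt_reg_r (INR n + 1)); [lra|]. unfold Rdiv at 1. rewrite Rmult_assoc, Rinv_l, Rmult_1_r by lra.
      apply (Rmult_lt_compat_r dl) in HD1; trivial. unfold Rdiv in HD1.
      rewrite (Rmult_assoc _ (/ dl)), Rinv_l, Rmult_1_r in HD1 by lra. nra. }
    assert (HLn : 4 * L * W / (INR n + 1) <= ep / 2).
    { apply (Rmult_le_reg_r (INR n + 1)); [lra|]. unfold Rdiv at 1. rewrite Rmult_assoc, Rinv_l, Rmult_1_r by lra.
      apply (Rmult_lt_compat_r ep) in HD2; trivial. unfold Rdiv in HD2.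
      rewrite (Rmult_assoc _ (/ ep)), Rinv_l, Rmult_1_r in HD2 by lra. lra. }
    assert (HBA : (B - A) / (INR n + 1) <= W / (INR n + 1)).
    { apply Rmult_le_compat_r; [left; apply Rinv_0_lt_compat; lra|unfold W; lra]. }
    assert (Hdc : (d - c) / (INR n + 1) <= W / (INR n + 1)).
    { apply Rmult_le_compat_r; [left; apply Rinv_0_lt_compat; lra|unfold W; lra]. }
    pose proof (inward_range A B x n HAB Hx) as R1. pose proof (inward_range c d e n Hcd He) as R2.
    assert (HF : Cmod (f (inward A B x n) (inward c d e n) - f x e) < ep / 2).
    { apply (H (inward A B x n, inward c d e n)); simpl; try lra. split; split; lra. }
    eapply Rle_trans; [apply (Cmod_triangle_sub _ (f (inward A B x n) (inward c d e n)))|]. lra. }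
  assert (G0 : Cmod (ext A B c d f x e - f x e) = 0).
  { apply Rle_antisym; [|apply Cmod_ge_0]. apply le_epsilon. exact G. }
  apply Cmod_eq_0 in G0.
  replace (ext A B c d f x e) with ((ext A B c d f x e - f x e) + f x e)%C by ring. rewrite G0. ring.
Qed.

(** * Working forms of the hypotheses on infima, little-o terms and smooth functions *)

Lemma inf_on_positive (I : R -> Prop) (f : R -> R) : Rbar_lt 0 (inf_on I f) ->
  exists k, 0 < k /\ forall x, I x -> k <= f x.
Proof.
  unfold inf_on. intros H.
  destruct (Glb_Rbar_correct (fun r => exists x, I x /\ r = f x)) as [Hlb _].
  destruct (Glb_Rbar _) as [g| |]; simpl in H.
  - exists g. split; trivial. intros x Hx. apply (Hlb (f x)). exists x. split; trivial.
  (* An infinite infimum means that [I] is empty, so 1 is an arbitrary choice. *)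
  - exists 1. split; [lra|]. intros x Hx. destruct (Hlb (f x)). exists x. split; trivial.
  - contradiction.
Qed.

Lemma unif_little_o_le {T : Type} (D : R -> T -> Prop) g h dl : unif_little_o D g h -> 0 < dl ->
  exists d, 0 < d /\ forall e, 0 < e < d -> forall t, D e t -> g e t <= dl * h e.
Proof.
  intros H Hdl. destruct (H (mkposreal dl Hdl)) as [d Hd]. exists d. split; [apply cond_pos|].
  intros e He. apply Hd; [|lra]. change (Rabs (e - 0) < d). rewrite Rabs_pos_eq; lra.
Qed.

Lemma minus_minus_plus (G : AbelianGroup) (u v s : G) : plus (minus (minus u v) s) (plus s v) = u.
Proof.
  unfold minus. transitivity (plus (plus u (opp v)) (plus (opp s) (plus s v))).
  { symmetry. apply plus_assoc. }
  transitivity (plus (plus u (opp v)) v).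
  - f_equal. transitivity (plus (plus (opp s) s) v); [apply plus_assoc|].
    rewrite plus_opp_l. apply plus_zero_l.
  - transitivity (plus u (plus (opp v) v)); [symmetry; apply plus_assoc|].
    rewrite plus_opp_l. apply plus_zero_r.
Qed.

Lemma smooth_on_bounded {V : NormedModule R_AbsRing} A B (f : R -> V) :
  smooth_on (cint A B) f -> exists K, forall x, cint A B x -> norm (f x) <= K.
Proof.
  intros [D [H0 HD]].
  (* The two-dimensional compactness statement is used with the second interval reduced to a point;
     the local bound is the definition of the derivative with tolerance 1. *)
  destruct (bounded_of_locally_bounded A B 0 0 (fun x _ => norm (f x))) as [K HK].
  - intros x y [Hx Hy]. destruct (HD 0%nat x Hx) as [_ H].
    assert (HL : is_filter_lim (within (cint A B) (locally x)) x).
    { intros P HP. unfold within. revert HP. apply filter_imp. trivial. }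
    destruct (H x HL (mkposreal 1 Rlt_0_1)) as [d Hd]. simpl in Hd.
    exists d. split; [apply cond_pos|]. exists (norm (f x) + d * (norm (D 1%nat x) + 1)).
    intros x' y' [Hx' _] Hxx' _. specialize (Hd x' Hxx' Hx'). rewrite !H0 in Hd by trivial.
    rewrite <- (minus_minus_plus _ (f x') (f x) (scal (minus x' x) (D 1%nat x))).
    eapply Rle_trans; [apply norm_triangle|].
    eapply Rle_trans; [apply Rplus_le_compat_l, norm_triangle|].
    pose proof (norm_scal (minus x' x) (D 1%nat x)) as HS.
    change (norm (minus x' x)) with (Rabs (x' - x)) in Hd. change (abs (minus x' x)) with (Rabs (x' - x)) in HS.
    pose proof (Rabs_pos (x' - x)). pose proof (norm_ge_0 (D 1%nat x)).
    assert (Rabs (x' - x) * norm (D 1%nat x) <= d * norm (D 1%nat x)) by (apply Rmult_le_compat_r; lra).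
    apply Rle_trans with (1 * Rabs (x' - x) + (Rabs (x' - x) * norm (D 1%nat x) + norm (f x))); [|lra].
    apply Rplus_le_compat; [exact Hd|]. apply Rplus_le_compat_r. exact HS.
  - exists K. intros x Hx. apply (HK x 0). split; trivial. lra.
Qed.

Lemma Cprod_bound f n k : 0 <= k -> (forall m, (1 <= m <= n)%nat -> Cmod (f m) <= k) ->
  Cmod (Cprod f n) <= k ^ n.
Proof.
  intros Hk. induction n as [|n IH]; intros H; simpl; [rewrite Cmod_1; lra|].
  rewrite Cmod_mult, Rmult_comm. apply Rmult_le_compat; try apply Cmod_ge_0.
  - apply H. lia.
  - apply IH. intros; apply H; lia.
Qed.

(** * The recurrence in scaled differences *)

Section Setup.
Variables (N : nat) (A B e0 : R) (a : nat -> R -> R -> C).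
Let l := S N.
Hypothesis hAB : A < B.
Hypothesis he0 : 0 < e0.
Hypothesis ha : standing_assumptions l A B a e0.

Definition diff_coef (r : nat) : fn := fun x e => shifted_coef l (fun j => a j x e) r.

(** The coefficient of the r-th scaled difference after division of the recurrence by a_l e^l: the
    r-th difference is e^r times the scaled one, which leaves e^-(l - r). The equation becomes
    monic, as the companion form requires. *)
Definition scaled_coef (r : nat) : fn := fun x e =>
  (/ a l x e * (/ RtoC (e ^ (l - r)) * diff_coef r x e))%C.

Lemma coefficients_lipschitz j : (j <= l)%nat -> exists L, 0 <= L /\
  forall x e x' e', crect A B 0 e0 x e -> crect A B 0 e0 x' e' ->
  Cmod (a j x' e' - a j x e) <= L * dist2 x e x' e'.
Proof.
  intros Hj. pose proof (proj1 ha j Hj) as Hs.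
  pose proof (smooth_on2_smooth2 A B 0 e0 (a j) hAB he0 Hs) as HS.
  destruct (smooth2_lip2 _ _ (convex2_rect A B 0 e0) HS) as [L [L0 HL]].
  pose proof (smooth_on2_continuous A B 0 e0 (a j) Hs) as HC.
  exists L. split; trivial. intros x e x' e' Hp Hp'.
  rewrite <- !(ext_of_continuous A B 0 e0 (a j) L hAB he0 L0 HL HC) by trivial.
  now apply ext_lip.
Qed.

Lemma leading_coefficient_bound : exists e2 k, 0 < e2 <= e0 /\ 0 < k /\
  forall x e, cint A B x -> 0 <= e <= e2 -> k <= Cmod (a l x e).
Proof.
  destruct ha as [_ [_ [_ Hl]]]. destruct (inf_on_positive _ _ Hl) as [k [Hk Hinf]].
  destruct (coefficients_lipschitz l (le_n _)) as [L [L0 HL]].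
  exists (Rmin e0 (k / (2 * (L + 1)))). exists (k / 2).
  assert (0 < k / (2 * (L + 1))) by (apply Rdiv_lt_0_compat; lra).
  split; [split; [now apply Rmin_pos|apply Rmin_l]|]. split; [lra|].
  intros x e Hx [He1 He2].
  assert (E1 : e <= e0) by (eapply Rle_trans; [exact He2|apply Rmin_l]).
  assert (E2 : e <= k / (2 * (L + 1))) by (eapply Rle_trans; [exact He2|apply Rmin_r]).
  assert (H0 : crect A B 0 e0 x 0) by (split; trivial; lra).
  assert (He : crect A B 0 e0 x e) by (split; trivial; lra).
  pose proof (HL _ _ _ _ H0 He) as H1. unfold dist2 in H1.
  rewrite Rminus_diag, Rabs_R0, Rplus_0_l, Rminus_0_r, Rabs_pos_eq in H1 by trivial.
  assert (L * e <= k / 2).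
  { apply (Rmult_le_compat_l (L + 1)) in E2; [|lra].
    replace ((L + 1) * (k / (2 * (L + 1)))) with (k / 2) in E2 by (field; lra). nra. }
  specialize (Hinf x Hx).
  replace (a l x 0) with (a l x e - (a l x e - a l x 0))%C in Hinf by ring.
  pose proof (Cmod_minus_le (a l x e) (a l x e - a l x 0)). lra.
Qed.

Lemma coefficients_bounded j : (j <= l)%nat -> exists K, 0 <= K /\
  forall x e, crect A B 0 e0 x e -> Cmod (a j x e) <= K.
Proof.
  intros Hj.
  destruct (continuous_on_bounded A B 0 e0 (a j)) as [K HK].
  - apply smooth_on2_continuous. now apply ha.
  - exists (Rabs K). split; [apply Rabs_pos|]. intros x e Hp.
    eapply Rle_trans; [now apply HK|apply Rle_abs].
Qed.

(** An identity for arbitrary y, so that it serves exact solutions as well as approximate ones, for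
    which the left-hand side is the residual. *)
Lemma recurrence_scaled x e (y : nat -> C) : e <> 0 -> a l x e <> RtoC 0 ->
  csum (fun j => a j x e * y j)%C l =
  (a l x e * RtoC (e ^ l) * (quot e y l 0 + csum (fun r => scaled_coef r x e * quot e y r 0)%C N))%C.
Proof.
  intros He Ha.
  transitivity (csum (fun j => a j x e * quot e y 0%nat j)%C l); [reflexivity|].
  rewrite (recurrence_in_differences (quot e y) (RtoC e) l (fun j => a j x e)) by
    (intros i n; now apply quot_step).
  change (csum (fun r => shifted_coef l (fun j => a j x e) r * (Cpow (RtoC e) r * quot e y r 0))%C N
    + shifted_coef l (fun j => a j x e) l * (Cpow (RtoC e) l * quot e y l 0) =
    a l x e * RtoC (e ^ l) * (quot e y l 0 + csum (fun r => scaled_coef r x e * quot e y r 0)%C N))%C.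
  rewrite shifted_coef_top, RtoC_pow.
  assert (E : (a l x e * RtoC (e ^ l) * csum (fun r => scaled_coef r x e * quot e y r 0)%C N)%C =
    csum (fun r => shifted_coef l (fun j => a j x e) r * (Cpow (RtoC e) r * quot e y r 0))%C N).
  { rewrite <- csum_scal. apply csum_ext. intros r Hr. unfold scaled_coef, diff_coef.
    rewrite <- RtoC_pow. replace (e ^ l) with (e ^ (l - r) * e ^ r) by (rewrite <- pow_add; f_equal; lia).
    rewrite RtoC_mult. field. split; [|trivial].
    intros E. apply RtoC_inj in E. revert E. now apply pow_nonzero. }
  rewrite <- E, RtoC_pow. ring.
Qed.

Variables (lam : nat -> R -> R -> C) (q : nat) (Q : nat -> R -> R).
Hypothesis hlam : characteristic_roots l A B a e0 lam.
Hypothesis hq : (1 <= q)%nat.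
Hypothesis hQ : forall m, (1 <= m <= l)%nat -> smooth_on (V := R_NormedModule) (cint A B) (Q m).
Hypothesis hlamQ : forall m, (1 <= m <= l)%nat ->
  unif_little_o (fun _ x => cint A B x)
    (fun e x => Rabs (Cmod (Cminus (lam m x e) (RtoC 1)) / e ^ q - Q m x)) (fun e => e).

(** As q >= 1 and e < 1, e^q <= e, and Q_m is bounded on the compact interval. The little-o term,
    taken with tolerance 1, contributes the additional 1; the induction merges the constants of the
    finitely many roots. *)
Lemma roots_near_one : exists d K, 0 < d /\ 0 <= K /\ forall m x e, (1 <= m <= l)%nat ->
  cint A B x -> 0 < e < d -> Cmod (lam m x e - RtoC 1) <= K * e.
Proof.
  assert (G : forall n, (n <= l)%nat -> exists d K, 0 < d /\ 0 <= K /\ forall m x e, (1 <= m <= n)%nat ->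
    cint A B x -> 0 < e < d -> Cmod (lam m x e - RtoC 1) <= K * e).
  { induction n as [|n IH]; intros Hn.
    - exists 1. exists 0. split; [lra|]. split; [lra|]. intros m x e Hm. lia.
    - destruct IH as [d [K [Hd [HK H]]]]; [lia|].
      destruct (smooth_on_bounded A B (Q (S n)) (hQ (S n) ltac:(lia))) as [K' HK'].
      destruct (unif_little_o_le _ _ _ 1 (hlamQ (S n) ltac:(lia)) ltac:(lra)) as [d' [Hd' H']].
      exists (Rmin (Rmin d d') 1). exists (K + (Rabs K' + 1)).
      split; [repeat apply Rmin_pos; lra|]. split; [pose proof (Rabs_pos K'); lra|].
      intros m x e Hm Hx [He1 He2].
      assert (E1 : e < 1) by (eapply Rlt_le_trans; [exact He2|apply Rmin_r]).
      assert (E : e < Rmin d d') by (eapply Rlt_le_trans; [exact He2|apply Rmin_l]).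
      assert (E2 : e < d) by (eapply Rlt_le_trans; [exact E|apply Rmin_l]).
      assert (E3 : e < d') by (eapply Rlt_le_trans; [exact E|apply Rmin_r]).
      pose proof (Rabs_pos K').
      destruct (Nat.eq_dec m (S n)) as [->|Hne].
      + specialize (H' e (conj He1 E3) x Hx). simpl in H'.
        specialize (HK' x Hx). change (norm (Q (S n) x)) with (Rabs (Q (S n) x)) in HK'.
        assert (Hq0 : 0 < e ^ q) by now apply pow_lt.
        assert (Hqe : e ^ q <= e).
        { destruct q as [|p]; [lia|]. simpl. assert (e ^ p <= 1) by (apply pow_le_one; lra).
          assert (0 <= e ^ p) by (apply pow_le; lra). nra. }
        set (c := Cmod (lam (S n) x e - RtoC 1)) in *.
        assert (H1 : c / e ^ q <= Rabs K' + 1).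
        { pose proof (Rle_abs (c / e ^ q - Q (S n) x)). pose proof (Rle_abs (Q (S n) x)).
          pose proof (Rle_abs K'). lra. }
        assert (H2 : c = c / e ^ q * e ^ q) by (field; lra).
        rewrite H2. apply Rle_trans with ((Rabs K' + 1) * e).
        * apply Rmult_le_compat; try lra. apply Rmult_le_pos; [apply Cmod_ge_0|left; now apply Rinv_0_lt_compat].
        * apply Rmult_le_compat_r; lra.
      + assert (Hm' : (1 <= m <= n)%nat) by lia.
        specialize (H m x e Hm' Hx (conj He1 E2)). nra. }
  apply (G l). lia.
Qed.

(** At lambda = 1 + e v with 0 <= v <= 1 each root factor is at most e (1 + C1), so the
    characteristic polynomial is O(e^l). As a polynomial in v its coefficients are [diff_coef r]
    times e^r, and [coefficient_bound] estimates them one by one. *)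
Lemma diff_coef_bound : exists e2 K, 0 < e2 <= e0 /\ 0 <= K /\ forall r x e, (r <= l)%nat ->
  cint A B x -> 0 < e < e2 -> Cmod (diff_coef r x e) <= K * e ^ (l - r).
Proof.
  destruct leading_coefficient_bound as [e2 [k [He2 [Hk Hlow]]]].
  destruct roots_near_one as [d [C1 [Hd [HC1 Hroots]]]].
  destruct (coefficients_bounded l (le_n _)) as [Ka [Ka0 HKa]].
  destruct (coefficient_bound l) as [Kc [Kc0 HKc]].
  exists (Rmin e2 d). exists (Kc * (Ka * (1 + C1) ^ l)).
  assert (HC1l : 0 <= (1 + C1) ^ l) by (apply pow_le; lra).
  split; [split; [apply Rmin_pos; lra|eapply Rle_trans; [apply Rmin_l|lra]]|].
  split; [apply Rmult_le_pos; [lra|]; now apply Rmult_le_pos|].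
  intros r x e Hr Hx [He1 He].
  assert (E2 : e < e2) by (eapply Rlt_le_trans; [exact He|apply Rmin_l]).
  assert (E3 : e < d) by (eapply Rlt_le_trans; [exact He|apply Rmin_r]).
  assert (Hne : a l x e <> RtoC 0).
  { intros E. specialize (Hlow x e Hx ltac:(lra)). rewrite E, Cmod_0 in Hlow. lra. }
  assert (Hne2 : forall n, e ^ n <> 0) by (intros; apply pow_nonzero; lra).
  assert (Hpos : forall n, 0 < e ^ n) by (intros; apply pow_lt; lra).
  set (c := fun r => (RtoC (/ e ^ l) * (diff_coef r x e * RtoC (e ^ r)))%C).
  assert (Hc : Cmod (c r) <= Kc * (Ka * (1 + C1) ^ l)).
  { apply (HKc c); trivial; [now apply Rmult_le_pos|]. intros v Hv.
    set (z := (1 + RtoC (e * v))%C).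
    assert (E : csum (fun r => c r * RtoC (v ^ r))%C l = (RtoC (/ e ^ l) * charpoly l a x e z)%C).
    { unfold charpoly. rewrite sum_n_csum. unfold z.
      rewrite (polynomial_shift l (fun j => a j x e) (RtoC (e * v))), <- csum_scal. apply csum_ext.
      intros s _. unfold c, diff_coef.
      replace (Cpow (RtoC (e * v)) s) with (RtoC (e ^ s * v ^ s)).
      - rewrite RtoC_mult. ring.
      - rewrite <- Rpow_mult_distr. apply RtoC_pow. }
    rewrite E, (hlam x e Hx ltac:(split; lra) Hne z), Cmod_rmult, Cmod_mult.
    rewrite Rabs_pos_eq by (left; apply Rinv_0_lt_compat; apply Hpos).
    assert (HP : Cmod (Cprod (fun m => (z - lam m x e)%C) l) <= (e * (1 + C1)) ^ l).
    { apply Cprod_bound; [apply Rmult_le_pos; lra|]. intros m Hm.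
      specialize (Hroots m x e Hm Hx (conj He1 E3)). unfold z.
      replace (1 + RtoC (e * v) - lam m x e)%C with (RtoC (e * v) - (lam m x e - RtoC 1))%C by ring.
      eapply Rle_trans; [apply Cmod_minus_le|]. rewrite Cmod_R, Rabs_pos_eq by (apply Rmult_le_pos; lra). nra. }
    rewrite Rpow_mult_distr in HP.
    assert (HKax : Cmod (a l x e) <= Ka) by (apply HKa; split; trivial; lra).
    apply Rle_trans with (/ e ^ l * (Ka * (e ^ l * (1 + C1) ^ l))).
    - apply Rmult_le_compat_l; [left; apply Rinv_0_lt_compat; apply Hpos|].
      apply Rmult_le_compat; trivial; apply Cmod_ge_0.
    - right. field. apply Hne2. }
  unfold c in Hc. rewrite Cmod_rmult, Cmod_mult, Cmod_R in Hc.
  rewrite (Rabs_pos_eq (/ _)) in Hc by (left; apply Rinv_0_lt_compat; apply Hpos).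
  rewrite (Rabs_pos_eq (e ^ r)) in Hc by (left; apply Hpos).
  replace (e ^ l) with (e ^ (l - r) * e ^ r) in Hc by (rewrite <- pow_add; f_equal; lia).
  replace (/ (e ^ (l - r) * e ^ r) * (Cmod (diff_coef r x e) * e ^ r)) with
    (Cmod (diff_coef r x e) / e ^ (l - r)) in Hc by (field; split; apply Hne2).
  apply (Rmult_le_compat_r (e ^ (l - r))) in Hc; [|left; apply Hpos].
  unfold Rdiv in Hc. rewrite Rmult_assoc, Rinv_l, Rmult_1_r in Hc by apply Hne2. exact Hc.
Qed.

Lemma diff_coef_smooth r e2 : 0 < e2 <= e0 -> smooth2 (rect A B 0 e2) (diff_coef r).
Proof.
  intros He2 n. unfold diff_coef, shifted_coef.
  apply (Sm_csum n _ (fun j x e => RtoC (INR (bin j r)) * a j x e)%C); [apply open2_rect|].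
  intros j Hj. apply Sm_scal; [apply open2_rect|].
  apply (Sm_sub n (rect A B 0 e0)).
  - intros x e [Hx He]. split; lra.
  - apply smooth_on2_smooth2; trivial. now apply ha.
Qed.

Theorem scaled_coefficients : exists e2 k K, 0 < e2 <= e0 /\ 0 < k /\ 1 <= K /\
  (forall x e, cint A B x -> 0 <= e <= e2 -> k <= Cmod (a l x e)) /\
  (forall r x e, (r <= N)%nat -> cint A B x -> 0 < e < e2 -> Cmod (scaled_coef r x e) <= K) /\
  (forall r, (r <= N)%nat -> smooth2 (rect A B 0 e2) (scaled_coef r)).
Proof.
  destruct leading_coefficient_bound as [ea [k [Hea [Hk Hlow]]]].
  destruct diff_coef_bound as [eb [K [Heb [HK HB]]]].
  (* The added 1 makes the constant also a bound for the unit entries of the companion matrix. *)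
  exists (Rmin ea eb). exists k. exists (/ k * K + 1).
  assert (Hik : 0 < / k) by now apply Rinv_0_lt_compat.
  assert (He2 : 0 < Rmin ea eb <= e0).
  { split; [apply Rmin_pos; lra|eapply Rle_trans; [apply Rmin_l|lra]]. }
  split; trivial. split; trivial. split; [nra|].
  assert (Hlow' : forall x e, cint A B x -> 0 <= e <= Rmin ea eb -> k <= Cmod (a l x e)).
  { intros x e Hx He. apply Hlow; trivial. pose proof (Rmin_l ea eb). lra. }
  split; trivial. split.
  - intros r x e Hr Hx He. unfold scaled_coef.
    pose proof (Hlow' x e Hx ltac:(lra)) as H1.
    assert (Hne : a l x e <> RtoC 0) by (intros E; rewrite E, Cmod_0 in H1; lra).
    pose proof (Rmin_r ea eb).
    specialize (HB r x e ltac:(lia) Hx ltac:(lra)).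
    assert (Hp : 0 < e ^ (l - r)) by (apply pow_lt; lra).
    assert (Hpne : RtoC (e ^ (l - r)) <> RtoC 0) by (intros E; apply RtoC_inj in E; lra).
    rewrite !Cmod_mult, !Cmod_inv, Cmod_R by trivial. rewrite Rabs_pos_eq by lra.
    assert (/ Cmod (a l x e) <= / k) by (apply Rinv_le_contravar; lra).
    assert (0 < / Cmod (a l x e)) by (apply Rinv_0_lt_compat; lra).
    assert (/ e ^ (l - r) * Cmod (diff_coef r x e) <= K).
    { apply (Rmult_le_reg_l (e ^ (l - r))); trivial. rewrite <- Rmult_assoc, Rinv_r, Rmult_1_l by lra. lra. }
    assert (0 <= / e ^ (l - r) * Cmod (diff_coef r x e)).
    { apply Rmult_le_pos; [left; now apply Rinv_0_lt_compat|apply Cmod_ge_0]. }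
    assert (/ Cmod (a l x e) * (/ e ^ (l - r) * Cmod (diff_coef r x e)) <= / k * K) by (apply Rmult_le_compat; lra).
    lra.
  - intros r Hr n. apply Sm_mult; [apply open2_rect| |].
    + apply (Sm_inv _ (open2_rect _ _ _ _) n (a l) k); trivial.
      * intros x e [Hx He]. apply Hlow'; [split|]; lra.
      * apply (Sm_sub n (rect A B 0 e0)).
        -- intros x e [Hx He]. split; lra.
        -- apply smooth_on2_smooth2; trivial. now apply ha.
    + apply (power_vanishing_quotient A B (Rmin ea eb) (l - r) hAB (proj1 He2) (diff_coef r) K).
      * now apply diff_coef_smooth.
      * intros x e [Hx He]. pose proof (Rmin_r ea eb). apply HB; [lia|split; lra|lra].
Qed.

End Setup.

(** * True solutions asymptotic to a formal one *)

Lemma unif_little_o_of_bound {T : Type} (D : R -> T -> Prop) (g : R -> T -> R) s K d : 0 < d ->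
  (forall e, 0 < e < d -> forall t, D e t -> g e t <= K * e ^ S s) ->
  unif_little_o D g (fun e => e ^ s).
Proof.
  intros Hd H dl.
  assert (HK : 0 < Rabs K + 1) by (pose proof (Rabs_pos K); lra).
  assert (Hm : 0 < Rmin d (dl / (Rabs K + 1))).
  { apply Rmin_pos; trivial. apply Rdiv_lt_0_compat; trivial. apply cond_pos. }
  exists (mkposreal _ Hm). intros e He Hpos t Ht.
  change (Rabs (e - 0) < Rmin d (dl / (Rabs K + 1))) in He.
  rewrite Rminus_0_r, Rabs_pos_eq in He by lra.
  assert (E1 : e < d) by (eapply Rlt_le_trans; [exact He|apply Rmin_l]).
  assert (E2 : e < dl / (Rabs K + 1)) by (eapply Rlt_le_trans; [exact He|apply Rmin_r]).
  eapply Rle_trans; [apply (H e); trivial; lra|]. simpl.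
  assert (Hp : 0 < e ^ s) by now apply pow_lt.
  rewrite <- Rmult_assoc. apply Rmult_le_compat_r; [lra|].
  apply (Rmult_lt_compat_r (Rabs K + 1)) in E2; trivial.
  unfold Rdiv in E2. rewrite Rmult_assoc, Rinv_l, Rmult_1_r in E2 by lra.
  pose proof (Rle_abs K). nra.
Qed.

Lemma csum_split (f : nat -> C) s m :
  csum f (S s + m) = (csum f s + csum (fun i => f (S s + i)%nat) m)%C.
Proof.
  induction m as [|m IH]; [rewrite Nat.add_0_r; simpl; now rewrite Nat.add_0_r|].
  rewrite Nat.add_succ_r. change (csum f (S (S s + m))) with (csum f (S s + m) + f (S (S s + m)))%C.
  rewrite IH. change (csum (fun i => f (S s + i)%nat) (S m)) with
   (csum (fun i => f (S s + i)%nat) m + f (S s + S m)%nat)%C. rewrite Nat.add_succ_r. ring.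
Qed.

Section Resummation.
Variables (A B : R) (Psi : nat -> R -> C).
Hypothesis HPsi : forall i, smooth_on (V := C_R_NormedModule) (cint A B) (Psi i).

Lemma series_bounds : exists b : nat -> R, forall i, 0 <= b i /\ forall x, cint A B x -> Cmod (Psi i x) <= b i.
Proof.
  assert (H : forall i, exists K, 0 <= K /\ forall x, cint A B x -> Cmod (Psi i x) <= K).
  { intros i. destruct (smooth_on_bounded A B (Psi i) (HPsi i)) as [K HK].
    exists (Rabs K). split; [apply Rabs_pos|]. intros x Hx. specialize (HK x Hx).
    rewrite <- Cmod_norm in HK. pose proof (Rle_abs K). lra. }
  exists (fun i => proj1_sig (constructive_indefinite_description _ (H i))).
  intros i. apply (proj2_sig (constructive_indefinite_description _ (H i))).
Qed.

(* The i-th term enters only for e so small that its coefficient times e is at most 2^-i. *)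
Theorem resummation : exists Gam : fn, forall s, exists K d, 0 < d /\ 0 <= K /\
  forall x e, cint A B x -> 0 < e < d -> Cmod (Gam x e - partial_series Psi s x e) <= K * e ^ S s.
Proof.
  destruct series_bounds as [b Hb].
  set (t := fun i => / (2 ^ i * (1 + b i))).
  assert (Ht : forall i, 0 < t i).
  { intros i. apply Rinv_0_lt_compat, Rmult_lt_0_compat; [apply pow_lt; lra|]. pose proof (proj1 (Hb i)). lra. }
  set (term := fun x e i => if Rle_dec e (t i) then (Psi i x * RtoC (e ^ i))%C else RtoC 0).
  (* A finite sum with upper index about 1 / e, which still contains any given index once e is
     small. *)
  exists (fun x e => csum (term x e) (step_count 1 e)). intros s.
  assert (HM : forall n, exists d, 0 < d /\ forall e, 0 < e < d -> forall i, (i <= n)%nat -> e <= t i).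
  { induction n as [|n [d [Hd H]]].
    - exists (t 0%nat). split; trivial. intros e He i Hi. replace i with 0%nat by lia. lra.
    - exists (Rmin d (t (S n))). split; [now apply Rmin_pos|]. intros e [He1 He2] i Hi.
      pose proof (Rmin_l d (t (S n))). pose proof (Rmin_r d (t (S n))).
      destruct (Nat.eq_dec i (S n)) as [->|Hn]; [lra|]. apply H; [lra|lia]. }
  destruct (HM s) as [d [Hd HT]].
  assert (HS : 0 < / INR (S (S s))) by (apply Rinv_0_lt_compat, lt_0_INR; lia).
  exists (b (S s) + 2). exists (Rmin d (/ INR (S (S s)))).
  split; [now apply Rmin_pos|]. pose proof (proj1 (Hb (S s))). split; [lra|].
  intros x e Hx [He1 He2].
  assert (E1 : e < d) by (eapply Rlt_le_trans; [exact He2|apply Rmin_l]).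
  assert (E2 : e < / INR (S (S s))) by (eapply Rlt_le_trans; [exact He2|apply Rmin_r]).
  assert (Hnn : (S s <= step_count 1 e)%nat).
  { pose proof (step_count_spec 1 e ltac:(lra) He1) as HC.
    assert (INR (S (S s)) * e < 1).
    { assert (HI : 0 < INR (S (S s))) by (apply lt_0_INR; lia).
      apply (Rmult_lt_compat_l (INR (S (S s)))) in E2; trivial. rewrite Rinv_r in E2 by lra. exact E2. }
    apply INR_le. apply (Rmult_le_reg_r e); trivial. rewrite S_INR in H0. lra. }
  assert (He3 : e <= 1).
  { assert (/ INR (S (S s)) <= / 1) by (apply Rinv_le_contravar; [lra|rewrite S_INR; pose proof (pos_INR (S s)); lra]).
    rewrite Rinv_1 in H0. lra. }
  replace (step_count 1 e) with (S s + (step_count 1 e - S s))%nat by lia.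
  rewrite csum_split. unfold partial_series. rewrite sum_n_csum.
  rewrite (csum_ext (term x e) (fun i => Psi i x * RtoC (e ^ i))%C s).
  2:{ intros i Hi. unfold term. destruct (Rle_dec e (t i)); trivial. elim n. apply HT; trivial. lra. }
  set (c := csum (fun i => Psi i x * RtoC (e ^ i))%C s).
  replace (c + csum (fun i => term x e (S s + i)%nat) (step_count 1 e - S s) - c)%C with
    (csum (fun i => term x e (S s + i)%nat) (step_count 1 e - S s)) by ring.
  generalize (step_count 1 e - S s)%nat as m. intros m.
  assert (Hpe : 0 < e ^ S s) by now apply pow_lt.
  (* The first term of the tail costs b (S s); every later one costs at most (1/2)^(S m) e^(S s) by
     the choice of [t]. Subtracting (1/2)^m leaves exactly the room for the next term. *)
  assert (G : Cmod (csum (fun i => term x e (S s + i)%nat) m) <= (b (S s) + 2 - (1 / 2) ^ m) * e ^ S s).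
  { induction m as [|m IH].
    - simpl csum. rewrite Nat.add_0_r. unfold term. change ((1 / 2) ^ 0) with 1. destruct (Rle_dec e (t (S s))).
      + rewrite Cmod_mult, Cmod_R, Rabs_pos_eq by lra. apply Rmult_le_compat_r; [lra|].
        pose proof (proj2 (Hb (S s)) x Hx). lra.
      + rewrite Cmod_0. apply Rmult_le_pos; lra.
    - simpl csum. eapply Rle_trans; [apply Cmod_triangle|].
      replace ((b (S s) + 2 - (1 / 2) ^ S m) * e ^ S s) with
       ((b (S s) + 2 - (1 / 2) ^ m) * e ^ S s + (1 / 2) ^ S m * e ^ S s) by (simpl; field).
      apply Rplus_le_compat; trivial.
      assert (Hq : 0 < (1 / 2) ^ S m) by (apply pow_lt; lra).
      change (S (s + S m)) with (S s + S m)%nat.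
      set (i := (S s + S m)%nat). unfold term. destruct (Rle_dec e (t i)) as [Hti|Hti].
      + rewrite Cmod_mult, Cmod_R, Rabs_pos_eq by (apply pow_le; lra).
        pose proof (proj2 (Hb i) x Hx) as Hbi. pose proof (proj1 (Hb i)) as Hbi0.
        assert (H2i : 0 < 2 ^ i) by (apply pow_lt; lra).
        assert (Hbe : b i * e <= (1 / 2) ^ i).
        { assert (Hx1 : (1 + b i) * e <= / 2 ^ i).
          { apply (Rmult_le_compat_l (1 + b i)) in Hti; [|lra].
            unfold t in Hti. rewrite Rinv_mult in Hti.
            replace ((1 + b i) * (/ 2 ^ i * / (1 + b i))) with (/ 2 ^ i) in Hti by (field; lra). lra. }
          replace ((1 / 2) ^ i) with (/ 2 ^ i); [nra|].
          rewrite <- pow_inv. f_equal. lra. }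
        assert (Hee : e ^ i = e * (e ^ S s * e ^ m)).
        { unfold i. rewrite pow_add. simpl. ring. }
        assert (Hem : 0 <= e ^ m <= 1) by (split; [apply pow_le; lra|apply pow_le_one; lra]).
        assert (Hhi : (1 / 2) ^ i <= (1 / 2) ^ S m).
        { unfold i. rewrite pow_add. assert ((1 / 2) ^ S s <= 1) by (apply pow_le_one; lra).
          assert (0 < (1 / 2) ^ S s) by (apply pow_lt; lra). nra. }
        rewrite Hee.
        apply Rle_trans with (b i * (e * (e ^ S s * e ^ m))).
        { apply Rmult_le_compat_r; trivial. apply Rmult_le_pos; [lra|]. apply Rmult_le_pos; lra. }
        rewrite <- Rmult_assoc. apply Rmult_le_compat.
        * apply Rmult_le_pos; lra.
        * apply Rmult_le_pos; lra.
        * lra.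
        * rewrite <- (Rmult_1_r (e ^ S s)) at 2. apply Rmult_le_compat_l; lra.
      + rewrite Cmod_0. apply Rmult_le_pos; lra. }
  eapply Rle_trans; [exact G|]. apply Rmult_le_compat_r; [lra|].
  assert (0 < (1 / 2) ^ m) by (apply pow_lt; lra). lra.
Qed.

End Resummation.

Lemma quot_shift e (y : nat -> C) n i m : quot e (fun j => y (n + j)%nat) i m = quot e y i (n + m).
Proof.
  revert m. induction i as [|i IH]; intros m; simpl; trivial.
  rewrite !IH. now rewrite Nat.add_succ_r.
Qed.

Lemma quot_minus e u v i m : quot e (fun j => u j - v j)%C i m = (quot e u i m - quot e v i m)%C.
Proof. revert m. induction i as [|i IH]; intros m; simpl; trivial. rewrite !IH. ring. Qed.

Lemma quot_bound e (u : nat -> C) k i m : 0 < e -> 0 <= k ->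
  (forall j, (m <= j <= m + i)%nat -> Cmod (u j) <= k) -> Cmod (quot e u i m) <= (2 / e) ^ i * k.
Proof.
  intros He Hk. revert m. induction i as [|i IH]; intros m H; simpl.
  - rewrite Rmult_1_l. apply H. lia.
  - rewrite Cmod_rmult, Rabs_pos_eq by (left; now apply Rinv_0_lt_compat).
    assert (H1 : Cmod (quot e u i (S m)) <= (2 / e) ^ i * k) by (apply IH; intros; apply H; lia).
    assert (H2 : Cmod (quot e u i m) <= (2 / e) ^ i * k) by (apply IH; intros; apply H; lia).
    replace (2 / e * (2 / e) ^ i * k) with (/ e * ((2 / e) ^ i * k + (2 / e) ^ i * k)) by (field; lra).
    apply Rmult_le_compat_l; [left; now apply Rinv_0_lt_compat|].
    eapply Rle_trans; [apply Cmod_minus_le|]. lra.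
Qed.

Lemma quot_of_chain e N P (W : nat -> nat -> C) : e <> 0 ->
  (forall n i, (n < P)%nat -> (i < N)%nat -> W (S n) i = (W n i + RtoC e * W n (S i))%C) ->
  forall i m, (i <= N)%nat -> (i + m <= P)%nat -> quot e (fun j => W j 0%nat) i m = W m i.
Proof.
  intros He H. induction i as [|i IH]; intros m Hi Hm; simpl; trivial.
  rewrite !IH, H, RtoC_inv by (trivial; lia). field. intros E. apply RtoC_inj in E. contradiction.
Qed.

(** Near the right end of the interval the recurrence is no longer available, as its last point
    would lie outside. Up to N further values are determined by the chain relations alone, each step
    at most doubling the bound because e <= 1. *)
Lemma chain_bound e N (W : nat -> nat -> C) n : 0 < e <= 1 ->
  (forall n i, (i < N)%nat -> W (S n) i = (W n i + RtoC e * W n (S i))%C) ->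
  forall j i, (i + j <= N)%nat -> Cmod (W (n + j)%nat i) <= 2 ^ j * vnorm N (W n).
Proof.
  intros He H. induction j as [|j IH]; intros i Hij.
  - rewrite Nat.add_0_r. simpl. rewrite Rmult_1_l. apply vnorm_ge. lia.
  - rewrite Nat.add_succ_r, H by lia. eapply Rle_trans; [apply Cmod_triangle|].
    rewrite Cmod_rmult, Rabs_pos_eq by lra.
    pose proof (IH i ltac:(lia)) as H1. pose proof (IH (S i) ltac:(lia)) as H2.
    pose proof (Cmod_ge_0 (W (n + j)%nat (S i))). simpl. nra.
Qed.

(** The ceiling of A / e, since [up] exceeds the floor by 1. *)
Definition first_index (A e : R) : Z := (1 - up (- (A / e)))%Z.

Lemma first_index_spec A e : 0 < e -> A <= IZR (first_index A e) * e < A + e.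
Proof.
  intros He. destruct (archimed (- (A / e))) as [H1 H2]. unfold first_index. rewrite minus_IZR.
  assert (E : A = A / e * e) by (field; lra).
  set (r := A / e) in *. rewrite E. split; [apply Rmult_le_compat_r; lra|].
  replace (r * e + e) with ((r + 1) * e) by ring. apply Rmult_lt_compat_r; lra.
Qed.

Lemma first_index_le A e k : 0 < e -> A <= IZR k * e -> (first_index A e <= k)%Z.
Proof.
  intros He Hk. destruct (first_index_spec A e He) as [_ H].
  apply Z.lt_succ_r. apply lt_IZR. rewrite succ_IZR.
  apply (Rmult_lt_reg_r e); trivial. lra.
Qed.

Section AsymptoticSolution.
Variables (N : nat) (A B e0 : R) (a : nat -> R -> R -> C) (sc : nat -> fn).
Let l := S N.
Hypothesis hAB : A < B.
Variables (e2 k0 K : R).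
Hypothesis He2 : 0 < e2 <= e0.
Hypothesis Hk0 : 0 < k0.
Hypothesis HK : 1 <= K.
Hypothesis Hlow : forall x e, cint A B x -> 0 <= e <= e2 -> k0 <= Cmod (a l x e).
Hypothesis Hsc : forall r x e, (r <= N)%nat -> cint A B x -> 0 < e < e2 -> Cmod (sc r x e) <= K.
Hypothesis Hrec : forall x e (y : nat -> C), e <> 0 -> a l x e <> RtoC 0 ->
  csum (fun j => a j x e * y j)%C l =
  (a l x e * RtoC (e ^ l) * (quot e y l 0 + csum (fun r => sc r x e * quot e y r 0)%C N))%C.

Lemma leading_nonzero x e : cint A B x -> 0 <= e <= e2 -> a l x e <> RtoC 0.
Proof. intros Hx He E. specialize (Hlow x e Hx He). rewrite E, Cmod_0 in Hlow. lra. Qed.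

Section FixedStep.
Variables (Gam : fn) (e : R).
Hypothesis He : 0 < e < e2.

Definition grid (n : nat) : R := IZR (first_index A e + Z.of_nat n) * e.

(** Iteration of the exact system from the scaled differences of the resummed series at the first
    grid point. It is continued beyond the interval as well, where its values are not constrained by
    the notion of a solution. *)
Fixpoint true_vector (n : nat) (i : nat) : C :=
  match n with
  | O => quot e (fun j => Gam (grid j) e) i 0
  | S m => apply_step N (companion N sc) (grid m) e (true_vector m) i
  end.

Definition true_solution (k : Z) : C :=
  if Z_lt_dec k (first_index A e) then RtoC 0 else true_vector (Z.to_nat (k - first_index A e)) 0.

Lemma grid_add n j : grid (n + j) = grid n + INR j * e.
Proof.
  unfold grid. rewrite Nat2Z.inj_add, Z.add_assoc, plus_IZR, <- (INR_IZR_INZ j). ring.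
Qed.

Lemma grid_start : A <= grid 0 < A + e.
Proof. unfold grid. rewrite Z.add_0_r. apply first_index_spec. lra. Qed.

Lemma true_vector_chain n i : (i < N)%nat ->
  true_vector (S n) i = (true_vector n i + RtoC e * true_vector n (S i))%C.
Proof. intros Hi. simpl. now apply companion_step. Qed.

Lemma true_vector_last n : true_vector (S n) N =
  (true_vector n N - RtoC e * csum (fun k => sc k (grid n) e * true_vector n k)%C N)%C.
Proof. apply companion_last. Qed.

Lemma true_solution_index k : (first_index A e <= k)%Z -> forall j,
  true_solution (k + Z.of_nat j) = true_vector (Z.to_nat (k - first_index A e) + j) 0.
Proof.
  intros Hk j. unfold true_solution. destruct (Z_lt_dec (k + Z.of_nat j) (first_index A e)); [lia|].
  f_equal. lia.
Qed.

Lemma grid_index k : (first_index A e <= k)%Z -> grid (Z.to_nat (k - first_index A e)) = IZR k * e.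
Proof. intros Hk. unfold grid. do 2 f_equal. rewrite Z2Nat.id; lia. Qed.

Lemma true_solution_correct : solution l A B a e true_solution.
Proof.
  intros k Hk. pose proof (Hk 0%nat ltac:(lia)) as Hx. simpl in Hx. rewrite Z.add_0_r in Hx.
  assert (Hidx : (first_index A e <= k)%Z) by (apply first_index_le; [lra|apply Hx]).
  set (n := Z.to_nat (k - first_index A e)).
  rewrite sum_n_csum.
  rewrite (csum_ext _ (fun j => a j (IZR k * e) e * true_vector (n + j) 0)%C).
  2:{ intros j _. now rewrite true_solution_index. }
  rewrite (Hrec (IZR k * e) e (fun j => true_vector (n + j) 0)) by (try lra; apply leading_nonzero; trivial; lra).
  assert (HQ : forall i, (i <= N)%nat -> quot e (fun j => true_vector (n + j) 0) i 0 = true_vector n i).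
  { intros i Hi. rewrite (quot_shift e (fun j => true_vector j 0) n i 0), Nat.add_0_r.
    eapply (quot_of_chain e N _ true_vector); trivial; [lra|]. intros; now apply true_vector_chain. }
  assert (HQ1 : quot e (fun j => true_vector (n + j) 0) N 1 = true_vector (S n) N).
  { rewrite (quot_shift e (fun j => true_vector j 0) n N 1), Nat.add_1_r.
    eapply (quot_of_chain e N _ true_vector); trivial; [lra|]. intros; now apply true_vector_chain. }
  rewrite (csum_ext _ (fun r => sc r (IZR k * e) e * true_vector n r)%C).
  2:{ intros r Hr. now rewrite HQ. }
  change (quot e (fun j => true_vector (n + j) 0) l 0) with
    (RtoC (/ e) * (quot e (fun j => true_vector (n + j) 0%nat) N 1 - quot e (fun j => true_vector (n + j) 0%nat) N 0))%C.
  rewrite HQ1, HQ, true_vector_last by lia. unfold n. rewrite grid_index by trivial.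
  rewrite RtoC_inv by lra. refine ((fun H : @eq C _ _ => H) _).
  field. intros E. apply RtoC_inj in E. lra.
Qed.

(* The scaled differences of the error satisfy the companion system forced by the residual. *)
Lemma error_estimate (gam : R -> C) (rho eta : R) :
  e <= 1 -> INR (S N) * K * e <= 1 / 2 -> A + INR l * e <= B -> 0 <= rho -> 0 <= eta ->
  (forall x, cint A B x -> cint A B (x + INR l * e) ->
     Cmod (csum (fun j => a j x e * gam (x + INR j * e)%R)%C l) <= rho) ->
  (forall x, cint A B x -> Cmod (Gam x e - gam x) <= eta) ->
  forall k, cint A B (IZR k * e) -> Cmod (true_solution k - gam (IZR k * e)) <=
    2 ^ N * (gronwall_constant N K (B - A) * (INR (S N) * ((2 / e) ^ N * eta) + / k0 * (/ e ^ l * rho))).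
Proof.
  intros He1 Hsmall Hlen Hrho Heta Hres Hini k Hk.
  assert (Hidx : (first_index A e <= k)%Z) by (apply first_index_le; [lra|apply Hk]).
  set (n := Z.to_nat (k - first_index A e)).
  assert (Hgn : grid n = IZR k * e) by now apply grid_index.
  pose proof grid_start as Hg0.
  set (g := fun j => gam (grid j)).
  set (W := fun m i => (true_vector m i - quot e g i m)%C).
  assert (Hgrid : forall m, A <= grid m).
  { intros m. rewrite <- (Nat.add_0_l m), grid_add. pose proof (pos_INR m).
    assert (0 <= INR m * e) by (apply Rmult_le_pos; lra). lra. }
  assert (Hchain : forall m i, (i < N)%nat -> W (S m) i = (W m i + RtoC e * W m (S i))%C).
  { intros m i Hi. unfold W. rewrite true_vector_chain, (quot_step e g i m) by (trivial; lra). ring. }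
  (* The residual of the comparison sequence divided by a_l e^l, as it enters the monic equation. *)
  set (r := fun m => (/ a l (grid m) e * (RtoC (/ e ^ l) * csum (fun j => a j (grid m) e * g (m + j)%nat)%C l))%C).
  assert (Hlast : forall m, cint A B (grid m) ->
     W (S m) N = (W m N - RtoC e * csum (fun k => sc k (grid m) e * W m k)%C N - RtoC e * r m)%C).
  { intros m Hm. pose proof (leading_nonzero (grid m) e Hm ltac:(lra)) as Hne.
    assert (Hen : e ^ l <> 0) by (apply pow_nonzero; lra).
    assert (HR : r m = (quot e g l m + csum (fun k => sc k (grid m) e * quot e g k m)%C N)%C).
    { unfold r. rewrite (Hrec (grid m) e (fun j => g (m + j)%nat)) by (trivial; lra).
      rewrite quot_shift, Nat.add_0_r.
      rewrite (csum_ext (fun r => sc r (grid m) e * quot e (fun j => g (m + j)%nat) r 0)%C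
         (fun k => sc k (grid m) e * quot e g k m)%C)
        by (intros i _; now rewrite quot_shift, Nat.add_0_r).
      rewrite RtoC_inv by trivial. field. split; trivial. intros E. apply RtoC_inj in E. contradiction. }
    unfold W. rewrite true_vector_last, (quot_step e g N m) by lra. fold l. rewrite HR.
    rewrite (csum_ext (fun k => sc k (grid m) e * (true_vector m k - quot e g k m))%C
      (fun k => sc k (grid m) e * true_vector m k + - RtoC 1 * (sc k (grid m) e * quot e g k m))%C)
      by (intros; ring).
    rewrite csum_plus, csum_scal. ring. }
  assert (Hstart : A + e + INR N * e <= B).
  { unfold l in Hlen. rewrite S_INR in Hlen. lra. }
  (* base index from which [n] is reached in at most N steps inside the interval *)
  set (n' := (n - N)%nat).
  assert (Hn' : grid n' + INR N * e <= B).
  { unfold n'. destruct (le_lt_dec N n) as [H|H].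
    - rewrite <- grid_add. replace (n - N + N)%nat with n by lia. rewrite Hgn. apply Hk.
    - replace (n - N)%nat with 0%nat by lia. lra. }
  assert (Hn0 : 0 <= INR n' * e) by (apply Rmult_le_pos; [apply pos_INR|lra]).
  assert (HGrid' : forall m, (m < n')%nat -> cint A B (grid m) /\ cint A B (grid m + INR l * e)).
  { intros m Hm. assert (E : grid n' = grid m + INR (n' - m) * e).
    { rewrite <- grid_add. f_equal. lia. }
    assert (1 <= INR (n' - m)) by (rewrite <- INR_1; apply le_INR; lia).
    assert (1 * e <= INR (n' - m) * e) by (apply Rmult_le_compat_r; lra).
    pose proof (Hgrid m). unfold l. rewrite S_INR. pose proof (pos_INR N).
    assert (0 <= INR N * e) by (apply Rmult_le_pos; lra). split; split; lra. }
  assert (HW0 : vnorm N (W 0%nat) <= INR (S N) * ((2 / e) ^ N * eta)).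
  { apply vnorm_le. intros i Hi. unfold W. simpl true_vector.
    rewrite <- quot_minus.
    assert (H2e : 1 <= 2 / e).
    { apply (Rmult_le_reg_r e); [lra|]. unfold Rdiv. rewrite Rmult_assoc, Rinv_l; lra. }
    apply Rle_trans with ((2 / e) ^ i * eta).
    - apply quot_bound; trivial; [lra|]. intros j Hj. apply Hini.
      split; [apply Hgrid|]. rewrite <- (Nat.add_0_l j), grid_add.
      assert (INR j <= INR N) by (apply le_INR; lia).
      assert (INR j * e <= INR N * e) by (apply Rmult_le_compat_r; lra). lra.
    - apply Rmult_le_compat_r; trivial. now apply Rle_pow. }
  assert (Hk0' : 0 < / k0) by now apply Rinv_0_lt_compat.
  assert (Hel : 0 < / e ^ l) by (apply Rinv_0_lt_compat, pow_lt; lra).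
  set (G := / k0 * (/ e ^ l * rho)).
  assert (HG0 : 0 <= G) by (unfold G; repeat apply Rmult_le_pos; lra).
  destruct (gronwall N (fun m i k => companion N sc i k (grid m) e)
    (fun m i => if Nat.eq_dec i N then (- r m)%C else RtoC 0) W e K G (B - A) n') as [HGr _]; trivial; try lra.
  - pose proof (grid_add 0 n') as E. simpl in E. pose proof (pos_INR N).
    assert (0 <= INR N * e) by (apply Rmult_le_pos; lra). lra.
  - intros m i j Hm Hi Hj. destruct (HGrid' m Hm) as [H1 _]. unfold companion.
    specialize (Hsc j (grid m) e Hj H1 He).
    destruct (Nat.eq_dec i N); [rewrite Cmod_mult, Cmod_opp, Cmod_1; lra|].
    destruct (Nat.eq_dec j (S i)); [rewrite Cmod_1; lra|rewrite Cmod_0; lra].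
  - intros m i Hm Hi. destruct (HGrid' m Hm) as [H1 H2].
    destruct (Nat.eq_dec i N); [|rewrite Cmod_0; trivial].
    rewrite Cmod_opp. unfold r, G. rewrite !Cmod_mult, Cmod_R, Rabs_pos_eq by lra.
    pose proof (Hlow (grid m) e H1 ltac:(lra)) as Hl.
    rewrite Cmod_inv by (apply leading_nonzero; trivial; lra).
    apply Rmult_le_compat.
    + left. apply Rinv_0_lt_compat. lra.
    + apply Rmult_le_pos; [lra|apply Cmod_ge_0].
    + apply Rinv_le_contravar; lra.
    + apply Rmult_le_compat_l; [lra|].
      rewrite (csum_ext (fun j => a j (grid m) e * g (m + j)%nat)%C
        (fun j => a j (grid m) e * gam (grid m + INR j * e)%R)%C).
      * now apply Hres.
      * intros j _. unfold g. now rewrite grid_add.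
  - intros m i Hm Hi. destruct (HGrid' m Hm) as [H1 _].
    replace (W m i + RtoC e * (csum (fun k => companion N sc i k (grid m) e * W m k)%C N +
      (if Nat.eq_dec i N then - r m else RtoC 0)))%C with
      (apply_step N (companion N sc) (grid m) e (W m) i + RtoC e * (if Nat.eq_dec i N then - r m else RtoC 0))%C
      by (unfold apply_step; ring).
    destruct (Nat.eq_dec i N) as [->|Hne].
    + rewrite companion_last, Hlast by trivial. ring.
    + rewrite companion_step, Hchain by lia. ring.
  - assert (HWn : Cmod (W n 0%nat) <= 2 ^ (n - n') * vnorm N (W n')).
    { replace n with (n' + (n - n'))%nat at 1 by (unfold n'; lia).
      apply (chain_bound e N W); trivial; [lra|unfold n'; lia]. }
    assert (E : W n 0%nat = (true_solution k - gam (IZR k * e)%R)%C).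
    { unfold W. simpl quot. unfold g. rewrite Hgn. f_equal.
      rewrite <- (Z.add_0_r k). change 0%Z with (Z.of_nat 0). rewrite (true_solution_index k Hidx 0).
      now rewrite Nat.add_0_r. }
    rewrite <- E. eapply Rle_trans; [exact HWn|].
    apply Rmult_le_compat; [apply pow_le; lra|apply vnorm_pos|apply Rle_pow; [lra|unfold n'; lia]|].
    eapply Rle_trans; [exact HGr|]. apply Rmult_le_compat_l.
    + unfold gronwall_constant. apply Rmult_le_pos; [left; apply exp_pos|].
      assert (0 <= INR (S N) * (B - A)) by (apply Rmult_le_pos; [apply pos_INR|lra]). lra.
    + fold G. lra.
Qed.

End FixedStep.

Theorem asymptotic_solution Psi : formal_solution l A B a Psi ->
  exists y : R -> Z -> C, (forall e, 0 < e <= e0 -> solution l A B a e (y e)) /\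
  forall s, unif_little_o (fun e k => cint A B (IZR k * e))
    (fun e k => Cmod (Cminus (y e k) (partial_series Psi s (IZR k * e) e))) (fun e => e ^ s).
Proof.
  intros [HPsi Hform]. destruct (resummation A B Psi HPsi) as [Gam HGam].
  (* For e >= e2 the zero sequence is taken, which is always a solution; the asymptotics concern
     small e only. *)
  exists (fun e k => if Rlt_dec e e2 then true_solution Gam e k else RtoC 0). split.
  - intros e He. destruct (Rlt_dec e e2) as [H|H].
    + apply true_solution_correct. lra.
    + intros k Hk. rewrite sum_n_csum. apply csum_zero. intros; ring.
  (* The comparison is with the partial sum of order s + l + 1. The additional orders compensate for
     the factor e^-l attached to the residual and for e^-N from the difference quotients of the
     initial error. *)
  - intros s. set (s' := (s + l)%nat).
    destruct (HGam s) as [K1 [d1 [Hd1 [HK1 H1]]]].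
    destruct (HGam (s' + 1)%nat) as [K2 [d2 [Hd2 [HK2 H2]]]].
    destruct (unif_little_o_le _ _ _ 1 (Hform (s' + 1)%nat) ltac:(lra)) as [d3 [Hd3 H3]].
    assert (Hc1 : 0 < INR (S N) * K) by (apply Rmult_lt_0_compat; [apply lt_0_INR; lia|lra]).
    assert (Hl : 0 < INR l) by (apply lt_0_INR; unfold l; lia).
    set (d := Rmin (Rmin (Rmin d1 d2) (Rmin d3 e2)) (Rmin 1 (Rmin (1 / (2 * (INR (S N) * K))) ((B - A) / INR l)))).
    assert (Hd : 0 < d).
    { unfold d. repeat apply Rmin_pos; try lra; apply Rdiv_lt_0_compat; lra. }
    set (C0 := gronwall_constant N K (B - A)).
    assert (HC0 : 0 <= C0).
    { unfold C0, gronwall_constant. apply Rmult_le_pos; [left; apply exp_pos|].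
      assert (0 <= INR (S N) * (B - A)) by (apply Rmult_le_pos; [apply pos_INR|lra]). lra. }
    apply (unif_little_o_of_bound _ _ s
      (2 ^ N * (C0 * (INR (S N) * (2 ^ N * K2) + / k0)) + (K2 + K1)) d Hd).
    intros e [He Hed] k Hk.
    assert (Hle : forall p q, e < Rmin p q -> e < p /\ e < q).
    { intros p q Hpq. split; eapply Rlt_le_trans; try exact Hpq; [apply Rmin_l|apply Rmin_r]. }
    destruct (Hle _ _ Hed) as [Ha Hb]. destruct (Hle _ _ Ha) as [Haa Hab].
    destruct (Hle _ _ Haa) as [E1 E2]. destruct (Hle _ _ Hab) as [E3 E4].
    destruct (Hle _ _ Hb) as [E5 Hbb]. destruct (Hle _ _ Hbb) as [E6 E7].
    destruct (Rlt_dec e e2) as [_|n]; [|contradiction].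
    set (x := IZR k * e) in *.
    assert (Hsm : INR (S N) * K * e <= 1 / 2).
    { apply (Rmult_lt_compat_l (INR (S N) * K)) in E6; trivial.
      unfold Rdiv in E6. rewrite Rinv_mult, Rmult_1_l in E6.
      set (z := INR (S N) * K) in *. replace (z * (/ 2 * / z)) with (1 / 2) in E6 by (field; lra). lra. }
    assert (Hlen : A + INR l * e <= B).
    { apply (Rmult_lt_compat_l (INR l)) in E7; trivial.
      replace (INR l * ((B - A) / INR l)) with (B - A) in E7 by (field; lra). lra. }
    assert (Hpe : forall n, 0 < e ^ n) by (intros; now apply pow_lt).
    pose proof (error_estimate Gam e ltac:(lra) (fun x => partial_series Psi (s' + 1) x e)
      (e ^ (s' + 1)) (K2 * e ^ S (s' + 1)) ltac:(lra) Hsm Hlen) as HE.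
    specialize (HE (Rlt_le _ _ (Hpe _)) ltac:(apply Rmult_le_pos; [lra|left; apply Hpe])).
    lapply HE; clear HE.
    2:{ intros z Hz1 Hz2. rewrite <- sum_n_csum.
        eapply Rle_trans; [apply (H3 e (conj He E3) z (conj Hz1 Hz2))|]. lra. }
    intros HE. lapply HE; clear HE.
    2:{ intros z Hz. apply H2; trivial. lra. }
    intros HE. specialize (HE k Hk). fold x C0 in HE.
    eapply Rle_trans; [apply (Cmod_triangle_sub _ (partial_series Psi (s' + 1) x e))|].
    assert (HP : Cmod (partial_series Psi (s' + 1) x e - partial_series Psi s x e) <= (K2 + K1) * e ^ S s).
    { eapply Rle_trans; [apply (Cmod_triangle_sub _ (Gam x e))|].
      rewrite (Cmod_sub_sym _ (Gam x e)).
      pose proof (H1 x e Hk ltac:(lra)) as Q1. pose proof (H2 x e Hk ltac:(lra)) as Q2.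
      assert (e ^ S (s' + 1) <= e ^ S s).
      { unfold s'. replace (S (s + l + 1)) with (S s + (l + 1))%nat by lia. rewrite pow_add.
        assert (e ^ (l + 1) <= 1) by (apply pow_le_one; lra). pose proof (Hpe (S s)). nra. }
      assert (K2 * e ^ S (s' + 1) <= K2 * e ^ S s) by (apply Rmult_le_compat_l; lra). lra. }
    assert (HF : INR (S N) * ((2 / e) ^ N * (K2 * e ^ S (s' + 1))) + / k0 * (/ e ^ l * e ^ (s' + 1))
      <= (INR (S N) * (2 ^ N * K2) + / k0) * e ^ S s).
    { unfold s'. replace (s + l + 1)%nat with (S s + l)%nat by lia.
      replace (S (S s + l)) with (S s + N + 2)%nat by (unfold l; lia).
      assert (HeN : e ^ N <> 0) by (apply Rgt_not_eq, Hpe). assert (Hel : e ^ l <> 0) by (apply Rgt_not_eq, Hpe).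
      rewrite (pow_add e (S s) l), !(pow_add e (S s + N) 2), (pow_add e (S s) N).
      unfold Rdiv. rewrite Rpow_mult_distr, pow_inv.
      replace (INR (S N) * (2 ^ N * / e ^ N * (K2 * (e ^ S s * e ^ N * e ^ 2))) + / k0 * (/ e ^ l * (e ^ S s * e ^ l)))
       with ((INR (S N) * (2 ^ N * K2) * e ^ 2 + / k0) * e ^ S s) by (field; repeat split; trivial; lra).
      apply Rmult_le_compat_r; [left; apply Hpe|].
      assert (e ^ 2 <= 1) by (apply pow_le_one; lra).
      assert (0 <= INR (S N) * (2 ^ N * K2)).
      { apply Rmult_le_pos; [apply pos_INR|]. apply Rmult_le_pos; [apply pow_le|]; lra. }
      nra. }
    assert (HG : 2 ^ N * (C0 * (INR (S N) * ((2 / e) ^ N * (K2 * e ^ S (s' + 1))) + / k0 * (/ e ^ l * e ^ (s' + 1))))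
      <= 2 ^ N * (C0 * ((INR (S N) * (2 ^ N * K2) + / k0) * e ^ S s))).
    { apply Rmult_le_compat_l; [apply pow_le; lra|]. now apply Rmult_le_compat_l. }
    lra.
Qed.

End AsymptoticSolution.

(** * A fundamental system of smooth solutions *)

Lemma one_step_combination A B e1 N M (Z : nat -> nat -> fn) (c : nat -> C) :
  (forall m, (m <= N)%nat -> one_step A B e1 N M (Z m) (fun _ _ _ => RtoC 0)) ->
  one_step A B e1 N M (fun i x e => csum (fun m => c m * Z m i x e)%C N) (fun _ _ _ => RtoC 0).
Proof.
  intros H i x e Hi Hx.
  rewrite (csum_ext _ (fun m => c m * Z m i x e + RtoC e * (c m * csum (fun k => M i k x e * Z m k x e)%C N))%C).
  2:{ intros m Hm. rewrite (H m Hm i x e Hi Hx). ring. }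
  rewrite csum_plus, csum_scal.
  rewrite (csum_ext (fun k => M i k x e * csum (fun m => c m * Z m k x e)%C N)%C
    (fun k => csum (fun m => c m * (M i k x e * Z m k x e))%C N)).
  2:{ intros k Hk. rewrite <- csum_scal. apply csum_ext. intros; ring. }
  rewrite csum_swap.
  rewrite (csum_ext (fun m => c m * csum (fun k => M i k x e * Z m k x e)%C N)%C
    (fun j => csum (fun k => c j * (M i k x e * Z j k x e))%C N)).
  2:{ intros m Hm. now rewrite csum_scal. }
  ring.
Qed.

Definition unit_vector (m i : nat) : C := if Nat.eq_dec m i then RtoC 1 else RtoC 0.

Lemma csum_unit_vector N (c : nat -> C) i : (i <= N)%nat -> csum (fun m => c m * unit_vector m i)%C N = c i.
Proof.
  intros Hi. rewrite (csum_single _ N i Hi).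
  - unfold unit_vector. destruct (Nat.eq_dec i i); [ring|congruence].
  - intros m Hm Hne. unfold unit_vector. destruct (Nat.eq_dec m i); [congruence|ring].
Qed.

Section FundamentalSystem.
Variables (A B e1 : R) (N : nat) (beta : nat -> fn) (K a1 a2 a3 : R).
Hypothesis Ha : A < a1 /\ a1 < a2 /\ a2 < a3 /\ a3 < B.
Let U := rect A B 0 e1.
Hypothesis Hbeta : forall k, (k <= N)%nat -> smooth2 U (beta k).
Hypothesis HK : forall k x e, (k <= N)%nat -> U x e -> Cmod (beta k x e) <= K.
Hypothesis HK1 : 1 <= K.
Hypothesis Hsmall : INR (S N) * K * e1 <= 1 / 2.
Hypothesis He1 : 0 < e1 /\ e1 <= 1 /\ e1 <= a1 - A /\ e1 <= B - a3.
Let Y (m : nat) := stage2 A B N beta a1 a2 a3 (unit_vector m).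
Let Z (m : nat) := stage1 A B N (companion N beta) a1 a2 (unit_vector m).
Let C0 := gronwall_constant N K (B - A).

(** The combination is followed from x to a point right of a2, where the two constructions coincide,
    and from there along the cut system to a point left of a1, where it equals the vector c itself.
    Each of the two journeys costs one Gronwall factor. *)
Lemma fundamental_bound c x e : U x e ->
  vnorm N c <= C0 * C0 * vnorm N (fun i => csum (fun m => c m * Y m i x e)%C N).
Proof.
  intros [[Hx1 Hx2] He].
  assert (HC0 : 0 <= C0).
  { unfold C0, gronwall_constant. apply Rmult_le_pos; [left; apply exp_pos|].
    assert (0 <= INR (S N) * (B - A)) by (apply Rmult_le_pos; [apply pos_INR|lra]). lra. }
  assert (H1 : exists n, a2 < x + INR n * e < B).
  { destruct (Rlt_dec a2 x) as [H|H]; [exists 0%nat; simpl; lra|].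
    destruct (floor_steps (a2 - x) e) as [n [H1 H2]]; try lra.
    exists (S n). rewrite S_INR. lra. }
  destruct H1 as [n [Hn1 Hn2]].
  set (x' := x + INR n * e) in *.
  set (W := fun i x e => csum (fun m => c m * Y m i x e)%C N).
  set (V := fun i x e => csum (fun m => c m * Z m i x e)%C N).
  assert (HW : one_step A B e1 N (companion N beta) W (fun _ _ _ => RtoC 0)).
  { apply (one_step_combination A B e1 N _ Y). intros m Hm. now apply (stage2_one_step A B e1 N beta K). }
  assert (HV : one_step A B e1 N (cut_matrix A (companion N beta) a1 a2) V (fun _ _ _ => RtoC 0)).
  { apply (one_step_combination A B e1 N _ Z). intros m Hm. now apply (Z1_one_step A B e1 N beta a1 a2 a3). }
  assert (HM : forall i k x e, (i <= N)%nat -> (k <= N)%nat -> U x e -> Cmod (companion N beta i k x e) <= K).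
  { intros. now apply (companion_bound A B e1 N beta K). }
  assert (F1 : vnorm N (fun i => W i x' e) <= C0 * (vnorm N (fun i => W i x e) + 0)).
  { apply (one_step_gronwall A B e1 N (companion N beta) K HM ltac:(lra) Hsmall W (fun _ _ _ => RtoC 0) 0 x e n);
      trivial; try lra. intros. rewrite Cmod_0. lra. }
  assert (E : vnorm N (fun i => W i x' e) = vnorm N (fun i => V i x' e)).
  { apply vnorm_ext. intros i Hi. unfold W, V. apply csum_ext. intros m Hm. f_equal.
    apply (stage2_right A B e1 N beta K a1 a2 a3); trivial; try lra. split; lra. }
  destruct (floor_steps (x' - a1) e) as [p [Hp1 Hp2]]; try lra.
  set (x'' := x' - INR (S p) * e).
  assert (Hx'' : A < x'' < a1) by (unfold x''; rewrite S_INR; lra).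
  assert (F2 : vnorm N (fun i => V i x'' e) <= C0 * (vnorm N (fun i => V i x' e) + 0)).
  { replace x' with (x'' + INR (S p) * e) by (unfold x''; ring).
    assert (HM' : forall i k x e, (i <= N)%nat -> (k <= N)%nat -> U x e ->
      Cmod (cut_matrix A (companion N beta) a1 a2 i k x e) <= K).
    { intros. apply (cut_matrix_bound A B e1 N _ K); trivial; lra. }
    refine (proj2 (one_step_gronwall A B e1 N (cut_matrix A (companion N beta) a1 a2) K HM' ltac:(lra) Hsmall
      V (fun _ _ _ => RtoC 0) 0 x'' e (S p) ltac:(lra) HV _ He _ _)).
    - intros. rewrite Cmod_0. lra.
    - apply Hx''.
    - unfold x''. lra. }
  assert (E2 : vnorm N (fun i => V i x'' e) = vnorm N c).
  { apply vnorm_ext. intros i Hi. unfold V.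
    rewrite (csum_ext _ (fun m => c m * unit_vector m i)%C); [now apply csum_unit_vector|].
    intros m Hm. f_equal. apply (stage1_left A B N); trivial; lra. }
  rewrite E2, <- E in F2. rewrite Rplus_0_r in *. rewrite Rmult_assoc.
  eapply Rle_trans; [exact F2|]. now apply Rmult_le_compat_l.
Qed.

End FundamentalSystem.

Theorem fundamental_system A B e2 N beta K : A < B -> 0 < e2 -> 1 <= K ->
  (forall k, (k <= N)%nat -> smooth2 (rect A B 0 e2) (beta k)) ->
  (forall k x e, (k <= N)%nat -> rect A B 0 e2 x e -> Cmod (beta k x e) <= K) ->
  exists e1 C0 (Y : nat -> nat -> fn), 0 < e1 <= e2 /\ 0 <= C0 /\ INR (S N) * e1 < B - A /\
  (forall m i, (i <= N)%nat -> smooth2 (rect A B 0 e1) (Y m i)) /\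
  (forall m, one_step A B e1 N (companion N beta) (Y m) (fun _ _ _ => RtoC 0)) /\
  forall c x e, rect A B 0 e1 x e ->
    vnorm N c <= C0 * vnorm N (fun i => csum (fun m => c m * Y m i x e)%C N).
Proof.
  intros HAB He2 HK1 Hs HK.
  assert (HS : 1 <= INR (S N)) by (rewrite S_INR; pose proof (pos_INR N); lra).
  assert (HSK : 0 < INR (S N) * K) by (apply Rmult_lt_0_compat; lra).
  set (h := B - A) in *. assert (Hh : 0 < h) by (unfold h; lra).
  (* The third entry is the Gronwall smallness condition. The last makes N + 1 steps shorter than a
     quarter of the interval; with a1, a2, a3 at the quarter points it also gives e1 <= a1 - A and
     e1 <= B - a3. *)
  set (e1 := Rmin (Rmin e2 1) (Rmin (1 / 2 * / (INR (S N) * K)) (h / 4 * / INR (S N)))).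
  assert (He1 : 0 < e1).
  { unfold e1. repeat apply Rmin_pos; try lra; apply Rmult_lt_0_compat; try lra; apply Rinv_0_lt_compat; lra. }
  assert (E : (e1 <= e2 /\ e1 <= 1) /\ e1 <= 1 / 2 * / (INR (S N) * K) /\ e1 <= h / 4 * / INR (S N)).
  { unfold e1. pose proof (Rmin_l (Rmin e2 1) (Rmin (1 / 2 * / (INR (S N) * K)) (h / 4 * / INR (S N)))).
    pose proof (Rmin_r (Rmin e2 1) (Rmin (1 / 2 * / (INR (S N) * K)) (h / 4 * / INR (S N)))).
    pose proof (Rmin_l e2 1). pose proof (Rmin_r e2 1).
    pose proof (Rmin_l (1 / 2 * / (INR (S N) * K)) (h / 4 * / INR (S N))).
    pose proof (Rmin_r (1 / 2 * / (INR (S N) * K)) (h / 4 * / INR (S N))). lra. }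
  destruct E as [[E1 E2] [E3 E4]].
  assert (F3 : INR (S N) * K * e1 <= 1 / 2).
  { apply (Rmult_le_compat_l (INR (S N) * K)) in E3; [|lra].
    set (z := INR (S N) * K) in *. replace (z * (1 / 2 * / z)) with (1 / 2) in E3 by (field; repeat split; lra). lra. }
  assert (F4 : INR (S N) * e1 <= h / 4).
  { apply (Rmult_le_compat_l (INR (S N))) in E4; [|lra].
    set (z := INR (S N)) in *. replace (z * (h / 4 * / z)) with (h / 4) in E4 by (field; repeat split; lra). lra. }
  assert (F5 : e1 <= h / 4).
  { eapply Rle_trans; [|exact F4]. rewrite <- (Rmult_1_l e1) at 1. apply Rmult_le_compat_r; lra. }
  assert (Hsub : sub2 (rect A B 0 e1) (rect A B 0 e2)) by (intros x e [? ?]; split; lra).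
  set (a1 := A + h / 4). set (a2 := A + h / 2). set (a3 := A + 3 * h / 4).
  assert (Ha : A < a1 /\ a1 < a2 /\ a2 < a3 /\ a3 < B) by (unfold a1, a2, a3, h in *; lra).
  assert (HE : 0 < e1 /\ e1 <= 1 /\ e1 <= a1 - A /\ e1 <= B - a3) by (unfold a1, a3, h in *; lra).
  assert (Hs' : forall k, (k <= N)%nat -> smooth2 (rect A B 0 e1) (beta k)).
  { intros k Hk n. apply (Sm_sub n (rect A B 0 e2)); trivial. now apply Hs. }
  assert (HK' : forall k x e, (k <= N)%nat -> rect A B 0 e1 x e -> Cmod (beta k x e) <= K).
  { intros k x e Hk Hx. apply HK; trivial. now apply Hsub. }
  exists e1, (gronwall_constant N K (B - A) * gronwall_constant N K (B - A)).
  exists (fun m => stage2 A B N beta a1 a2 a3 (unit_vector m)).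
  split; [lra|]. split; [apply Rle_0_sqr|]. split; [lra|]. split; [|split].
  - intros m i Hi. now apply (stage2_smooth A B e1 N beta K).
  - intros m. now apply (stage2_one_step A B e1 N beta K).
  - intros c x e Hx. now apply (fundamental_bound A B e1 N beta K a1 a2 a3).
Qed.

(** * Linear dependence *)

(** The increasing enumeration of the indices different from p. *)
Definition skip (p m : nat) : nat := if Nat.ltb m p then m else S m.

Lemma csum_skip (f : nat -> C) n p : (p <= S n)%nat ->
  csum f (S n) = (f p + csum (fun m => f (skip p m)) n)%C.
Proof.
  revert p. induction n as [|n IH]; intros p Hp.
  - simpl. unfold skip. destruct p as [|[|p]]; [| |lia]; simpl; ring.
  - destruct (Nat.eq_dec p (S (S n))) as [->|Hne].
    + rewrite (csum_ext (fun m => f (skip (S (S n)) m)) f).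
      * change (csum f (S (S n))) with (csum f (S n) + f (S (S n)))%C. ring.
      * intros m Hm. unfold skip. destruct (Nat.ltb_spec m (S (S n))); [trivial|lia].
    + change (csum f (S (S n))) with (csum f (S n) + f (S (S n)))%C. rewrite (IH p) by lia.
      change (csum (fun m => f (skip p m)) (S n)) with (csum (fun m => f (skip p m)) n + f (skip p (S n)))%C.
      replace (skip p (S n)) with (S (S n)); [ring|].
      unfold skip. destruct (Nat.ltb_spec (S n) p); lia.
Qed.

(** Gaussian elimination for n equations in n + 1 unknowns. With a pivot in column p of the last row
    that unknown is eliminated and recovered as -s; without a pivot the last row is zero and the
    last unknown is set to 0. *)
Lemma linear_dependence n : forall a : nat -> nat -> C, exists c : nat -> C,
  (exists m, (m <= n)%nat /\ c m <> RtoC 0) /\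
  forall i, (i < n)%nat -> csum (fun m => c m * a i m)%C n = RtoC 0.
Proof.
  induction n as [|n IH]; intros a.
  - exists (fun _ => RtoC 1). split; [|intros; lia]. exists 0%nat. split; trivial.
    intros H. apply RtoC_inj in H. lra.
  - destruct (classic (exists p, (p <= S n)%nat /\ a n p <> RtoC 0)) as [[p [Hp Hap]]|Hno].
    + destruct (IH (fun i m => a i (skip p m) - a i p * (a n (skip p m) / a n p))%C) as [c [[m [Hm Hc]] H]].
      set (s := csum (fun m => c m * (a n (skip p m) / a n p))%C n).
      exists (fun j => if Nat.eq_dec j p then (- s)%C else c (if Nat.ltb j p then j else pred j)).
      assert (Hskip : forall k, (if Nat.eq_dec (skip p k) p then (- s)%C
         else c (if Nat.ltb (skip p k) p then skip p k else pred (skip p k))) = c k).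
      { intros k. unfold skip. destruct (Nat.ltb_spec k p).
        - destruct (Nat.eq_dec k p); [lia|]. destruct (Nat.ltb_spec k p); [trivial|lia].
        - destruct (Nat.eq_dec (S k) p); [lia|]. destruct (Nat.ltb_spec (S k) p); [lia|trivial]. }
      split.
      * exists (skip p m). rewrite Hskip. split; trivial. unfold skip. destruct (Nat.ltb m p); lia.
      * intros i Hi. rewrite (csum_skip _ n p Hp).
        destruct (Nat.eq_dec p p) as [_|]; [|congruence].
        rewrite (csum_ext _ (fun k => c k * (a i (skip p k) - a i p * (a n (skip p k) / a n p))
           + a i p * (c k * (a n (skip p k) / a n p)))%C).
        2:{ intros k Hk. rewrite Hskip. ring. }
        rewrite csum_plus, csum_scal. fold s.
        destruct (Nat.eq_dec i n) as [->|Hne].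
        -- rewrite (csum_zero _ n); [ring|]. intros k Hk. field. trivial.
        -- rewrite H by lia. ring.
    + destruct (IH a) as [c [[m [Hm Hc]] H]].
      exists (fun j => if Nat.eq_dec j (S n) then RtoC 0 else c j).
      split.
      * exists m. split; [lia|]. destruct (Nat.eq_dec m (S n)); [lia|trivial].
      * intros i Hi. destruct (Nat.eq_dec i n) as [->|Hne].
        -- apply csum_zero. intros k Hk. replace (a n k) with (RtoC 0); [ring|].
           apply NNPP. intros Hk'. apply Hno. exists k. split; trivial. intros E. apply Hk'. now rewrite E.
        -- change (csum ?f (S n)) with (csum f n + f (S n))%C. cbv beta.
           destruct (Nat.eq_dec (S n) (S n)) as [_|]; [|congruence].
           rewrite (csum_ext _ (fun m => c m * a i m)%C).
           ++ rewrite H by lia. ring.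
           ++ intros k Hk. destruct (Nat.eq_dec k (S n)); [lia|trivial].
Qed.

(** * Curves missing a hyperplane *)

Lemma pigeonhole (f : nat -> nat) n p : (p < n)%nat -> (forall k, (k < n)%nat -> (f k < p)%nat) ->
  exists i j, (i < j < n)%nat /\ f i = f j.
Proof.
  intros Hp Hf. apply NNPP. intros Hno.
  assert (Hnd : NoDup (map f (seq 0 n))).
  { apply NoDup_map_NoDup_ForallPairs; [|apply seq_NoDup].
    intros x y Hx Hy E. apply in_seq in Hx. apply in_seq in Hy.
    destruct (lt_eq_lt_dec x y) as [[H|H]|H]; trivial; elim Hno; [exists x, y|exists y, x]; split; auto; lia. }
  assert (Hin : incl (map f (seq 0 n)) (seq 0 p)).
  { intros z Hz. apply in_map_iff in Hz. destruct Hz as [k [<- Hk]]. apply in_seq in Hk.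
    apply in_seq. specialize (Hf k). lia. }
  pose proof (NoDup_incl_length Hnd Hin) as H. rewrite length_map, !length_seq in H. lia.
Qed.

(* (p + 1)^2 points of a square grid, but only p^2 pieces of the curve, each too short to come
   close to two of them. *)
Lemma curve_avoidance (g : R -> C) (s t L r : R) : s <= t -> 0 <= L -> 0 < r ->
  (forall x y, s <= x <= t -> s <= y <= t -> Cmod (g x - g y) <= L * Rabs (x - y)) ->
  exists w eta, Cmod w <= r /\ 0 < eta /\ forall x, s <= x <= t -> eta <= Cmod (w - g x).
Proof.
  intros Hst HL Hr Hg.
  assert (Hex : exists p, (1 <= p)%nat /\ 8 * L * (t - s) / r < INR p).
  { destruct (INR_unbounded (8 * L * (t - s) / r)) as [p0 Hp0]. exists (S p0).
    split; [lia|]. rewrite S_INR; lra. }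
  destruct Hex as [p [Hp1 Hp]].
  assert (Hpp : 0 < INR p) by (apply lt_0_INR; lia).
  (* The mesh of the grid of (p + 1)^2 points, all of modulus at most r. The choice of p makes the
     curve move by at most h / 4 on each of its p^2 pieces, so two grid points within h / 8 of the
     same piece would be at distance at most 3 h / 4, less than the mesh. *)
  set (h := r / (2 * INR p)). assert (Hh : 0 < h) by (apply Rdiv_lt_0_compat; lra).
  set (w := fun k => (INR (k / (p + 1)) * h, INR (k mod (p + 1)) * h) : C).
  apply NNPP. intros Hno.
  set (n := ((p + 1) * (p + 1))%nat).
  set (d := (t - s) / (INR p * INR p)).
  assert (Hd : 0 <= d) by (unfold d; apply Rmult_le_pos; [lra|left; apply Rinv_0_lt_compat; nra]).
  assert (Hd2 : L * d <= h / 4).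
  { unfold d, h. apply (Rmult_le_reg_r (8 * (INR p * INR p) / r)).
    - apply Rdiv_lt_0_compat; [|trivial]. assert (0 < INR p * INR p) by nra. lra.
    - replace (L * ((t - s) / (INR p * INR p)) * (8 * (INR p * INR p) / r)) with (8 * L * (t - s) / r) by (field; repeat split; lra).
      replace (r / (2 * INR p) / 4 * (8 * (INR p * INR p) / r)) with (INR p) by (field; repeat split; lra). lra. }
  assert (Hw : forall k, (k < n)%nat -> Cmod (w k) <= r).
  { intros k Hk.
    assert (H1 : (k / (p + 1) <= p)%nat) by (apply Nat.lt_succ_r; apply Nat.Div0.div_lt_upper_bound; unfold n in Hk; lia).
    assert (H2 : (k mod (p + 1) <= p)%nat) by (pose proof (Nat.mod_upper_bound k (p + 1)); lia).
    eapply Rle_trans; [apply Cmod_le_Re_Im|].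
    change (Re (w k)) with (INR (k / (p + 1)) * h). change (Im (w k)) with (INR (k mod (p + 1)) * h).
    apply le_INR in H1. apply le_INR in H2.
    rewrite !Rabs_pos_eq by (apply Rmult_le_pos; [apply pos_INR|lra]).
    apply Rle_trans with (INR p * h + INR p * h).
    - apply Rplus_le_compat; apply Rmult_le_compat_r; lra.
    - unfold h. right. field. lra. }
  assert (Hhit : forall k, (k < n)%nat -> exists x, s <= x <= t /\ Cmod (w k - g x) < h / 8).
  { intros k Hk. apply NNPP. intros Hn. apply Hno. exists (w k), (h / 8). repeat split; auto; try lra.
    intros x Hx. destruct (Rle_dec (h / 8) (Cmod (w k - g x))) as [H|H]; trivial.
    elim Hn. exists x. split; trivial. lra. }
  assert (Hpiece : forall k, (k < n)%nat -> exists j, (j < p * p)%nat /\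
     Cmod (w k - g (s + INR j * d)) <= h / 8 + h / 4 /\ s <= s + INR j * d <= t).
  { intros k Hk. destruct (Hhit k Hk) as [x [Hx Hwx]].
    assert (Hj : exists j, (j < p * p)%nat /\ s + INR j * d <= x <= s + INR j * d + d).
    { assert (Hpd : INR (p * p) * d = t - s) by (rewrite mult_INR; unfold d; field; repeat split; lra).
      assert (Hq : forall q, (1 <= q)%nat -> x <= s + INR q * d -> exists j, (j < q)%nat /\ s + INR j * d <= x <= s + INR j * d + d).
      { induction q as [|q IH]; [lia|]. intros _ Hxq.
        destruct (Rle_dec (s + INR q * d) x) as [H|H].
        - exists q. split; [lia|]. rewrite S_INR in Hxq. lra.
        - destruct q as [|q]; [simpl in H; lra|]. destruct IH as [j [Hj1 Hj2]]; [lia|lra|].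
          exists j. split; [lia|trivial]. }
      apply Hq; [nia|lra]. }
    destruct Hj as [j [Hj1 Hj2]]. exists j. split; trivial.
    assert (Hin : s <= s + INR j * d <= t).
    { pose proof (pos_INR j). assert (0 <= INR j * d) by now apply Rmult_le_pos. lra. }
    split; trivial.
    eapply Rle_trans; [apply (Cmod_triangle_sub _ (g x))|].
    assert (Cmod (g x - g (s + INR j * d)) <= L * d).
    { eapply Rle_trans; [apply Hg; trivial|]. apply Rmult_le_compat_l; trivial. rewrite Rabs_pos_eq; lra. }
    lra. }
  set (f := fun k => match lt_dec k n with
    | left H => proj1_sig (constructive_indefinite_description _ (Hpiece k H)) | right _ => 0%nat end).
  assert (Hf : forall k, (k < n)%nat -> (f k < p * p)%nat /\ Cmod (w k - g (s + INR (f k) * d)) <= h / 8 + h / 4).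
  { intros k Hk. unfold f. destruct (lt_dec k n) as [H|H]; [|lia].
    destruct (proj2_sig (constructive_indefinite_description _ (Hpiece k H))) as [H1 [H2 _]]. now split. }
  destruct (pigeonhole f n (p * p)) as [i [j [Hij Heq]]].
  { unfold n. nia. }
  { intros k Hk. now apply Hf. }
  destruct (Hf i ltac:(lia)) as [_ Hi]. destruct (Hf j ltac:(lia)) as [_ Hj]. rewrite <- Heq in Hj.
  assert (Hclose : Cmod (w i - w j) <= 3 / 4 * h).
  { eapply Rle_trans; [apply (Cmod_triangle_sub _ (g (s + INR (f i) * d)))|].
    rewrite (Cmod_sub_sym (g _)). lra. }
  assert (Hsep : forall a b : nat, a <> b -> h <= Rabs (INR a * h - INR b * h)).
  { intros a b Hab. replace (INR a * h - INR b * h) with ((INR a - INR b) * h) by ring.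
    rewrite Rabs_mult, (Rabs_pos_eq h) by lra. rewrite <- (Rmult_1_l h) at 1. apply Rmult_le_compat_r; [lra|].
    destruct (Nat.lt_total a b) as [H|[H|H]]; [|contradiction|].
    - rewrite Rabs_left1; apply le_INR in H; rewrite S_INR in H; lra.
    - rewrite Rabs_pos_eq; apply le_INR in H; rewrite S_INR in H; lra. }
  assert (Hne : (i / (p + 1) <> j / (p + 1) \/ i mod (p + 1) <> j mod (p + 1))%nat).
  { destruct (Nat.eq_dec (i / (p + 1)) (j / (p + 1))) as [E1|E1]; [right|now left]. intros E2.
    pose proof (Nat.div_mod_eq i (p + 1)). pose proof (Nat.div_mod_eq j (p + 1)). rewrite E1, E2 in *. lia. }
  destruct Hne as [H|H]; apply Hsep in H.
  - pose proof (re_le_Cmod (w i - w j)) as HR.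
    change (Re (w i - w j)) with (INR (i / (p + 1)) * h - INR (j / (p + 1)) * h) in HR. lra.
  - pose proof (Im_le_Cmod (w i - w j)) as HR.
    change (Im (w i - w j)) with (INR (i mod (p + 1)) * h - INR (j mod (p + 1)) * h) in HR. lra.
Qed.

(* One coefficient is perturbed for each short subinterval, on which the corresponding component
   of the curve does not vanish; the perturbation has to avoid a Lipschitz curve only. *)
Lemma nonvanishing_combination N (gam : nat -> R -> C) A B L M k : A < B -> 0 < L -> 0 < M -> 0 < k ->
  (forall j x y, (j <= N)%nat -> A <= x <= B -> A <= y <= B -> Cmod (gam j x - gam j y) <= L * Rabs (x - y)) ->
  (forall j x, (j <= N)%nat -> A <= x <= B -> Cmod (gam j x) <= M) ->
  (forall x, A <= x <= B -> exists j, (j <= N)%nat /\ 2 * k <= Cmod (gam j x)) ->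
  exists c eta, 0 < eta /\ forall x, A <= x <= B -> eta <= Cmod (csum (fun j => c j * gam j x)%C N).
Proof.
  intros HAB HL HM Hk Hlip Hbd Hlow.
  (* A component of modulus at least 2 k at one point stays above k for a length k / L. The
     induction advances over one such subinterval at a time. *)
  set (h := k / L). assert (Hh : 0 < h) by now apply Rdiv_lt_0_compat.
  assert (HLh : L * h = k) by (unfold h; field; lra).
  assert (H : forall n, exists c eta, 0 < eta /\ forall x, A <= x <= B -> x < A + INR n * h ->
     eta <= Cmod (csum (fun j => c j * gam j x)%C N)).
  { induction n as [|n [c [eta [Heta IH]]]].
    - exists (fun _ => RtoC 0), 1. split; [lra|]. intros x Hx Hx'. simpl in Hx'. lra.
    - destruct (Rlt_dec B (A + INR n * h)) as [HB|HB].
      { exists c, eta. split; trivial. intros x Hx _. apply IH; trivial. lra. }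
      set (t0 := A + INR n * h) in *.
      assert (Ht0 : A <= t0 <= B).
      { pose proof (pos_INR n). assert (0 <= INR n * h) by (apply Rmult_le_pos; lra). unfold t0 in *. lra. }
      destruct (Hlow t0 Ht0) as [j [Hj Hkj]].
      set (t1 := Rmin B (t0 + h)).
      assert (Ht1 : t0 <= t1 <= B /\ t1 <= t0 + h).
      { unfold t1. pose proof (Rmin_l B (t0 + h)). pose proof (Rmin_r B (t0 + h)).
        split; [split|]; trivial. apply Rmin_glb; lra. }
      assert (Hgk : forall x, t0 <= x <= t1 -> k <= Cmod (gam j x)).
      { intros x Hx. pose proof (Hlip j t0 x Hj Ht0 ltac:(lra)) as H1.
        assert (L * Rabs (t0 - x) <= k).
        { rewrite <- HLh. apply Rmult_le_compat_l; [lra|]. rewrite Rabs_left1; lra. }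
        pose proof (Cmod_triangle (gam j t0 - gam j x) (gam j x)) as H2.
        replace (gam j t0 - gam j x + gam j x)%C with (gam j t0) in H2 by ring. lra. }
      set (f := fun x => csum (fun j => c j * gam j x)%C N) in *.
      set (Mf := vnorm N c * M). set (Lf := vnorm N c * L). pose proof (vnorm_pos N c) as Hc.
      assert (HMf : forall x, A <= x <= B -> Cmod (f x) <= Mf).
      { intros x Hx. unfold f, Mf. rewrite Rmult_comm.
        rewrite (csum_ext _ (fun i => gam i x * c i)%C) by (intros; ring).
        apply matrix_vector_bound. intros; now apply Hbd. }
      assert (HLf : forall x y, A <= x <= B -> A <= y <= B -> Cmod (f x - f y) <= Lf * Rabs (x - y)).
      { intros x y Hx Hy. unfold f, Lf.
        replace (csum (fun j => c j * gam j x)%C N - csum (fun j => c j * gam j y)%C N)%C with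
          (csum (fun i => (gam i x - gam i y) * c i)%C N).
        - rewrite Rmult_assoc, Rmult_comm. apply matrix_vector_bound. intros; now apply Hlip.
        - rewrite (csum_ext _ (fun i => c i * gam i x + - RtoC 1 * (c i * gam i y))%C) by (intros; ring).
          rewrite csum_plus, csum_scal. ring. }
      assert (HMf0 : 0 <= Mf) by (apply Rmult_le_pos; lra).
      assert (HLf0 : 0 <= Lf) by (apply Rmult_le_pos; lra).
      assert (Hnz : forall x, t0 <= x <= t1 -> gam j x <> RtoC 0).
      { intros x Hx E. specialize (Hgk x Hx). rewrite E, Cmod_0 in Hgk. lra. }
      assert (Hik : 0 < / k) by now apply Rinv_0_lt_compat.
      assert (Hinv : forall x, t0 <= x <= t1 -> Cmod (/ gam j x) <= / k).
      { intros x Hx. rewrite Cmod_inv by now apply Hnz. apply Rinv_le_contravar; trivial. now apply Hgk. }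
      (* The perturbed combination f + w gam_j vanishes exactly where w meets the curve -f / gam_j.
         The size eta / (2 M) of w preserves half of the lower bound already obtained on the
         left. *)
      destruct (curve_avoidance (fun x => - (f x * / gam j x))%C t0 t1 (Lf * / k + Mf * (L * (/ k * / k)))
        (eta / (2 * M))) as [w [eta' [Hw [Heta' Hav]]]].
      + apply Ht1.
      + apply Rplus_le_le_0_compat; repeat apply Rmult_le_pos; lra.
      + apply Rdiv_lt_0_compat; lra.
      + intros x y Hx Hy.
        replace (- (f x * / gam j x) - - (f y * / gam j y))%C with
          ((f y - f x) * / gam j y + f x * ((gam j x - gam j y) * (/ gam j x * / gam j y)))%C
          by (field; split; now apply Hnz).
        eapply Rle_trans; [apply Cmod_triangle|]. rewrite Rmult_plus_distr_r. apply Rplus_le_compat.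
        * rewrite Cmod_mult, Cmod_sub_sym.
          replace (Lf * / k * Rabs (x - y)) with (Lf * Rabs (x - y) * / k) by ring.
          apply Rmult_le_compat; try apply Cmod_ge_0; auto. apply HLf; lra.
        * rewrite !Cmod_mult. replace (Mf * (L * (/ k * / k)) * Rabs (x - y)) with
            (Mf * ((L * Rabs (x - y)) * (/ k * / k))) by ring.
          apply Rmult_le_compat; [apply Cmod_ge_0| | apply HMf; lra|].
          { apply Rmult_le_pos; [apply Cmod_ge_0|]. apply Rmult_le_pos; apply Cmod_ge_0. }
          apply Rmult_le_compat; [apply Cmod_ge_0| | apply Hlip; trivial; lra|].
          { apply Rmult_le_pos; apply Cmod_ge_0. }
          apply Rmult_le_compat; try apply Cmod_ge_0; auto.
      + exists (fun i => c i + w * unit_vector j i)%C, (Rmin (eta / 2) (k * eta')).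
        assert (E : forall x, csum (fun i => (c i + w * unit_vector j i) * gam i x)%C N = (f x + w * gam j x)%C).
        { intros x. rewrite (csum_ext _ (fun i => c i * gam i x + w * (unit_vector j i * gam i x))%C) by (intros; ring).
          rewrite csum_plus, csum_scal. f_equal. f_equal.
          rewrite (csum_single _ N j Hj).
          - unfold unit_vector. destruct (Nat.eq_dec j j); [ring|congruence].
          - intros i _ Hi. unfold unit_vector. destruct (Nat.eq_dec j i); [congruence|ring]. }
        split; [apply Rmin_pos; [lra|now apply Rmult_lt_0_compat]|].
        intros x Hx Hxn. rewrite E. destruct (Rlt_dec x t0) as [Hx0|Hx0].
        * eapply Rle_trans; [apply Rmin_l|].
          pose proof (IH x Hx Hx0) as H1.
          assert (H2 : Cmod (w * gam j x) <= eta / 2).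
          { rewrite Cmod_mult. apply Rle_trans with (eta / (2 * M) * M).
            - apply Rmult_le_compat; try apply Cmod_ge_0; auto.
            - right. field. lra. }
          pose proof (Cmod_minus_le (f x + w * gam j x) (w * gam j x)) as H3.
          replace (f x + w * gam j x - w * gam j x)%C with (f x) in H3 by ring. fold (f x) in H1. lra.
        * assert (Hx1 : t0 <= x <= t1).
          { split; [lra|]. unfold t1. apply Rmin_glb; [lra|]. rewrite S_INR in Hxn. unfold t0. lra. }
          eapply Rle_trans; [apply Rmin_r|].
          replace (f x + w * gam j x)%C with (gam j x * (w - - (f x * / gam j x)))%C by (field; now apply Hnz).
          rewrite Cmod_mult. apply Rmult_le_compat; try lra; auto. }
  destruct (INR_unbounded ((B - A) / h)) as [n Hn]. destruct (H n) as [c [eta [Heta Hc]]].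
  exists c, eta. split; trivial. intros x Hx. apply Hc; trivial.
  apply Rgt_lt, (Rmult_lt_compat_r h) in Hn; trivial.
  unfold Rdiv in Hn. rewrite Rmult_assoc, Rinv_l in Hn by lra. lra.
Qed.

(** * The complex exponential and logarithms *)

Lemma cexp_plus z w : cexp (z + w) = (cexp z * cexp w)%C.
Proof.
  unfold cexp. destruct z as [a b], w as [c d]. simpl.
  apply injective_projections; simpl; rewrite exp_plus, ?cos_plus, ?sin_plus; ring.
Qed.

Lemma cexp_0 : cexp (RtoC 0) = RtoC 1.
Proof. unfold cexp. simpl. rewrite exp_0, cos_0, sin_0. apply injective_projections; simpl; ring. Qed.

Lemma cexp_opp z : (cexp z * cexp (- z))%C = RtoC 1.
Proof. rewrite <- cexp_plus, <- cexp_0. f_equal. ring. Qed.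

Lemma Cmod_cexp z : Cmod (cexp z) = exp (Re z).
Proof.
  replace (cexp z) with (RtoC (exp (Re z)) * (cos (Im z), sin (Im z)))%C.
  - rewrite Cmod_rmult, Rabs_pos_eq by (left; apply exp_pos). unfold Cmod. simpl.
    pose proof (sin2_cos2 (Im z)) as E. unfold Rsqr in E.
    replace (cos (Im z) * (cos (Im z) * 1) + sin (Im z) * (sin (Im z) * 1)) with 1 by lra.
    rewrite sqrt_1. ring.
  - unfold cexp. apply injective_projections; simpl; ring.
Qed.

Lemma cexp_surjective w : w <> RtoC 0 -> exists z, cexp z = w.
Proof.
  intros Hw. assert (Hm : 0 < Cmod w) by now apply Cmod_gt_0.
  destruct w as [a b]. set (m := Cmod (a, b)) in *.
  assert (Hm2 : a * a + b * b = m * m).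
  { unfold m, Cmod. simpl. rewrite sqrt_sqrt by nra. ring. }
  assert (Hab : (a / m) * (a / m) + (b / m) * (b / m) = 1).
  { replace (a / m * (a / m) + b / m * (b / m)) with ((a * a + b * b) / (m * m)) by (field; lra).
    rewrite Hm2. field. lra. }
  set (p := a / m) in *. set (s := b / m) in *.
  assert (Hp : -1 <= p <= 1) by (split; nra).
  assert (Ha : a = m * p) by (unfold p; field; lra). assert (Hb : b = m * s) by (unfold s; field; lra).
  assert (Hsin : sin (acos p) = Rabs s).
  { rewrite sin_acos by trivial. rewrite <- sqrt_Rsqr_abs. f_equal. unfold Rsqr. lra. }
  destruct (Rle_dec 0 s) as [Hs|Hs].
  - exists (ln m, acos p). unfold cexp. simpl. rewrite exp_ln, cos_acos, Hsin, Rabs_pos_eq, Ha, Hb; trivial.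
  - exists (ln m, - acos p). unfold cexp. simpl.
    rewrite exp_ln, cos_neg, sin_neg, cos_acos, Hsin, Rabs_left1, Ha, Hb by (trivial; lra).
    f_equal. ring.
Qed.

Lemma exp_quadratic a : Rabs a <= 1 -> Rabs (exp a - 1 - a) <= 3 * a ^ 2.
Proof.
  intros Ha.
  pose proof (real_taylor1 (fun t => Rabs t <= 1) exp exp exp 3) as H.
  assert (Hd : forall t, is_derive exp t (exp t)) by (intros; apply is_derive_exp).
  specialize (H ltac:(intros x y t Hx Hy Ht; apply Rabs_le_between in Hx; apply Rabs_le_between in Hy;
    apply Rabs_le_between; split; nra) ltac:(auto) ltac:(auto)).
  specialize (H ltac:(intros t Ht; rewrite Rabs_pos_eq by (left; apply exp_pos); apply Rle_trans with (exp 1);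
    [apply Rabs_le_between in Ht; destruct (Rle_lt_or_eq_dec t 1 ltac:(lra)) as [E| ->]; [left; now apply exp_increasing|lra]|apply exp_le_3])).
  specialize (H 0 a ltac:(cbv beta; rewrite Rabs_R0; lra) Ha). rewrite exp_0 in H.
  replace (exp a - 1 - (a - 0) * 1) with (exp a - 1 - a) in H by ring.
  now replace (a - 0) with a in H by ring.
Qed.

Lemma sin_quadratic b : Rabs (sin b - b) <= b ^ 2.
Proof.
  pose proof (real_taylor1 (fun _ => True) sin cos (fun t => - sin t) 1) as H.
  specialize (H ltac:(now intros x y t) ltac:(intros; apply is_derive_sin) ltac:(intros; apply is_derive_cos)).
  specialize (H ltac:(intros t _; cbv beta; rewrite Rabs_Ropp; apply Rabs_le_between; apply SIN_bound) 0 b I I).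
  cbv beta in H. rewrite sin_0, cos_0 in H. replace (sin b - 0 - (b - 0) * 1) with (sin b - b) in H by ring.
  replace (b - 0) with b in H by ring. lra.
Qed.

Lemma cos_quadratic b : Rabs (cos b - 1) <= b ^ 2.
Proof.
  pose proof (real_taylor1 (fun _ => True) cos (fun t => - sin t) (fun t => - cos t) 1) as H.
  specialize (H ltac:(now intros x y t) ltac:(intros; apply is_derive_cos)
    ltac:(intros; apply (is_derive_opp sin), is_derive_sin)).
  specialize (H ltac:(intros t _; cbv beta; rewrite Rabs_Ropp; apply Rabs_le_between; apply COS_bound) 0 b I I).
  cbv beta in H. rewrite sin_0, cos_0 in H. replace (cos b - 1 - (b - 0) * - 0) with (cos b - 1) in H by ring.
  replace (b - 0) with b in H by ring. lra.
Qed.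

Lemma cexp_quadratic w : Cmod w <= 1 -> Cmod (cexp w - 1 - w) <= 8 * Cmod w ^ 2.
Proof.
  intros Hw. pose proof (re_le_Cmod w) as H1. pose proof (Im_le_Cmod w) as H2.
  assert (Hm : Re w ^ 2 + Im w ^ 2 = Cmod w ^ 2).
  { unfold Cmod. rewrite pow2_sqrt; [reflexivity|]. pose proof (pow2_ge_0 (fst w)). pose proof (pow2_ge_0 (snd w)). lra. }
  set (a := Re w) in *. set (b := Im w) in *. rewrite <- Hm.
  pose proof (exp_quadratic a ltac:(lra)) as E. pose proof (sin_quadratic b) as S. pose proof (cos_quadratic b) as D.
  assert (He : 0 < exp a <= 3).
  { split; [apply exp_pos|]. apply Rle_trans with (exp 1); [|apply exp_le_3].
    assert (a <= 1) by (apply Rabs_le_between in H1; lra).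
    destruct (Rle_lt_or_eq_dec a 1 ltac:(lra)) as [Q| ->]; [left; now apply exp_increasing|lra]. }
  assert (HR : Rabs (Re (cexp w - 1 - w)) <= 3 * a ^ 2 + 3 * b ^ 2).
  { change (Re (cexp w - 1 - w)) with (exp a * cos b + - 1 + - a).
    replace (exp a * cos b + - 1 + - a) with ((exp a - 1 - a) + exp a * (cos b - 1)) by ring.
    eapply Rle_trans; [apply Rabs_triang|]. apply Rplus_le_compat; trivial.
    rewrite Rabs_mult, (Rabs_pos_eq (exp a)) by lra. apply Rmult_le_compat; try apply Rabs_pos; lra. }
  assert (HI : Rabs (Im (cexp w - 1 - w)) <= 2 * a ^ 2 + 5 * b ^ 2).
  { change (Im (cexp w - 1 - w)) with (exp a * sin b + - 0 + - b).
    replace (exp a * sin b + - 0 + - b) with (exp a * (sin b - b) + ((exp a - 1 - a) + a) * b) by ring.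
    eapply Rle_trans; [apply Rabs_triang|].
    rewrite !Rabs_mult, (Rabs_pos_eq (exp a)) by lra.
    assert (T1 : exp a * Rabs (sin b - b) <= 3 * b ^ 2) by (apply Rmult_le_compat; try apply Rabs_pos; lra).
    assert (T2 : Rabs (exp a - 1 - a + a) <= 4 * Rabs a).
    { eapply Rle_trans; [apply Rabs_triang|].
      assert (a ^ 2 <= Rabs a).
      { rewrite <- (Rabs_pos_eq (a ^ 2)) by apply pow2_ge_0. simpl. rewrite Rmult_1_r, Rabs_mult.
        pose proof (Rabs_pos a). nra. }
      lra. }
    assert (T3 : Rabs (exp a - 1 - a + a) * Rabs b <= 4 * Rabs a * Rabs b)
      by (apply Rmult_le_compat_r; [apply Rabs_pos|trivial]).
    assert (T4 : 2 * (Rabs a * Rabs b) <= a ^ 2 + b ^ 2).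
    { rewrite <- (pow2_abs a), <- (pow2_abs b). pose proof (pow2_ge_0 (Rabs a - Rabs b)). nra. }
    lra. }
  eapply Rle_trans; [apply Cmod_le_Re_Im|]. pose proof (pow2_ge_0 a). pose proof (pow2_ge_0 b). lra.
Qed.

Lemma exponential_ode (y g G : R -> C) (M : R) : 1 <= M ->
  (forall t, 0 <= t <= 1 -> Cmod (y t) <= M /\ Cmod (g t) <= M /\ Cmod (G t) <= M) ->
  (forall t t', 0 <= t <= 1 -> 0 <= t' <= 1 ->
     Cmod (y t' - y t - RtoC (t' - t) * (g t * y t)) <= M * (t' - t) ^ 2) ->
  (forall t t', 0 <= t <= 1 -> 0 <= t' <= 1 ->
     Cmod (G t' - G t - RtoC (t' - t) * g t) <= M * (t' - t) ^ 2) ->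
  (y 1 * cexp (- G 1))%C = (y 0 * cexp (- G 0))%C.
Proof.
  intros HM Hb Hy HG. set (E := exp M). assert (HE : 0 < E) by apply exp_pos.
  assert (Hcexp : forall t, 0 <= t <= 1 -> Cmod (cexp (- G t)) <= E).
  { intros t Ht. rewrite Cmod_cexp. destruct (Hb t Ht) as [_ [_ H]].
    pose proof (re_le_Cmod (- G t)) as H1. rewrite Cmod_opp in H1. apply Rabs_le_between in H1.
    assert (H2 : Re (- G t) <= M) by lra. unfold E.
    destruct (Rle_lt_or_eq_dec _ _ H2) as [H3| ->]; [left; now apply exp_increasing|lra]. }
  assert (HM2 : 1 <= M * M) by nra. assert (HM3 : 1 <= M * M * M) by nra.
  set (P := fun t => (y t * cexp (- G t))%C).
  enough (H : Cmod (P 1 - P 0) <= 0 * Rabs (1 - 0)).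
  { assert (H0 : Cmod (P 1 - P 0) = 0) by (pose proof (Cmod_ge_0 (P 1 - P 0)); lra).
    apply Cmod_eq_0 in H0. unfold P in H0.
    replace (y 1 * cexp (- G 1))%C with (y 1 * cexp (- G 1) - y 0 * cexp (- G 0) + y 0 * cexp (- G 0))%C by ring.
    rewrite H0. ring. }
  apply (lipschitz_of_derivative (fun t => 0 <= t <= 1) P (fun _ => RtoC 0) (E * (50 * (M * M * M))) 0);
    [apply unit_interval_convex| |intros; rewrite Cmod_0; lra|lra|lra].
  intros t t' Ht Ht'. set (d := t' - t).
  replace (P t' - P t - RtoC d * RtoC 0)%C with (P t' - P t)%C by ring.
  destruct (Hb t Ht) as [Hyt [Hgt HGt]]. destruct (Hb t' Ht') as [Hyt' [Hgt' HGt']].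
  specialize (Hy t t' Ht Ht'). specialize (HG t t' Ht Ht'). fold d in Hy, HG.
  set (a := Rabs d). assert (Ha : 0 <= a <= 1) by (unfold a, d; split; [apply Rabs_pos|apply Rabs_le_between; lra]).
  assert (Hd2 : d ^ 2 = a * a) by (rewrite <- pow2_abs; fold a; ring). rewrite Hd2 in *.
  set (w := (- (G t' - G t))%C).
  assert (Haa : a * a <= a) by nra.
  assert (Hw : Cmod w <= 2 * M * a).
  { unfold w. rewrite Cmod_opp. pose proof (Cmod_triangle (G t' - G t - RtoC d * g t) (RtoC d * g t)) as H1.
    replace (G t' - G t - RtoC d * g t + RtoC d * g t)%C with (G t' - G t)%C in H1 by ring.
    rewrite (Cmod_rmult d) in H1. fold a in H1.
    assert (a * Cmod (g t) <= a * M) by (apply Rmult_le_compat_l; lra).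
    assert (M * (a * a) <= M * a) by (apply Rmult_le_compat_l; lra). lra. }
  assert (Hyd : Cmod (y t' - y t) <= 2 * (M * M) * a).
  { pose proof (Cmod_triangle (y t' - y t - RtoC d * (g t * y t)) (RtoC d * (g t * y t))) as H1.
    replace (y t' - y t - RtoC d * (g t * y t) + RtoC d * (g t * y t))%C with (y t' - y t)%C in H1 by ring.
    rewrite (Cmod_rmult d), Cmod_mult in H1. fold a in H1.
    assert (Cmod (g t) * Cmod (y t) <= M * M) by (apply Rmult_le_compat; try apply Cmod_ge_0; lra).
    assert (a * (Cmod (g t) * Cmod (y t)) <= a * (M * M)) by (apply Rmult_le_compat_l; lra).
    assert (M * (a * a) <= M * M * a) by (rewrite Rmult_assoc; apply Rmult_le_compat_l; [lra|nra]). lra. }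
  destruct (Rle_dec (Cmod w) 1) as [Hw1|Hw1].
  - pose proof (cexp_quadratic w Hw1) as Hq.
    replace (P t' - P t)%C with (cexp (- G t) * (y t' * cexp w - y t))%C.
    2:{ unfold P. replace (- G t')%C with (- G t + w)%C by (unfold w; ring). rewrite cexp_plus. ring. }
    rewrite Cmod_mult, Rmult_assoc.
    apply Rmult_le_compat; [apply Cmod_ge_0|apply Cmod_ge_0|now apply Hcexp|].
    replace (y t' * cexp w - y t)%C with (y t' * (cexp w - 1 - w) + ((y t' - y t - RtoC d * (g t * y t))
      + ((y t' - y t) * w + - (y t * (G t' - G t - RtoC d * g t)))))%C by (unfold w; ring).
    assert (Q1 : Cmod (y t' * (cexp w - 1 - w)) <= M * (8 * ((2 * M * a) * (2 * M * a)))).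
    { rewrite Cmod_mult. apply Rmult_le_compat; try apply Cmod_ge_0; trivial.
      eapply Rle_trans; [exact Hq|]. apply Rmult_le_compat_l; [lra|]. simpl. rewrite Rmult_1_r.
      apply Rmult_le_compat; try apply Cmod_ge_0; trivial. }
    assert (Q3 : Cmod ((y t' - y t) * w) <= (2 * (M * M) * a) * (2 * M * a)).
    { rewrite Cmod_mult. apply Rmult_le_compat; try apply Cmod_ge_0; trivial. }
    assert (Q4 : Cmod (- (y t * (G t' - G t - RtoC d * g t))) <= M * (M * (a * a))).
    { rewrite Cmod_opp, Cmod_mult. apply Rmult_le_compat; try apply Cmod_ge_0; trivial. }
    eapply Rle_trans; [apply Cmod_triangle|]. eapply Rle_trans; [apply Rplus_le_compat; [exact Q1|]|].
    { eapply Rle_trans; [apply Cmod_triangle|]. apply Rplus_le_compat; [exact Hy|].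
      eapply Rle_trans; [apply Cmod_triangle|]. apply Rplus_le_compat; [exact Q3|exact Q4]. }
    replace (M * (8 * (2 * M * a * (2 * M * a))) + (M * (a * a) + (2 * (M * M) * a * (2 * M * a) + M * (M * (a * a)))))
      with ((36 * (M * M * M) + M + M * M) * (a * a)) by ring.
    apply Rmult_le_compat_r; [nra|]. assert (M <= M * M * M) by nra. assert (M * M <= M * M * M) by nra. lra.
  - assert (H1 : 1 <= 2 * M * a) by lra.
    assert (H2 : 1 <= 4 * (M * M) * (a * a)).
    { replace (4 * (M * M) * (a * a)) with ((2 * M * a) * (2 * M * a)) by ring.
      rewrite <- (Rmult_1_r 1) at 1. apply Rmult_le_compat; lra. }
    assert (HP : forall s, 0 <= s <= 1 -> Cmod (P s) <= M * E).
    { intros s Hs. unfold P. rewrite Cmod_mult. apply Rmult_le_compat; try apply Cmod_ge_0; [now apply Hb|now apply Hcexp]. }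
    eapply Rle_trans; [apply Cmod_minus_le|].
    pose proof (HP t Ht). pose proof (HP t' Ht').
    apply Rle_trans with (2 * (M * E) * (4 * (M * M) * (a * a))).
    + rewrite <- (Rmult_1_r (Cmod (P t') + Cmod (P t))). apply Rmult_le_compat; try lra.
      pose proof (Cmod_ge_0 (P t)). pose proof (Cmod_ge_0 (P t')). lra.
    + replace (2 * (M * E) * (4 * (M * M) * (a * a))) with (E * (8 * (M * M * M)) * (a * a)) by ring.
      apply Rmult_le_compat_r; [nra|]. apply Rmult_le_compat_l; lra.
Qed.

Lemma lipschitz_antiderivative (h : R -> C) L a : 0 <= L ->
  (forall s t, Cmod (h s - h t) <= L * Rabs (s - t)) ->
  forall t t', Cmod (Cint h a t' - Cint h a t - RtoC (t' - t) * h t) <= L * (t' - t) ^ 2.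
Proof.
  intros HL Hh t t'.
  assert (HI : forall u v, isI h u v (Cint h u v)).
  { intros u v. apply isI_Cint. intros s _. exists L, 1. split; [lra|]. intros; apply Hh. }
  rewrite (isI_unique h a t' (Cint h a t + Cint h t t')) by (apply (isI_chasles h a t t'); apply HI).
  replace (Cint h a t + Cint h t t' - Cint h a t - RtoC (t' - t) * h t)%C with
    (Cint h t t' - RtoC (t' - t) * h t)%C by ring.
  replace (L * (t' - t) ^ 2) with (L * Rabs (t' - t) * Rabs (t' - t)) by (rewrite <- pow2_abs; ring).
  eapply isI_bound; [apply isI_minus; [apply HI|apply isI_const]|].
  intros s Hs. eapply Rle_trans; [apply Hh|]. apply Rmult_le_compat_l; trivial.
  unfold in_between, Rmin, Rmax in Hs. destruct (Rle_dec t t').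
  - rewrite !Rabs_pos_eq; lra.
  - rewrite !Rabs_left1; lra.
Qed.

Section Logarithm.
Variables (U : dom) (u : fn) (eta D xc ec : R).
Hypothesis HU : open2 U.
Hypothesis HC : convex2 U.
Hypothesis Hu : smooth2 U u.
Hypothesis Heta : 0 < eta.
Hypothesis Hlow : forall x e, U x e -> eta <= Cmod (u x e).
Hypothesis Hcen : U xc ec.
Hypothesis Hdiam : forall x e x' e', U x e -> U x' e' -> dist2 x e x' e' <= D.
Let px : fn := fun x e => (dX u x e * / u x e)%C.
Let pe : fn := fun x e => (dE u x e * / u x e)%C.

Lemma log_derivatives_smooth : smooth2 U px /\ smooth2 U pe.
Proof.
  assert (Hi : smooth2 U (fun x e => / u x e)%C) by (intros n; now apply (Sm_inv U HU n u eta)).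
  split; intros n; apply Sm_mult; trivial; [apply (smooth2_dX U u Hu)|apply (smooth2_dE U u Hu)].
Qed.

Lemma u_nonzero x e : U x e -> u x e <> RtoC 0.
Proof. intros H E. specialize (Hlow x e H). rewrite E, Cmod_0 in Hlow. lra. Qed.

(* The lower bound on u makes increments of a Lipschitz logarithm comparable, up to a quadratic
   error, to relative increments of u. *)
Lemma lipschitz_log_smooth (lg : fn) L K : 0 <= L -> lip2 U lg L ->
  (forall x e, U x e -> Cmod (lg x e) <= K) ->
  (forall x e, U x e -> cexp (lg x e) = u x e) -> smooth2 U lg.
Proof.
  intros HL Hlip HK Hexp. destruct log_derivatives_smooth as [Hpx Hpe].
  assert (Hb : bounded2 U lg) by now exists K.
  intros [|n]; [split; trivial|].
  apply (Sm_intro n U lg px pe); trivial.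
  destruct (diff2_pos _ _ _ _ (smooth2_diff2 U u Hu)) as [K1 [HK1 H1]].
  destruct (bounded2_pos _ _ (smooth2_bounded U px Hpx)) as [M1 [HM1 B1]].
  destruct (bounded2_pos _ _ (smooth2_bounded U pe Hpe)) as [M2 [HM2 B2]].
  exists (8 * (L * L) + K1 * / eta + (L + (M1 + M2)) * L).
  intros x e x' e' Hx Hx'. set (d := dist2 x e x' e').
  assert (Hd : 0 <= d) by apply dist2_pos.
  assert (Hie : 0 < / eta) by now apply Rinv_0_lt_compat.
  set (w := (lg x' e' - lg x e)%C).
  assert (Hw : Cmod w <= L * d) by now apply Hlip.
  assert (Hd2 : d ^ 2 = d * d) by ring. rewrite Hd2.
  assert (N1 : 0 <= 8 * (L * L) * (d * d)) by (repeat apply Rmult_le_pos; lra).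
  assert (N2 : 0 <= K1 * / eta * (d * d)) by (repeat apply Rmult_le_pos; lra).
  assert (N3 : 0 <= (L + (M1 + M2)) * L * (d * d)) by (repeat apply Rmult_le_pos; lra).
  destruct (Rle_dec (Cmod w) 1) as [Hw1|Hw1].
  - assert (E : remainder lg px pe x e x' e' =
      (remainder u (dX u) (dE u) x e x' e' * / u x e + - (cexp w - 1 - w))%C).
    { assert (Ew : (cexp w * u x e)%C = u x' e').
      { rewrite <- (Hexp x e Hx), <- (Hexp x' e' Hx'), <- cexp_plus. f_equal. unfold w. ring. }
      unfold remainder, px, pe. rewrite <- Ew. unfold w. field. now apply u_nonzero. }
    rewrite E. eapply Rle_trans; [apply Cmod_triangle|]. rewrite Cmod_opp, Cmod_mult.
    rewrite Cmod_inv by now apply u_nonzero.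
    assert (T1 : Cmod (remainder u (dX u) (dE u) x e x' e') * / Cmod (u x e) <= K1 * (d * d) * / eta).
    { apply Rmult_le_compat; [apply Cmod_ge_0|left; apply Rinv_0_lt_compat| |apply Rinv_le_contravar; auto].
      - apply Cmod_gt_0. now apply u_nonzero.
      - rewrite <- Hd2. now apply H1. }
    assert (T2 : Cmod (cexp w - 1 - w) <= 8 * ((L * d) * (L * d))).
    { eapply Rle_trans; [now apply cexp_quadratic|]. apply Rmult_le_compat_l; [lra|].
      simpl. rewrite Rmult_1_r. apply Rmult_le_compat; try apply Cmod_ge_0; trivial. }
    lra.
  - assert (HLd : 1 <= L * d) by lra.
    assert (T : Cmod (remainder lg px pe x e x' e') <= (L + (M1 + M2)) * d).
    { unfold remainder. fold w.
      replace (w - RtoC (x' - x) * px x e - RtoC (e' - e) * pe x e)%C with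
        (w - (RtoC (x' - x) * px x e + RtoC (e' - e) * pe x e))%C by ring.
      eapply Rle_trans; [apply Cmod_minus_le|]. rewrite Rmult_plus_distr_r. apply Rplus_le_compat; trivial.
      apply linear_part_bound; [pose proof (B1 x e Hx)|pose proof (B2 x e Hx)]; lra. }
    assert (T2 : (L + (M1 + M2)) * d * 1 <= (L + (M1 + M2)) * d * (L * d)).
    { apply Rmult_le_compat_l; trivial. apply Rmult_le_pos; lra. }
    lra.
Qed.

(** The logarithm is the integral of du / u along the segment from the centre. On each segment
    [exponential_ode] shows that its exponential is u. The integral is seen directly to be
    Lipschitz, and smoothness is then read off from [cexp lg = u] by [lipschitz_log_smooth]. *)
Theorem smooth_logarithm : exists lg, smooth2 U lg /\ forall x e, U x e -> cexp (lg x e) = u x e.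
Proof.
  destruct log_derivatives_smooth as [Hpx Hpe].
  destruct (bounded2_pos _ _ (smooth2_bounded U px Hpx)) as [M1 [HM1 B1]].
  destruct (bounded2_pos _ _ (smooth2_bounded U pe Hpe)) as [M2 [HM2 B2]].
  destruct (bounded2_pos _ _ (smooth2_bounded U u Hu)) as [M3 [HM3 B3]].
  destruct (smooth2_lip2 U px HC Hpx) as [L1 [HL1 Hl1]].
  destruct (smooth2_lip2 U pe HC Hpe) as [L2 [HL2 Hl2]].
  destruct (diff2_pos _ _ _ _ (smooth2_diff2 U u Hu)) as [K1 [HK1 H1]].
  assert (HD : 0 <= D).
  { eapply Rle_trans; [|apply (Hdiam xc ec xc ec Hcen Hcen)]. apply dist2_pos. }
  (* Clamping the parameter makes the integrand Lipschitz on the whole line, so that it can be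
     integrated between any limits. *)
  set (sx := fun x t => xc + clamp 0 1 t * (x - xc)). set (se := fun e t => ec + clamp 0 1 t * (e - ec)).
  assert (Hseg : forall x e t, U x e -> U (sx x t) (se e t)).
  { intros x e t Hx. apply HC; trivial. apply clamp_range. lra. }
  set (h := fun x e t => (RtoC (x - xc) * px (sx x t) (se e t) + RtoC (e - ec) * pe (sx x t) (se e t))%C).
  assert (Hxe : forall x e, U x e -> Rabs (x - xc) <= D /\ Rabs (e - ec) <= D).
  { intros x e Hx. pose proof (Hdiam xc ec x e Hcen Hx) as H. unfold dist2 in H.
    pose proof (Rabs_pos (x - xc)). pose proof (Rabs_pos (e - ec)). lra. }
  assert (Hhb : forall x e t, U x e -> Cmod (h x e t) <= D * (M1 + M2)).
  { intros x e t Hx. destruct (Hxe x e Hx) as [D1 D2]. specialize (Hseg x e t Hx).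
    unfold h. eapply Rle_trans; [apply Cmod_triangle|].
    rewrite (Cmod_rmult (x - xc)), (Cmod_rmult (e - ec)), Rmult_plus_distr_l.
    apply Rplus_le_compat; apply Rmult_le_compat; try apply Cmod_ge_0; try apply Rabs_pos; auto. }
  assert (Hht : forall x e, U x e -> forall s t, Cmod (h x e s - h x e t) <= D * ((L1 + L2) * (D + D)) * Rabs (s - t)).
  { intros x e Hx s t. destruct (Hxe x e Hx) as [D1 D2].
    assert (Hdist : dist2 (sx x t) (se e t) (sx x s) (se e s) <= (D + D) * Rabs (s - t)).
    { unfold dist2, sx, se.
      replace (xc + clamp 0 1 s * (x - xc) - (xc + clamp 0 1 t * (x - xc))) with ((clamp 0 1 s - clamp 0 1 t) * (x - xc)) by ring.
      replace (ec + clamp 0 1 s * (e - ec) - (ec + clamp 0 1 t * (e - ec))) with ((clamp 0 1 s - clamp 0 1 t) * (e - ec)) by ring.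
      rewrite !Rabs_mult, <- Rmult_plus_distr_l, Rmult_comm.
      apply Rmult_le_compat; try apply Rabs_pos; [|lra|apply clamp_lip].
      pose proof (Rabs_pos (x - xc)). pose proof (Rabs_pos (e - ec)). lra. }
    pose proof (Hl1 _ _ _ _ (Hseg x e t Hx) (Hseg x e s Hx)) as F1.
    pose proof (Hl2 _ _ _ _ (Hseg x e t Hx) (Hseg x e s Hx)) as F2.
    unfold h.
    replace (RtoC (x - xc) * px (sx x s) (se e s) + RtoC (e - ec) * pe (sx x s) (se e s)
      - (RtoC (x - xc) * px (sx x t) (se e t) + RtoC (e - ec) * pe (sx x t) (se e t)))%C with
      (RtoC (x - xc) * (px (sx x s) (se e s) - px (sx x t) (se e t)) +
       RtoC (e - ec) * (pe (sx x s) (se e s) - pe (sx x t) (se e t)))%C by ring.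
    eapply Rle_trans; [apply Cmod_triangle|]. rewrite (Cmod_rmult (x - xc)), (Cmod_rmult (e - ec)).
    replace (D * ((L1 + L2) * (D + D)) * Rabs (s - t)) with
      (D * (L1 * ((D + D) * Rabs (s - t))) + D * (L2 * ((D + D) * Rabs (s - t)))) by ring.
    apply Rplus_le_compat; apply Rmult_le_compat; try apply Rabs_pos; try apply Cmod_ge_0; trivial.
    - eapply Rle_trans; [exact F1|]. now apply Rmult_le_compat_l.
    - eapply Rle_trans; [exact F2|]. now apply Rmult_le_compat_l. }
  set (Lh := D * ((L1 + L2) * (D + D))) in *.
  assert (HLh : 0 <= Lh) by (unfold Lh; repeat apply Rmult_le_pos; lra).
  assert (HI : forall x e, U x e -> forall a b, isI (h x e) a b (Cint (h x e) a b)).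
  { intros x e Hx a b. apply isI_Cint. intros s _. exists Lh, 1. split; [lra|]. intros; now apply Hht. }
  destruct (cexp_surjective (u xc ec) (u_nonzero xc ec Hcen)) as [z Hz].
  set (lg := fun x e => (z + Cint (h x e) 0 1)%C).
  assert (Hexp : forall x e, U x e -> cexp (lg x e) = u x e).
  { intros x e Hx. destruct (Hxe x e Hx) as [D1 D2].
    set (M := 1 + M3 + D * (M1 + M2) + Lh + K1 * dist2 xc ec x e ^ 2).
    assert (P1 : 0 <= D * (M1 + M2)) by (apply Rmult_le_pos; lra).
    assert (P2 : 0 <= K1 * dist2 xc ec x e ^ 2) by (apply Rmult_le_pos; [lra|apply pow2_ge_0]).
    assert (Hode := exponential_ode (fun t => u (sx x t) (se e t)) (h x e) (fun t => Cint (h x e) 0 t) M).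
    assert (Hone : sx x 1 = x /\ se e 1 = e /\ sx x 0 = xc /\ se e 0 = ec).
    { unfold sx, se. rewrite !clamp_id by lra. repeat split; ring. }
    destruct Hone as [O1 [O2 [O3 O4]]]. cbv beta in Hode. rewrite O1, O2, O3, O4 in Hode.
    assert (H0 : Cint (h x e) 0 0 = RtoC 0).
    { assert (Hc0 : Cmod (Cint (h x e) 0 0) <= D * (M1 + M2) * Rabs (0 - 0)).
      { apply (isI_bound (h x e) 0 0); [apply HI; trivial|]. intros; now apply Hhb. }
      rewrite Rminus_0_r, Rabs_R0, Rmult_0_r in Hc0. apply Cmod_eq_0.
      pose proof (Cmod_ge_0 (Cint (h x e) 0 0)). lra. }
    rewrite H0 in Hode. replace (- RtoC 0)%C with (RtoC 0) in Hode by ring. rewrite cexp_0 in Hode.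
    unfold lg. rewrite cexp_plus, Hz.
    enough (Hq : (u x e * cexp (- Cint (h x e) 0 1) = u xc ec * RtoC 1)%C).
    { replace (u xc ec) with (u xc ec * RtoC 1)%C by ring. rewrite <- Hq.
      rewrite <- Cmult_assoc, (Cmult_comm (cexp (- _))), cexp_opp. ring. }
    apply Hode.
    - unfold M. lra.
    - intros t Ht. split; [|split].
      + eapply Rle_trans; [apply B3; now apply Hseg|]. unfold M. lra.
      + eapply Rle_trans; [now apply Hhb|]. unfold M. lra.
      + assert (Hq : Cmod (Cint (h x e) 0 t) <= D * (M1 + M2) * Rabs (t - 0)).
        { apply (isI_bound (h x e) 0 t); [apply HI; trivial|]. intros; now apply Hhb. }
        assert (D * (M1 + M2) * Rabs (t - 0) <= D * (M1 + M2) * 1).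
        { apply Rmult_le_compat_l; trivial. rewrite Rabs_pos_eq; lra. }
        unfold M. lra.
    - intros t t' Ht Ht'.
      pose proof (segment_derivative U u (dX u) (dE u) K1 xc ec x e HC Hcen Hx H1 t t' Ht Ht') as HS.
      replace (h x e t * u (sx x t) (se e t))%C with
        (RtoC (x - xc) * dX u (sx x t) (se e t) + RtoC (e - ec) * dE u (sx x t) (se e t))%C.
      2:{ unfold h, px, pe. field. apply u_nonzero. now apply Hseg. }
      unfold sx, se. rewrite !clamp_id by trivial.
      eapply Rle_trans; [exact HS|]. apply Rmult_le_compat_r; [apply pow2_ge_0|]. unfold M. lra.
    - intros t t' Ht Ht'. eapply Rle_trans; [apply (lipschitz_antiderivative (h x e) Lh); trivial; now apply Hht|].
      apply Rmult_le_compat_r; [apply pow2_ge_0|]. unfold M. lra. }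
  exists lg. split; trivial.
  assert (Hlip : lip2 U lg (M1 + M2 + D * (L1 + L2))).
  { intros x e x' e' Hx Hx'. unfold lg. destruct (Hxe x' e' Hx') as [D1 D2].
    replace (z + Cint (h x' e') 0 1 - (z + Cint (h x e) 0 1))%C with (Cint (h x' e') 0 1 - Cint (h x e) 0 1)%C by ring.
    set (d := dist2 x e x' e').
    replace ((M1 + M2 + D * (L1 + L2)) * d) with ((M1 + M2 + D * (L1 + L2)) * d * Rabs (1 - 0))
      by (rewrite Rminus_0_r, Rabs_R1; ring).
    eapply isI_bound; [apply isI_minus; apply HI; trivial|].
    intros t _. pose proof (Hseg x e t Hx) as Hs. pose proof (Hseg x' e' t Hx') as Hs'.
    assert (Hdist : dist2 (sx x t) (se e t) (sx x' t) (se e' t) <= d).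
    { unfold d, dist2, sx, se. assert (Hcl : 0 <= clamp 0 1 t <= 1) by (apply clamp_range; lra).
      replace (xc + clamp 0 1 t * (x' - xc) - (xc + clamp 0 1 t * (x - xc))) with (clamp 0 1 t * (x' - x)) by ring.
      replace (ec + clamp 0 1 t * (e' - ec) - (ec + clamp 0 1 t * (e - ec))) with (clamp 0 1 t * (e' - e)) by ring.
      rewrite !Rabs_mult, (Rabs_pos_eq (clamp 0 1 t)) by lra.
      pose proof (Rabs_pos (x' - x)). pose proof (Rabs_pos (e' - e)).
      assert (clamp 0 1 t * Rabs (x' - x) <= 1 * Rabs (x' - x)) by (apply Rmult_le_compat_r; lra).
      assert (clamp 0 1 t * Rabs (e' - e) <= 1 * Rabs (e' - e)) by (apply Rmult_le_compat_r; lra). lra. }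
    pose proof (Hl1 _ _ _ _ Hs Hs') as F1. pose proof (Hl2 _ _ _ _ Hs Hs') as F2.
    unfold h.
    replace (RtoC (x' - xc) * px (sx x' t) (se e' t) + RtoC (e' - ec) * pe (sx x' t) (se e' t)
      - (RtoC (x - xc) * px (sx x t) (se e t) + RtoC (e - ec) * pe (sx x t) (se e t)))%C with
      ((RtoC (x' - x) * px (sx x t) (se e t) + RtoC (e' - e) * pe (sx x t) (se e t)) +
       (RtoC (x' - xc) * (px (sx x' t) (se e' t) - px (sx x t) (se e t)) +
       RtoC (e' - ec) * (pe (sx x' t) (se e' t) - pe (sx x t) (se e t))))%C
      by (rewrite !RtoC_minus; ring).
    eapply Rle_trans; [apply Cmod_triangle|].
    replace ((M1 + M2 + D * (L1 + L2)) * d) with ((M1 + M2) * d + (D * (L1 * d) + D * (L2 * d))) by ring.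
    apply Rplus_le_compat.
    - apply linear_part_bound; [pose proof (B1 _ _ Hs)|pose proof (B2 _ _ Hs)]; lra.
    - eapply Rle_trans; [apply Cmod_triangle|]. rewrite (Cmod_rmult (x' - xc)), (Cmod_rmult (e' - ec)).
      apply Rplus_le_compat; apply Rmult_le_compat; try apply Rabs_pos; try apply Cmod_ge_0; trivial.
      + eapply Rle_trans; [exact F1|]. now apply Rmult_le_compat_l.
      + eapply Rle_trans; [exact F2|]. now apply Rmult_le_compat_l. }
  apply (lipschitz_log_smooth lg _ (Cmod z + D * (M1 + M2) * Rabs (1 - 0)) ) with (2 := Hlip); trivial.
  - apply Rplus_le_le_0_compat; [lra|apply Rmult_le_pos; lra].
  - intros x e Hx. unfold lg. eapply Rle_trans; [apply Cmod_triangle|]. apply Rplus_le_compat_l.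
    apply (isI_bound (h x e) 0 1); [apply HI; trivial|]. intros; now apply Hhb.
Qed.

End Logarithm.

(** * Smoothness on the closed rectangle *)

Lemma is_derive_on_of_quadratic (I : R -> Prop) (f : R -> C) x d K : I x ->
  (forall u, I u -> Cmod (f u - f x - RtoC (u - x) * d) <= K * (u - x) ^ 2) ->
  is_derive_on (V := C_R_NormedModule) I f x d.
Proof.
  intros Hx H. split; [apply (is_linear_scal_l (V := C_R_NormedModule))|]. intros y Hy.
  (* Every neighbourhood of x within [I] contains x itself, so the restricted filter has no limit
     other than x. *)
  assert (Ey : x = y).
  { apply NNPP. intros Hne. assert (Hr : 0 < Rabs (x - y)) by (apply Rabs_pos_lt; lra).
    assert (HP : locally y (fun z => Rabs (z - y) < Rabs (x - y))).
    { exists (mkposreal _ Hr). intros z Hz. exact Hz. }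
    apply Hy in HP. destruct HP as [dl HP]. specialize (HP x (ball_center x dl) Hx). lra. }
  subst y. intros eps. assert (HK : 0 < Rabs K + 1) by (pose proof (Rabs_pos K); lra).
  assert (Hd : 0 < eps / (Rabs K + 1)) by (apply Rdiv_lt_0_compat; trivial; apply cond_pos).
  exists (mkposreal _ Hd). intros u Hu HIu.
  change (Rabs (u - x) < eps / (Rabs K + 1)) in Hu.
  rewrite <- Cmod_norm.
  change (Cmod (f u - f x - scal (V := C_R_NormedModule) (u - x)%R d)%C <= eps * Rabs (u - x)).
  rewrite scal_R_Cmult. eapply Rle_trans; [now apply H|].
  rewrite <- pow2_abs. simpl. rewrite Rmult_1_r, <- Rmult_assoc.
  apply Rmult_le_compat_r; [apply Rabs_pos|].
  apply (Rmult_lt_compat_r (Rabs K + 1)) in Hu; trivial.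
  unfold Rdiv in Hu. rewrite Rmult_assoc, Rinv_l, Rmult_1_r in Hu by lra.
  pose proof (Rle_abs K). pose proof (Rabs_pos (u - x)).
  assert (K * Rabs (u - x) <= (Rabs K + 1) * Rabs (u - x)) by (apply Rmult_le_compat_r; lra). lra.
Qed.

Lemma continuous_on_of_lipschitz (P : R * R -> Prop) (f : fn) L : 0 <= L ->
  (forall x e x' e', Cmod (f x' e' - f x e) <= L * dist2 x e x' e') ->
  continuous_on P (fun p => f (fst p) (snd p)).
Proof.
  intros HL Hf p _. apply (filterlim_locally (U := C_UniformSpace)). intros eps.
  assert (Hd : 0 < eps / (2 * L + 1)) by (apply Rdiv_lt_0_compat; [apply cond_pos|lra]).
  exists (mkposreal _ Hd). intros q [H1 H2] _.
  change (Rabs (fst q - fst p) < eps / (2 * L + 1)) in H1.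
  change (Rabs (snd q - snd p) < eps / (2 * L + 1)) in H2.
  assert (H : Cmod (f (fst q) (snd q) - f (fst p) (snd p)) < eps).
  { eapply Rle_lt_trans; [apply Hf|]. unfold dist2.
    set (r := eps / (2 * L + 1)) in *. assert (E : pos eps = r * (2 * L + 1)) by (unfold r; field; lra).
    rewrite E. assert (L * (Rabs (fst q - fst p) + Rabs (snd q - snd p)) <= L * (2 * r)) by (apply Rmult_le_compat_l; lra).
    lra. }
  split.
  - change (Rabs (Re (f (fst q) (snd q) - f (fst p) (snd p))) < eps). eapply Rle_lt_trans; [apply re_le_Cmod|exact H].
  - change (Rabs (Im (f (fst q) (snd q) - f (fst p) (snd p))) < eps). eapply Rle_lt_trans; [apply Im_le_Cmod|exact H].
Qed.

(** The derivatives on the closed rectangle are the extensions of the interior ones: the quadratic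
    estimates hold up to the boundary by [diff2_ext_closed], and they give one-sided derivatives at
    end points, in particular at e = 0. *)
Theorem smooth_on2_ext A B e1 e' f : A < B -> 0 < e' <= e1 -> smooth2 (rect A B 0 e1) f ->
  smooth_on2 (cint A B) (cint 0 e') (ext A B 0 e1 f).
Proof.
  intros HAB He' Hf. assert (He1 : 0 < e1) by lra.
  assert (HX : forall n, smooth2 (rect A B 0 e1) (Nat.iter n dX f)).
  { induction n as [|n IH]; trivial. now apply (smooth2_dX _ (Nat.iter n dX f)). }
  assert (HE : forall n, smooth2 (rect A B 0 e1) (Nat.iter n dE f)).
  { induction n as [|n IH]; trivial. now apply (smooth2_dE _ (Nat.iter n dE f)). }
  assert (HQ : forall g, smooth2 (rect A B 0 e1) g ->
    diff2 (crect A B 0 e1) (ext A B 0 e1 g) (ext A B 0 e1 (dX g)) (ext A B 0 e1 (dE g))).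
  { intros g Hg.
    destruct (smooth2_lip2 _ g (convex2_rect _ _ _ _) Hg) as [L1 [HL1 Hl1]].
    destruct (smooth2_lip2 _ _ (convex2_rect _ _ _ _) (smooth2_dX _ g Hg)) as [L2 [HL2 Hl2]].
    destruct (smooth2_lip2 _ _ (convex2_rect _ _ _ _) (smooth2_dE _ g Hg)) as [L3 [HL3 Hl3]].
    assert (Hw : forall k L, 0 <= L -> L <= L1 + L2 + L3 -> lip2 (rect A B 0 e1) k L -> lip2 (rect A B 0 e1) k (L1 + L2 + L3)).
    { intros k L H0 H1 H x e y d Hx Hy. eapply Rle_trans; [now apply H|]. apply Rmult_le_compat_r; trivial. apply dist2_pos. }
    apply (diff2_ext_closed A B 0 e1 HAB He1 g (dX g) (dE g) (L1 + L2 + L3)).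
    - lra.
    - apply (Hw g L1); trivial; lra.
    - apply (Hw (dX g) L2); trivial; lra.
    - apply (Hw (dE g) L3); trivial; lra.
    - apply smooth2_bounded, smooth2_dX, Hg.
    - apply smooth2_bounded, smooth2_dE, Hg.
    - now apply smooth2_diff2. }
  assert (HCo : forall g, smooth2 (rect A B 0 e1) g -> forall P : R * R -> Prop,
    continuous_on P (fun p => ext A B 0 e1 g (fst p) (snd p))).
  { intros g Hg P. destruct (smooth2_lip2 _ g (convex2_rect _ _ _ _) Hg) as [L [HL Hl]].
    apply (continuous_on_of_lipschitz P (ext A B 0 e1 g) L HL). now apply ext_lip. }
  exists (fun n => ext A B 0 e1 (Nat.iter n dX f)), (fun n => ext A B 0 e1 (Nat.iter n dE f)).
  split; [|split].
  - intros x e _ _. split; reflexivity.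
  - intros n x e Hx He. assert (He2 : 0 <= e <= e1) by (unfold cint in He; lra).
    split.
    + destruct (HQ _ (HX n)) as [K HK]. apply (is_derive_on_of_quadratic _ _ _ _ K); trivial.
      intros u Hu. specialize (HK x e u e (conj Hx He2) (conj Hu He2)).
      unfold remainder, dist2 in HK. rewrite Rminus_diag, Rabs_R0, Rplus_0_r, pow2_abs in HK.
      eapply Rle_trans; [|exact HK]. right. f_equal.
      change (Nat.iter (S n) dX f) with (dX (Nat.iter n dX f)). ring.
    + destruct (HQ _ (HE n)) as [K HK]. apply (is_derive_on_of_quadratic _ _ _ _ K); trivial.
      intros u Hu. assert (Hu2 : 0 <= u <= e1) by (unfold cint in Hu; lra).
      specialize (HK x e x u (conj Hx He2) (conj Hx Hu2)).
      unfold remainder, dist2 in HK. rewrite Rminus_diag, Rabs_R0, Rplus_0_l, pow2_abs in HK.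
      eapply Rle_trans; [|exact HK]. right. f_equal.
      change (Nat.iter (S n) dE f) with (dE (Nat.iter n dE f)). ring.
  - intros n. split; apply HCo; trivial.
Qed.

(** * Nonvanishing fundamental systems *)

Lemma uniform_constant N (P : nat -> R -> Prop) : (forall j K K', K <= K' -> P j K -> P j K') ->
  (forall j, (j <= N)%nat -> exists K, P j K) -> exists K, 0 < K /\ forall j, (j <= N)%nat -> P j K.
Proof.
  intros Hmono. induction N as [|N IH]; intros H.
  - destruct (H 0%nat ltac:(lia)) as [K HK]. exists (Rabs K + 1).
    pose proof (Rle_abs K). pose proof (Rabs_pos K). split; [lra|].
    intros j Hj. replace j with 0%nat by lia. apply (Hmono _ K); trivial. lra.
  - destruct IH as [K1 [HK1 H1]]; [intros; apply H; lia|].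
    destruct (H (S N) ltac:(lia)) as [K2 H2]. exists (K1 + Rabs K2).
    pose proof (Rle_abs K2). pose proof (Rabs_pos K2). split; [lra|].
    intros j Hj. destruct (Nat.eq_dec j (S N)) as [->|Hne].
    + apply (Hmono _ K2); trivial. lra.
    + apply (Hmono _ K1); [lra|]. apply H1. lia.
Qed.

Lemma csum_vector_bound N (c : nat -> C) v K : (forall m, (m <= N)%nat -> Cmod (v m) <= K) ->
  Cmod (csum (fun m => c m * v m)%C N) <= K * vnorm N c.
Proof.
  intros H. rewrite (csum_ext _ (fun m => v m * c m)%C) by (intros; ring). now apply matrix_vector_bound.
Qed.

Lemma vnorm_zero N v : vnorm N v <= 0 -> forall i, (i <= N)%nat -> v i = RtoC 0.
Proof.
  intros H i Hi. apply Cmod_eq_0. pose proof (vnorm_ge N v i Hi). pose proof (Cmod_ge_0 (v i)). lra.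
Qed.

(** Invertibility of the matrix with columns [Y m], in the quantitative form of a bound on the
    inverse. In this form it passes to limits. *)
Definition lower_bound (U : dom) (N : nat) (Y : nat -> nat -> fn) (k : R) :=
  forall c x e, U x e -> vnorm N c <= k * vnorm N (fun i => csum (fun m => c m * Y m i x e)%C N).

Section ClosedSystem.
Variables (N : nat) (A B e1 : R) (Y : nat -> nat -> fn) (C0 : R).
Hypothesis HAB : A < B.
Hypothesis He1 : 0 < e1.
Let U := rect A B 0 e1.
Hypothesis HY : forall m i, (m <= N)%nat -> (i <= N)%nat -> smooth2 U (Y m i).
Hypothesis HC0 : 0 <= C0.
Hypothesis Hlow : lower_bound U N Y C0.

Lemma system_lipschitz : exists L, 0 < L /\ forall m i, (m <= N)%nat -> (i <= N)%nat -> lip2 U (Y m i) L.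
Proof.
  assert (Hmono : forall f K K', K <= K' -> lip2 U f K -> lip2 U f K').
  { intros f K K' HK H x e x' e' Hx Hx'. eapply Rle_trans; [now apply H|].
    apply Rmult_le_compat_r; trivial. apply dist2_pos. }
  destruct (uniform_constant N (fun m K => forall i, (i <= N)%nat -> lip2 U (Y m i) K)) as [L [HL H]].
  - intros j K K' HK H i Hi. now apply (Hmono _ K), H.
  - intros m Hm. destruct (uniform_constant N (fun i K => lip2 U (Y m i) K)) as [L [HL H]].
    + intros j K K'. apply Hmono.
    + intros i Hi. destruct (smooth2_lip2 U (Y m i) (convex2_rect _ _ _ _) (HY m i Hm Hi)) as [L [_ HL]]. now exists L.
    + now exists L.
  - exists L. split; trivial. intros; now apply H.
Qed.

Lemma system_bounded : exists M, 0 < M /\ forall m i, (m <= N)%nat -> (i <= N)%nat ->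
  forall x e, U x e -> Cmod (Y m i x e) <= M.
Proof.
  destruct (uniform_constant N (fun m K => forall i, (i <= N)%nat -> forall x e, U x e -> Cmod (Y m i x e) <= K))
    as [L [HL H]].
  - intros j K K' HK H i Hi x e Hx. apply Rle_trans with K; trivial. now apply H.
  - intros m Hm. destruct (uniform_constant N (fun i K => forall x e, U x e -> Cmod (Y m i x e) <= K)) as [L [HL H]].
    + intros j K K' HK H x e Hx. apply Rle_trans with K; trivial. now apply H.
    + intros i Hi. apply (smooth2_bounded U (Y m i)), HY; trivial.
    + now exists L.
  - exists L. split; trivial. intros; now apply H.
Qed.

(** The interior bound at the contracted points tends to that at the boundary. It holds at every
    point of the plane because [ext] first projects onto the rectangle. *)
Lemma closed_lower_bound : lower_bound (fun _ _ => True) N (fun m i => ext A B 0 e1 (Y m i)) C0.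
Proof.
  intros c x e _. destruct system_lipschitz as [L [HL Hl]].
  pose proof (vnorm_pos N c) as Hc.
  set (W := B - A + (e1 - 0)). assert (HW : 0 < W) by (unfold W; lra).
  apply (le_of_archimedean _ _ (C0 * (INR (S N) * (4 * L * W * vnorm N c)))).
  intros n. pose proof (ext_point A B 0 e1 HAB He1 x e n) as Hp. cbv beta zeta in Hp.
  eapply Rle_trans; [apply (Hlow c _ _ Hp)|].
  set (xn := inward A B (clamp A B x) n) in *. set (en := inward 0 e1 (clamp 0 e1 e) n) in *.
  replace (C0 * vnorm N (fun i => csum (fun m => c m * ext A B 0 e1 (Y m i) x e)%C N) +
    C0 * (INR (S N) * (4 * L * W * vnorm N c)) / (INR n + 1)) with
    (C0 * (vnorm N (fun i => csum (fun m => c m * ext A B 0 e1 (Y m i) x e)%C N) +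
    INR (S N) * (4 * L * W * vnorm N c / (INR n + 1)))) by (unfold Rdiv; ring).
  apply Rmult_le_compat_l; trivial. apply vnorm_add_le. intros i Hi.
  replace (csum (fun m => c m * Y m i xn en)%C N) with
    (csum (fun m => c m * ext A B 0 e1 (Y m i) x e)%C N +
     csum (fun m => c m * (Y m i xn en - ext A B 0 e1 (Y m i) x e))%C N)%C.
  2:{ rewrite <- csum_plus. apply csum_ext. intros; ring. }
  eapply Rle_trans; [apply Cmod_triangle|]. apply Rplus_le_compat_l.
  replace (4 * L * W * vnorm N c / (INR n + 1)) with (4 * L * W / (INR n + 1) * vnorm N c) by (unfold Rdiv; ring).
  apply csum_vector_bound. intros m Hm. rewrite Cmod_sub_sym.
  apply (ext_approx A B 0 e1 HAB He1 (Y m i) L); [lra|]. now apply Hl.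
Qed.

(* The remaining N rows always admit a dependency, so the first row cannot be small. *)
Lemma first_row_bound x e : exists j, (j <= N)%nat /\ / (C0 + 1) <= Cmod (ext A B 0 e1 (Y j 0%nat) x e).
Proof.
  apply NNPP. intros Hno.
  destruct (linear_dependence N (fun i m => ext A B 0 e1 (Y m (S i)) x e)) as [c [[p [Hp Hcp]] Hc]].
  pose proof (closed_lower_bound c x e Logic.I) as HL.
  assert (HC1 : 0 < / (C0 + 1)) by (apply Rinv_0_lt_compat; lra).
  assert (Hv : vnorm N (fun i => csum (fun m => c m * ext A B 0 e1 (Y m i) x e)%C N) <= / (C0 + 1) * vnorm N c).
  { assert (E : forall g : nat -> C, (forall i, (i < N)%nat -> g (S i) = RtoC 0) -> vnorm N g <= Cmod (g 0%nat)).
    { intros g Hg. unfold vnorm. clear - Hg. induction N as [|n IH]; simpl; [lra|].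
      rewrite Hg by lia. rewrite Cmod_0, Rplus_0_r. apply IH. intros; apply Hg; lia. }
    eapply Rle_trans; [apply E; intros i Hi; apply (Hc i Hi)|].
    apply csum_vector_bound. intros m Hm.
    destruct (Rle_dec (/ (C0 + 1)) (Cmod (ext A B 0 e1 (Y m 0%nat) x e))) as [H|H]; [|lra].
    elim Hno. now exists m. }
  apply Hcp. apply (vnorm_zero N c); trivial.
  assert (H1 : C0 * (/ (C0 + 1) * vnorm N c) = vnorm N c - / (C0 + 1) * vnorm N c) by (field; lra).
  assert (H2 : vnorm N c <= C0 * (/ (C0 + 1) * vnorm N c)).
  { eapply Rle_trans; [exact HL|]. now apply Rmult_le_compat_l. }
  pose proof (vnorm_pos N c) as Hpos.
  destruct (Rle_lt_or_eq_dec _ _ Hpos) as [H|H]; [|lra].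
  pose proof (Rmult_lt_0_compat _ _ HC1 H). lra.
Qed.

(* A generic combination of the first row vanishes nowhere; a small multiple of each basis
   solution is added to it. *)
Theorem nonvanishing_system M :
  (forall m, (m <= N)%nat -> one_step A B e1 N M (Y m) (fun _ _ _ => RtoC 0)) ->
  exists e2 (V : nat -> nat -> fn) C1 eta, 0 < e2 <= e1 /\ 0 <= C1 /\ 0 < eta /\
  (forall m i, (m <= N)%nat -> (i <= N)%nat -> smooth2 (rect A B 0 e2) (V m i)) /\
  (forall m, (m <= N)%nat -> one_step A B e2 N M (V m) (fun _ _ _ => RtoC 0)) /\
  lower_bound (rect A B 0 e2) N V C1 /\
  forall m x e, (m <= N)%nat -> rect A B 0 e2 x e -> eta <= Cmod (V m 0%nat x e).
Proof.
  intros HM. destruct system_lipschitz as [L [HL Hl]]. destruct system_bounded as [K [HK Hb]].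
  set (gam := fun j x => ext A B 0 e1 (Y j 0%nat) x 0).
  assert (HC1 : 0 < / (C0 + 1)) by (apply Rinv_0_lt_compat; lra).
  destruct (nonvanishing_combination N gam A B L K (/ (C0 + 1) / 2)) as [c [eta [Heta Hc]]]; trivial; try lra.
  { intros j x y Hj _ _. unfold gam.
    eapply Rle_trans; [apply (ext_lip A B 0 e1 HAB He1 (Y j 0%nat) L); [lra|apply Hl; lia]|].
    unfold dist2. rewrite Rminus_diag, Rabs_R0, Rplus_0_r. lra. }
  { intros j x Hj _. apply (ext_bound A B 0 e1 HAB He1 (Y j 0%nat) L); [lra|apply Hl; lia|]. apply Hb; lia. }
  { intros x _. destruct (first_row_bound x 0) as [j [Hj H]]. exists j. split; trivial. unfold gam. lra. }
  set (s := csum c N).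
  (* The new solutions are sum_j c_j Y_j + dl Y_m, a change of basis with determinant dl^N (s + dl),
     where s is the sum of the c_j. Of the two candidates for dl at most one is a zero of s + dl. *)
  assert (Hdl : exists dl, 0 < dl /\ dl * K <= eta / 2 /\ (s + RtoC dl)%C <> RtoC 0).
  { assert (H1 : 0 < eta / (2 * K)) by (apply Rdiv_lt_0_compat; lra).
    assert (H2 : eta / (2 * K) * K = eta / 2) by (field; lra).
    destruct (Ceq_dec (s + RtoC (eta / (2 * K))) (RtoC 0)) as [E|E].
    - exists (eta / (2 * K) / 2). split; [lra|]. split; [lra|]. intros E'.
      assert (E2 : RtoC (eta / (2 * K)) = RtoC (eta / (2 * K) / 2)).
      { replace (RtoC (eta / (2 * K))) with (s + RtoC (eta / (2 * K)) - s)%C by ring.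
        rewrite E, <- E'. ring. }
      apply RtoC_inj in E2. lra.
    - exists (eta / (2 * K)). split; [lra|]. split; [lra|trivial]. }
  destruct Hdl as [dl [Hdl [HdlK Hs]]].
  set (V := fun m i x e => (csum (fun j => c j * Y j i x e)%C N + RtoC dl * Y m i x e)%C).
  pose proof (vnorm_pos N c) as Hvc.
  set (q := L * (vnorm N c + dl)). assert (Hq : 0 < q) by (apply Rmult_lt_0_compat; lra).
  (* Out of the lower bound eta at e = 0, the perturbation dl Y_m takes at most eta / 2 and, for e <
     e2, the Lipschitz variation in e at most eta / 4; eta / 4 remains. *)
  set (e2 := Rmin e1 (eta / (4 * q))).
  assert (He2 : 0 < e2) by (apply Rmin_pos; trivial; apply Rdiv_lt_0_compat; lra).
  assert (He21 : e2 <= e1) by apply Rmin_l.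
  assert (He2q : e2 * q <= eta / 4).
  { apply Rle_trans with (eta / (4 * q) * q); [apply Rmult_le_compat_r; [lra|apply Rmin_r]|right; field; lra]. }
  assert (Hsub : sub2 (rect A B 0 e2) U) by (intros x e [? ?]; split; lra).
  exists e2, V, ((1 + vnorm N c * / Cmod (s + RtoC dl)) * / dl * C0), (eta / 4).
  assert (Hsd : 0 < Cmod (s + RtoC dl)) by now apply Cmod_gt_0.
  assert (His : 0 < / Cmod (s + RtoC dl)) by now apply Rinv_0_lt_compat.
  assert (Hid : 0 < / dl) by now apply Rinv_0_lt_compat.
  assert (HP : 0 <= vnorm N c * / Cmod (s + RtoC dl)) by (apply Rmult_le_pos; lra).
  split; [split; lra|]. split; [repeat apply Rmult_le_pos; lra|]. split; [lra|].
  split; [|split; [|split]].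
  - intros m i Hm Hi n. apply (Sm_sub n U); trivial.
    apply Sm_plus; [apply open2_rect| |apply Sm_scal; [apply open2_rect|now apply HY]].
    apply Sm_csum; [apply open2_rect|]. intros k Hk. apply Sm_scal; [apply open2_rect|now apply HY].
  - intros m Hm i x e Hi [Hx He].
    assert (Ht : trap A B e1 x e) by (split; trivial; lra).
    pose proof (one_step_combination A B e1 N M Y c HM i x e Hi Ht) as E1.
    pose proof (HM m Hm i x e Hi Ht) as E2. unfold V. cbv beta in E1. rewrite E1, E2.
    rewrite (csum_ext (fun k => M i k x e * (csum (fun j => c j * Y j k x e)%C N + RtoC dl * Y m k x e))%C
      (fun k => M i k x e * csum (fun j => c j * Y j k x e)%C N + RtoC dl * (M i k x e * Y m k x e))%C)
      by (intros; ring).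
    rewrite csum_plus, csum_scal. ring.
  (* The change of basis is inverted explicitly: [f] holds the coordinates with respect to [Y],
     their sum is D (s + dl), which recovers D and then each d_j. *)
  - intros d x e Hx. set (D := csum d N). set (f := fun j => (D * c j + RtoC dl * d j)%C).
    assert (E : forall i, csum (fun m => d m * V m i x e)%C N = csum (fun j => f j * Y j i x e)%C N).
    { intros i. unfold V, f.
      rewrite (csum_ext (fun m => d m * (csum (fun j => c j * Y j i x e)%C N + RtoC dl * Y m i x e))%C
        (fun m => csum (fun j => c j * Y j i x e)%C N * d m + RtoC dl * (d m * Y m i x e))%C) by (intros; ring).
      rewrite (csum_ext (fun j => (D * c j + RtoC dl * d j) * Y j i x e)%C
        (fun j => D * (c j * Y j i x e) + RtoC dl * (d j * Y j i x e))%C) by (intros; ring).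
      rewrite !csum_plus, !csum_scal. fold D. ring. }
    rewrite (vnorm_ext N (fun i => csum (fun m => d m * V m i x e)%C N)
      (fun i => csum (fun j => f j * Y j i x e)%C N)) by (intros; apply E).
    apply Rle_trans with ((1 + vnorm N c * / Cmod (s + RtoC dl)) * / dl * vnorm N f).
    2:{ rewrite (Rmult_assoc _ C0). apply Rmult_le_compat_l; [apply Rmult_le_pos; lra|]. apply Hlow. now apply Hsub. }
    assert (HD : Cmod D <= / Cmod (s + RtoC dl) * vnorm N f).
    { assert (EF : csum f N = (D * (s + RtoC dl))%C).
      { unfold f. rewrite csum_plus, !csum_scal. fold s D. ring. }
      apply (Rmult_le_reg_r (Cmod (s + RtoC dl))); trivial.
      rewrite <- Cmod_mult, <- EF. eapply Rle_trans; [apply Cmod_csum|]. unfold vnorm. right. field. lra. }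
    assert (Hf : 0 <= vnorm N f) by apply vnorm_pos.
    assert (Hdj : forall j, (j <= N)%nat -> Cmod (d j) <= / dl * (Cmod (f j) + Cmod D * Cmod (c j))).
    { intros j Hj. apply (Rmult_le_reg_l dl); trivial. rewrite <- Rmult_assoc, Rinv_r, Rmult_1_l by lra.
      replace (dl * Cmod (d j)) with (Cmod (RtoC dl * d j)) by (rewrite Cmod_rmult, Rabs_pos_eq; lra).
      replace (RtoC dl * d j)%C with (f j - D * c j)%C by (unfold f; ring).
      eapply Rle_trans; [apply Cmod_minus_le|]. rewrite Cmod_mult. lra. }
    assert (Hsum : vnorm N d <= / dl * (vnorm N f + Cmod D * vnorm N c)).
    { unfold vnorm. rewrite scal_sum.
      rewrite <- sum_plus.
      replace (/ dl * sum_f_R0 (fun l => Cmod (f l) + Cmod (c l) * Cmod D) N) with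
        (sum_f_R0 (fun l => (Cmod (f l) + Cmod (c l) * Cmod D) * / dl) N) by (rewrite scal_sum; trivial).
      apply sum_Rle. intros j Hj. specialize (Hdj j Hj). lra. }
    eapply Rle_trans; [exact Hsum|].
    replace ((1 + vnorm N c * / Cmod (s + RtoC dl)) * / dl * vnorm N f) with
      (/ dl * (vnorm N f + / Cmod (s + RtoC dl) * vnorm N f * vnorm N c)) by ring.
    apply Rmult_le_compat_l; [lra|]. apply Rplus_le_compat_l. now apply Rmult_le_compat_r.
  - intros m x e Hm Hx. pose proof (Hsub x e Hx) as HxU. destruct Hx as [Hx He].
    set (z := fun j => (Y j 0%nat x e - gam j x)%C).
    assert (Hz : forall j, (j <= N)%nat -> Cmod (z j) <= L * e).
    { intros j Hj. unfold z, gam. assert (Hlj : lip2 U (Y j 0%nat) L) by (apply Hl; lia).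
      rewrite <- (ext_inside A B 0 e1 HAB He1 (Y j 0%nat) L) by (trivial; lra).
      eapply Rle_trans; [apply (ext_lip A B 0 e1 HAB He1 (Y j 0%nat) L); trivial; lra|].
      unfold dist2. rewrite Rminus_diag, Rabs_R0, Rplus_0_l, Rminus_0_r, Rabs_pos_eq; lra. }
    assert (E : V m 0%nat x e = (csum (fun j => c j * gam j x) N + RtoC dl * gam m x
       + (csum (fun j => c j * z j) N + RtoC dl * z m))%C).
    { unfold V. rewrite (csum_ext (fun j => c j * Y j 0%nat x e)%C (fun j => c j * gam j x + c j * z j)%C)
        by (intros; unfold z; ring).
      rewrite csum_plus. unfold z. ring. }
    pose proof (Hc x ltac:(lra)) as F1.
    assert (F2 : Cmod (RtoC dl * gam m x) <= eta / 2).
    { rewrite Cmod_rmult, Rabs_pos_eq by lra. eapply Rle_trans; [|exact HdlK]. apply Rmult_le_compat_l; [lra|].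
      apply (ext_bound A B 0 e1 HAB He1 (Y m 0%nat) L); [lra|apply Hl; lia|]. apply Hb; lia. }
    assert (F3 : Cmod (csum (fun j => c j * z j)%C N + RtoC dl * z m) <= eta / 4).
    { eapply Rle_trans; [apply Cmod_triangle|].
      pose proof (csum_vector_bound N c z (L * e) Hz) as G1.
      assert (G2 : Cmod (RtoC dl * z m) <= dl * (L * e)).
      { rewrite Cmod_rmult, Rabs_pos_eq by lra. apply Rmult_le_compat_l; [lra|]. now apply Hz. }
      assert (G3 : e * q <= e2 * q) by (apply Rmult_le_compat_r; lra).
      assert (G4 : L * e * vnorm N c + dl * (L * e) = e * q) by (unfold q; ring). lra. }
    rewrite E. set (p1 := csum (fun j => c j * gam j x)%C N) in *. set (p2 := (RtoC dl * gam m x)%C) in *.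
    set (p3 := (csum (fun j => c j * z j)%C N + RtoC dl * z m)%C) in *.
    pose proof (Cmod_minus_le (p1 + p2 + p3) p3) as T1. replace (p1 + p2 + p3 - p3)%C with (p1 + p2)%C in T1 by ring.
    pose proof (Cmod_minus_le (p1 + p2) p2) as T2. replace (p1 + p2 - p2)%C with p1 in T2 by ring. lra.
Qed.

End ClosedSystem.

(** * Fundamental sets on the closed interval *)

Lemma lipschitz_zero_closed (f : R -> C) p q K : p < q -> 0 <= K ->
  (forall x y, p <= x <= q -> p <= y <= q -> Cmod (f y - f x) <= K * Rabs (y - x)) ->
  (forall x, p < x < q -> f x = RtoC 0) -> forall x, p <= x <= q -> f x = RtoC 0.
Proof.
  intros Hpq HK Hf H0 x Hx. apply Cmod_eq_0.
  assert (H : Cmod (f x) <= 0); [|pose proof (Cmod_ge_0 (f x)); lra].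
  apply (le_of_archimedean _ _ (K * (q - p))). intros n.
  pose proof (inward_range p q x n Hpq Hx) as H1. pose proof (inward_self p q x n Hpq Hx) as H2.
  pose proof (Hf x (inward p q x n) Hx ltac:(lra)) as H3. rewrite (H0 _ H1) in H3.
  replace (RtoC 0 - f x)%C with (- f x)%C in H3 by ring. rewrite Cmod_opp in H3.
  eapply Rle_trans; [exact H3|]. rewrite Rplus_0_l. unfold Rdiv. rewrite Rmult_assoc.
  now apply Rmult_le_compat_l.
Qed.

Lemma cexp_lipschitz M : exists K, 0 <= K /\ forall z w, Cmod z <= M -> Cmod w <= M ->
  Cmod (cexp z - cexp w) <= K * Cmod (z - w).
Proof.
  set (E := exp M). assert (HE : 0 < E) by apply exp_pos.
  exists (9 * E). split; [lra|].
  assert (Hb : forall z, Cmod z <= M -> Cmod (cexp z) <= E).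
  { intros z Hz. rewrite Cmod_cexp. pose proof (re_le_Cmod z) as H1. apply Rabs_le_between in H1.
    unfold E. destruct (Rle_lt_or_eq_dec (Re z) M ltac:(lra)) as [H3| ->]; [left; now apply exp_increasing|lra]. }
  intros z w Hz Hw. set (r := (z - w)%C).
  destruct (Rle_dec (Cmod r) 1) as [Hr|Hr].
  - replace (cexp z - cexp w)%C with (cexp w * ((cexp r - 1 - r) + r))%C.
    2:{ replace z with (w + r)%C by (unfold r; ring). rewrite cexp_plus. ring. }
    rewrite Cmod_mult. replace (9 * E * Cmod r) with (E * (8 * Cmod r + Cmod r)) by ring.
    apply Rmult_le_compat; try apply Cmod_ge_0; auto.
    eapply Rle_trans; [apply Cmod_triangle|]. apply Rplus_le_compat_r.
    eapply Rle_trans; [now apply cexp_quadratic|]. pose proof (Cmod_ge_0 r). simpl. rewrite Rmult_1_r.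
    assert (Cmod r * Cmod r <= 1 * Cmod r) by (apply Rmult_le_compat_r; lra). lra.
  - eapply Rle_trans; [apply Cmod_minus_le|]. pose proof (Hb z Hz). pose proof (Hb w Hw).
    assert (9 * E * 1 <= 9 * E * Cmod r) by (apply Rmult_le_compat_l; lra). lra.
Qed.

(** Bounded and Lipschitz functions form an algebra in which an identity on the open interval
    extends to the end points. Identities between extensions are proved in this way, since only
    their interior values are known explicitly. *)
Definition regular_on (p q : R) (f : R -> C) := exists K, 0 <= K /\
  (forall x, p <= x <= q -> Cmod (f x) <= K) /\
  forall x y, p <= x <= q -> p <= y <= q -> Cmod (f y - f x) <= K * Rabs (y - x).

Lemma regular_on_plus p q f g : regular_on p q f -> regular_on p q g -> regular_on p q (fun x => f x + g x)%C.
Proof.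
  intros [K1 [HK1 [B1 L1]]] [K2 [HK2 [B2 L2]]]. exists (K1 + K2). split; [lra|]. split.
  - intros x Hx. eapply Rle_trans; [apply Cmod_triangle|]. apply Rplus_le_compat; auto.
  - intros x y Hx Hy. replace (f y + g y - (f x + g x))%C with ((f y - f x) + (g y - g x))%C by ring.
    eapply Rle_trans; [apply Cmod_triangle|]. rewrite Rmult_plus_distr_r. apply Rplus_le_compat; auto.
Qed.

Lemma regular_on_mult p q f g : regular_on p q f -> regular_on p q g -> regular_on p q (fun x => f x * g x)%C.
Proof.
  intros [K1 [HK1 [B1 L1]]] [K2 [HK2 [B2 L2]]]. exists (K1 * K2 + (K1 * K2 + K1 * K2)).
  assert (HK : 0 <= K1 * K2) by now apply Rmult_le_pos.
  split; [lra|]. split.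
  - intros x Hx. rewrite Cmod_mult. apply Rle_trans with (K1 * K2); [|lra].
    apply Rmult_le_compat; try apply Cmod_ge_0; auto.
  - intros x y Hx Hy. replace (f y * g y - f x * g x)%C with ((f y - f x) * g y + f x * (g y - g x))%C by ring.
    pose proof (Rabs_pos (y - x)) as Hd.
    assert (T1 : Cmod ((f y - f x) * g y) <= K1 * Rabs (y - x) * K2).
    { rewrite Cmod_mult. apply Rmult_le_compat; try apply Cmod_ge_0; auto. }
    assert (T2 : Cmod (f x * (g y - g x)) <= K1 * (K2 * Rabs (y - x))).
    { rewrite Cmod_mult. apply Rmult_le_compat; try apply Cmod_ge_0; auto. }
    assert (0 <= K1 * K2 * Rabs (y - x)) by now apply Rmult_le_pos.
    eapply Rle_trans; [apply Cmod_triangle|]. lra.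
Qed.

Lemma regular_on_const p q c : regular_on p q (fun _ => c).
Proof.
  exists (Cmod c). split; [apply Cmod_ge_0|]. split; [intros; lra|]. intros x y _ _.
  replace (c - c)%C with (RtoC 0) by ring. rewrite Cmod_0. apply Rmult_le_pos; [apply Cmod_ge_0|apply Rabs_pos].
Qed.

Lemma regular_on_csum p q (f : nat -> R -> C) n : (forall j, (j <= n)%nat -> regular_on p q (f j)) ->
  regular_on p q (fun x => csum (fun j => f j x) n).
Proof.
  induction n as [|n IH]; intros H; simpl; [now apply H|].
  apply regular_on_plus; [apply IH; intros; apply H; lia|now apply H].
Qed.

Lemma regular_on_shift p q s f : regular_on (p + s) (q + s) f -> regular_on p q (fun x => f (x + s)).
Proof.
  intros [K [HK [B L]]]. exists K. split; trivial. split.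
  - intros x Hx. apply B. lra.
  - intros x y Hx Hy. replace (y - x) with (y + s - (x + s)) by ring. apply L; lra.
Qed.

Lemma regular_on_sub p q p' q' f : p <= p' -> q' <= q -> regular_on p q f -> regular_on p' q' f.
Proof. intros H1 H2 [K [HK [B L]]]. exists K. split; trivial. split; intros; [apply B|apply L]; lra. Qed.

Lemma regular_on_zero f p q : p < q -> regular_on p q f -> (forall x, p < x < q -> f x = RtoC 0) ->
  forall x, p <= x <= q -> f x = RtoC 0.
Proof. intros Hpq [K [HK [_ L]]]. now apply (lipschitz_zero_closed f p q K). Qed.

Lemma regular_on_cexp p q f : regular_on p q f -> regular_on p q (fun x => cexp (f x)).
Proof.
  intros [K [HK [B L]]]. destruct (cexp_lipschitz K) as [E [HE H]].
  exists (E * K + exp K). pose proof (exp_pos K) as Hp. assert (HEK : 0 <= E * K) by now apply Rmult_le_pos.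
  split; [lra|]. split.
  - intros x Hx. rewrite Cmod_cexp. pose proof (re_le_Cmod (f x)) as H1. apply Rabs_le_between in H1.
    pose proof (B x Hx). assert (exp (Re (f x)) <= exp K); [|lra].
    destruct (Rle_lt_or_eq_dec (Re (f x)) K ltac:(lra)) as [H3| ->]; [left; now apply exp_increasing|lra].
  - intros x y Hx Hy. eapply Rle_trans; [apply H; auto|].
    pose proof (Rabs_pos (y - x)). assert (0 <= exp K * Rabs (y - x)) by (apply Rmult_le_pos; lra).
    assert (E * Cmod (f y - f x) <= E * (K * Rabs (y - x))) by (apply Rmult_le_compat_l; auto). lra.
Qed.

Lemma regular_on_ext A B e1 f e : A < B -> 0 < e1 -> smooth2 (rect A B 0 e1) f ->
  regular_on A B (fun x => ext A B 0 e1 f x e).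
Proof.
  intros HAB He1 Hf. destruct (smooth2_lip2 _ f (convex2_rect _ _ _ _) Hf) as [L [HL Hl]].
  destruct (bounded2_pos _ _ (smooth2_bounded _ f Hf)) as [K [HK Hb]].
  exists (K + L). split; [lra|]. split.
  - intros x _. apply Rle_trans with K; [|lra]. now apply (ext_bound A B 0 e1 HAB He1 f L).
  - intros x y _ _. eapply Rle_trans; [now apply (ext_lip A B 0 e1 HAB He1 f L)|].
    unfold dist2. rewrite Rminus_diag, Rabs_R0, Rplus_0_r. apply Rmult_le_compat_r; [apply Rabs_pos|lra].
Qed.

Section FundamentalSet.
Variables (N : nat) (A B e0 : R) (a : nat -> R -> R -> C) (sc : nat -> fn).
Let l := S N.
Hypothesis hAB : A < B.
Variables (e1 k0 C1 : R) (V : nat -> nat -> fn) (lg : nat -> fn).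
Hypothesis He1 : 0 < e1 <= e0.
Hypothesis Hlen : INR l * e1 < B - A.
Hypothesis Hk0 : 0 < k0.
Hypothesis Hlow : forall x e, cint A B x -> 0 <= e <= e1 -> k0 <= Cmod (a l x e).
Hypothesis Hreg : forall j e, (j <= l)%nat -> 0 <= e <= e0 -> regular_on A B (fun x => a j x e).
Hypothesis Hrec : forall x e (y : nat -> C), e <> 0 -> a l x e <> RtoC 0 ->
  csum (fun j => a j x e * y j)%C l =
  (a l x e * RtoC (e ^ l) * (quot e y l 0 + csum (fun r => sc r x e * quot e y r 0)%C N))%C.
Hypothesis HV : forall m i, (m <= N)%nat -> (i <= N)%nat -> smooth2 (rect A B 0 e1) (V m i).
Hypothesis Hstep : forall m, (m <= N)%nat -> one_step A B e1 N (companion N sc) (V m) (fun _ _ _ => RtoC 0).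
Hypothesis HC1 : 0 <= C1.
Hypothesis HlowV : lower_bound (rect A B 0 e1) N V C1.
Hypothesis Hlg : forall m, (m <= N)%nat -> smooth2 (rect A B 0 e1) (lg m).
Hypothesis Hexp : forall m x e, (m <= N)%nat -> rect A B 0 e1 x e -> cexp (lg m x e) = V m 0%nat x e.

Definition exponent (m : nat) : fn := fun x e => (RtoC e * lg m x e)%C.

Lemma exponent_smooth m : (m <= N)%nat -> smooth2 (rect A B 0 e1) (exponent m).
Proof.
  intros Hm n. apply Sm_mult; [apply open2_rect| |now apply Hlg].
  apply (Sm_coordinate n _ e1); [apply open2_rect|]. intros x e [_ He]. exact He.
Qed.

Variable e : R.
Hypothesis He : 0 < e < e1.
Let W (m i : nat) (x : R) := ext A B 0 e1 (V m i) x e.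

Lemma closed_inside f x : smooth2 (rect A B 0 e1) f -> A < x < B -> ext A B 0 e1 f x e = f x e.
Proof.
  intros Hf Hx. destruct (smooth2_lip2 _ f (convex2_rect _ _ _ _) Hf) as [L [HL Hl]].
  apply (ext_inside A B 0 e1 hAB (proj1 He1) f L); trivial. split; lra.
Qed.

Lemma closed_regular m i : (m <= N)%nat -> (i <= N)%nat -> regular_on A B (W m i).
Proof. intros Hm Hi. apply regular_on_ext; [trivial|apply He1|now apply HV]. Qed.

Lemma multiple_length j : (j <= l)%nat -> 0 <= INR j * e <= INR l * e /\ INR l * e < B - A.
Proof.
  intros Hj. apply le_INR in Hj. pose proof (pos_INR j).
  assert (0 <= INR j * e) by (apply Rmult_le_pos; lra).
  assert (INR j * e <= INR l * e) by (apply Rmult_le_compat_r; lra).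
  assert (INR l * e <= INR l * e1) by (apply Rmult_le_compat_l; lra). lra.
Qed.

Lemma step_length : A + e < B.
Proof. pose proof (multiple_length 1 ltac:(unfold l; lia)) as H. change (INR 1) with 1 in H. lra. Qed.

Lemma closed_chain m i x : (m <= N)%nat -> (i < N)%nat -> A <= x -> x + e <= B ->
  W m i (x + e) = (W m i x + RtoC e * W m (S i) x)%C.
Proof.
  intros Hm Hi Hx1 Hx2. pose proof step_length as Hl1.
  enough (H : (W m i (x + e) + (- RtoC 1) * (W m i x + RtoC e * W m (S i) x))%C = RtoC 0).
  { replace (W m i (x + e)) with ((W m i (x + e)%R + (- RtoC 1) * (W m i x + RtoC e * W m (S i) x))
      + (W m i x + RtoC e * W m (S i) x))%C by ring. rewrite H. ring. }
  pose proof (closed_regular m i Hm ltac:(lia)) as R1. pose proof (closed_regular m (S i) Hm Hi) as R2.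
  assert (Hs : forall f, regular_on A B f -> regular_on A (B - e) f).
  { intros f. apply regular_on_sub; lra. }
  apply (regular_on_zero (fun x => W m i (x + e)%R + (- RtoC 1) * (W m i x + RtoC e * W m (S i) x))%C A (B - e));
    try lra.
  - apply regular_on_plus.
    + apply (regular_on_shift A (B - e) e (W m i)). apply (regular_on_sub A B); trivial; lra.
    + apply regular_on_mult; [apply regular_on_const|]. apply regular_on_plus; [now apply Hs|].
      apply regular_on_mult; [apply regular_on_const|now apply Hs].
  - intros z Hz. unfold W. rewrite !closed_inside by (try apply HV; trivial; try lia; lra).
    rewrite (Hstep m Hm i z e ltac:(lia)) by (split; lra).
    pose proof (companion_step N sc z e (fun k => V m k z e) i Hi) as E. unfold apply_step in E.
    replace (V m i z e + RtoC e * (csum (fun k => companion N sc i k z e * V m k z e)%C N + RtoC 0))%C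
      with (V m i z e + RtoC e * csum (fun k => companion N sc i k z e * V m k z e)%C N)%C by ring.
    rewrite E. ring.
Qed.

Lemma leading_coefficient_nonzero x : cint A B x -> a l x e <> RtoC 0.
Proof. intros Hx E. pose proof (Hlow x e Hx ltac:(lra)) as H. rewrite E, Cmod_0 in H. lra. Qed.

(** For x strictly inside, the scaled form of the recurrence reduces the claim to the companion
    system. Regularity then carries it to x = A and x + l e = B, which occur when an end point of
    the interval lies on the grid. *)
Lemma closed_recurrence m x : (m <= N)%nat -> A <= x -> x + INR l * e <= B ->
  csum (fun j => a j x e * W m 0%nat (x + INR j * e)%R)%C l = RtoC 0.
Proof.
  intros Hm Hx1 Hx2.
  apply (regular_on_zero (fun x => csum (fun j => a j x e * W m 0%nat (x + INR j * e)%R)%C l) A (B - INR l * e)).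
  - pose proof (multiple_length 0 ltac:(lia)). lra.
  - apply (regular_on_csum A (B - INR l * e) (fun j x => a j x e * W m 0%nat (x + INR j * e)%R)%C l).
    intros j Hj. pose proof (multiple_length j Hj). apply regular_on_mult.
    + apply (regular_on_sub A B); try lra. apply Hreg; trivial. lra.
    + apply (regular_on_shift A (B - INR l * e) (INR j * e) (W m 0%nat)).
      apply (regular_on_sub A B); try lra. apply closed_regular; trivial. lia.
  - clear x Hx1 Hx2. intros x Hx.
    pose proof (multiple_length 0 ltac:(lia)) as Hlt.
    rewrite (Hrec x e (fun j => W m 0%nat (x + INR j * e)%R)) by (try lra; apply leading_coefficient_nonzero; split; lra).
    set (Z := fun n i => W m i (x + INR n * e)).
    assert (HQ : forall i n, (i <= N)%nat -> (i + n <= l)%nat -> quot e (fun j => Z j 0%nat) i n = Z n i).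
    { apply (quot_of_chain e N l Z); [lra|]. intros n i Hn Hi. unfold Z.
      pose proof (multiple_length (S n) Hn) as Hb. pose proof (multiple_length n ltac:(lia)) as Hb'.
      replace (x + INR (S n) * e) with (x + INR n * e + e) by (rewrite S_INR; ring).
      rewrite S_INR in Hb. apply closed_chain; trivial; lra. }
    change (fun j => W m 0%nat (x + INR j * e)%R) with (fun j => Z j 0%nat).
    rewrite (csum_ext (fun r => sc r x e * quot e (fun j => Z j 0%nat) r 0)%C (fun r => sc r x e * V m r x e)%C).
    2:{ intros r Hr. rewrite HQ by (unfold l; lia). unfold Z. simpl INR. rewrite Rmult_0_l, Rplus_0_r.
        unfold W. rewrite closed_inside; trivial; [now apply HV|lra]. }
    change (quot e (fun j => Z j 0%nat) l 0) with
      (RtoC (/ e) * (quot e (fun j => Z j 0%nat) N 1 - quot e (fun j => Z j 0%nat) N 0))%C.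
    rewrite !HQ by (unfold l; lia). unfold Z, W. simpl INR. rewrite Rmult_0_l, Rplus_0_r, Rmult_1_l.
    pose proof step_length.
    assert (Hxe : x + e < B).
    { pose proof (multiple_length 1 ltac:(unfold l; lia)) as H1. change (INR 1) with 1 in H1. lra. }
    rewrite !closed_inside by (try (apply HV; trivial); lra).
    rewrite (Hstep m Hm N x e ltac:(lia)) by (split; lra).
    pose proof (companion_last N sc x e (fun k => V m k x e)) as E. unfold apply_step in E.
    replace (V m N x e + RtoC e * (csum (fun k => companion N sc N k x e * V m k x e)%C N + RtoC 0))%C
      with (V m N x e + RtoC e * csum (fun k => companion N sc N k x e * V m k x e)%C N)%C by ring.
    rewrite E, RtoC_inv by lra. refine ((fun H : @eq C _ _ => H) _).
    field. intros E0. apply RtoC_inj in E0. lra.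
  - lra.
Qed.

Lemma closed_exponential m x : (m <= N)%nat -> cint A B x ->
  cexp (RtoC (/ e) * ext A B 0 e1 (exponent m) x e) = W m 0%nat x.
Proof.
  intros Hm Hx.
  enough (H : (cexp (RtoC (/ e) * ext A B 0 e1 (exponent m) x e) + (- RtoC 1) * W m 0%nat x)%C = RtoC 0).
  { replace (cexp (RtoC (/ e) * ext A B 0 e1 (exponent m) x e)) with
      (cexp (RtoC (/ e) * ext A B 0 e1 (exponent m) x e) + (- RtoC 1) * W m 0%nat x + W m 0%nat x)%C by ring.
    rewrite H. ring. }
  apply (regular_on_zero (fun x => cexp (RtoC (/ e) * ext A B 0 e1 (exponent m) x e) + (- RtoC 1) * W m 0%nat x)%C A B);
    trivial.
  - apply regular_on_plus.
    + apply regular_on_cexp. apply regular_on_mult; [apply regular_on_const|].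
      apply regular_on_ext; [trivial|apply He1|now apply exponent_smooth].
    + apply regular_on_mult; [apply regular_on_const|]. apply closed_regular; trivial. lia.
  - intros z Hz. unfold W. rewrite !closed_inside by (trivial; try (apply HV; trivial; lia); now apply exponent_smooth).
    unfold exponent. replace (RtoC (/ e) * (RtoC e * lg m z e))%C with (lg m z e).
    + rewrite Hexp by (trivial; split; lra). ring.
    + rewrite RtoC_inv by lra. field. intros E0. apply RtoC_inj in E0. lra.
Qed.

Lemma sum_n_m_csum (f : nat -> C) n : sum_n_m (fun m => f (m - 1)%nat) 1 (S n) = csum f n.
Proof.
  rewrite <- sum_n_m_S, <- sum_n_csum. apply sum_n_m_ext. intros k. f_equal. lia.
Qed.

(** Completeness rests on two facts: a solution is matched with a combination of the basis at the
    first l grid points, and the recurrence, solved for its last value by dividing by a_l, forces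
    agreement at all later ones. *)
Theorem exponential_fundamental_set : fundamental_set l A B a e
  (fun m k => cexp (RtoC (/ e) * ext A B 0 e1 (exponent (m - 1)) (IZR k * e) e)).
Proof.
  assert (Hgood : forall k j, (j <= l)%nat -> IZR (k + Z.of_nat j) * e = IZR k * e + INR j * e).
  { intros k j _. rewrite plus_IZR, <- INR_IZR_INZ. ring. }
  split.
  - intros m Hm k Hk. rewrite sum_n_csum.
    rewrite (csum_ext _ (fun j => a j (IZR k * e)%R e * W (m - 1) 0%nat (IZR k * e + INR j * e)%R)%C).
    + pose proof (Hk 0%nat ltac:(lia)) as K0. pose proof (Hk l ltac:(lia)) as K1.
      rewrite Hgood in K0, K1 by lia. unfold cint in K0, K1. simpl INR in K0.
      apply closed_recurrence; [unfold l in Hm; lia|lra|lra].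
    + intros j Hj. rewrite closed_exponential; [|unfold l in Hm; lia|now apply Hk]. now rewrite Hgood.
  - intros y Hy. set (k1 := first_index A e). set (g := fun n : nat => IZR (k1 + Z.of_nat n) * e).
    assert (Hg0 : A <= g 0%nat < A + e).
    { unfold g. rewrite Z.add_0_r. apply first_index_spec. lra. }
    assert (Hgs : forall n j, g (n + j)%nat = g n + INR j * e).
    { intros n j. unfold g. rewrite Nat2Z.inj_add, Z.add_assoc, (plus_IZR _ (Z.of_nat j)), <- (INR_IZR_INZ j). ring. }
    assert (HgA : forall n, A <= g n).
    { intros n. rewrite <- (Nat.add_0_l n), Hgs. pose proof (pos_INR n).
      assert (0 <= INR n * e) by (apply Rmult_le_pos; lra). lra. }
    assert (HgB : forall n, (n <= N)%nat -> g n <= B).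
    { intros n Hn. rewrite <- (Nat.add_0_l n), Hgs. pose proof (multiple_length (S n) ltac:(unfold l; lia)) as H.
      rewrite S_INR in H. lra. }
    set (w := fun m n => W m 0%nat (g n)).
    (* Columns 0 to N hold the basis solutions and column N + 1 holds y, each at the first N + 1
       grid points. *)
    destruct (linear_dependence (S N) (fun i m => if le_lt_dec m N then w m i else y (k1 + Z.of_nat i)%Z))
      as [c [[p [Hp Hcp]] Hc]].
    assert (Hc' : forall i, (i <= N)%nat ->
      (csum (fun m => c m * w m i)%C N + c (S N) * y (k1 + Z.of_nat i)%Z)%C = RtoC 0).
    { intros i Hi. rewrite <- (Hc i) by lia.
      change (csum ?f (S N)) with (csum f N + f (S N))%C. cbv beta.
      destruct (le_lt_dec (S N) N); [lia|]. f_equal. apply csum_ext. intros m Hm.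
      destruct (le_lt_dec m N); [trivial|lia]. }
    (* Otherwise a combination of basis solutions alone vanishes at N + 1 consecutive points. Then
       all its scaled differences vanish at the first of them, and the bound on the inverse matrix
       makes every coefficient zero. *)
    assert (HcN : c (S N) <> RtoC 0).
    { intros E. apply Hcp.
      set (Z := fun n i => csum (fun m => c m * W m i (g n))%C N).
      assert (HZ : forall i, (i <= N)%nat -> Z 0%nat i = RtoC 0).
      { intros i Hi. rewrite <- (quot_of_chain e N N Z) with (i := i) (m := 0%nat); try lia; try lra.
        - apply Cmod_eq_0. pose proof (Cmod_ge_0 (quot e (fun j => Z j 0%nat) i 0)).
          assert (Cmod (quot e (fun j => Z j 0%nat) i 0) <= (2 / e) ^ i * 0); [|lra].
          apply quot_bound; try lra. intros j Hj. unfold Z. specialize (Hc' j ltac:(lia)). rewrite E in Hc'.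
          replace (csum (fun m => c m * W m 0%nat (g j))%C N) with
            (csum (fun m => c m * w m j) N + RtoC 0 * y (k1 + Z.of_nat j)%Z)%C by (unfold w; ring).
          rewrite Hc', Cmod_0. lra.
        - intros n j Hn Hj. unfold Z. rewrite <- csum_scal, <- csum_plus. apply csum_ext. intros m Hm.
          pose proof (HgB (S n) Hn) as Hb. replace (S n) with (n + 1)%nat in * by lia.
          rewrite Hgs in *. simpl INR in *. rewrite Rmult_1_l in *. rewrite closed_chain; trivial. ring. }
      destruct (Nat.eq_dec p (S N)) as [->|Hne]; trivial.
      apply (vnorm_zero N c); [|lia].
      pose proof (closed_lower_bound N A B e1 V C1 hAB (proj1 He1) HV HC1 HlowV c (g 0%nat) e Logic.I) as HL.
      eapply Rle_trans; [exact HL|].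
      apply Rle_trans with (C1 * (INR (S N) * 0)); [|right; ring]. apply Rmult_le_compat_l; trivial.
      apply vnorm_le. intros i Hi. specialize (HZ i Hi). unfold Z, W in HZ. rewrite HZ, Cmod_0. lra. }
    set (d := fun m => (- (c m / c (S N)))%C).
    set (z := fun n => (csum (fun m => d m * w m n)%C N + - RtoC 1 * y (k1 + Z.of_nat n)%Z)%C).
    (* The difference between the combination and y satisfies the recurrence; strong induction goes
       from the l preceding values to the next. *)
    assert (Hz : forall n, g n <= B -> z n = RtoC 0).
    { intros n. induction n as [n IH] using (well_founded_induction lt_wf). intros Hn.
      destruct (le_lt_dec n N) as [HnN|HnN].
      - unfold z. rewrite (csum_ext _ (fun m => - / c (S N) * (c m * w m n))%C) by (intros; unfold d; field; trivial).
        rewrite csum_scal. specialize (Hc' n HnN).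
        replace (csum (fun m => c m * w m n)%C N) with
          (csum (fun m => c m * w m n) N + c (S N) * y (k1 + Z.of_nat n)%Z - c (S N) * y (k1 + Z.of_nat n)%Z)%C by ring.
        rewrite Hc'. field. trivial.
      - set (n0 := (n - l)%nat). assert (En : n = (n0 + l)%nat) by (unfold n0, l; lia).
        assert (Hx : cint A B (g n0)).
        { split; trivial. rewrite En, Hgs in Hn. pose proof (multiple_length l ltac:(lia)). lra. }
        assert (HS : csum (fun j => a j (g n0) e * z (n0 + j)%nat)%C l = RtoC 0).
        { unfold z. rewrite (csum_ext _ (fun j => csum (fun m => d m * (a j (g n0) e * w m (n0 + j)%nat))%C N
            + - RtoC 1 * (a j (g n0) e * y (k1 + Z.of_nat (n0 + j))%Z))%C).
          2:{ intros j Hj. rewrite (csum_ext (fun m => d m * (a j (g n0) e * w m (n0 + j)%nat))%C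
                (fun m => a j (g n0) e * (d m * w m (n0 + j)%nat))%C) by (intros; ring).
              rewrite csum_scal. ring. }
          rewrite csum_plus, csum_scal, csum_swap.
          rewrite (csum_zero (fun m => csum (fun j => d m * (a j (g n0) e * w m (n0 + j)%nat))%C l) N).
          2:{ intros m Hm. rewrite csum_scal. unfold w.
              rewrite (csum_ext _ (fun j => a j (g n0) e * W m 0%nat (g n0 + INR j * e)%R)%C)
                by (intros; now rewrite Hgs).
              rewrite closed_recurrence; trivial; [ring|]. rewrite <- Hgs, <- En. exact Hn. }
          assert (Hsol : csum (fun j => a j (g n0) e * y (k1 + Z.of_nat (n0 + j))%Z)%C l = RtoC 0).
          { rewrite <- (Hy (k1 + Z.of_nat n0)%Z).
            - rewrite sum_n_csum. apply csum_ext. intros j _. unfold g. do 2 f_equal. lia.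
            - intros j Hj. rewrite <- Z.add_assoc, <- Nat2Z.inj_add. change (cint A B (g (n0 + j)%nat)).
              split; trivial. rewrite Hgs. rewrite En, Hgs in Hn. pose proof (multiple_length j Hj). lra. }
          rewrite Hsol. ring. }
        unfold l in HS. change (csum ?f (S N)) with (csum f N + f (S N))%C in HS. cbv beta in HS.
        rewrite csum_zero in HS.
        + fold l in HS. rewrite <- En in HS.
          pose proof (leading_coefficient_nonzero (g n0) Hx) as Hne.
          replace (z n) with (/ a l (g n0) e * (RtoC 0 + a l (g n0) e * z n))%C by (field; trivial).
          rewrite HS. ring.
        + intros j Hj. rewrite IH; [ring|rewrite En; unfold l; lia|].
          rewrite Hgs. rewrite En, Hgs in Hn. pose proof (multiple_length j ltac:(unfold l; lia)). lra. }
    exists (fun m => d (m - 1)%nat). intros k Hk.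
    assert (Hidx : (k1 <= k)%Z) by (apply first_index_le; [lra|apply Hk]).
    set (n := Z.to_nat (k - k1)). assert (Ek : k = (k1 + Z.of_nat n)%Z) by (unfold n; lia).
    unfold l. rewrite (sum_n_m_csum (fun m => d m * cexp (RtoC (/ e) * ext A B 0 e1 (exponent m) (IZR k * e) e))%C).
    rewrite (csum_ext _ (fun m => d m * w m n)%C).
    + assert (Hzn : z n = RtoC 0). { apply Hz. unfold g. rewrite <- Ek. apply Hk. }
      unfold z in Hzn. rewrite <- Ek in Hzn.
      replace (y k) with (y k + (csum (fun m => d m * w m n)%C N + - RtoC 1 * y k))%C; [ring|].
      rewrite Hzn. ring.
    + intros m Hm. rewrite closed_exponential by trivial. unfold w, g. now rewrite <- Ek.
Qed.

End FundamentalSet.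

Theorem proposition2p3
  (l : nat) (hl : (1 <= l)%nat)
  (A B : R) (hAB : A < B)
  (e0 : R) (he0 : 0 < e0)
  (a : nat -> R -> R -> C)
  (ha : standing_assumptions l A B a e0)
  (lam : nat -> R -> R -> C)
  (hlam : characteristic_roots l A B a e0 lam)
  (q : nat) (hq : (1 <= q)%nat)
  (Q : nat -> R -> R)
  (hQ : forall m, (1 <= m <= l)%nat -> smooth_on (V := R_NormedModule) (cint A B) (Q m))
  (hlamQ : forall m, (1 <= m <= l)%nat ->
     unif_little_o (fun _ x => cint A B x)
       (fun e x => Rabs (Cmod (Cminus (lam m x e) (RtoC 1)) / e ^ q - Q m x))
       (fun e => e))
  (hQpos : forall m, (1 <= m <= l)%nat -> Rbar_lt 0 (inf_on (cint A B) (Q m)))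
  (hQsep : forall m n, (1 <= m <= l)%nat -> (1 <= n <= l)%nat -> m <> n ->
     Rbar_lt 0 (inf_on (cint A B) (fun x => Rabs (Q m x - Q n x)))) :
  (exists e1 : R, 0 < e1 <= e0 /\
   exists F : nat -> R -> R -> C,
     (forall m, (1 <= m <= l)%nat -> smooth_on2 (cint A B) (cint 0 e1) (F m)) /\
     (forall e, 0 < e <= e1 ->
        fundamental_set l A B a e
          (fun m k => cexp (Cmult (RtoC (/ e)) (F m (IZR k * e) e))))) /\
  (forall Psi : nat -> R -> C, formal_solution l A B a Psi ->
   exists y : R -> Z -> C,
     (forall e, 0 < e <= e0 -> solution l A B a e (y e)) /\
     (forall s : nat,
        unif_little_o (fun e k => cint A B (IZR k * e))
          (fun e k => Cmod (Cminus (y e k) (partial_series Psi s (IZR k * e) e)))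
          (fun e => e ^ s))).
Proof.
  destruct l as [|N]; [lia|].
  destruct (scaled_coefficients N A B e0 a hAB he0 ha lam q Q hlam hq hQ hlamQ)
    as [e2 [k0 [K [He2 [Hk0 [HK [Hlow [Hsc Hsm]]]]]]]].
  set (sc := scaled_coef N a) in *.
  assert (Hrec : forall x e (y : nat -> C), e <> 0 -> a (S N) x e <> RtoC 0 ->
    csum (fun j => a j x e * y j)%C (S N) =
    (a (S N) x e * RtoC (e ^ S N) * (quot e y (S N) 0 + csum (fun r => sc r x e * quot e y r 0)%C N))%C).
  { intros x e y H1 H2. now apply (recurrence_scaled N a). }
  split.
  - destruct (fundamental_system A B e2 N sc K hAB ltac:(lra) HK Hsm) as [e3 [C0 [Y [He3 [HC0 [Hlen [HY [Hst HlY]]]]]]]].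
    { intros k x e Hk [Hx He]. apply Hsc; trivial. split; lra. }
    destruct (nonvanishing_system N A B e3 Y C0 hAB (proj1 He3) (fun m i _ Hi => HY m i Hi) HC0 HlY
      (companion N sc) (fun m _ => Hst m)) as [e4 [V [C1 [eta [He4 [HC1 [Heta [HV [HsV [HlV Hnz]]]]]]]]]].
    (* Stated for every m so that a family can be chosen; out of range the zero function serves as a
       default. *)
    assert (Hlog : forall m, exists lg, (m <= N)%nat -> smooth2 (rect A B 0 e4) lg /\
      forall x e, rect A B 0 e4 x e -> cexp (lg x e) = V m 0%nat x e).
    { intros m. destruct (le_lt_dec m N) as [Hm|Hm].
      - destruct (smooth_logarithm (rect A B 0 e4) (V m 0%nat) eta (B - A + e4) ((A + B) / 2) (e4 / 2))
          as [lg Hlg]; try (now exists lg).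
        + apply open2_rect.
        + apply convex2_rect.
        + apply HV; lia.
        + trivial.
        + intros; now apply Hnz.
        + split; lra.
        + intros x e x' e' [Hx He] [Hx' He']. unfold dist2.
          apply Rplus_le_compat; apply Rabs_le_between; lra.
      - exists (fun _ _ => RtoC 0). lia. }
    set (lg := fun m => proj1_sig (constructive_indefinite_description _ (Hlog m))).
    assert (Hlg : forall m, (m <= N)%nat -> smooth2 (rect A B 0 e4) (lg m) /\
      forall x e, rect A B 0 e4 x e -> cexp (lg m x e) = V m 0%nat x e).
    { intros m. exact (proj2_sig (constructive_indefinite_description _ (Hlog m))). }
    (* The constructed solutions are controlled for e < e4 only, whereas the assertion concerns a
       closed range of e; halving leaves the upper end inside. *)
    exists (e4 / 2). split; [lra|].
    (* The shift by 1 translates between the numbering 1, ..., l of the assertion and 0, ..., N of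
       the construction. *)
    exists (fun m => ext A B 0 e4 (exponent lg (m - 1))). split.
    + intros m Hm. apply smooth_on2_ext; trivial; [lra|].
      apply (exponent_smooth N A B e4 lg); [intros; now apply Hlg|lia].
    + intros e He.
      apply (exponential_fundamental_set N A B e0 a sc hAB e4 k0 C1 V lg); trivial; try lra.
      * apply Rle_lt_trans with (INR (S N) * e3); [apply Rmult_le_compat_l; [apply pos_INR|lra]|trivial].
      * intros x e' Hx He'. apply Hlow; trivial. lra.
      * intros j e' Hj He'.
        destruct (coefficients_lipschitz N A B e0 a hAB he0 ha j Hj) as [L [HL Hl]].
        destruct (coefficients_bounded N A B e0 a ha j Hj) as [M [HM Hb]].
        exists (M + L). split; [lra|]. split.
        -- intros x Hx. apply Rle_trans with M; [|lra]. apply Hb. now split.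
        -- intros x y Hx Hy. eapply Rle_trans; [apply Hl; now split|].
           unfold dist2. rewrite Rminus_diag, Rabs_R0, Rplus_0_r. apply Rmult_le_compat_r; [apply Rabs_pos|lra].
      * intros m Hm. now apply Hlg.
      * intros m x e' Hm. now apply Hlg.
  - intros Psi HPsi. apply (asymptotic_solution N A B e0 a sc hAB e2 k0 K); trivial.
Qed.
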